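(* Let $X\colon[0,T]\times\Omega\to\mathbb R$ be a one-dimensional process satisfying Conditions (i)–(iii) of the context with radius $R$, and let $f\colon\mathbb R\to\mathbb R$ extend to an entire function with $|f(z)|\le Ce^{r|z|}$ on $\mathbb C$ for some $C>0$ and $r<R$. Then for all $0\le s<t\le T$ $$\int_s^tf(X_u)\diamond dX_u=\int_s^tf(X_u)\,dX_u-\sum_{n=2}^\infty\frac1{n!}\int_s^tf^{(n-1)}(X_u)\,\kappa_n(du),$$ $$f(X_t)-f(X_s)=\int_s^tf'(X_u)\diamond dX_u+\sum_{n=2}^\infty\frac1{n!}\int_s^tf^{(n)}(X_u)\,\kappa_n(du).$$ Furthermore, if $X$ is centred, then for $n\ge0$ (assuming, for the second identity, that the shifted process $(X_{s,u})_{u\ge s}$ also satisfies Conditions (i)–(iii)) $$\int_s^tX_u^{\diamond n}\diamond dX_u=\frac{X_t^{\diamond(n+1)}-X_s^{\diamond(n+1)}}{n+1},\qquad\int_s^t(X_{s,u})^{\diamond n}\diamond dX_u=\frac{(X_{s,t})^{\diamond(n+1)}}{n+1}.$$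
   Context: $X_{u,v}=X_v-X_u$. Conditions on a one-dimensional process $X$: (i) $X$ is a.s. continuous and of bounded $p$-variation for some $p<2$. (ii) With $\mathcal M_{s,t}(z,w)=\mathbb Ee^{zX_s+wX_t}$, $\mathcal K_{s,t}=\log\mathcal M_{s,t}$ and $D_R=\{\theta\in\mathbb C:|\theta|<R\}$, there is $R>0$ such that $\mathcal K_{s,t}$ is holomorphic on $D_R\times D_R$ (i.e. $\mathcal M_{s,t}$ is defined and non-vanishing there), $\partial_t\mathcal K_{s,t}(z,w)$ exists for all $t\in[0,T]$, is continuous in $(s,t,z,w)$, and $\sup_{s,t\in[0,T],\,z,w\in D_R}|\partial_t\mathcal K_{s,t}(z,w)|<\infty$. (iii) For any $t$ in the time interval other than the initial time there is an open $U\subset\mathbb R$ with $\mathbb P[X_t\in U]>0$ such that $X_t$ has a density on $U$. $\kappa_n(u)$ is the $n$-th cumulant of $X_u$ and $\kappa_n(du)=\frac d{du}\kappa_n(u)\,du$. $\int f(X)\,dX$ is a Young integral. For a random variable $Z$ with moment-generating function $\mathcal M_Z$ holomorphic near $0$, $Z^{\diamond n}=w_n(Z)$, where $e^{\theta x}/\mathcal M_Z(\theta)=\sum_nw_n(x)\theta^n/n!$. For a random vector $(Z,Y)$ in $\mathbb R^2$ with moment-generating function $\mathcal M$, $e^{\xi x+\eta y}/\mathcal M(\xi,\eta)=\sum_{n,k}(x,y)^{\diamond(n,k)}\frac{\xi^n\eta^k}{n!k!}$, and for entire $h$ on $\mathbb C$ with $|h(z)|\le Ce^{r|z|}$ for all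 $z\in\mathbb C$, for some $C>0$ and $r<R$ ($R$ being the radius in (ii)), with $a_n=\mathbb E[h^{(n)}(Z)]$, $h(Z)\diamond Y$ is the value at $(x,y)=(Z,Y)$ of $\sum_n\frac{a_n}{n!}\bigl((x,y)^{\diamond(n,1)}+\mathbb E[Y](x,y)^{\diamond(n,0)}\bigr)$. The Wick integral is $\int_s^th(X_u,u)\diamond dX_u=\lim_m\sum_{[u,v]\in\pi_m}h(X_u,u)\diamond X_{u,v}$ (a.s. limit along any sequence of partitions of $[s,t]$ with vanishing mesh, Wick product with $(Z,Y)=(X_u,X_{u,v})$), for $h$ jointly continuous and entire in the first variable with uniform exponential bounds of type $r<R$. In particular $X_u^{\diamond n}\diamond X_{u,v}$ is obtained from $h(\cdot,u)=$ the $n$-th Appell polynomial of $X_u$; in the last identity the same construction is applied to the shifted process $(X_{s,u})_{u\ge s}$, whose increments coincide with those of $X$. *)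

(* Defs.v *)
From HB Require Import structures.
From mathcomp Require Import all_boot all_order all_algebra.
From mathcomp Require Import all_classical all_reals all_analysis.
From mathcomp Require Import complex.

Set Implicit Arguments.
Unset Strict Implicit.
Unset Printing Implicit Defensive.

Import Order.TTheory GRing.Theory Num.Theory.
Import numFieldNormedType.Exports.

Local Open Scope classical_set_scope.
Local Open Scope ring_scope.
Local Open Scope complex_scope.

(* [R[i]^o] rather than [R[i]]: the topology and the normed module structure of
   a numeric field are found by unification on its regular algebra. *)
Notation cplx R := (R[i]^o).

Section partitions.
Context {R : realType}.

(* [p : seq R] with [itv_partition a b p] encodes the partition of [a, b] whose
   points are those of [a :: p]. *)
Definition ppoint (a : R) (p : seq R) (i : nat) : R := nth a (a :: p) i.

Definition mesh (a : R) (p : seq R) : R :=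
  \big[Num.max/0]_(0 <= i < size p) (ppoint a p i.+1 - ppoint a p i).

Definition bounded_pvariation (q a b : R) (x : R -> R) : Prop :=
  exists M : R, forall p : seq R, itv_partition a b p ->
    \sum_(0 <= i < size p) `|x (ppoint a p i.+1) - x (ppoint a p i)| `^ q <= M.

(* Young's integral of [y] against [x]: the limit of the Riemann-Stieltjes sums,
   with arbitrary tags [tau], as the mesh vanishes. *)
Definition is_young_integral (y x : R -> R) (a b I : R) : Prop :=
  forall eps : R, 0 < eps -> exists2 delta : R, 0 < delta &
    forall (p : seq R) (tau : nat -> R),
      itv_partition a b p -> mesh a p < delta ->
      (forall i, (i < size p)%N -> ppoint a p i <= tau i <= ppoint a p i.+1) ->
      `| \sum_(0 <= i < size p)
           y (tau i) * (x (ppoint a p i.+1) - x (ppoint a p i)) - I | < eps.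

End partitions.

Section complex_analysis.
Context {R : realType}.

Definition cexp (z : cplx R) : cplx R :=
  (expR (complex.Re z))%:C * (cos (complex.Im z) +i* sin (complex.Im z)).

Definition cdisk (r : R) : set (cplx R) := [set z | `|z| < r%:C].

Definition entire (g : cplx R -> cplx R) : Prop := forall z, derivable g z 1.

Definition extends_entire_exp (rad : R) (f : R -> R) : Prop :=
  exists g : cplx R -> cplx R,
    [/\ entire g, (forall x : R, g x%:C = (f x)%:C) &
     exists C r : R, [/\ 0 < C, r < rad &
       forall z, `|g z| <= (C * expR (r * complex.Re `|z|))%:C]].

(* Derivative at [t] relative to [a, b], hence one-sided at the endpoints. *)
Definition is_deriv_within (a b : R) (g : R -> cplx R) (t : R) (l : cplx R) :=
  (fun v => ((v - t)%:C)^-1 * (g v - g t) : cplx R)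
    @ within `[a, b] (t^') --> l.

End complex_analysis.

Section generating_functions.
Context {R : realType}.

Definition is_egf (c : nat -> R) (x l : R) : Prop :=
  series (fun n => c n * x ^+ n / n`!%:R) @ \oo --> l.

(* The coefficients [c] with [g x = \sum_n c n * x ^ n / n!] near [0]. *)
Definition egf_coef (g : R -> R) : nat -> R :=
  xget (fun=> 0) [set c : nat -> R | exists2 rho : R, 0 < rho &
    forall x, `|x| < rho -> is_egf c x (g x)].

(* The coefficients [c] with
   [g x y = \sum_(n, k) c n k * x ^ n * y ^ k / (n! * k!)] near [(0, 0)].
   The double sum is iterated, which already determines [c] uniquely. *)
Definition egf_coef2 (g : R -> R -> R) : nat -> nat -> R :=
  xget (fun _ _ => 0) [set c : nat -> nat -> R | exists2 rho : R, 0 < rho &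
    forall x y, `|x| < rho -> `|y| < rho ->
      exists2 b : nat -> R,
        (forall n, is_egf (c n) y (b n)) & is_egf b x (g x y)].

End generating_functions.

Section wick.
Context {R : realType} {d : measure_display} {Omega : measurableType d}.
Variable P : probability Omega R.
Implicit Types (Z Y : Omega -> R) (X : R -> Omega -> R).

Definition mgf Z (th : R) : R := fine ('M_P Z th).

Definition mgf2 Z Y (xi eta : R) : R :=
  fine 'E_P[fun o => expR (xi * Z o + eta * Y o)].

Definition cumulant Z (n : nat) : R := derive1n n (fun th => ln (mgf Z th)) 0.

(* [appell Z n x] is w_n(x), so that [appell Z n (Z o)] is the value at [o] of
   the n-th Wick power of [Z]. *)
Definition appell Z (n : nat) (x : R) : R :=
  egf_coef (fun th => expR (th * x) / mgf Z th) n.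

Definition appell2 Z Y (n k : nat) (x y : R) : R :=
  egf_coef2 (fun xi eta => expR (xi * x + eta * y) / mgf2 Z Y xi eta) n k.

(* Here [h] is the restriction to the reals of an entire function; the complex
   derivatives of the latter restrict to the real derivatives of [h]. *)
Definition wick_term (h : R -> R) Z Y (o : Omega) (n : nat) : R :=
  fine 'E_P[fun o' => derive1n n h (Z o')] / n`!%:R *
  (appell2 Z Y n 1 (Z o) (Y o) + fine 'E_P[Y] * appell2 Z Y n 0 (Z o) (Y o)).

Definition wick_prod (h : R -> R) Z Y (o : Omega) : R :=
  limn (series (wick_term h Z Y o)).

Definition wick_sum (h : R -> R -> R) X (s : R) (p : seq R) (o : Omega) : R :=
  \sum_(0 <= i < size p)
    let u := ppoint s p i in let v := ppoint s p i.+1 in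
    wick_prod (h u) (X u) (X v \- X u) o.

(* [W] is the Wick integral over [s, t] of the process [h u (X u)] against [X];
   the exceptional null set may depend on the sequence of partitions. The first
   clause ensures that [wick_prod] is not a junk value of [limn]. *)
Definition is_wick_integral (h : R -> R -> R) X (s t : R) (W : Omega -> R) :=
  (forall u v, s <= u -> u < v -> v <= t ->
     {ae P, forall o, cvgn (series (wick_term (h u) (X u) (X v \- X u) o))}) /\
  (forall p : nat -> seq R, (forall m, itv_partition s t (p m)) ->
     (mesh s (p m) @[m --> \oo] --> (0 : R)) ->
     {ae P, forall o, wick_sum h X s (p m) o @[m --> \oo] --> W o}).

Definition cintegrable (F : Omega -> cplx R) : Prop :=
  P.-integrable setT (fun o => (complex.Re (F o))%:E) /\
  P.-integrable setT (fun o => (complex.Im (F o))%:E).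

Definition cexpectation (F : Omega -> cplx R) : cplx R :=
  fine 'E_P[fun o => complex.Re (F o)] +i* fine 'E_P[fun o => complex.Im (F o)].

Definition cexp_lin Z Y (z w : cplx R) (o : Omega) : cplx R :=
  cexp (z * (Z o)%:C + w * (Y o)%:C).

(* [K] is the holomorphic logarithm of [M] on the bidisk of radius [rad] with
   [K (0, 0) = 0]. *)
Definition is_holomorphic_log (rad : R) (M K : cplx R -> cplx R -> cplx R) :=
  [/\ forall z w, cdisk rad z -> cdisk rad w ->
        differentiable (fun q : cplx R * cplx R => K q.1 q.2) (z, w),
      forall z w, cdisk rad z -> cdisk rad w -> cexp (K z w) = M z w &
      K 0 0 = 0].

Definition condition_i X (a b : R) : Prop :=
  exists q : R, [/\ 1 <= q, q < 2 &
    {ae P, forall o, {within `[a, b], continuous (fun u => X u o)} /\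
      bounded_pvariation q a b (fun u => X u o)}].

Definition condition_ii X (a b rad : R) : Prop :=
  [/\ 0 < rad,
      forall s t z w, s \in `[a, b] -> t \in `[a, b] ->
        cdisk rad z -> cdisk rad w ->
        cintegrable (cexp_lin (X s) (X t) z w) /\
        cexpectation (cexp_lin (X s) (X t) z w) != 0 &
      exists K dK : R -> R -> cplx R -> cplx R -> cplx R,
      [/\ forall s t, s \in `[a, b] -> t \in `[a, b] ->
            is_holomorphic_log rad
              (fun z w => cexpectation (cexp_lin (X s) (X t) z w)) (K s t),
          forall s t z w, s \in `[a, b] -> t \in `[a, b] ->
            cdisk rad z -> cdisk rad w ->
            is_deriv_within a b (fun v => K s v z w) t (dK s t z w),
          {within `[a, b] `*` `[a, b] `*` cdisk rad `*` cdisk rad,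
            continuous (fun q : R * R * cplx R * cplx R =>
              dK q.1.1.1 q.1.1.2 q.1.2 q.2)} &
          exists B : R, forall s t z w, s \in `[a, b] -> t \in `[a, b] ->
            cdisk rad z -> cdisk rad w -> `|dK s t z w| <= B%:C]].

Definition condition_iii X (a b : R) : Prop :=
  forall t, a < t -> t <= b ->
    exists U : set R, [/\ open U, (0 < P (X t @^-1` U))%E &
      exists g : R -> R,
        [/\ measurable_fun setT g, (forall x, 0 <= g x) &
          forall A, measurable A -> A `<=` U ->
            P (X t @^-1` A) = (\int[lebesgue_measure]_(x in A) (g x)%:E)%E]].

Definition wick_conditions X (a b rad : R) : Prop :=
  [/\ condition_i X a b, condition_ii X a b rad & condition_iii X a b].

Definition shifted X (s u : R) : Omega -> R := X u \- X s.

(* The integrand, at [u] and [o], of the integral against [kappa_n(du)] of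
   [g(X_u)]. *)
Definition cumulant_integrand X (g : R -> R) (n : nat) (o : Omega) (u : R) : R :=
  g (X u o) * derive1 (fun v => cumulant (X v) n) u.

(* [S] is the sum over [n >= 2] of
   [1 / n! * \int_s^t g_n(X_u) kappa_n(du)], all of whose terms and whose
   limit exist. *)
Definition is_cumulant_series X (g : nat -> R -> R) (s t : R) (o : Omega)
    (S : R) : Prop :=
  (forall n, (2 <= n)%N -> lebesgue_measure.-integrable `[s, t]
     (EFin \o cumulant_integrand X (g n) n o)) /\
  (\sum_(2 <= n < N) (n`!%:R)^-1 *
     (\int[lebesgue_measure]_(u in `[s, t]) cumulant_integrand X (g n) n o u)
   @[N --> \oo] --> S).

End wick.

(* Main.v *)
Require Import Defs.
From HB Require Import structures.
From mathcomp Require Import all_boot all_order all_algebra.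
From mathcomp Require Import all_classical all_reals all_analysis.
From mathcomp Require Import complex measurable_realfun.
From mathcomp Require Import ring lra.

Set Implicit Arguments.
Unset Strict Implicit.
Unset Printing Implicit Defensive.

Import Order.TTheory GRing.Theory Num.Theory.
Import numFieldNormedType.Exports.

Local Open Scope classical_set_scope.
Local Open Scope ring_scope.
Import Normc.

(** Write [M_u] for the moment-generating function of [X_u], and [F' = f].

    A Wick product is computed by pairing the Taylor coefficients of [f] with a
    generating series. With [B(th) = E (Y * exp (th * Z)) / E (exp (th * Z))] and
    [b_n] the coefficients of [B], this gives
    [f(Z) <> Y = f(Z) * Y - \sum_(n >= 1) b_n * f^(n)(Z)], where [<>] is the Wick
    product ([wick_series], from the two-variable Appell coefficients
    [appell2_conv]).

    For [Z = X_u] and [Y = X_v - X_u] the coefficients satisfy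
    [b_n = (v - u) * beta_n(u) + o(v - u)], where
    [th * \sum_n beta_n(u) * th ^ n = d/du log M_u(th)] ([jcum_incr],
    [cbeta_series]); thus [(n + 1)! * beta_n] is the density of the cumulant of
    order [n + 1] ([cumulant_rint]). Summing over [n],
    [f(X_u) <> (X_v - X_u) = f(X_u) * (X_v - X_u) - (v - u) * Phi(u) + o(v - u)],
    where [Phi], called [drift] below, integrates to the cumulant series. The
    increment of [F(X)] differs from [f(X_u) * (X_v - X_u)] by a multiple of
    [|X_v - X_u| ^ 2], and the sums of these squares vanish with the mesh since
    [X] has finite variation of an order below 2 ([riemann_limit]). So the Wick sums
    telescope to [F(X_t) - F(X_s) - \int Phi] ([wick_efun]). The Young integral
    is [F(X_t) - F(X_s)] by the same comparison ([young_efun]), which is the first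
    identity; the second one is the first for the derivative of [f].

    For the Wick powers, let [w_n(x, u)] be the Appell polynomials of [X_u]. When
    [X] is centred, [w_(n+1) / (n + 1)] has derivative [w_n] in [x], and its
    derivative in [u] is minus the drift of [w_n]; therefore the Wick sums of [w_n]
    telescope to its increment ([wick_appell]). Applied to the shifted process, which
    vanishes at the initial time, this gives the last identity.

    The main point is the expansion of [b_n], uniform with weight [rho ^ n] for
    some [rho] above the exponential rate of [f]. Condition (ii) controls
    [E exp (z * X_u + w * X_v)], whereas [B] contains the increment [Y] itself. The
    difference between [om * Y] and [exp (om * Y) - 1] is dominated by
    [exp (om * Y) + exp (- om * Y) - 2]; weighted by [exp (x * X_u)], its expectation is
    nonnegative for [v] on both sides of [u], vanishes at [v = u] and is
    differentiable there, so its derivative is zero ([exp_var_small]). Hence, on the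
    circle of radius [rho], [B] is [(v - u) * dK_(u,u)(th - om, om) / om] up to
    [o(v - u)] ([ratio_incr]), and Cauchy's estimate on that circle controls all the
    coefficients at once ([coef_approx]). This is where complex arguments are
    essential. They also give the convergence of the series of [1 / M_u] on the
    whole disc ([finv_mom1_sbnd]) and the growth of the derivatives of [f]
    ([entire_efun]). Taylor expansions come from Goursat's theorem on rectangles, the
    complex exponential turning rectangles into annuli ([circint_const],
    [taylor_disc]). *)

Local Open Scope complex_scope.

(** * Integrals over segments *)

Section real_integral.
Context {R : realType}.
Implicit Types (a b c x : R) (f g : R -> R).

Definition rint a b f : R := \int[lebesgue_measure]_(x in `[a, b]) f x.

(** The topology of [[a, b]] as a subspace is awkward for estimates; this is the same
    continuity, see [econt_within]. *)
Definition econt a b f := forall x, a <= x <= b -> forall e, 0 < e ->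
  exists2 dl : R, 0 < dl & forall y, a <= y <= b -> `|y - x| < dl -> `|f y - f x| <= e.

Lemma econt_within a b f : econt a b f <-> {within `[a, b], continuous f}.
Proof.
rewrite subspace_continuousP; split => [H x /= | H x xab e e0].
  rewrite in_itv /= => xab; apply/cvgrPdist_le => e e0.
  have [dl dl0 Hd] := H x xab e e0.
  rewrite /prop_near1 /within /=.
  have := @nbhsx_ballx _ R x dl dl0; apply: filterS => y.
  rewrite -ball_normE /= distrC in_itv /= => yx yab.
  by rewrite distrC; apply: Hd.
have := H x; rewrite /= in_itv /= => /(_ xab) /cvgrPdist_le /(_ e e0).
rewrite /prop_near1 /within /= => -[dl /= dl0 Hd]; exists dl => // y yab yx.
by rewrite distrC; apply: Hd => //=; rewrite ?in_itv //= distrC.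
Qed.

Lemma econtW a b c d f : a <= c -> d <= b -> econt a b f -> econt c d f.
Proof.
move=> ac db H x /andP[cx xd] e e0.
have [|dl dl0 Hd] := H x _ e e0; first by rewrite (le_trans ac cx) (le_trans xd).
exists dl => // y /andP[cy yd] yx; apply: Hd => //.
by rewrite (le_trans ac cy) (le_trans yd).
Qed.

Lemma econtD a b f g : econt a b f -> econt a b g -> econt a b (fun x => f x + g x).
Proof.
move=> /econt_within cf /econt_within cg; apply/econt_within => x.
by apply: cvgD; [exact: cf|exact: cg].
Qed.

Lemma econtM a b f g : econt a b f -> econt a b g -> econt a b (fun x => f x * g x).
Proof.
move=> /econt_within cf /econt_within cg; apply/econt_within => x.
by apply: cvgM; [exact: cf|exact: cg].
Qed.

Lemma econt_cst a b c : econt a b (fun=> c).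
Proof. by move=> x _ e e0; exists 1 => // y _ _; rewrite subrr normr0 ltW. Qed.

Lemma econtN a b f : econt a b f -> econt a b (fun x => - f x).
Proof.
move=> cf; have -> : (fun x => - f x) = (fun x => -1 * f x).
  by apply/funext => x; rewrite mulN1r.
by apply: econtM => //; exact: econt_cst.
Qed.

Lemma econtB a b f g : econt a b f -> econt a b g -> econt a b (fun x => f x - g x).
Proof. by move=> cf cg; apply: econtD => //; exact: econtN. Qed.

Lemma econt_sum a b n (F : nat -> R -> R) : (forall i, econt a b (F i)) ->
  econt a b (fun x => \sum_(i < n) F i x).
Proof.
move=> cF; elim: n => [|n IH].
  by under eq_fun do rewrite big_ord0; exact: econt_cst.
by under eq_fun do rewrite big_ord_recr /=; exact: econtD.
Qed.

Lemma continuous_econt a b f : continuous f -> econt a b f.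
Proof. by move=> cf; apply/econt_within; exact: continuous_subspaceT. Qed.

Lemma econt_integrable a b f : econt a b f ->
  lebesgue_measure.-integrable `[a, b] (EFin \o f).
Proof.
move=> /econt_within cf; apply: continuous_compact_integrable cf.
exact: segment_compact.
Qed.

Lemma rintD a b f g : econt a b f -> econt a b g ->
  rint a b (fun x => f x + g x) = rint a b f + rint a b g.
Proof. by move=> cf cg; rewrite /rint RintegralD //; exact: econt_integrable. Qed.

Lemma rintB a b f g : econt a b f -> econt a b g ->
  rint a b (fun x => f x - g x) = rint a b f - rint a b g.
Proof. by move=> cf cg; rewrite /rint RintegralB //; exact: econt_integrable. Qed.

Lemma rintZ a b c f : econt a b f ->
  rint a b (fun x => c * f x) = c * rint a b f.
Proof. by move=> cf; rewrite /rint RintegralZl //; exact: econt_integrable. Qed.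

Lemma eq_rint a b f g : (forall x, a <= x <= b -> f x = g x) ->
  rint a b f = rint a b g.
Proof.
by move=> fg; apply: eq_Rintegral => x; rewrite inE /= in_itv /=; exact: fg.
Qed.

Lemma rint_sum a b n (F : nat -> R -> R) : (forall i, econt a b (F i)) ->
  rint a b (fun x => \sum_(i < n) F i x) = \sum_(i < n) rint a b (F i).
Proof.
move=> cF; elim: n => [|n IH].
  have H := rintZ 0 (@econt_cst a b 0); rewrite big_ord0 -[RHS](mul0r (rint a b (fun=> 0))) -H.
  by apply: eq_rint => x _; rewrite big_ord0 mul0r.
rewrite big_ord_recr /= -IH -rintD //; last exact: econt_sum.
by apply: eq_rint => x _; rewrite big_ord_recr.
Qed.

Lemma rint_cst a b c : a <= b -> rint a b (fun=> c) = c * (b - a).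
Proof.
move=> ab; rewrite /rint Rintegral_cst //= lebesgue_measure_itv /= lte_fin; congr (_ * _).
case: ltP => [//|ba] /=.
by have -> : a = b; [apply/le_anti/andP|rewrite subrr].
Qed.

Lemma ler_rint a b f g : econt a b f -> econt a b g ->
  (forall x, a <= x <= b -> f x <= g x) -> rint a b f <= rint a b g.
Proof.
by move=> cf cg fg; apply: le_Rintegral => //; exact: econt_integrable.
Qed.

Lemma ler_norm_rint a b f S : a <= b -> econt a b f ->
  (forall x, a <= x <= b -> `|f x| <= S) -> `|rint a b f| <= S * (b - a).
Proof.
move=> ab cf fS; rewrite ler_norml -mulNr -!rint_cst //; apply/andP; split.
  apply: ler_rint => //; first exact: econt_cst.
  by move=> x /fS; rewrite ler_norml => /andP[].
apply: ler_rint => //; first exact: econt_cst.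
by move=> x /fS; rewrite ler_norml => /andP[].
Qed.

Lemma rint_split a b c f : a <= c -> c <= b -> econt a b f ->
  rint a b f = rint a c f + rint c b f.
Proof.
move=> ac cb /econt_integrable cf; rewrite /rint.
have H := @Rintegral_itvB R f (BLeft a) (BRight b) c cf.
rewrite -[LHS](subrK (\int[lebesgue_measure]_(t in `[a, c]) f t)) H //.
rewrite addrC Rintegral_itv_obnd_cbnd //.
by apply: integrableS cf => //; apply: subset_itv; rewrite bnd_simp.
Qed.

Lemma rint_id a b : a <= b -> rint a b id = (b ^+ 2 - a ^+ 2) / 2.
Proof.
rewrite le_eqVlt => /predU1P[->|ab].
  by rewrite /rint set_itv1 Rintegral_set1 subrr mul0r.
have dF (x : R) : is_derive x 1 (fun x : R => x ^+ 2 / 2) x.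
  apply: trigger_derive; rewrite /GRing.scale /=.
  by field.
suff H : (\int[lebesgue_measure]_(x in `[a, b]) (id x)%:E = (b ^+ 2 / 2)%:E - (a ^+ 2 / 2)%:E)%E.
  by rewrite mulrBl; exact: (congr1 fine H).
apply: (@continuous_FTC2 R id (fun x => x ^+ 2 / 2) a b ab).
- by apply: continuous_subspaceT => x; exact: cvg_id.
- have cF : continuous (fun x : R => x ^+ 2 / 2).
    move=> x; apply: differentiable_continuous; apply/derivable1_diffP.
    exact: (@ex_derive _ _ _ _ _ _ _ (dF x)).
  split; first by move=> x _; exact: (@ex_derive _ _ _ _ _ _ _ (dF x)).
    by apply: cvg_at_right_filter; exact: cF.
  by apply: cvg_at_left_filter; exact: cF.
- by move=> x _; rewrite derive1E; exact: (@derive_val _ _ _ _ _ _ _ (dF x)).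
Qed.

End real_integral.

(** * Modulus and complex derivative *)

Section complex_basics.
Context {R : realType}.
Implicit Types (z w : R[i]) (x y e : R).

Lemma normE z : `|z| = (normc z)%:C. Proof. by []. Qed.

Lemma normc_ge0 z : 0 <= normc z.
Proof. by case: z => x y; exact: sqrtr_ge0. Qed.

Lemma normc_eq0 z : (normc z == 0) = (z == 0).
Proof. by apply/eqP/eqP => [/eq0_normc//|->]; exact: normc0. Qed.

Lemma normc_gt0 z : (0 < normc z) = (z != 0).
Proof. by rewrite lt_def normc_ge0 andbT normc_eq0. Qed.

Lemma normcB z w : normc (z - w) = normc (w - z).
Proof. by rewrite -normcN opprB. Qed.

Lemma normc_real x : normc x%:C = `|x|.
Proof. by rewrite /= expr0n /= addr0 sqrtr_sqr. Qed.

Lemma normc_Re z : `|complex.Re z| <= normc z.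
Proof.
case: z => a b /=; rewrite -sqrtr_sqr ler_wsqrtr // lerDl.
exact: sqr_ge0.
Qed.

Lemma normc_Im z : `|complex.Im z| <= normc z.
Proof.
case: z => a b /=; rewrite -sqrtr_sqr ler_wsqrtr // lerDr.
exact: sqr_ge0.
Qed.

Lemma normc_le_ReIm z : normc z <= `|complex.Re z| + `|complex.Im z|.
Proof.
rewrite {1}(complexE z).
rewrite (le_trans (le_normcD _ _)) // normcM !normc_real.
have -> : normc ('i : R[i]) = 1 by rewrite /= expr0n expr1n /= add0r sqrtr1.
by rewrite mul1r.
Qed.

Lemma normcX z n : normc (z ^+ n) = normc z ^+ n.
Proof. by elim: n => [|n IH]; rewrite ?expr0 ?normc1 // !exprS normcM IH. Qed.

Lemma normc_sum n (F : 'I_n -> R[i]) : normc (\sum_(i < n) F i) <= \sum_(i < n) normc (F i).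
Proof.
elim/big_ind2: _ => //; first by rewrite normc0.
by move=> a b c d ab cd; rewrite (le_trans (le_normcD _ _)) // lerD.
Qed.

Lemma ler_normcB z w : normc (z - w) <= normc z + normc w.
Proof. by rewrite -(normcN w); exact: le_normcD. Qed.

Lemma lerB_normc z w : normc z - normc w <= normc (z - w).
Proof. by rewrite lerBlDr -{1}(subrK w z) le_normcD. Qed.

Lemma Re_sum n (F : 'I_n -> R[i]) :
  complex.Re (\sum_(i < n) F i) = \sum_(i < n) complex.Re (F i).
Proof. by elim/big_rec2: _ => //= i a b _ <-; case: (F i) b => ? ? []. Qed.

Lemma Im_sum n (F : 'I_n -> R[i]) :
  complex.Im (\sum_(i < n) F i) = \sum_(i < n) complex.Im (F i).
Proof. by elim/big_rec2: _ => //= i a b _ <-; case: (F i) b => ? ? []. Qed.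

Lemma ReD z w : complex.Re (z + w) = complex.Re z + complex.Re w.
Proof. by case: z w => ? ? []. Qed.
Lemma ImD z w : complex.Im (z + w) = complex.Im z + complex.Im w.
Proof. by case: z w => ? ? []. Qed.
Lemma ReN z : complex.Re (- z) = - complex.Re z.
Proof. by case: z. Qed.
Lemma ImN z : complex.Im (- z) = - complex.Im z.
Proof. by case: z. Qed.
Lemma ReM z w : complex.Re (z * w) =
  complex.Re z * complex.Re w - complex.Im z * complex.Im w.
Proof. by case: z w => ? ? []. Qed.
Lemma ImM z w : complex.Im (z * w) =
  complex.Re z * complex.Im w + complex.Im z * complex.Re w.
Proof. by case: z w => ? ? []. Qed.

Lemma complex_gt0 (e : R[i]) : 0 < e -> 0 < complex.Re e /\ e = (complex.Re e)%:C.
Proof. by rewrite ltcE /= => /andP[/eqP i0 ->]; case: e i0 => a b /= ->. Qed.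

Lemma normc_lt z x : (`|z| < x%:C) = (normc z < x).
Proof. by rewrite normE ltcR. Qed.
Lemma normc_le z x : (`|z| <= x%:C) = (normc z <= x).
Proof. by rewrite normE lecR. Qed.

(** [R[i]] carries its norm in [R[i]] itself; the estimates are written with the
    real number [normc z] instead, hence this elementary form of derivability. *)
Definition cdiff (g : R[i] -> R[i]) z l := forall e, 0 < e ->
  exists2 dl : R, 0 < dl & forall h, normc h < dl ->
    normc (g (z + h) - g z - l * h) <= e * normc h.

Lemma derivable_cdiff (g : cplx R -> cplx R) (z : cplx R) :
  derivable g z 1 -> cdiff g z ('D_1 g z).
Proof.
move=> dg e e0.
have /cvgrPdist_le /(_ e%:C) : (fun h : cplx R => h^-1 *: ((g \o shift z) (h *: (1 : cplx R)) - g z)) @ 0^' --> 'D_1 g z by exact: dg.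
rewrite ltcR e0 => /(_ isT).
move=> /(nbhs_ballP (0 : cplx R)) [d' /= /complex_gt0 [d0 ->] Hd].
exists (complex.Re d') => // h hd; have [->|h0] := eqVneq h 0.
  by rewrite addr0 mulr0 subr0 subrr normc0 mulr0.
have := Hd h; rewrite -ball_normE /ball_ /= sub0r normrN normc_lt => /(_ hd h0).
rewrite /shift /= /GRing.scale /= mulr1 normc_le normcB (addrC h) => H.
have -> : g (z + h) - g z - 'D_1 g z * h = h * (h^-1 * (g (z + h) - g z) - 'D_1 g z).
  by rewrite mulrBr mulrA divff // mul1r [_ * h]mulrC.
by rewrite normcM mulrC ler_wpM2r // normc_ge0.
Qed.

Lemma cdiff_derivable (g : cplx R -> cplx R) (z : cplx R) l :
  cdiff g z l -> derivable g z 1.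
Proof.
move=> dg; apply/cvg_ex; exists l; apply/cvgrPdist_le => e /complex_gt0[e0 ->].
have [dl dl0 Hd] := dg _ e0.
apply/(nbhs_ballP (0 : cplx R)); exists dl%:C; first by rewrite /= ltcR.
move=> h; rewrite -ball_normE /ball_ /= sub0r normrN normc_lt => /Hd H h0.
rewrite /GRing.scale /= mulr1 normc_le normcB (addrC h).
have -> : h^-1 * (g (z + h) - g z) - l = h^-1 * (g (z + h) - g z - l * h).
  by rewrite [in RHS]mulrBr [l * h]mulrC mulrA mulVf // mul1r.
by rewrite normcM normcV mulrC ler_pdivrMr ?normc_gt0.
Qed.

End complex_basics.

(** * The complex exponential *)

Section complex_exponential.
Context {R : realType}.
Implicit Types (z w : R[i]) (x y e : R).

Lemma cexpE z : cexp z = (expR (complex.Re z) * cos (complex.Im z))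
   +i* (expR (complex.Re z) * sin (complex.Im z)) :> R[i].
Proof. by rewrite /cexp /=; congr (_ +i* _); rewrite ?mul0r ?subr0 ?addr0. Qed.

Lemma cexpD z w : cexp (z + w) = cexp z * cexp w :> R[i].
Proof.
rewrite !cexpE ReD ImD expRD sinD cosD; simpc.
by congr (_ +i* _); ring.
Qed.

Lemma cexp0 : cexp (0 : R[i]) = 1 :> R[i].
Proof. by rewrite cexpE /= expR0 cos0 sin0 mulr1 mulr0. Qed.

Lemma cexp_real x : cexp (x%:C : R[i]) = (expR x)%:C :> R[i].
Proof. by rewrite cexpE /= cos0 sin0 mulr1 mulr0. Qed.

Lemma normc_cexp z : normc (cexp z) = expR (complex.Re z).
Proof.
rewrite cexpE /= !exprMn -mulrDr cos2Dsin2 mulr1 sqrtr_sqr ger0_norm //.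
Qed.

Lemma cexp_neq0 z : cexp z != 0 :> R[i].
Proof. by rewrite -normc_gt0 normc_cexp expR_gt0. Qed.

Lemma cexpN z : cexp (- z) = (cexp z)^-1 :> R[i].
Proof.
by apply: (mulfI (cexp_neq0 z)); rewrite -cexpD subrr cexp0 divff // cexp_neq0.
Qed.

Lemma cexpMn z n : cexp (n%:R * z) = cexp z ^+ n :> R[i].
Proof.
elim: n => [|n IH]; first by rewrite mul0r cexp0.
by rewrite exprS -IH -cexpD -natr1 mulrDl mul1r addrC.
Qed.

Lemma cexp_2pi z : cexp (z + 0 +i* (2 * pi)) = cexp z :> R[i].
Proof.
rewrite cexpD [X in _ * X]cexpE /= expR0 !mul1r.
rewrite (_ : 2 * pi = pi + pi); last by rewrite mulr_natl.
rewrite cosD sinD !sinpi !cospi !(mulr0, mul0r) subr0 addr0 mulN1r opprK.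
by rewrite -[X in _ * X]/(1 : R[i]) mulr1.
Qed.

Lemma derive_small (f : R -> R) l : is_derive (0 : R) 1 f l -> forall e, 0 < e ->
  exists2 dl : R, 0 < dl & forall h, `|h| < dl -> `|f h - f 0 - l * h| <= e * `|h|.
Proof.
move=> df e e0.
have /cvgrPdist_le /(_ e e0) : (fun h : R => h^-1 *: ((f \o shift 0) (h *: (1 : R)) - f 0)) @ 0^' --> l.
  have := @derive_val _ _ _ _ _ _ _ df; rewrite -[_ @ _ --> _]/(_ --> _) => <-.
  exact: (@ex_derive _ _ _ _ _ _ _ df).
move=> /(nbhs_ballP (0 : R)) [dl /= dl0 Hd]; exists dl => // h hd.
have [->|h0] := eqVneq h 0; first by rewrite mulr0 subr0 subrr normr0 mulr0.
have := Hd h; rewrite -ball_normE /ball_ /= sub0r normrN => /(_ hd h0).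
rewrite /shift /= /GRing.scale /= mulr1 addr0 distrC => H.
have -> : f h - f 0 - l * h = h * (h^-1 * (f h - f 0) - l).
  by rewrite mulrBr mulrA divff // mul1r [_ * h]mulrC.
by rewrite normrM mulrC ler_wpM2r.
Qed.

(** From the derivatives of [expR], [cos] and [sin] at [0]. *)
Lemma cexp_cdiff0 : cdiff (@cexp R) 0 1.
Proof.
move=> e e0.
pose k : R := Num.min 1 (e / 16).
have k0 : 0 < k by rewrite lt_min ltr01 divr_gt0.
have k1 : k <= 1 by rewrite ge_min lexx.
have ke : k <= e / 16 by rewrite ge_min lexx orbT.
move: k k0 k1 ke => k k0 k1 ke.
have [d1 d10 H1] := derive_small (is_derive_expR 0) k0.
have [d2 d20 H2] := derive_small (is_derive_cos 0) k0.
have [d3 d30 H3] := derive_small (is_derive_sin 0) k0.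
pose d := Num.min (Num.min d1 d2) (Num.min d3 k).
exists d; first by rewrite !lt_min d10 d20 d30 k0.
move=> [x y]; rewrite add0r cexp0 mul1r cexpE [complex.Re _]/= [complex.Im _]/=.
have hx : `|x| <= normc (x +i* y) := normc_Re (x +i* y).
have hy : `|y| <= normc (x +i* y) := normc_Im (x +i* y).
move: (normc_ge0 (x +i* y)) hx hy; move: (normc (x +i* y)) => n n0 hx hy.
rewrite !lt_min => /andP[/andP[n1 n2] /andP[n3 n4]].
have {}H1 := H1 x (le_lt_trans hx n1).
have {}H2 := H2 y (le_lt_trans hy n2).
have {}H3 := H3 y (le_lt_trans hy n3).
move: H1 H2 H3; rewrite expR0 cos0 sin0 oppr0 mul1r mul0r !subr0 addr0 mul1r => H1 H2 H3.
rewrite (le_trans (normc_le_ReIm _)) //=.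
set E := expR x in H1 *; set c := cos y in H2 *; set s := sin y in H3 *.
have kn : k * n <= n by rewrite ler_piMl.
have B1 : `|E - 1 - x| <= k * n by apply: (le_trans H1); rewrite ler_wpM2l // ltW.
have B2 : `|c - 1| <= k * n by apply: (le_trans H2); rewrite ler_wpM2l // ltW.
have B3 : `|s - y| <= k * n by apply: (le_trans H3); rewrite ler_wpM2l // ltW.
have nk : n <= k by exact: ltW.
have n1' : n <= 1 by exact: le_trans nk k1.
have E3 : `|E| <= 3.
  have -> : E = (E - 1 - x) + (1 + x) by ring.
  rewrite (le_trans (ler_normD _ _)) //.
  have : `|1 + x| <= 1 + `|x| by rewrite (le_trans (ler_normD _ _)) // normr1.
  move: B1; lra.
have E1 : `|E - 1| <= 2 * n.
  have -> : E - 1 = (E - 1 - x) + x by ring.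
  rewrite (le_trans (ler_normD _ _)) //; move: B1; lra.
have -> : E * c - 1 - x = (E - 1 - x) + E * (c - 1) by ring.
have -> : E * s - 0 - y = (E - 1) * y + E * (s - y) by ring.
have T1 := ler_normD (E - 1 - x) (E * (c - 1)).
have T2 := ler_normD ((E - 1) * y) (E * (s - y)).
have T3 : `|E * (c - 1)| <= 3 * (k * n) by rewrite normrM ler_pM.
have T4 : `|E * (s - y)| <= 3 * (k * n) by rewrite normrM ler_pM.
have T5 : `|(E - 1) * y| <= 2 * n * k by rewrite normrM ler_pM // (le_trans hy).
have T6 : k * n <= e / 16 * n by rewrite ler_wpM2r.
apply: (le_trans (lerD T1 T2)).
apply: (le_trans (lerD (lerD B1 T3) (lerD T5 T4))).
have -> : k * n + 3 * (k * n) + (2 * n * k + 3 * (k * n)) = 9 * (k * n) by ring.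
apply: (le_trans (ler_wpM2l _ T6)) => //.
have en : 0 <= e * n by rewrite mulr_ge0 // ltW.
have -> : 9 * (e / 16 * n) = 9 / 16 * (e * n) by field.
by rewrite ler_piMl // ler_pdivrMr // mul1r ler_nat.
Qed.

Lemma cexp_cdiff z : cdiff (@cexp R) z (cexp z).
Proof.
move=> e e0.
have c0 : 0 < normc (cexp z) by rewrite normc_cexp expR_gt0.
have [dl dl0 Hd] := cexp_cdiff0 (divr_gt0 e0 c0).
exists dl => // h /Hd; rewrite add0r cexp0 mul1r cexpD => H.
have -> : cexp z * cexp h - cexp z - cexp z * h = cexp z * (cexp h - 1 - h) :> R[i] by ring.
by rewrite normcM mulrC -ler_pdivlMr // mulrAC.
Qed.

End complex_exponential.

(** * Bisection of rectangles and integrals of complex functions *)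

Section bisection.
Context {R : realType}.

Lemma lt_half_pow (w eta : R) : 0 < eta -> exists n, w / 2 ^+ n < eta.
Proof.
move=> e0; exists (Num.bound (`|w| / eta)); set n := Num.bound _.
have H : `|w| / eta < n%:R by apply: archi_boundP; rewrite divr_ge0 // ltW.
rewrite ltr_pdivrMr ?exprn_gt0 // (le_lt_trans (ler_norm w)) //.
rewrite mulrC -ltr_pdivrMr // (lt_trans H) //.
by rewrite -natrX ltr_nat ltn_expl.
Qed.

Record rect := Rect {rl : R; rr : R; rb : R; rt : R}.

Definition rect_ok q := rl q <= rr q /\ rb q <= rt q.

Definition quarter q (i j : bool) :=
  let m := (rl q + rr q) / 2 in let n := (rb q + rt q) / 2 in
  Rect (if i then m else rl q) (if i then rr q else m)
       (if j then n else rb q) (if j then rt q else n).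

Lemma quarterP q i j : rect_ok q ->
  [/\ rect_ok (quarter q i j), rl q <= rl (quarter q i j),
      rr (quarter q i j) <= rr q, rb q <= rb (quarter q i j) &
      rt (quarter q i j) <= rt q] /\
  (rr (quarter q i j) - rl (quarter q i j) = (rr q - rl q) / 2) /\
  (rt (quarter q i j) - rb (quarter q i j) = (rt q - rb q) / 2).
Proof.
case: q => a b c d [/= ab cd]; split; last first.
  by split; case: i; case: j => /=; field.
by split; rewrite ?/rect_ok /=; case: i; case: j => /=; try split; lra.
Qed.

(** A property of rectangles that passes from the four quarters to the whole, and
    that holds for all small rectangles around each point, holds: otherwise a
    nested sequence of quarters on which it fails shrinks to a point. *)
Lemma rect_bisection (P : rect -> Prop) q0 : rect_ok q0 ->
  (forall q, rect_ok q -> (forall i j, P (quarter q i j)) -> P q) ->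
  (forall x y, rl q0 <= x <= rr q0 -> rb q0 <= y <= rt q0 ->
    exists2 eta, 0 < eta & forall q, rect_ok q ->
      rl q0 <= rl q -> rr q <= rr q0 -> rb q0 <= rb q -> rt q <= rt q0 ->
      rl q <= x <= rr q -> rb q <= y <= rt q ->
      rr q - rl q < eta -> rt q - rb q < eta -> P q) -> P q0.
Proof.
move=> ok0 Hq Hloc; apply: contrapT => nP0.
have step q : exists q', rect_ok q -> ~ P q -> ~ P q' /\ exists i j, q' = quarter q i j.
  have [ok|nok] := pselect (rect_ok q); last by exists q.
  have [Pq|nPq] := pselect (P q); first by exists q.
  have [i /existsNP[j nPij]] : exists i, ~ forall j, P (quarter q i j).
    by apply/existsNP => H; apply: nPq; apply: Hq.
  by exists (quarter q i j) => _ _; split => //; exists i, j.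
have [f fP] := choice step.
pose s n := iter n f q0.
have sok n : rect_ok (s n) /\ ~ P (s n).
  elim: n => [//|n [okn nPn]]; have [nP [i [j E]]] := fP _ okn nPn.
  by split => //; rewrite /s iterS E; have [[]] := quarterP i j okn.
have sS n : [/\ rl (s n) <= rl (s n.+1), rr (s n.+1) <= rr (s n),
    rb (s n) <= rb (s n.+1) & rt (s n.+1) <= rt (s n)] /\
    (rr (s n.+1) - rl (s n.+1) = (rr (s n) - rl (s n)) / 2) /\
    (rt (s n.+1) - rb (s n.+1) = (rt (s n) - rb (s n)) / 2).
  have [okn nPn] := sok n; have [nP [i [j E]]] := fP _ okn nPn.
  by rewrite /s iterS E -/(s n); have [[]] := quarterP i j okn.
have mono n m : (n <= m)%N -> [/\ rl (s n) <= rl (s m), rr (s m) <= rr (s n),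
    rb (s n) <= rb (s m) & rt (s m) <= rt (s n)].
  elim: m => [|m IH]; first by rewrite leqn0 => /eqP ->.
  rewrite leq_eqVlt => /orP[/eqP -> //|]; rewrite ltnS => /IH [h1 h2 h3 h4].
  by have [[g1 g2 g3 g4] _] := sS m; split; [exact: le_trans h1 g1|
    exact: le_trans g2 h2|exact: le_trans h3 g3|exact: le_trans g4 h4].
have width n : rr (s n) - rl (s n) = (rr q0 - rl q0) / 2 ^+ n /\
    rt (s n) - rb (s n) = (rt q0 - rb q0) / 2 ^+ n.
  elim: n => [|n [h1 h2]]; first by rewrite expr0 !divr1.
  have [_ [-> ->]] := sS n; rewrite h1 h2 exprSr invfM.
  by rewrite -!mulrA.
have cross n m : rl (s n) <= rr (s m) /\ rb (s n) <= rt (s m).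
  have [k1 _ k3 _] := mono _ _ (leq_maxl n m).
  have [_ k2 _ k4] := mono _ _ (leq_maxr n m).
  have [[u1 u2] _] := sok (maxn n m).
  by split; [exact: le_trans k1 (le_trans u1 k2)|exact: le_trans k3 (le_trans u2 k4)].
pose x := sup (range (fun n => rl (s n))); pose y := sup (range (fun n => rb (s n))).
have hx n : rl (s n) <= x <= rr (s n).
  apply/andP; split; last by apply: ge_sup => [|_ [m _ <-]]; [exists (rl (s 0)); exists 0|have [] := cross m n].
  by apply: ub_le_sup; [exists (rr (s 0)) => _ [m _ <-]; have [] := cross m 0|exists n].
have hy n : rb (s n) <= y <= rt (s n).
  apply/andP; split; last by apply: ge_sup => [|_ [m _ <-]]; [exists (rb (s 0)); exists 0|have [] := cross m n].
  by apply: ub_le_sup; [exists (rt (s 0)) => _ [m _ <-]; have [] := cross m 0|exists n].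
have [eta eta0 Heta] := Hloc x y (hx 0%N) (hy 0%N).
have [n1 Hn1] := lt_half_pow (rr q0 - rl q0) eta0.
have [n2 Hn2] := lt_half_pow (rt q0 - rb q0) eta0.
pose n := maxn n1 n2.
have [okn nPn] := sok n; apply: nPn.
have [m1 m2 m3 m4] := mono 0%N n isT.
have [_ k2 _ _] := mono _ _ (leq_maxl n1 n2); have [k1 _ _ _] := mono _ _ (leq_maxl n1 n2).
have [_ _ k3 k4] := mono _ _ (leq_maxr n1 n2).
apply: Heta => //.
  by have [E _] := width n1; apply: le_lt_trans Hn1; rewrite -E lerB.
by have [_ E] := width n2; apply: le_lt_trans Hn2; rewrite -E lerB.
Qed.

End bisection.

Section complex_integral.
Context {R : realType}.
Implicit Types (a b c d x y : R) (F G : R -> R[i]) (z w : R[i]).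

Definition ccont a b F :=
  econt a b (fun x => complex.Re (F x)) /\ econt a b (fun x => complex.Im (F x)).

(** Integrating the real and imaginary parts avoids a theory of vector-valued
    integrals. *)
Definition cint a b F : R[i] :=
  rint a b (fun x => complex.Re (F x)) +i* rint a b (fun x => complex.Im (F x)).

Lemma ccontP a b F : (forall x, a <= x <= b -> forall e : R, 0 < e ->
    exists2 dl : R, 0 < dl & forall y, a <= y <= b -> `|y - x| < dl ->
      normc (F y - F x) <= e) -> ccont a b F.
Proof.
move=> H; split => x xab e e0; have [dl dl0 Hd] := H x xab e e0; exists dl => // y yab yx.
  by rewrite -ReN -ReD (le_trans (normc_Re _)) // Hd.
by rewrite -ImN -ImD (le_trans (normc_Im _)) // Hd.
Qed.

Lemma ccontD a b F G : ccont a b F -> ccont a b G -> ccont a b (fun x => F x + G x).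
Proof.
move=> [r1 i1] [r2 i2]; split.
  by under eq_fun do rewrite ReD; exact: econtD.
by under eq_fun do rewrite ImD; exact: econtD.
Qed.

Lemma ccontM a b F G : ccont a b F -> ccont a b G -> ccont a b (fun x => F x * G x).
Proof.
move=> [r1 i1] [r2 i2]; split.
  by under eq_fun do rewrite ReM; apply: econtB; exact: econtM.
by under eq_fun do rewrite ImM; apply: econtD; exact: econtM.
Qed.

Lemma ccont_cst a b z : ccont a b (fun=> z).
Proof. by split; exact: econt_cst. Qed.

Lemma ccontZ a b z F : ccont a b F -> ccont a b (fun x => z * F x).
Proof. by apply: ccontM; exact: ccont_cst. Qed.

Lemma ccontB a b F G : ccont a b F -> ccont a b G -> ccont a b (fun x => F x - G x).
Proof.
move=> cF cG; under eq_fun do rewrite -mulN1r.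
by apply: ccontD => //; exact: ccontZ.
Qed.

Lemma cintD a b F G : ccont a b F -> ccont a b G ->
  cint a b (fun x => F x + G x) = cint a b F + cint a b G.
Proof.
move=> [r1 i1] [r2 i2]; rewrite /cint.
under [X in X +i* _]eq_rint do rewrite ReD.
under [X in _ +i* X]eq_rint do rewrite ImD.
by rewrite !rintD.
Qed.

Lemma cintZ a b z F : ccont a b F -> cint a b (fun x => z * F x) = z * cint a b F.
Proof.
move=> [r i]; rewrite /cint.
under [X in X +i* _]eq_rint do rewrite ReM.
under [X in _ +i* X]eq_rint do rewrite ImM.
have cz (x : R) f : econt a b f -> econt a b (fun y => x * f y).
  by apply: econtM; exact: econt_cst.
rewrite rintB ?rintD ?rintZ //; [|exact: cz..].
by case: z => u v /=; simpc.
Qed.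

Lemma cintB a b F G : ccont a b F -> ccont a b G ->
  cint a b (fun x => F x - G x) = cint a b F - cint a b G.
Proof.
move=> cF cG; under [in LHS]eq_fun do rewrite -mulN1r.
by rewrite cintD ?cintZ ?mulN1r //; exact: ccontZ.
Qed.

Lemma eq_cint a b F G : (forall x, a <= x <= b -> F x = G x) -> cint a b F = cint a b G.
Proof. by move=> FG; congr (_ +i* _); apply: eq_rint => x /FG ->. Qed.

Lemma cint_cst a b z : a <= b -> cint a b (fun=> z) = z * (b - a)%:C.
Proof. by move=> ab; rewrite /cint !rint_cst //; case: z => u v /=; simpc. Qed.

Lemma cint_id a b : a <= b -> cint a b (fun x => x%:C) = ((b ^+ 2 - a ^+ 2) / 2)%:C.
Proof. by move=> ab; rewrite /cint /= (rint_id ab) rint_cst // mul0r. Qed.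

(** The factor 2 comes from bounding the real and imaginary parts separately. *)
Lemma normc_cint a b F S : a <= b -> ccont a b F ->
  (forall x, a <= x <= b -> normc (F x) <= S) -> normc (cint a b F) <= 2 * S * (b - a).
Proof.
move=> ab [r i] FS; rewrite (le_trans (normc_le_ReIm _)) //= mulr_natl mulrDl.
by rewrite lerD // ler_norm_rint // => x /FS; apply: le_trans;
  rewrite ?normc_Re ?normc_Im.
Qed.

Lemma cint_split a b c F : a <= c -> c <= b -> ccont a b F ->
  cint a b F = cint a c F + cint c b F.
Proof. by move=> ac cb [r i]; rewrite /cint (rint_split ac cb r) (rint_split ac cb i). Qed.

Lemma cint_sum a b n (F : nat -> R -> R[i]) : (forall i, ccont a b (F i)) ->
  cint a b (fun x => \sum_(i < n) F i x) = \sum_(i < n) cint a b (F i).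
Proof.
move=> cF; have cS m : ccont a b (fun x => \sum_(i < m) F i x).
  elim: m => [|m IH]; first by under eq_fun do rewrite big_ord0; exact: ccont_cst.
  by under eq_fun do rewrite big_ord_recr /=; exact: ccontD.
elim: n => [|n IH].
  have H := cintZ 0 (@ccont_cst a b 0).
  rewrite big_ord0 -[RHS](mul0r (cint a b (fun=> 0))) -H.
  by apply: eq_cint => x _; rewrite big_ord0 mul0r.
rewrite big_ord_recr /= -IH -cintD //.
by apply: eq_cint => x _; rewrite big_ord_recr.
Qed.

End complex_integral.
Arguments cint {R} a b F : simpl never.

(** * Goursat's theorem on rectangles *)

Section goursat.
Context {R : realType}.
Implicit Types (a b c d x y : R) (G : R[i] -> R[i]) (z w l : R[i]).

Lemma cdiff_cont G z l : cdiff G z l -> forall e, 0 < e ->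
  exists2 dl : R, 0 < dl & forall h, normc h < dl -> normc (G (z + h) - G z) <= e.
Proof.
move=> dG e e0; have [d1 d10 H] := dG 1 ltr01.
have l0 : 0 < 1 + normc l by rewrite ltr_pwDl // normc_ge0.
exists (Num.min d1 (e / (1 + normc l))); first by rewrite lt_min d10 divr_gt0.
move=> h; rewrite lt_min => /andP[/H {}H]; rewrite ltr_pdivlMr // => he.
rewrite -(subrK (l * h) (_ - _)) (le_trans (le_normcD _ _)) // normcM.
rewrite (le_trans _ (ltW he)) // mulrDr mulr1 lerD //; first by rewrite mul1r in H.
by rewrite mulrC.
Qed.

Lemma hsegB x y c : (y +i* c) = (x +i* c) + (y - x)%:C :> R[i].
Proof. by simpc; rewrite addrC subrK. Qed.

Lemma vsegB x y c : (c +i* y) = (c +i* x) + 'i * (y - x)%:C :> R[i].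
Proof. by simpc; rewrite addrC subrK. Qed.

Lemma normc_i : normc ('i : R[i]) = 1.
Proof. by rewrite /= expr0n expr1n /= add0r sqrtr1. Qed.

Definition holo_rect G (q : rect) := forall x y,
  rl q <= x <= rr q -> rb q <= y <= rt q -> exists l, cdiff G (x +i* y) l.

Lemma holo_hseg G q y a b : holo_rect G q -> rb q <= y <= rt q ->
  rl q <= a -> b <= rr q -> ccont a b (fun x => G (x +i* y)).
Proof.
move=> hG yq la br; apply: ccontP => x /andP[ax xb] e e0.
have [|l dG] := hG x y _ yq; first by rewrite (le_trans la ax) (le_trans xb br).
have [dl dl0 H] := cdiff_cont dG e0; exists dl => // x' _ xx'.
by rewrite (hsegB x x') H // normc_real.
Qed.

Lemma holo_vseg G q x c d : holo_rect G q -> rl q <= x <= rr q ->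
  rb q <= c -> d <= rt q -> ccont c d (fun y => G (x +i* y)).
Proof.
move=> hG xq bc dt; apply: ccontP => y /andP[cy yd] e e0.
have [|l dG] := hG x y xq _; first by rewrite (le_trans bc cy) (le_trans yd dt).
have [dl dl0 H] := cdiff_cont dG e0; exists dl => // y' _ yy'.
by rewrite (vsegB y y') H // normcM normc_i mul1r normc_real.
Qed.

(** The boundary of [q] is run counterclockwise. *)
Definition bdint G (q : rect) : R[i] :=
  (cint (rl q) (rr q) (fun x => G (x +i* rb q))
   - cint (rl q) (rr q) (fun x => G (x +i* rt q)))
  + 'i * (cint (rb q) (rt q) (fun y => G (rr q +i* y))
          - cint (rb q) (rt q) (fun y => G (rl q +i* y))).

Lemma bdint_quarters G q : rect_ok q -> holo_rect G q ->
  bdint G q = bdint G (quarter q false false) + bdint G (quarter q false true)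
    + bdint G (quarter q true false) + bdint G (quarter q true true).
Proof.
case: q => a b c d [ab cd] hG; rewrite /bdint /quarter; cbn [rl rr rb rt] in *.
set m := (a + b) / 2; set n := (c + d) / 2.
have [am mb] : a <= m /\ m <= b by rewrite /m; split; lra.
have [cn nd] : c <= n /\ n <= d by rewrite /n; split; lra.
have H y : c <= y <= d -> cint a b (fun x => G (x +i* y)) =
    cint a m (fun x => G (x +i* y)) + cint m b (fun x => G (x +i* y)).
  by move=> yq; apply: cint_split => //; apply: (holo_hseg hG yq) => /=.
have V x : a <= x <= b -> cint c d (fun y => G (x +i* y)) =
    cint c n (fun y => G (x +i* y)) + cint n d (fun y => G (x +i* y)).
  by move=> xq; apply: cint_split => //; apply: (holo_vseg hG xq) => /=.
rewrite (H c) ?lexx ?cd // (H d) ?lexx ?cd ?andbT //.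
rewrite (V a) ?lexx ?ab // (V b) ?lexx ?ab ?andbT //.
ring.
Qed.

(** An affine function has a primitive. *)
Lemma bdint_affine (u v : R[i]) q : rect_ok q -> bdint (fun z => u + v * z) q = 0.
Proof.
case: q => a b c d [ab cd]; rewrite /bdint; cbn [rl rr rb rt] in *.
have I (s t : R) (u' v' : R[i]) : s <= t ->
    cint s t (fun x => u' + v' * x%:C) = u' * (t - s)%:C + v' * ((t ^+ 2 - s ^+ 2) / 2)%:C.
  move=> st; have c1 : ccont s t (fun x => x%:C).
    by split => /=; [apply: continuous_econt => x; exact: cvg_id|exact: econt_cst].
  by rewrite cintD ?cintZ ?cint_cst ?cint_id //; [exact: ccont_cst|exact: ccontZ].
have E1 (y : R) : cint a b (fun x => u + v * (x +i* y)) =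
    (u + v * ('i * y%:C)) * (b - a)%:C + v * ((b ^+ 2 - a ^+ 2) / 2)%:C.
  rewrite -I //; apply: eq_cint => x _; rewrite -addrA -mulrDr; congr (_ + _ * _).
  by simpc.
have E2 (x : R) : cint c d (fun y => u + v * (x +i* y)) =
    (u + v * x%:C) * (d - c)%:C + (v * 'i) * ((d ^+ 2 - c ^+ 2) / 2)%:C.
  rewrite -I //; apply: eq_cint => y _; rewrite -addrA -mulrA -mulrDr; congr (_ + _ * _).
  by simpc.
rewrite !E1 !E2.
set A := (b - a)%:C; set B := (d - c)%:C.
have -> : (u + v * ('i * c%:C)) * A + v * ((b ^+ 2 - a ^+ 2) / 2)%:C -
  ((u + v * ('i * d%:C)) * A + v * ((b ^+ 2 - a ^+ 2) / 2)%:C) +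
  'i * ((u + v * b%:C) * B + v * 'i * ((d ^+ 2 - c ^+ 2) / 2)%:C -
  ((u + v * a%:C) * B + v * 'i * ((d ^+ 2 - c ^+ 2) / 2)%:C)) =
  'i * v * (A * (c%:C - d%:C) + (b%:C - a%:C) * B) by ring.
rewrite /A /B !rmorphB /=; ring.
Qed.

Lemma bdint_bound F S q : rect_ok q -> holo_rect F q ->
  (forall x y, rl q <= x <= rr q -> rb q <= y <= rt q -> normc (F (x +i* y)) <= S) ->
  normc (bdint F q) <= 4 * S * ((rr q - rl q) + (rt q - rb q)).
Proof.
case: q => a b c d [ab cd] hF FS; rewrite /bdint; cbn [rl rr rb rt] in *.
have la : a <= a <= b by rewrite lexx. have lb : a <= b <= b by rewrite lexx ab.
have lc : c <= c <= d by rewrite lexx. have ld : c <= d <= d by rewrite lexx cd.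
have H y : c <= y <= d -> normc (cint a b (fun x => F (x +i* y))) <= 2 * S * (b - a).
  by move=> yq; apply: normc_cint => // [|x xq]; [exact: (holo_hseg hF)|exact: FS].
have V x : a <= x <= b -> normc (cint c d (fun y => F (x +i* y))) <= 2 * S * (d - c).
  by move=> xq; apply: normc_cint => // [|y yq]; [exact: (holo_vseg hF)|exact: FS].
apply: (le_trans (le_normcD _ _)); rewrite normcM normc_i mul1r.
have := lerD (ler_normcB (cint a b (fun x => F (x +i* c))) (cint a b (fun x => F (x +i* d))))
  (ler_normcB (cint c d (fun y => F (b +i* y))) (cint c d (fun y => F (a +i* y)))).
move=> T; apply: (le_trans T); have := H _ lc; have := H _ ld; have := V _ la; have := V _ lb.
lra.
Qed.

Lemma bdintB F G q : rect_ok q -> holo_rect F q -> holo_rect G q ->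
  bdint (fun z => F z - G z) q = bdint F q - bdint G q.
Proof.
case: q => a b c d [ab cd] hF hG; rewrite /bdint; cbn [rl rr rb rt] in *.
rewrite !cintB; do ?[by apply: holo_hseg; rewrite /= ?lexx ?cd |by apply: holo_vseg; rewrite /= ?lexx ?ab].
all: try by [apply: (holo_hseg hF); rewrite /= ?lexx ?cd|apply: (holo_hseg hG); rewrite /= ?lexx ?cd
  |apply: (holo_vseg hF); rewrite /= ?lexx ?ab|apply: (holo_vseg hG); rewrite /= ?lexx ?ab].
ring.
Qed.

Lemma cdiff_affine (u v : R[i]) z : cdiff (fun z => u + v * z) z v.
Proof.
move=> e e0; exists 1 => // h _; rewrite mulrDr.
have -> : u + (v * z + v * h) - (u + v * z) - v * h = 0 by ring.
by rewrite normc0; apply: mulr_ge0; [exact: ltW|exact: normc_ge0].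
Qed.

Lemma cdiffB F G z l m : cdiff F z l -> cdiff G z m ->
  cdiff (fun z => F z - G z) z (l - m).
Proof.
move=> dF dG e e0; have e20 : 0 < e / 2 by rewrite divr_gt0.
have [d1 d10 H1] := dF _ e20; have [d2 d20 H2] := dG _ e20.
exists (Num.min d1 d2); first by rewrite lt_min d10.
move=> h; rewrite lt_min => /andP[/H1 {}H1 /H2 {}H2].
have -> : F (z + h) - G (z + h) - (F z - G z) - (l - m) * h =
  (F (z + h) - F z - l * h) - (G (z + h) - G z - m * h) by ring.
by rewrite (le_trans (ler_normcB _ _)) // (splitr e) mulrDl lerD.
Qed.

(** The boundary integrals over the four quarters add up, so the bound
    [e * (width ^ 2 + height ^ 2)] passes to the whole; it holds for small
    rectangles because the affine part of [G] integrates to [0]. *)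
Lemma goursat G q : rect_ok q -> holo_rect G q -> bdint G q = 0.
Proof.
move=> okq hG; apply/eqP; rewrite -normc_eq0 eq_le normc_ge0 andbT.
pose D (q : @rect R) : R := (rr q - rl q) ^+ 2 + (rt q - rb q) ^+ 2.
suff H (e : R) : 0 < e -> normc (bdint G q) <= e * D q.
  have D0 : 0 <= D q by rewrite addr_ge0 // sqr_ge0.
  apply/ler_addgt0Pl => e e0; rewrite addr0.
  have D1 : 0 < 1 + D q by rewrite ltr_pwDl.
  apply: le_trans (H _ (divr_gt0 e0 D1)) _.
  by rewrite mulrAC ler_pdivrMr // ler_pM2l // lerDr.
move=> e0.
pose P (q' : @rect R) := rl q <= rl q' -> rr q' <= rr q -> rb q <= rb q' -> rt q' <= rt q ->
  normc (bdint G q') <= e * D q'.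
have sub q' : rl q <= rl q' -> rr q' <= rr q -> rb q <= rb q' -> rt q' <= rt q -> holo_rect G q'.
  move=> s1 s2 s3 s4 x y /andP[x1 x2] /andP[y1 y2]; apply: hG.
    by rewrite (le_trans s1 x1) (le_trans x2).
  by rewrite (le_trans s3 y1) (le_trans y2).
apply: (@rect_bisection _ P q) => //.
- move=> q' ok' Hq s1 s2 s3 s4; rewrite bdint_quarters //; last exact: sub.
  have {}Hq i j : normc (bdint G (quarter q' i j)) <= e * (D q' / 4).
    have [[w1 w2 w3 w4 w5] [E1 E2]] := quarterP i j ok'.
    have -> : D q' / 4 = D (quarter q' i j) by rewrite /D E1 E2; field.
    by apply: Hq; [exact: le_trans s1 w2|exact: le_trans w3 s2|exact: le_trans s3 w4|exact: le_trans w5 s4].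
  apply: (le_trans (le_normcD _ _)).
  move: (Hq false false) (Hq false true) (Hq true false) (Hq true true).
  have n1 := le_normcD (bdint G (quarter q' false false)) (bdint G (quarter q' false true)).
  have n2 := le_normcD (bdint G (quarter q' false false) + bdint G (quarter q' false true)) (bdint G (quarter q' true false)).
  lra.
- move=> x y xq yq; have [l dG] := hG x y xq yq.
  have e80 : 0 < e / 8 by rewrite divr_gt0.
  have [dl dl0 Hd] := dG _ e80; exists (dl / 2); first by rewrite divr_gt0.
  move=> q' ok' s1 s2 s3 s4 /andP[x1 x2] /andP[y1 y2] w1 w2 _ _ _ _.
  pose z := x +i* y; pose A z' := (G z - l * z) + l * z'.
  have hA : holo_rect A q' by move=> ? ? _ _; exists l; exact: cdiff_affine.
  have hq' := sub _ s1 s2 s3 s4.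
  have -> : bdint G q' = bdint (fun z => G z - A z) q'.
    by rewrite bdintB // bdint_affine // subr0.
  set w := rr q' - rl q' in w1 *; set h := rt q' - rb q' in w2 *.
  have w0 : 0 <= w by rewrite subr_ge0; case: ok'.
  have h0 : 0 <= h by rewrite subr_ge0; case: ok'.
  apply: (@le_trans _ _ (4 * (e / 8 * (w + h)) * (w + h))); last first.
    rewrite /D -/w -/h.
    have -> : 4 * (e / 8 * (w + h)) * (w + h) = e * ((w + h) ^+ 2 / 2) by field.
    rewrite ler_pM2l // -subr_ge0.
    have -> : w ^+ 2 + h ^+ 2 - (w + h) ^+ 2 / 2 = (w - h) ^+ 2 / 2 by field.
    by rewrite divr_ge0 // sqr_ge0.
  apply: bdint_bound => //.
    move=> x' y' x'q y'q; have [l' dG'] := hq' x' y' x'q y'q.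
    by exists (l' - l); apply: cdiffB => //; exact: cdiff_affine.
  move=> x' y' /andP[x'1 x'2] /andP[y'1 y'2].
  pose k := (x' - x) +i* (y' - y).
  have kn : normc k <= w + h.
    rewrite (le_trans (normc_le_ReIm _)) //= lerD // ler_norml /w /h; lra.
  have -> : x' +i* y' = z + k by rewrite /z /k; simpc; rewrite !(addrC x, addrC y) !subrK.
  have -> : G (z + k) - A (z + k) = G (z + k) - G z - l * k by rewrite /A; ring.
  apply: (le_trans (Hd _ _)); first by rewrite (le_lt_trans kn) // (splitr dl) ltrD.
  by rewrite ler_pM2l.
Qed.

End goursat.

(** * Integrals over circles *)

Section circle_integrals.
Context {R : realType}.
Implicit Types (a b x y : R) (z w l : R[i]) (g q f : R[i] -> R[i]).

Definition ccont_at q z := forall e : R, 0 < e ->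
  exists2 dl : R, 0 < dl & forall h, normc h < dl -> normc (q (z + h) - q z) <= e.

Lemma double_divK x y : y != 0 -> 2 * (x / (2 * y)) * y = x.
Proof. by move=> y0; field. Qed.

Lemma cdiffP f z : (exists l, cdiff f z l) <-> derivable (f : cplx R -> cplx R) z 1.
Proof.
split=> [[l]|df]; first exact: cdiff_derivable.
by exists ('D_1 (f : cplx R -> cplx R) z); exact: derivable_cdiff.
Qed.

Lemma cdiff_near f g z l d : 0 < d -> (forall h, normc h < d -> f (z + h) = g (z + h)) ->
  cdiff f z l -> cdiff g z l.
Proof.
move=> d0 fg df e e0; have [dl dl0 H] := df e e0.
exists (Num.min dl d); first by rewrite lt_min dl0.
move=> h; rewrite lt_min => /andP[/H {}H hd]; rewrite -fg //.
by rewrite -(addr0 z) -fg ?normc0 // addr0.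
Qed.

Lemma cdiff_comp f q z m l : cdiff f z m -> cdiff q (f z) l ->
  cdiff (fun z => q (f z)) z (l * m).
Proof.
move=> df dq e e0.
have m0 : 0 < 1 + normc m by rewrite ltr_pwDl // normc_ge0.
have l0 : 0 < 1 + normc l by rewrite ltr_pwDl // normc_ge0.
have e1 : 0 < e / 2 / (1 + normc m) by rewrite !divr_gt0.
have e2 : 0 < Num.min 1 (e / 2 / (1 + normc l)) by rewrite lt_min ltr01 !divr_gt0.
have [d1 d10 H1] := dq _ e1; have [d2 d20 H2] := df _ e2.
exists (Num.min d2 (d1 / (1 + normc m))); first by rewrite lt_min d20 divr_gt0.
move=> h; rewrite lt_min => /andP[/H2 {}H2]; rewrite ltr_pdivlMr // => hd.
have nh : 0 <= normc h by exact: normc_ge0.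
pose k := f (z + h) - f z.
have kh : normc k <= (1 + normc m) * normc h.
  rewrite /k -(subrK (m * h) (_ - _)); apply: (le_trans (le_normcD _ _)).
  rewrite normcM mulrDl mul1r lerD2r (le_trans H2) // ler_piMl //.
  by rewrite ge_min lexx.
have -> : q (f (z + h)) - q (f z) - l * m * h =
   (q (f z + k) - q (f z) - l * k) + l * (k - m * h).
  rewrite /k; have -> : f z + (f (z + h) - f z) = f (z + h) by ring.
  ring.
apply: (le_trans (le_normcD _ _)); rewrite normcM (splitr e) mulrDl lerD //.
  apply: (le_trans (H1 _ _)); first by rewrite (le_lt_trans kh) // mulrC.
  apply: (le_trans (ler_wpM2l (ltW e1) kh)).
  by rewrite mulrA divfK ?gt_eqF.
apply: (@le_trans _ _ (normc l * (e / 2 / (1 + normc l) * normc h))).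
  rewrite ler_wpM2l ?normc_ge0 // (le_trans H2) // ler_wpM2r //.
  by rewrite ge_min lexx orbT.
have -> : normc l * (e / 2 / (1 + normc l) * normc h) = (e / 2 * normc h) * (normc l / (1 + normc l)).
  by field; rewrite gt_eqF.
rewrite ler_piMr //; first by rewrite mulr_ge0 // divr_ge0 // ltW.
by rewrite ler_pdivrMr // mul1r lerDr.
Qed.

(** The circle of radius [expR a] is the image of the segment of abscissa [a]
    under the exponential; by Goursat the integral over it does not move with [a]
    as long as the integrand is holomorphic in between. *)
Definition circint q a : R[i] := cint 0 (2 * pi) (fun y => q (cexp (a +i* y))).

(** The integrals over the two horizontal sides cancel, the exponential having
    period [2 * pi * i]. *)
Lemma circint_const q a b : a <= b ->
  (forall z, expR a <= normc z <= expR b -> exists l, cdiff q z l) ->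
  circint q a = circint q b.
Proof.
move=> ab hq.
have pi0 : 0 <= 2 * pi :> R by rewrite mulr_ge0 // pi_ge0.
have hol : holo_rect (fun z => q (cexp z)) (Rect a b 0 (2 * pi)).
  move=> x y /= /andP[ax xb] _.
  have [|l dq] := hq (cexp (x +i* y)); first by rewrite normc_cexp /= !ler_expR ax.
  by exists (l * cexp (x +i* y)); apply: cdiff_comp dq; exact: cexp_cdiff.
have := goursat (conj ab pi0 : rect_ok (Rect a b 0 (2 * pi))) hol.
rewrite /bdint; cbn [rl rr rb rt].
have -> : cint a b (fun x => q (cexp (x +i* (2 * pi)))) =
    cint a b (fun x => q (cexp (x +i* 0))).
  apply: eq_cint => x _; rewrite -(cexp_2pi (x +i* 0)).
  by congr (q (cexp _)); simpc.
rewrite subrr add0r => /eqP; rewrite mulf_eq0 => /orP[|].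
  by rewrite -normc_eq0 normc_i oner_eq0.
by rewrite subr_eq0 => /eqP.
Qed.

Lemma ccont_at_comp_cexp q z e : ccont_at q (cexp z) -> 0 < e ->
  exists2 dl : R, 0 < dl & forall h, normc h < dl ->
     normc (q (cexp (z + h)) - q (cexp z)) <= e.
Proof.
move=> cq e0; have [d1 d10 H1] := cq _ e0.
have d1h : 0 < d1 / 2 by rewrite divr_gt0.
have [d2 d20 H2] := cdiff_cont (cexp_cdiff z) d1h.
exists d2 => // h /H2 H; rewrite -(subrKC (cexp z) (cexp (z + h))) H1 //.
by rewrite (le_lt_trans H) // ltr_pdivrMr // ltr_pMr // ltr1n.
Qed.

Lemma ccont_circle q a : (forall z, normc z = expR a -> ccont_at q z) ->
  ccont 0 (2 * pi) (fun y => q (cexp (a +i* y))).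
Proof.
move=> cq; apply: ccontP => y _ e e0.
have [|dl dl0 H] := @ccont_at_comp_cexp q (a +i* y) e _ e0.
  by apply: cq; rewrite normc_cexp.
exists dl => // y' _ yy'.
by rewrite (vsegB y y') H // normcM normc_i mul1r normc_real.
Qed.

(** By compactness of [[0, 2 * pi]], [q] is uniformly continuous near the circle. *)
Lemma circint_continuous q a e : (forall z, z != 0 -> normc z = expR a -> ccont_at q z) ->
  (forall b, `|b - a| < 1 -> ccont 0 (2 * pi) (fun y => q (cexp (b +i* y)))) -> 0 < e ->
  exists2 dl : R, 0 < dl & forall b, `|b - a| < dl -> normc (circint q b - circint q a) <= e.
Proof.
move=> cq cc e0.
have pi0 : 0 < 2 * pi :> R by rewrite mulr_gt0 // pi_gt0.
pose e' := e / (2 * (2 * pi)); have e'0 : 0 < e' by rewrite divr_gt0 // mulr_gt0.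
have [dl dl0 H] : exists2 dl : R, 0 < dl & forall b, `|b - a| < dl -> forall y, 0 <= y <= 2 * pi ->
    normc (q (cexp (b +i* y)) - q (cexp (a +i* y))) <= e'.
  have /compact_near_coveringP nc : compact `[0, 2 * pi :> R] by exact: segment_compact.
  have := @nc _ (nbhs a) (fun b y => normc (q (cexp (b +i* y)) - q (cexp (a +i* y))) <= e') _.
  case.
    move=> y _; have e'20 : 0 < e' / 2 by rewrite divr_gt0.
    have [|dl dl0 H] := @ccont_at_comp_cexp q (a +i* y) _ _ e'20.
      by apply: cq; rewrite ?normc_cexp // cexp_neq0.
    exists (ball y (dl / 2), ball a (dl / 2)) => /=.
      by split; apply: nbhsx_ballx; rewrite divr_gt0.
    move=> [y' b] [] /=; rewrite -!ball_normE /= => yy' bb.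
    have HH c : `|a - c| < dl / 2 -> normc (q (cexp (c +i* y')) - q (cexp (a +i* y))) <= e' / 2.
      move=> ac; have -> : c +i* y' = (a +i* y) + ((c - a) +i* (y' - y)).
        by simpc; rewrite !subrKC.
      apply: H; apply: (le_lt_trans (normc_le_ReIm _)) => /=.
      by rewrite (splitr dl) ltrD // distrC.
    have -> : q (cexp (b +i* y')) - q (cexp (a +i* y')) =
      (q (cexp (b +i* y')) - q (cexp (a +i* y))) - (q (cexp (a +i* y')) - q (cexp (a +i* y))).
      by ring.
    apply: (le_trans (ler_normcB _ _)); rewrite (splitr e') lerD // HH //.
    by rewrite subrr normr0 divr_gt0.
  move=> dl /= dl0 H; exists dl => // b ab y y2; apply: H => /=; last by rewrite in_itv.
  by rewrite distrC.
exists (Num.min dl 1); first by rewrite lt_min dl0 ltr01.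
move=> b; rewrite lt_min => /andP[/H {}H b1].
have ca : ccont 0 (2 * pi) (fun y => q (cexp (a +i* y))) by apply: cc; rewrite subrr normr0.
rewrite /circint -cintB //; last exact: cc.
apply: le_trans (normc_cint (ltW pi0) _ H) _; first by apply: ccontB => //; exact: cc.
rewrite subr0 /e'; by rewrite double_divK // gt_eqF.
Qed.

(** The integral varies continuously across the circle through [z1], where [q] is
    merely continuous, and it tends to [0] with the radius. *)
Lemma circint_eq0 q z1 r0 rho : z1 != 0 -> normc z1 < rho -> rho < r0 ->
  (forall z, z != z1 -> normc z < r0 -> exists l, cdiff q z l) ->
  ccont_at q z1 -> q 0 = 0 -> ccont_at q 0 -> circint q (ln rho) = 0.
Proof.
move=> z10 z1r rr hq cq1 q00 cq0.
have n1 : 0 < normc z1 by rewrite normc_gt0.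
have pi0 : 0 < 2 * pi :> R by rewrite mulr_gt0 // pi_gt0.
have rho0 : 0 < rho by exact: lt_trans n1 z1r.
have r00 : 0 < r0 by exact: lt_trans rho0 rr.
pose a1 := ln (normc z1).
have ea1 : expR a1 = normc z1 by rewrite lnK.
have erho : expR (ln rho) = rho by rewrite lnK.
have cq z : normc z < r0 -> ccont_at q z.
  have [->//|zz1] := eqVneq z z1.
  by move=> /(hq _ zz1) [l dq] e; exact: (cdiff_cont dq).
have cc a : expR a < r0 -> ccont 0 (2 * pi) (fun y => q (cexp (a +i* y))).
  by move=> ar; apply: ccont_circle => z zn; apply: cq; rewrite zn.
have small a e : 0 < e -> a < a1 -> normc (circint q a) <= e.
  move=> e0 aa1; pose e' := e / (2 * (2 * pi)); have e'0 : 0 < e' by rewrite divr_gt0 // mulr_gt0.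
  have [dl dl0 H] := cq0 _ e'0.
  pose b := Num.min a (ln (dl / 2)).
  have ba : b <= a by rewrite ge_min lexx.
  have bdl : expR b < dl.
    have : expR b <= expR (ln (dl / 2)) by rewrite ler_expR ge_min lexx orbT.
    rewrite lnK ?posrE ?divr_gt0 // => /le_lt_trans; apply.
    by rewrite ltr_pdivrMr // ltr_pMr // ltr1n.
  rewrite -(circint_const ba); last first.
    move=> z /andP[_ za]; have zz : normc z < normc z1.
      by rewrite (le_lt_trans za) // -ea1 ltr_expR.
    apply: hq; first by apply: contraTneq zz => ->; rewrite ltxx.
    by rewrite (lt_trans zz) // (lt_trans z1r).
  have br : expR b < r0.
    rewrite (lt_trans _ rr) // (lt_trans _ z1r) // -ea1 ltr_expR.
    exact: le_lt_trans aa1.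
  rewrite /circint; apply: le_trans (@normc_cint _ _ _ _ e' (ltW pi0) (cc _ br) _) _.
    move=> y _; have := H (cexp (b +i* y)); rewrite add0r q00 subr0 normc_cexp.
    exact.
  rewrite subr0 /e'; by rewrite double_divK // gt_eqF.
have big a : a1 < a -> expR a < r0 -> forall b, a1 < b -> b <= a -> circint q b = circint q a.
  move=> a1a ar b a1b ba; apply: circint_const => // z /andP[bz za].
  have zz : normc z1 < normc z by rewrite (lt_le_trans _ bz) // -ea1 ltr_expR.
  apply: hq; last exact: le_lt_trans za ar.
  by apply: contraTneq zz => ->; rewrite ltxx.
have cont e : 0 < e -> exists2 dl : R, 0 < dl & forall b, `|b - a1| < dl ->
    normc (circint q b - circint q a1) <= e.
  move=> e0; pose k : R := Num.min 1 (ln r0 - a1).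
  have a1r : a1 < ln r0 by rewrite ltr_ln ?posrE // (lt_trans z1r).
  have [d1 d10 H1] : exists2 dl : R, 0 < dl & forall b, `|b - a1| < dl -> expR b < r0.
    exists (ln r0 - a1); first by rewrite subr_gt0.
    move=> b /ltr_normlW; rewrite ltrD2r => bl.
    by rewrite -[r0]lnK // ltr_expR.
  (* outside the disc the integrand is replaced by 0, which changes nothing near [a1] *)
  pose q' z := if normc z < r0 then q z else 0.
  have E b : expR b < r0 -> circint q' b = circint q b.
    by move=> br; apply: eq_cint => y _; rewrite /q' normc_cexp /= br.
  have E' b : expR b < r0 -> (fun y => q' (cexp (b +i* y))) = (fun y => q (cexp (b +i* y))).
    by move=> br; apply/funext => y; rewrite /q' normc_cexp /= br.
  have [||dl dl0 H] := @circint_continuous q' a1 e _ _ e0.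
  - move=> z z0 zn e' e'0.
    have zr : normc z < r0 by rewrite zn ea1 (lt_trans z1r).
    have [d2 d20 H2] := cq _ zr _ e'0.
    exists (Num.min d2 (r0 - normc z)); first by rewrite lt_min d20 subr_gt0.
    move=> h; rewrite lt_min => /andP[/H2 {}H2 hr].
    rewrite /q' zr; have -> // : normc (z + h) < r0.
    by rewrite (le_lt_trans (le_normcD _ _)) // -ltrBrDl.
  - move=> b _; have [br|br] := ltP (expR b) r0; first by rewrite E' //; exact: cc.
    have -> : (fun y => q' (cexp (b +i* y))) = fun=> 0; last exact: ccont_cst.
    by apply/funext => y; rewrite /q' normc_cexp /= ltNge br.
  - exists (Num.min dl d1); first by rewrite lt_min dl0.
    move=> b; rewrite lt_min => /andP[/H {}H /H1 br]; rewrite -!E //.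
    by rewrite ea1 (lt_trans z1r).
have I1 : circint q a1 = 0.
  apply/eqP; rewrite -normc_eq0 eq_le normc_ge0 andbT; apply/ler_addgt0Pl => e e0.
  rewrite addr0 (splitr e); have e20 : 0 < e / 2 by rewrite divr_gt0.
  have [dl dl0 H] := cont _ e20.
  have -> : circint q a1 = circint q (a1 - dl / 2) - (circint q (a1 - dl / 2) - circint q a1) by ring.
  apply: (le_trans (ler_normcB _ _)); rewrite lerD //.
    by apply: small => //; rewrite ltrBlDr ltrDl divr_gt0.
  apply: H; rewrite addrAC subrr add0r normrN gtr0_norm ?divr_gt0 //.
  by rewrite ltr_pdivrMr // ltr_pMr // ltr1n.
have a1rho : a1 < ln rho by rewrite ltr_ln ?posrE.
apply/eqP; rewrite -normc_eq0 eq_le normc_ge0 andbT; apply/ler_addgt0Pl => e e0.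
rewrite addr0; have [dl dl0 H] := cont _ e0.
pose b := Num.min (ln rho) (a1 + dl / 2).
have a1b : a1 < b by rewrite lt_min a1rho ltrDl divr_gt0.
have bl : b <= ln rho by rewrite ge_min lexx.
rewrite -(big _ a1rho _ _ a1b bl) ?erho // -[X in normc X]subr0 -I1; apply: H.
rewrite gtr0_norm ?subr_gt0 // ltrBlDl.
have : b <= a1 + dl / 2 by rewrite ge_min lexx orbT.
move/le_lt_trans; apply; rewrite ltrD2l.
by rewrite ltr_pdivrMr // ltr_pMr // ltr1n.
Qed.

End circle_integrals.

(** * Taylor series of holomorphic functions *)

Section taylor.
Context {R : realType}.
Implicit Types (a b x y : R) (z w l : R[i]) (g q f : R[i] -> R[i]).

Definition hol f z := exists l, cdiff f z l.

Lemma holM f g z : hol f z -> hol g z -> hol (fun z => f z * g z) z.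
Proof.
move=> /cdiffP df /cdiffP dg; apply/cdiffP.
exact: (@derivableM R[i] (cplx R) (f : cplx R -> cplx R) (g : cplx R -> cplx R) z 1 df dg).
Qed.

Lemma holB f g z : hol f z -> hol g z -> hol (fun z => f z - g z) z.
Proof. by move=> [l dl] [m dm]; exists (l - m); exact: cdiffB. Qed.

Lemma hol_cst c z : hol (fun=> c) z.
Proof.
exists 0 => e e0; exists 1 => // h _; rewrite subrr mul0r subr0 normc0.
by apply: mulr_ge0; [exact: ltW|exact: normc_ge0].
Qed.

Lemma hol_id z : hol id z.
Proof.
exists 1 => e e0; exists 1 => // h _ /=.
have -> : z + h - z - 1 * h = 0 by ring.
rewrite normc0.
by apply: mulr_ge0; [exact: ltW|exact: normc_ge0].
Qed.

Lemma holX n z : hol (fun z => z ^+ n) z.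
Proof.
elim: n => [|n IH]; first exact: hol_cst.
have -> : (fun z : R[i] => z ^+ n.+1) = (fun z => id z * z ^+ n).
  by apply/funext => x; rewrite exprS.
by apply: holM => //; exact: hol_id.
Qed.

Lemma holV f z : f z != 0 -> hol f z -> hol (fun z => (f z)^-1) z.
Proof.
move=> f0 /cdiffP df; apply/cdiffP.
exact: (@derivableV R[i] (cplx R) (f : cplx R -> cplx R) z 1 f0 df).
Qed.

Lemma hol_cont f z : hol f z -> ccont_at f z.
Proof. by move=> [l dl] e; exact: (cdiff_cont dl). Qed.

Lemma hol_monom m n z : z != 0 -> hol (fun z => z ^+ m / z ^+ n) z.
Proof.
move=> z0; apply: (@holM (fun z => z ^+ m) (fun z => (z ^+ n)^-1)); first exact: holX.
by apply: (@holV (fun z => z ^+ n)); [rewrite expf_neq0|exact: holX].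
Qed.

Lemma hol_invX n z : z != 0 -> hol (fun z => (z ^+ n)^-1) z.
Proof. by move=> z0; apply: (@holV (fun z => z ^+ n)); [rewrite expf_neq0|exact: holX]. Qed.

(** The circle integral of [z ^ (m - n)] is multiplied by [expR (m - n)] when the
    radius is multiplied by [e], but does not depend on the radius. *)
Lemma circle_orth a (m n : nat) : m != n ->
  circint (fun z => z ^+ m / z ^+ n : R[i]) a = 0.
Proof.
move=> mn; pose c : R[i] := m%:R - n%:R.
have E x : circint (fun z => z ^+ m / z ^+ n : R[i]) x =
    cint 0 (2 * pi) (fun y => cexp (c * (x +i* y))).
  apply: eq_cint => y _; rewrite mulrBl cexpD -mulNr mulNr cexpN !cexpMn.
  by [].
have I01 : circint (fun z => z ^+ m / z ^+ n : R[i]) a =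
    circint (fun z => z ^+ m / z ^+ n : R[i]) (a + 1).
  apply: circint_const; first by rewrite lerDl.
  move=> z /andP[za _]; have z0 : z != 0 by rewrite -normc_gt0 (lt_le_trans _ za) // expR_gt0.
  exact: hol_monom.
have I02 : circint (fun z => z ^+ m / z ^+ n : R[i]) (a + 1) =
    cexp c * circint (fun z => z ^+ m / z ^+ n : R[i]) a.
  rewrite !E -cintZ; last first.
    have -> : (fun y => cexp (c * (a +i* y))) = (fun y => (fun z : R[i] => z ^+ m / z ^+ n) (cexp (a +i* y))).
      by apply/funext => y; rewrite mulrBl cexpD -mulNr mulNr cexpN !cexpMn.
    apply: (@ccont_circle _ (fun z : R[i] => z ^+ m / z ^+ n)) => z za.
    have z0 : z != 0 by rewrite -normc_gt0 za expR_gt0.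
    exact: (hol_cont (hol_monom m n z0)).
  apply: eq_cint => y _; rewrite -cexpD; congr cexp.
  have -> : (a + 1) +i* y = (a +i* y) + 1%:C :> R[i] by simpc.
  by rewrite rmorph1; ring.
have : (cexp c - 1) * circint (fun z => z ^+ m / z ^+ n : R[i]) a = 0.
  by rewrite mulrBl mul1r -I02 -I01 subrr.
move/eqP; rewrite mulf_eq0 => /orP[|/eqP //].
have -> : c = (m%:R - n%:R)%:C by rewrite rmorphB /= !rmorph_nat.
rewrite cexp_real subr_eq0 => /eqP /(congr1 (@complex.Re R)) /= /eqP.
rewrite -[X in _ == X]expR0 (inj_eq (@expR_inj R)) subr_eq0 eqr_nat.
move=> mn'; exfalso; by move: mn; rewrite mn'.
Qed.

Lemma circle_int1 a (n : nat) : circint (fun z => z ^+ n / z ^+ n : R[i]) a = (2 * pi)%:C.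
Proof.
have pi0 : 0 <= 2 * pi :> R by rewrite mulr_ge0 // pi_ge0.
rewrite /circint -[RHS]mul1r -[X in X%:C]subr0 -cint_cst //; apply: eq_cint => y _.
by rewrite divff // expf_neq0 // cexp_neq0.
Qed.

(** The Fourier coefficients of [g] on the circle of radius [rho], normalized as
    Taylor coefficients. *)
Definition circ_coef g (rho : R) (n : nat) : R[i] :=
  (2 * pi)%:C^-1 * circint (fun z => g z / z ^+ n) (ln rho).

Lemma pi2_gt0 : 0 < 2 * pi :> R.
Proof. by rewrite mulr_gt0 // pi_gt0. Qed.

Lemma normc_circ_coef g rho S n : 0 < rho ->
  ccont 0 (2 * pi) (fun y => g (cexp (ln rho +i* y))) ->
  (forall y, 0 <= y <= 2 * pi -> normc (g (cexp (ln rho +i* y))) <= S) ->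
  normc (circ_coef g rho n) * rho ^+ n <= 2 * S.
Proof.
move=> r0 cg gS; rewrite /circ_coef normcM normcV normc_real gtr0_norm ?pi2_gt0 //.
have er : expR (ln rho) = rho by rewrite lnK.
have rn : 0 < rho ^+ n by rewrite exprn_gt0.
suff H : normc (circint (fun z => g z / z ^+ n) (ln rho)) <= 2 * (S / rho ^+ n) * (2 * pi - 0).
  have -> : 2 * S = (2 * pi)^-1 * (2 * (S / rho ^+ n) * (2 * pi - 0)) * rho ^+ n.
    by rewrite subr0; have := pi2_gt0; move: (2 * pi) => p p0; field; rewrite !gt_eqF.
  by rewrite ler_pM2r // ler_pM2l // invr_gt0 pi2_gt0.
apply: normc_cint; first exact: ltW pi2_gt0.
  apply: ccontM => //.
  apply: (@ccont_circle _ (fun z : R[i] => (z ^+ n)^-1)) => z; rewrite er => zr.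
  have z0 : z != 0 by rewrite -normc_gt0 zr.
  exact: (hol_cont (hol_invX n z0)).
move=> y yp; rewrite normcM normcV normcX normc_cexp /= er ler_pdivrMr // divfK ?gt_eqF //.
exact: gS.
Qed.

(** A function that is complex differentiable on an open disc is the sum of its
    Taylor series: integrate [(g z - g z1) * z / (z - z1)] over the circle after
    expanding [z / (z - z1)] in powers of [z1 / z]. *)
Lemma taylor_disc g r0 rho S : (forall z, normc z < r0 -> exists l, cdiff g z l) ->
  0 < rho -> rho < r0 ->
  (forall y, 0 <= y <= 2 * pi -> normc (g (cexp (ln rho +i* y))) <= S) ->
  (forall n, normc (circ_coef g rho n) * rho ^+ n <= 2 * S) /\
  (forall z, normc z < rho -> forall e, 0 < e -> exists N, forall n, (N <= n)%N ->
     normc (\sum_(i < n) circ_coef g rho i * z ^+ i - g z) <= e).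
Proof.
move=> hg rho0 rr gS.
have er : expR (ln rho) = rho by rewrite lnK.
have r00 := lt_trans rho0 rr.
have cgz z : normc z < r0 -> ccont_at g z by move=> /hg[l dl] e; exact: (cdiff_cont dl).
have cg : ccont 0 (2 * pi) (fun y => g (cexp (ln rho +i* y))).
  by apply: ccont_circle => z zr; apply: cgz; rewrite zr er.
split=> [n|z1 z1r]; first exact: normc_circ_coef.
have [l1 dg1] := hg z1 (lt_trans z1r rr).
pose q0 z := if z == z1 then l1 else (g z - g z1) / (z - z1).
pose q z := q0 z * z.
have dq0 z : z != z1 -> normc z < r0 -> exists l, cdiff q0 z l.
  move=> zz1 /hg dgz; have d0 : 0 < normc (z - z1) by rewrite normc_gt0 subr_eq0.
  have [l dl] : hol (fun z => (g z - g z1) / (z - z1)) z.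
    apply: (@holM (fun z => g z - g z1) (fun z => (z - z1)^-1)).
      by apply: holB => //; exact: hol_cst.
    apply: (@holV (fun z => z - z1)); first by rewrite subr_eq0.
    by apply: (@holB id); [exact: hol_id|exact: hol_cst].
  exists l; apply: cdiff_near d0 _ dl => h hd; rewrite /q0 ifF //.
  apply: contraTF hd => /eqP <-; rewrite opprD addNKr normcN ltxx //.
have dq z : z != z1 -> normc z < r0 -> exists l, cdiff q z l.
  by move=> zz1 zr; apply: (@holM q0 id); [exact: dq0|exact: hol_id].
have cq0 : ccont_at q0 z1.
  move=> e e0; have [dl dl0 H] := dg1 _ e0; exists dl => // h hd.
  rewrite {2}/q0 eqxx /q0; case: eqVneq => [_|hz]; first by rewrite subrr normc0 ltW.
  have h0 : h != 0 by apply: contra hz => /eqP ->; rewrite addr0.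
  have -> : z1 + h - z1 = h by ring.
  have := H h hd.
  have -> : g (z1 + h) - g z1 - l1 * h = h * ((g (z1 + h) - g z1) / h - l1) by field.
  by rewrite normcM mulrC ler_pM2r // normc_gt0.
have cq0' z : normc z < r0 -> ccont_at q0 z.
  move=> zr; have [->//|zz1] := eqVneq z z1.
  by have [l dl] := dq0 z zz1 zr; move=> e; exact: (cdiff_cont dl).
have cq z : normc z < r0 -> ccont_at q z.
  move=> zr e e0; have nz : 0 < 1 + normc z by rewrite ltr_pwDl // normc_ge0.
  have nq : 0 < 1 + normc (q0 z) by rewrite ltr_pwDl // normc_ge0.
  have e1 : 0 < Num.min 1 (e / 2 / (1 + normc z)) by rewrite lt_min ltr01 !divr_gt0.
  have [dl dl0 H] := cq0' z zr _ e1.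
  exists (Num.min dl (e / 2 / (1 + normc (q0 z)))); first by rewrite lt_min dl0 !divr_gt0.
  move=> h; rewrite lt_min => /andP[/H {}H hd].
  move: H; rewrite le_min => /andP[H1 H2].
  have -> : q (z + h) - q z = (q0 (z + h) - q0 z) * z + q0 (z + h) * h by rewrite /q; ring.
  apply: (le_trans (le_normcD _ _)); rewrite !normcM (splitr e) lerD //.
    apply: (le_trans (ler_wpM2r (normc_ge0 z) H2)).
    by rewrite mulrAC ler_pdivrMr // ler_wpM2l ?divr_ge0 ?ltW // ltr_pwDl.
  have H3 : normc (q0 (z + h)) <= 1 + normc (q0 z).
    by rewrite -{1}(subrK (q0 z) (q0 (z + h))); apply: (le_trans (le_normcD _ _)); rewrite lerD2r.
  apply: (le_trans (ler_wpM2r (normc_ge0 h) H3)).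
  by move: hd; rewrite ltr_pdivlMr // mulrC => /ltW.
have q00 : q 0 = 0 by rewrite /q mulr0.
have I0 : circint q (ln rho) = 0.
  have [z10|z10] := eqVneq z1 0; last first.
    apply: (@circint_eq0 _ q z1 r0) => //; first exact: cq (lt_trans z1r rr).
    by apply: cq; rewrite normc0.
  have hr : 0 < rho / 2 by rewrite divr_gt0.
  have nr : normc ((rho / 2)%:C : R[i]) < rho.
    by rewrite normc_real gtr0_norm // ltr_pdivrMr // ltr_pMr // ltr1n.
  apply: (@circint_eq0 _ q (rho / 2)%:C r0) => //.
  - by rewrite -normc_gt0 normc_real gtr0_norm.
  - move=> z _ zr; have [zz1|zz1] := eqVneq z z1; last exact: dq.
    exists l1; move: dg1; rewrite zz1 z10 => dg1 e /dg1 [d1 d10 H]; exists d1 => // h /H.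
    rewrite !add0r /q /q0 z10 mulr0 subr0; case: eqVneq => [->|h0].
      by rewrite !mulr0 !subr0 subrr.
    by rewrite subr0 divfK.
  - exact: cq (lt_trans nr rr).
  - by apply: cq; rewrite normc0.
move=> e e0.
pose S' := S + normc (g z1); pose th := normc z1 / rho.
have S0 : 0 <= S.
  by apply: le_trans (gS 0 _); [exact: normc_ge0|rewrite lexx ltW // pi2_gt0].
have S'0 : 0 <= S' by rewrite addr_ge0 // normc_ge0.
have th1 : th < 1 by rewrite ltr_pdivrMr // mul1r.
have th0 : 0 <= th by rewrite divr_ge0 ?normc_ge0 // ltW.
have th1' : 0 < 1 - th by rewrite subr_gt0.
pose T n z : R[i] := (g z - g z1) * \sum_(i < n) (z1 / z) ^+ i.
have cmon n : ccont 0 (2 * pi) (fun y => (cexp (ln rho +i* y) ^+ n)^-1 : R[i]).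
  apply: (@ccont_circle _ (fun z : R[i] => (z ^+ n)^-1)) => z; rewrite er => zr.
  have z0 : z != 0 by rewrite -normc_gt0 zr.
  exact: (hol_cont (hol_invX n z0)).
have ccq : ccont 0 (2 * pi) (fun y => q (cexp (ln rho +i* y))).
  by apply: ccont_circle => z zr; apply: cq; rewrite zr er.
have cgn n : ccont 0 (2 * pi) (fun y => g (cexp (ln rho +i* y)) / cexp (ln rho +i* y) ^+ n).
  exact: ccontM.
have ct i : ccont 0 (2 * pi) (fun y => z1 ^+ i * (g (cexp (ln rho +i* y)) / cexp (ln rho +i* y) ^+ i)
   - (z1 ^+ i * g z1) * (cexp (ln rho +i* y) ^+ i)^-1).
  by apply: ccontB; apply: ccontZ.
have TE n (y : R) : T n (cexp (ln rho +i* y)) = \sum_(i < n) (z1 ^+ i * (g (cexp (ln rho +i* y)) / cexp (ln rho +i* y) ^+ i)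
   - (z1 ^+ i * g z1) * (cexp (ln rho +i* y) ^+ i)^-1).
  rewrite /T mulr_sumr; apply: eq_bigr => i _; rewrite expr_div_n; ring.
have cT n : ccont 0 (2 * pi) (fun y => T n (cexp (ln rho +i* y))).
  under eq_fun do rewrite TE.
  elim: n => [|n IH]; first by under eq_fun do rewrite big_ord0; exact: ccont_cst.
  by under eq_fun do rewrite big_ord_recr /=; apply: ccontD => //; exact: ct.
have orth i : cint 0 (2 * pi) (fun y => (cexp (ln rho +i* y) ^+ i)^-1) =
    if i == 0%N then (2 * pi)%:C else 0 :> R[i].
  case: eqVneq => [->|i0].
    rewrite -(circle_int1 (ln rho) 0); apply: eq_cint => y _.
    by rewrite !expr0 invr1 mulr1.
  rewrite eq_sym in i0; rewrite -(circle_orth (ln rho) i0); apply: eq_cint => y _.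
  by rewrite expr0 mul1r.
have p0 : (2 * pi)%:C != 0 :> R[i].
  by rewrite -normc_gt0 normc_real gtr0_norm ?pi2_gt0.
have IT n : (0 < n)%N -> cint 0 (2 * pi) (fun y => T n (cexp (ln rho +i* y))) =
    (2 * pi)%:C * (\sum_(i < n) circ_coef g rho i * z1 ^+ i - g z1).
  move=> n0; pose F i y := z1 ^+ i * (g (cexp (ln rho +i* y)) / cexp (ln rho +i* y) ^+ i)
   - (z1 ^+ i * g z1) * (cexp (ln rho +i* y) ^+ i)^-1.
  have -> : cint 0 (2 * pi) (fun y => T n (cexp (ln rho +i* y))) =
      cint 0 (2 * pi) (fun y => \sum_(i < n) F i y).
    by apply: eq_cint => y _; rewrite TE.
  rewrite (@cint_sum _ 0 (2 * pi) n F ct) /F.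
  under eq_bigr => i _.
    rewrite cintB ?cintZ ?orth //; [|exact: ccontZ..].
    have -> : cint 0 (2 * pi) (fun x => g (cexp (ln rho +i* x)) / cexp (ln rho +i* x) ^+ i) =
       (2 * pi)%:C * circ_coef g rho i by rewrite /circ_coef mulrA divff // mul1r.
    over.
  rewrite sumrB mulrBr; congr (_ - _); last first.
    case: n n0 => // n _; rewrite big_ord_recl /= expr0 mul1r.
    by rewrite big1 ?addr0 1?mulrC // => i _; rewrite mulr0.
  by rewrite mulr_sumr; apply: eq_bigr => i _; ring.
have bound n : (0 < n)%N -> normc (\sum_(i < n) circ_coef g rho i * z1 ^+ i - g z1) <=
    2 * (S' / (1 - th)) * th ^+ n.
  move=> n0.
  have : normc (cint 0 (2 * pi) (fun y => T n (cexp (ln rho +i* y)) - q (cexp (ln rho +i* y))))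
      <= 2 * (S' * (th ^+ n / (1 - th))) * (2 * pi - 0).
    apply: normc_cint; first exact: ltW pi2_gt0.
      exact: ccontB.
    move=> y yp; have gzS := gS y yp; move: gzS; set z := cexp (ln rho +i* y) => gzS.
    have nz : normc z = rho by rewrite normc_cexp /= er.
    clearbody z.
    have zz1 : z != z1 by apply: contraTneq z1r => <-; rewrite nz ltxx.
    have z0 : z != 0 by rewrite -normc_gt0 nz.
    have t1 : 1 - z1 / z != 0.
      by rewrite subr_eq0; apply: contraNneq zz1 => /esym/eqP; rewrite (can2_eq (divfK z0) (mulfK z0)) mul1r => /eqP ->.
    have -> : T n z - q z = - ((g z - g z1) * ((z1 / z) ^+ n / (1 - z1 / z))).
      rewrite /T /q /q0 (negbTE zz1).
      have -> : \sum_(i < n) (z1 / z) ^+ i = (1 - (z1 / z) ^+ n) / (1 - z1 / z).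
        apply: (mulfI t1); rewrite [RHS]mulrC divfK //.
        by rewrite -[1 - z1 / z]opprB mulNr -subrX1 opprB.
      set t := z1 / z in t1 *; set X := t ^+ n.
      have -> : (g z - g z1) / (z - z1) * z = (g z - g z1) / (1 - t).
        have -> : 1 - t = (z - z1) / z by rewrite /t mulrBl divff.
        by rewrite invfM invrK mulrA.
      clear -t1; move: (g z - g z1) => A; field.
      exact: t1.
    rewrite normcN !normcM normcV normcX.
    have nt : normc (z1 / z) = th by rewrite normcM normcV nz.
    rewrite nt; apply: ler_pM; rewrite ?normc_ge0 ?mulr_ge0 ?invr_ge0 ?normc_ge0 ?exprn_ge0 //.
      by apply: (le_trans (ler_normcB _ _)); rewrite lerD2r.
    rewrite ler_wpM2l ?exprn_ge0 // lef_pV2 ?posrE ?normc_gt0 //.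
    by rewrite -nt; have := lerB_normc 1 (z1 / z); rewrite normc1.
  have -> : cint 0 (2 * pi) (fun y => T n (cexp (ln rho +i* y)) - q (cexp (ln rho +i* y))) =
     (2 * pi)%:C * (\sum_(i < n) circ_coef g rho i * z1 ^+ i - g z1).
    rewrite cintB // IT //; move: I0; rewrite /circint => ->; by rewrite subr0.
  rewrite normcM normc_real gtr0_norm ?pi2_gt0 // subr0 [X in _ <= X]mulrC ler_pM2l ?pi2_gt0 //.
  by rewrite (mulrC (th ^+ n)) !mulrA.
have [N HN] : exists N, forall n, (N <= n)%N -> 2 * (S' / (1 - th)) * th ^+ n <= e.
  pose K := 2 * (S' / (1 - th)); have K0 : 0 <= K by rewrite mulr_ge0 // divr_ge0 // ltW.
  have K1 : 0 < 1 + K by rewrite ltr_pwDl.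
  have := @cvg_expr R th; rewrite ger0_norm // => /(_ th1) /cvgrPdist_le /(_ _ (divr_gt0 e0 K1)).
  move=> [N _ H]; exists N => n /H; rewrite sub0r normrN ger0_norm ?exprn_ge0 //.
  rewrite ler_pdivlMr // => H'; apply: le_trans H'; rewrite mulrC ler_wpM2l ?exprn_ge0 //.
  by rewrite lerDr.
exists N.+1 => n Nn; apply: (le_trans (bound n _)); first exact: leq_ltn_trans Nn.
by apply: HN; exact: ltnW.
Qed.

End taylor.

(** * Formal and absolutely convergent power series *)

Section convolution.
Context {K : comNzRingType}.
Implicit Types (a b c h : nat -> K).

Definition conv a b n := \sum_(i < n.+1) a i * b (n - i)%N.

Definition delta0 n : K := (n == 0%N)%:R.

Lemma conv_poly a b n k : (n <= k)%N ->
  conv a b n = ((\poly_(i < k.+1) a i) * (\poly_(i < k.+1) b i))`_n.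
Proof.
move=> nk; rewrite coefM; apply: eq_bigr => i _; rewrite !coef_poly.
rewrite (leq_trans (ltn_ord i)) ?ltnS //.
by rewrite (leq_trans (leq_subr _ _)).
Qed.

Lemma convC a b : conv a b = conv b a.
Proof. by apply/funext => n; rewrite !(conv_poly _ _ (leqnn n)) mulrC. Qed.

Lemma convA a b c : conv a (conv b c) = conv (conv a b) c.
Proof.
apply/funext => n.
pose P (x : nat -> K) := \poly_(i < n.+1) x i.
have E1 : conv a (conv b c) n = (P a * (P b * P c))`_n.
  rewrite coefM; apply: eq_bigr => i _; rewrite coef_poly ltn_ord.
  by rewrite (conv_poly _ _ (leq_subr i n)).
have E2 : conv (conv a b) c n = ((P a * P b) * P c)`_n.
  rewrite coefM; apply: eq_bigr => i _; rewrite [(P c)`__]coef_poly ltnS leq_subr.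
  by rewrite -(conv_poly a b (n := i)) // -ltnS.
by rewrite E1 E2 mulrA.
Qed.

Lemma conv_delta a : conv a delta0 = a.
Proof.
apply/funext => n; rewrite /conv big_ord_recr /= subnn /delta0 mulr1 big1 ?add0r // => i _.
by rewrite subn_eq0 leqNgt ltn_ord mulr0.
Qed.

Lemma convDl a b c : conv (fun n => a n + b n) c = (fun n => conv a c n + conv b c n).
Proof.
by apply/funext => n; rewrite /conv -big_split; apply: eq_bigr => i _; rewrite mulrDl.
Qed.

Lemma convZl x a b : conv (fun n => x * a n) b = (fun n => x * conv a b n).
Proof.
by apply/funext => n; rewrite /conv mulr_sumr; apply: eq_bigr => i _; rewrite mulrA.
Qed.

(** Summing over the triangle [i + k < n] by diagonals or by rows. *)
Lemma triangle_sum h a b n : \sum_(j < n) h j * conv a b j =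
  \sum_(i < n) a i * \sum_(k < n - i) h (i + k)%N * b k.
Proof.
elim: n => [|n IH]; first by rewrite !big_ord0.
rewrite big_ord_recr /= IH [RHS]big_ord_recr /= subSnn big_ord1 addn0.
rewrite /conv big_ord_recr /= subnn mulrDr addrA; congr (_ + _); last by ring.
rewrite mulr_sumr -big_split; apply: eq_bigr => i _ /=.
rewrite subSn ?(ltnW (ltn_ord i)) // big_ord_recr /= subnKC ?(ltnW (ltn_ord i)) //.
by rewrite mulrDr; congr (_ + _); ring.
Qed.

(** The list of the first [n] coefficients, so that the recursion sees all of them. *)
Fixpoint finv_seq a n : seq K :=
  if n is n'.+1 then
    let l := finv_seq a n' in
    rcons l (if n' is 0 then 1 else - \sum_(k < n') a k.+1 * l`_(n' - k.+1))
  else [::].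

(** The coefficients of the formal inverse of a series with constant term 1. *)
Definition finv a n : K := (finv_seq a n.+1)`_n.

Lemma size_finv_seq a n : size (finv_seq a n) = n.
Proof. by elim: n => //= n IH; rewrite size_rcons IH. Qed.

Lemma nth_finv_seq a n i : (i < n)%N -> (finv_seq a n)`_i = finv a i.
Proof.
elim: n => // n IH; rewrite ltnS leq_eqVlt => /orP[/eqP ->//|lin].
by rewrite /= nth_rcons size_finv_seq lin IH.
Qed.

Lemma finv0 a : finv a 0 = 1. Proof. by []. Qed.

Lemma finvS a n : finv a n.+1 = - \sum_(k < n.+1) a k.+1 * finv a (n - k).
Proof.
rewrite /finv /= nth_rcons size_rcons size_finv_seq ltnn eqxx; congr (- _).
apply: eq_bigr => k _; rewrite subSS; congr (_ * _).
by rewrite -[RHS](@nth_finv_seq a n.+1) // ltnS leq_subr.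
Qed.

Lemma conv_finv a : a 0%N = 1 -> conv a (finv a) = delta0.
Proof.
move=> a0; apply/funext => -[|n].
  by rewrite /conv big_ord1 a0 finv0 mulr1.
rewrite /conv big_ord_recl a0 mul1r subn0 finvS addrC; apply/eqP.
by rewrite subr_eq0; apply/eqP; apply: eq_bigr => k _; rewrite /= subSS.
Qed.

Lemma conv_inj m a b : m 0%N = 1 -> conv a m = conv b m -> a = b.
Proof.
move=> m0 ab; rewrite -(conv_delta a) -(conv_delta b) -(conv_finv m0) !convA.
by rewrite ab.
Qed.

Lemma finv_unique m c : m 0%N = 1 -> conv c m = delta0 -> c = finv m.
Proof. by move=> m0 cm; apply: (conv_inj m0); rewrite cm [RHS]convC conv_finv. Qed.

End convolution.

Section weighted_series.
Context {R : realType} {K : comNzRingType}.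

(** The properties shared by the absolute values of [R] and of [R[i]]. *)
Definition absval (N : K -> R) : Prop :=
  [/\ forall x, N x = 0 <-> x = 0, forall x, N (- x) = N x,
      forall x y, N (x + y) <= N x + N y & forall x y, N (x * y) = N x * N y].

Variable N : K -> R.
Hypothesis hN : absval N.
Implicit Types (a b c h u : nat -> K) (x y z l : K) (rho S : R).

Lemma abs0 : N 0 = 0. Proof. by case: hN => h _ _ _; apply/h. Qed.
Lemma absN x : N (- x) = N x. Proof. by case: hN. Qed.
Lemma absD x y : N (x + y) <= N x + N y. Proof. by case: hN. Qed.
Lemma absM x y : N (x * y) = N x * N y. Proof. by case: hN. Qed.
Lemma absB x y : N (x - y) <= N x + N y. Proof. by rewrite -(absN y) absD. Qed.
Lemma abs_ge0 x : 0 <= N x.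
Proof. by have := absD x (- x); rewrite subrr abs0 absN -mulr2n pmulrn_lge0. Qed.
Lemma abs_eq0 x : N x = 0 -> x = 0. Proof. by case: hN => h _ _ _ /h. Qed.

Lemma abs1 : N 1 = 1.
Proof.
have : N 1 * N 1 = N 1 * 1 by rewrite -absM !mulr1.
by apply: mulfI; apply/eqP => /abs_eq0/eqP; rewrite oner_eq0.
Qed.

Lemma absX x n : N (x ^+ n) = N x ^+ n.
Proof. by elim: n => [|n IH]; rewrite ?expr0 ?abs1 // !exprS absM IH. Qed.

Lemma abs_sum n (F : 'I_n -> K) : N (\sum_(i < n) F i) <= \sum_(i < n) N (F i).
Proof.
elim/big_ind2: _ => //; first by rewrite abs0.
by move=> a b c d ab cd; rewrite (le_trans (absD _ _)) // lerD.
Qed.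

(** Convergence in terms of the real-valued [N], common to [R] and [R[i]]. *)
Definition slim u l := forall e : R, 0 < e -> exists M, forall n, (M <= n)%N -> N (u n - l) <= e.

Definition ps_to a z l := slim (fun n => \sum_(i < n) a i * z ^+ i) l.

(** Absolute summability with weight [rho], as a bound on the partial sums. *)
Definition sbnd rho a S := forall n, \sum_(i < n) N (a i) * rho ^+ i <= S.

Lemma slim_unique u l l' : slim u l -> slim u l' -> l = l'.
Proof.
move=> ul ul'; apply/eqP; rewrite -subr_eq0; apply/eqP/abs_eq0/eqP.
rewrite eq_le abs_ge0 andbT; apply/ler_addgt0Pl => e e0; rewrite addr0.
have e20 : 0 < e / 2 by rewrite divr_gt0.
have [M1 H1] := ul _ e20; have [M2 H2] := ul' _ e20.
have -> : l - l' = (u (maxn M1 M2) - l') - (u (maxn M1 M2) - l) by ring.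
by rewrite (le_trans (absB _ _)) // (splitr e) lerD // ?H1 ?H2 // ?leq_maxl ?leq_maxr.
Qed.

Lemma slimD u v l m : slim u l -> slim v m -> slim (fun n => u n + v n) (l + m).
Proof.
move=> ul vm e e0; have e20 : 0 < e / 2 by rewrite divr_gt0.
have [M1 H1] := ul _ e20; have [M2 H2] := vm _ e20; exists (maxn M1 M2) => n.
rewrite geq_max => /andP[/H1 h1 /H2 h2].
have -> : u n + v n - (l + m) = (u n - l) + (v n - m) by ring.
by rewrite (le_trans (absD _ _)) // (splitr e) lerD.
Qed.

Lemma slimZ x u l : slim u l -> slim (fun n => x * u n) (x * l).
Proof.
move=> ul e e0; have x0 : 0 < 1 + N x by rewrite ltr_pwDl // abs_ge0.
have [M H] := ul _ (divr_gt0 e0 x0); exists M => n /H.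
rewrite -mulrBr absM ler_pdivlMr // => h; apply: le_trans h.
by rewrite mulrC ler_wpM2l ?abs_ge0 // lerDr.
Qed.

Lemma eq_slim u v l : u = v -> slim u l -> slim v l. Proof. by move=> ->. Qed.

Lemma slim_cst l : slim (fun=> l) l.
Proof. by move=> e e0; exists 0%N => n _; rewrite subrr abs0 ltW. Qed.

Lemma slim_le u l S : slim u l -> (forall n, N (u n) <= S) -> N l <= S.
Proof.
move=> ul uS; apply/ler_addgt0Pl => e e0; have [M H] := ul _ e0.
have -> : l = u M - (u M - l) by ring.
by apply: (le_trans (absB _ _)); rewrite addrC; apply: lerD; [exact: H|exact: uS].
Qed.

Lemma sbnd_ge0 rho a S : sbnd rho a S -> 0 <= S.
Proof. by move=> /(_ 0%N); rewrite big_ord0. Qed.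

Lemma sbndD rho a b S T : 0 <= rho -> sbnd rho a S -> sbnd rho b T ->
  sbnd rho (fun n => a n + b n) (S + T).
Proof.
move=> r0 aS bT n; apply: le_trans (lerD (aS n) (bT n)); rewrite -big_split.
by apply: ler_sum => i _; rewrite /= -mulrDl ler_wpM2r ?exprn_ge0 // absD.
Qed.

Lemma sbndZ rho x a S : sbnd rho a S -> sbnd rho (fun n => x * a n) (N x * S).
Proof.
move=> aS n; apply: le_trans (ler_wpM2l (abs_ge0 x) (aS n)).
by rewrite mulr_sumr ler_sum // => i _; rewrite absM mulrA.
Qed.

Lemma sbnd_le rho rho' a S : 0 <= rho' -> rho' <= rho -> sbnd rho a S -> sbnd rho' a S.
Proof.
move=> r0 rr aS n; apply: le_trans (aS n); apply: ler_sum => i _.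
by rewrite ler_wpM2l ?abs_ge0 // lerXn2r // nnegrE // (le_trans r0).
Qed.

Lemma sbnd_delta rho : sbnd rho delta0 1.
Proof.
move=> [|n]; first by rewrite big_ord0.
rewrite big_ord_recl expr0 mulr1 abs1 big1 ?addr0 // => i _.
by rewrite /delta0 /= abs0 mul0r.
Qed.

Lemma sbnd_conv rho a b S T : 0 <= rho -> sbnd rho a S -> sbnd rho b T ->
  sbnd rho (conv a b) (S * T).
Proof.
move=> r0 aS bT n.
have T0 := sbnd_ge0 bT.
pose a' i := N (a i) * rho ^+ i; pose b' i := N (b i) * rho ^+ i.
have a'0 i : 0 <= a' i by rewrite mulr_ge0 ?abs_ge0 ?exprn_ge0.
apply: (@le_trans _ _ (\sum_(j < n) (fun=> 1) j * conv a' b' j)).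
  apply: ler_sum => j _; rewrite mul1r.
  apply: (le_trans (ler_wpM2r (exprn_ge0 _ r0) (abs_sum _))).
  rewrite mulr_suml; apply: ler_sum => i _; rewrite absM /a' /b'.
  by rewrite mulrACA -exprD subnKC // -ltnS.
rewrite (triangle_sum (fun=> 1)).
apply: (@le_trans _ _ (\sum_(i < n) a' i * T)).
  apply: ler_sum => i _; apply: ler_wpM2l => //.
  by under eq_bigr do rewrite mul1r; exact: bT.
by rewrite -mulr_suml ler_wpM2r //; exact: aS.
Qed.

(** The remainders of an absolutely convergent series. *)
Lemma sbnd_tail rho a S : 0 <= rho -> sbnd rho a S -> exists t : nat -> R,
  [/\ forall n, 0 <= t n, forall n, t n <= S,
      forall e, 0 < e -> exists M, forall n, (M <= n)%N -> t n <= e &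
      forall n k, \sum_(i < n + k) N (a i) * rho ^+ i - \sum_(i < n) N (a i) * rho ^+ i <= t n].
Proof.
move=> r0 aS; pose p n := \sum_(i < n) N (a i) * rho ^+ i.
have pS n : p n <= p n.+1.
  by rewrite /p big_ord_recr /= lerDl mulr_ge0 ?abs_ge0 ?exprn_ge0.
have p_mono n k : p n <= p (n + k)%N.
  by elim: k => [|k IH]; rewrite ?addn0 // addnS (le_trans IH).
have p0 n : 0 <= p n by have := p_mono 0%N n; rewrite {1}/p big_ord0.
have hs : has_sup (range p).
  by split; [exists (p 0%N), 0%N|exists S => _ [n _ <-]; exact: aS].
exists (fun n => sup (range p) - p n); split=> [n|n|e e0|n k].
- by rewrite subr_ge0; apply: ub_le_sup; [case: hs|exists n].
- rewrite lerBlDr (@le_trans _ _ S) ?lerDl //; apply: ge_sup; first by case: hs.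
  by move=> _ [m _ <-]; exact: aS.
- have [_ [M _ <-] HM] := sup_adherent e0 hs; exists M => n Mn.
  have := p_mono M (n - M)%N; rewrite subnKC // => H.
  by rewrite lerBlDr -lerBlDl (le_trans (ltW HM)).
- by rewrite lerD2r; apply: ub_le_sup; [case: hs|exists (n + k)%N].
Qed.

Lemma big_ord_split (F : nat -> K) M n :
  \sum_(i < M + n) F i = \sum_(i < M) F i + \sum_(i < n) F (M + i)%N.
Proof. by rewrite big_split_ord. Qed.

(** A sequence [h] of geometric growth acts on absolutely summable ones by
    [psi |-> \sum_n psi_n h_n]; convolving with [m] is adjoint to replacing
    [h_n] by [\sum_k h_(n + k) m_k]. *)
Lemma pairing h psi m A C rho S T : 0 <= rho -> 0 <= C ->
  (forall j, N (h j) <= C * rho ^+ j) -> sbnd rho psi S -> sbnd rho m T ->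
  (forall n, slim (fun k => \sum_(i < k) h (n + i)%N * m i) (A n)) ->
  slim (fun n => \sum_(i < n) psi i * A i - \sum_(j < n) h j * conv psi m j) 0.
Proof.
move=> r0 C0 hC pS mT hA e e0.
have [t [t0 tT tl tP]] := sbnd_tail r0 mT.
have [t' [t'0 t'S t'l t'P]] := sbnd_tail r0 pS.
pose p i := N (psi i) * rho ^+ i.
have p0 i : 0 <= p i by rewrite mulr_ge0 ?abs_ge0 ?exprn_ge0.
have AT n M : N (A n - \sum_(i < M) h (n + i)%N * m i) <= C * rho ^+ n * t M.
  apply/ler_addgt0Pl => e' e'0; have [M' HM'] := hA n _ e'0.
  pose k := (M' - M)%N; have := HM' (M + k)%N; rewrite -leq_subLR leqnn => /(_ isT) H.
  have -> : A n - \sum_(i < M) h (n + i)%N * m i =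
    (\sum_(i < M + k) h (n + i)%N * m i - \sum_(i < M) h (n + i)%N * m i)
    - (\sum_(i < M + k) h (n + i)%N * m i - A n) by ring.
  apply: (le_trans (absB _ _)); rewrite addrC; apply: lerD; first exact: H.
  rewrite (big_ord_split (fun i => h (n + i)%N * m i)) addrAC subrr add0r.
  apply: (le_trans (abs_sum _)).
  apply: (le_trans _ (ler_wpM2l _ (tP M k))); last by rewrite mulr_ge0 ?exprn_ge0.
  rewrite (big_split_ord) /= addrAC subrr add0r mulr_sumr; apply: ler_sum => i _.
  rewrite absM; apply: (le_trans (ler_wpM2r (abs_ge0 _) (hC _))).
  by rewrite exprD -!mulrA [rho ^+ (M + i) * _]mulrC.
pose e1 := e / (1 + C * (S + T)).
have ST : 0 <= C * (S + T) by rewrite mulr_ge0 // addr_ge0 ?(sbnd_ge0 pS) ?(sbnd_ge0 mT).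
have ST1 : 0 < 1 + C * (S + T) by rewrite ltr_pwDl.
have e10 : 0 < e1 by rewrite divr_gt0.
have [M1 H1] := tl _ e10; have [M2 H2] := t'l _ e10.
exists (M2 + M1)%N => n Mn; rewrite subr0 triangle_sum -sumrB.
have Mn2 : (M2 <= n)%N by rewrite (leq_trans (leq_addr _ _) Mn).
under eq_bigr do rewrite -mulrBr.
apply: (le_trans (abs_sum _)).
apply: (@le_trans _ _ (\sum_(i < n) C * (p i * t (n - i)%N))).
  apply: ler_sum => i _; rewrite absM.
  apply: (le_trans (ler_wpM2l (abs_ge0 _) (AT i _))).
  by rewrite /p; have -> // : N (psi i) * (C * rho ^+ i * t (n - i)%N) =
     C * (N (psi i) * rho ^+ i * t (n - i)%N) by ring.
rewrite -mulr_sumr.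
suff H : \sum_(i < n) p i * t (n - i)%N <= S * e1 + e1 * T.
  apply: (le_trans (ler_wpM2l C0 H)).
  have -> : C * (S * e1 + e1 * T) = e * (C * (S + T) / (1 + C * (S + T))).
    by rewrite /e1; field; rewrite gt_eqF.
  by apply: ler_piMr; [exact: ltW|rewrite ler_pdivrMr // mul1r lerDr].
rewrite -(subnKC Mn2) (big_split_ord) /=; apply: lerD.
  apply: (@le_trans _ _ (\sum_(i < M2) p i * e1)).
    apply: ler_sum => i _; apply: ler_wpM2l => //; apply: H1.
    rewrite subnKC // leq_subRL; last by rewrite (leq_trans (ltnW (ltn_ord i))).
    by rewrite (leq_trans _ Mn) // leq_add2r ltnW.
  by rewrite -mulr_suml; apply: ler_wpM2r; [exact: ltW|exact: pS].
apply: (@le_trans _ _ (\sum_(i < n - M2) p (M2 + i)%N * T)).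
  by apply: ler_sum => i _; apply: ler_wpM2l.
rewrite -mulr_suml ler_wpM2r ?(sbnd_ge0 mT) //.
apply: le_trans (H2 M2 (leqnn _)); apply: le_trans (t'P M2 (n - M2)%N).
by rewrite big_split_ord /= addrAC subrr add0r.
Qed.

Lemma ps_toM a b z l m rho S T : N z <= rho -> sbnd rho a S -> sbnd rho b T ->
  ps_to a z l -> ps_to b z m -> ps_to (conv a b) z (l * m).
Proof.
move=> zr aS bT al bm; have r0 := le_trans (abs_ge0 z) zr.
have aS' := sbnd_le (abs_ge0 z) zr aS; have bT' := sbnd_le (abs_ge0 z) zr bT.
have P : slim (fun n => \sum_(i < n) a i * (z ^+ i * m) - \sum_(j < n) z ^+ j * conv a b j) 0.
  apply: (@pairing (fun j => z ^+ j) a b (fun n => z ^+ n * m) 1 (N z) S T) => //; first exact: abs_ge0.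
    by move=> j; rewrite absX mul1r.
  move=> n; have := slimZ (z ^+ n) bm; apply: eq_slim; apply/funext => k.
  by rewrite mulr_sumr; apply: eq_bigr => i _; rewrite exprD; ring.
have Q := slimZ m al.
have := slimD Q (slimZ (- 1) P); rewrite mulr0 addr0 mulrC; apply: eq_slim.
apply/funext => n; rewrite mulN1r opprB mulr_sumr.
have -> : \sum_(i < n) m * (a i * z ^+ i) = \sum_(i < n) a i * (z ^+ i * m).
  by apply: eq_bigr => i _; ring.
by rewrite addrC subrK; apply: eq_bigr => i _; rewrite mulrC.
Qed.

Lemma ps_toD a b z l m : ps_to a z l -> ps_to b z m -> ps_to (fun n => a n + b n) z (l + m).
Proof.
move=> al bm; have := slimD al bm; apply: eq_slim; apply/funext => n.
by rewrite -big_split; apply: eq_bigr => i _; rewrite mulrDl.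
Qed.

Lemma ps_toZ x a z l : ps_to a z l -> ps_to (fun n => x * a n) z (x * l).
Proof.
move=> al; have := slimZ x al; apply: eq_slim; apply/funext => n.
by rewrite mulr_sumr; apply: eq_bigr => i _; rewrite mulrA.
Qed.

Lemma ps_to0 a : ps_to a 0 (a 0%N).
Proof.
move=> e e0; exists 1%N => -[//|n] _; rewrite big_ord_recl expr0 mulr1 big1 ?addr0.
  by rewrite subrr abs0 ltW.
by move=> i _; rewrite exprS mul0r mulr0.
Qed.

Lemma ps_to_delta z : ps_to delta0 z 1.
Proof.
move=> e e0; exists 1%N => -[//|k] _; rewrite big_ord_recl /delta0 expr0 mulr1.
by rewrite big1 ?addr0 ?subrr ?abs0 ?(ltW e0) // => i _; rewrite mul0r.
Qed.

(** The formal inverse converges on a disc whose radius depends only on a bound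
    for the given series. *)
Lemma sbnd_finv rho a S : 0 < rho -> a 0%N = 1 -> sbnd rho a S ->
  sbnd (rho / (2 * (S + 1))) (finv a) 2.
Proof.
move=> r0 a0 aS; have S0 := sbnd_ge0 aS; set r := rho / _.
have S2 : 0 < 2 * (S + 1) by rewrite mulr_gt0 // ltr_wpDl.
have rp : 0 < r by rewrite divr_gt0.
have rr : r <= rho.
  rewrite ler_pdivrMr // ler_pMr //; have : 1 <= S + 1 by rewrite lerDr.
  by lra.
have tl n : \sum_(i < n) N (a i.+1) * r ^+ i.+1 <= 2^-1.
  apply: (@le_trans _ _ (\sum_(i < n) (r / rho) * (N (a i.+1) * rho ^+ i.+1))).
    apply: ler_sum => i _; rewrite mulrCA ler_wpM2l ?abs_ge0 //.
    rewrite !exprS mulrA divfK ?gt_eqF //; apply: ler_wpM2l; first exact: ltW.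
    by apply: lerXn2r => //; rewrite nnegrE ltW.
  rewrite -mulr_sumr; apply: (@le_trans _ _ ((r / rho) * (S + 1))).
    apply: ler_wpM2l; first by rewrite ltW // divr_gt0.
    have := aS n.+1; rewrite big_ord_recl => H.
    apply: (@le_trans _ _ S); last by rewrite lerDl.
    by apply: le_trans H; rewrite lerDr mulr_ge0 ?abs_ge0 // exprn_ge0 // ltW.
  by rewrite /r le_eqVlt; apply/orP; left; apply/eqP; field; rewrite !gt_eqF //= ltr_wpDl.
move=> n; elim: n => [|n IH]; first by rewrite big_ord0.
rewrite big_ord_recl finv0 abs1 expr0 mulr1.
suff : \sum_(i < n) N (finv a i.+1) * r ^+ i.+1 <= 2^-1 * 2.
  by rewrite mulVf // => H; rewrite -[2]/(1 + 1) lerD2l.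
pose b i := N (a i.+1) * r ^+ i.+1; pose c i := N (finv a i) * r ^+ i.
have b0 i : 0 <= b i by rewrite mulr_ge0 ?abs_ge0 // exprn_ge0 // ltW.
have c0 i : 0 <= c i by rewrite mulr_ge0 ?abs_ge0 // exprn_ge0 // ltW.
apply: (@le_trans _ _ (\sum_(j < n) (fun=> 1) j * conv b c j)).
  apply: ler_sum => j _; rewrite mul1r finvS absN.
  apply: (le_trans (ler_wpM2r (exprn_ge0 _ (ltW rp)) (abs_sum _))).
  rewrite mulr_suml; apply: ler_sum => i _; rewrite absM /b /c.
  by rewrite mulrACA -exprD addSn subnKC // -ltnS.
rewrite (triangle_sum (fun=> 1)).
apply: (@le_trans _ _ (\sum_(i < n) b i * 2)); last by rewrite -mulr_suml ler_wpM2r // tl.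
apply: ler_sum => i _; apply: ler_wpM2l => //; under eq_bigr do rewrite mul1r.
apply: le_trans IH.
have -> : \sum_(i < n) N (finv a i) * r ^+ i = \sum_(i < (n - i) + i) c i.
  by rewrite subnK // ltnW.
by rewrite big_split_ord /= lerDl sumr_ge0.
Qed.

End weighted_series.

(** * Real power series and functions of exponential type *)

Section real_series.
Context {R : realType}.
Implicit Types (a b c h u : nat -> R) (x y l C r rho S : R).

Lemma absval_normr : absval (@Num.norm R R : R -> R).
Proof.
split; [|exact: normrN|exact: ler_normD|exact: normrM].
by move=> x; split=> [/normr0_eq0//|->]; rewrite normr0.
Qed.

Lemma absval_normc : absval (@normc R).
Proof.
split; [|exact: normcN|exact: le_normcD|exact: normcM].
by move=> x; split=> [/eq0_normc//|->]; rewrite normc0.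
Qed.

Local Notation nR := (@Num.norm R R : R -> R).
Local Notation nC := (@normc R).

Lemma slim_cvg u l : slim nR u l <-> u @ \oo --> l.
Proof.
split=> [ul|/cvgrPdist_le ul e e0].
  by apply/cvgrPdist_le => e /ul [M H]; exists M => // n /H; rewrite distrC.
by have [M _ H] := ul e e0; exists M => n /H; rewrite distrC.
Qed.

Lemma ps_to_cvg a x l : ps_to nR a x l <-> series (fun n => a n * x ^+ n) @ \oo --> l.
Proof.
rewrite -slim_cvg /ps_to.
suff -> : (fun n => \sum_(i < n) a i * x ^+ i) = series (fun n => a n * x ^+ n) by [].
by apply/funext => n; rewrite /series /= big_mkord.
Qed.

Lemma ex_slim u S : (forall n, \sum_(i < n) `|u i| <= S) ->
  exists l, slim nR (fun n => \sum_(i < n) u i) l.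
Proof.
move=> uS; have : cvgn (series (fun n => `|u n|)).
  apply: nondecreasing_is_cvgn.
    by apply/nondecreasing_seqP => n; rewrite /series /= big_nat_recr //= lerDl.
  by exists S => _ [n _ <-]; rewrite /series /= big_mkord.
move/normed_cvg => /cvg_ex [l ul]; exists l; apply/slim_cvg.
suff -> : (fun n => \sum_(i < n) u i) = series u by [].
by apply/funext => n; rewrite /series /= big_mkord.
Qed.

Lemma ex_ps_to rho a S x : sbnd nR rho a S -> `|x| <= rho -> exists l, ps_to nR a x l.
Proof.
move=> aS xr; apply: (@ex_slim (fun i => a i * x ^+ i) S) => n.
under eq_bigr do rewrite normrM normrX.
exact: (sbnd_le absval_normr (normr_ge0 x) xr aS).
Qed.

(** The terms of a convergent series are bounded: Abel's lemma. *)
Lemma sbnd_of_ps_to a x l : 0 < x -> ps_to nR a x l -> exists S, sbnd nR (x / 2) a S.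
Proof.
move=> x0 al; have [M HM] : exists M, forall n, `|a n * x ^+ n| <= M.
  have cv : cvgn (series (fun n => a n * x ^+ n)) by apply/cvg_ex; exists l; exact/ps_to_cvg.
  have [M [_ HM]] := cvg_seq_bounded cv.
  have {}HM n : `|series (fun n => a n * x ^+ n) n| <= `|M| + 1.
    by apply: HM => //; rewrite (le_lt_trans (ler_norm M)) // ltrDl.
  exists ((`|M| + 1) + (`|M| + 1)) => n.
  have -> : a n * x ^+ n = series (fun n => a n * x ^+ n) n.+1 - series (fun n => a n * x ^+ n) n.
    by rewrite /series /= big_nat_recr //= addrAC subrr add0r.
  by apply: (le_trans (ler_normB _ _)); apply: lerD.
exists (2 * M) => n.
have M0 : 0 <= M by apply: le_trans (HM 0%N).
apply: (@le_trans _ _ (\sum_(i < n) M * (1 / 2) ^+ i)).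
  apply: ler_sum => i _; rewrite !expr_div_n expr1n.
  have := HM i; rewrite normrM [`|x ^+ i|]gtr0_norm ?exprn_gt0 // => H.
  by rewrite mulrA div1r ler_wpM2r // invr_ge0 exprn_ge0.
rewrite -mulr_sumr mulrC ler_wpM2r //.
elim: n {HM} => [|n IH]; first by rewrite big_ord0.
rewrite big_ord_recl expr0; under eq_bigr do rewrite /= exprS.
by rewrite -mulr_sumr; move: IH; lra.
Qed.

(** The lowest nonzero term would dominate the others near [0]. *)
Lemma ps_eq0 rho a S : 0 < rho -> sbnd nR rho a S ->
  (forall x, 0 < x -> x < rho -> ps_to nR a x 0) -> forall n, a n = 0.
Proof.
move=> r0 aS a0 n; have [k] := ubnP n; elim: k n => // k IH n; rewrite ltnS => nk.
have S0 := sbnd_ge0 aS.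
have {}IH i : (i < n)%N -> a i = 0 by move=> lin; apply: IH; exact: leq_trans lin nk.
have key x : 0 < x -> x < rho -> `|a n| <= x * (S / rho ^+ n.+1).
  move=> x0 xr.
  suff : `|a n| * x ^+ n <= x ^+ n.+1 * (S / rho ^+ n.+1).
    by rewrite exprS (mulrC x) -mulrA [X in X <= _]mulrC ler_pM2l ?exprn_gt0.
  apply/ler_addgt0Pl => e e0; have [M HM] := a0 x x0 xr e e0.
  have := HM (n.+1 + M)%N (leq_addl _ _); rewrite subr0 big_split_ord /= big_ord_recr /=.
  rewrite big1 ?add0r => [|i _]; last by rewrite IH ?mul0r.
  set A := a n * _; set B := \sum_(i < M) _ => H.
  have -> : `|a n| * x ^+ n = `|A| by rewrite normrM [`|x ^+ n|]ger0_norm // exprn_ge0 // ltW.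
  have -> : A = (A + B) - B by ring.
  apply: (le_trans (ler_normB _ _)); apply: lerD => //.
  apply: (le_trans (ler_norm_sum _ _ _)).
  apply: (@le_trans _ _ (\sum_(i < M) (x ^+ n.+1 / rho ^+ n.+1) * (`|a (n.+1 + i)%N| * rho ^+ (n.+1 + i)))).
    apply: ler_sum => i _; rewrite normrM normrX [`|x|]gtr0_norm // [X in _ <= X]mulrCA ler_wpM2l //.
    rewrite !exprD mulrA divfK ?gt_eqF ?exprn_gt0 //.
    apply: ler_wpM2l; first by rewrite exprn_ge0 // ltW.
    by apply: lerXn2r; rewrite ?nnegrE ltW.
  rewrite -mulr_sumr -mulrA [X in _ <= _ * X]mulrC ler_wpM2l ?exprn_ge0 ?(ltW x0) //.
  apply: ler_wpM2l; first by rewrite invr_ge0 exprn_ge0 // ltW.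
  have := aS (n.+1 + M)%N; rewrite big_split_ord /=; apply: le_trans.
  by rewrite lerDr sumr_ge0 // => i _; rewrite mulr_ge0 // exprn_ge0 // ltW.
apply/eqP; rewrite -normr_eq0 eq_le normr_ge0 andbT; apply/ler_addgt0Pl => e e0; rewrite addr0.
pose D := S / rho ^+ n.+1; have D0 : 0 <= D by rewrite divr_ge0 // exprn_ge0 // ltW.
have D1 : 0 < D + 1 by rewrite ltr_wpDl.
pose x := Num.min (rho / 2) (e / (D + 1)).
have x0 : 0 < x by rewrite lt_min !divr_gt0.
have xr : x < rho.
  by rewrite gt_min ltr_pdivrMr // ltr_pMr // ltr1n.
apply: (le_trans (key x x0 xr)); rewrite -/D.
have xe : x <= e / (D + 1) by rewrite ge_min lexx orbT.
apply: (le_trans (ler_wpM2r D0 xe)).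
by rewrite mulrAC ler_pdivrMr // ler_wpM2l ?(ltW e0) // lerDl.
Qed.

Lemma ps_unique rho a b (g : R -> R) : 0 < rho ->
  (forall x, 0 < x -> x < rho -> ps_to nR a x (g x)) ->
  (forall x, 0 < x -> x < rho -> ps_to nR b x (g x)) -> a = b.
Proof.
move=> r0 ag bg; have r20 : 0 < rho / 2 by rewrite divr_gt0.
have r2 : rho / 2 < rho by rewrite ltr_pdivrMr // ltr_pMr // ltr1n.
pose dd n := a n + (-1) * b n.
have dd0 x : 0 < x -> x < rho -> ps_to nR dd x 0.
  move=> x0 xr; have := ps_toD absval_normr (ag x x0 xr) (ps_toZ absval_normr (-1) (bg x x0 xr)).
  by rewrite mulN1r subrr.
have [S dS] := sbnd_of_ps_to r20 (dd0 _ r20 r2).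
apply/funext => n; have := @ps_eq0 (rho / 2 / 2) dd S _ dS _ n.
rewrite /dd mulN1r => H; apply/eqP; rewrite -subr_eq0; apply/eqP; apply: H.
  by rewrite divr_gt0.
move=> x x0 xr; apply: dd0 => //; rewrite (lt_trans xr) // (lt_trans _ r2) //.
by rewrite ltr_pdivrMr // ltr_pMr // ltr1n.
Qed.

Lemma real_complexX x n : (x%:C : R[i]) ^+ n = (x ^+ n)%:C.
Proof. by rewrite rmorphXn. Qed.

Lemma ps_to_Re (a : nat -> R[i]) x (l : R[i]) : ps_to nC a x%:C l ->
  ps_to nR (fun n => complex.Re (a n)) x (complex.Re l).
Proof.
move=> al e e0; have [M HM] := al e e0; exists M => n /HM; apply: le_trans.
have -> : \sum_(i < n) complex.Re (a i) * x ^+ i = complex.Re (\sum_(i < n) a i * x%:C ^+ i).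
  by rewrite Re_sum; apply: eq_bigr => i _; rewrite real_complexX ReM /= mulr0 subr0.
by rewrite -ReN -ReD normc_Re.
Qed.

Lemma ps_to_Im (a : nat -> R[i]) x (l : R[i]) : ps_to nC a x%:C l ->
  ps_to nR (fun n => complex.Im (a n)) x (complex.Im l).
Proof.
move=> al e e0; have [M HM] := al e e0; exists M => n /HM; apply: le_trans.
have -> : \sum_(i < n) complex.Im (a i) * x ^+ i = complex.Im (\sum_(i < n) a i * x%:C ^+ i).
  by rewrite Im_sum; apply: eq_bigr => i _; rewrite real_complexX ImM /= mulr0 add0r.
by rewrite -ImN -ImD normc_Im.
Qed.

Lemma psC_unique rho (a b : nat -> R[i]) (g : R -> R[i]) : 0 < rho ->
  (forall x, 0 < x -> x < rho -> ps_to nC a x%:C (g x)) ->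
  (forall x, 0 < x -> x < rho -> ps_to nC b x%:C (g x)) -> a = b.
Proof.
move=> r0 ag bg.
have H1 : (fun n => complex.Re (a n)) = (fun n => complex.Re (b n)).
  by apply: (@ps_unique rho _ _ (fun x => complex.Re (g x))) => // x x0 xr; apply: ps_to_Re; [exact: ag|exact: bg].
have H2 : (fun n => complex.Im (a n)) = (fun n => complex.Im (b n)).
  by apply: (@ps_unique rho _ _ (fun x => complex.Im (g x))) => // x x0 xr; apply: ps_to_Im; [exact: ag|exact: bg].
apply/funext => n; have := congr1 (@^~ n) H1; have := congr1 (@^~ n) H2 => /=.
by case: (a n) (b n) => ? ? [? ?] /= -> ->.
Qed.

Lemma ps_to_realC a x l : ps_to nR a x l -> ps_to nC (fun n => (a n)%:C) x%:C l%:C.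
Proof.
move=> al e e0; have [M HM] := al e e0; exists M => n /HM; apply: le_trans.
have -> : \sum_(i < n) (a i)%:C * (x%:C : R[i]) ^+ i = (\sum_(i < n) a i * x ^+ i)%:C.
  by rewrite rmorph_sum; apply: eq_bigr => i _; rewrite real_complexX rmorphM.
by rewrite -rmorphB normc_real.
Qed.

Definition exp_c (n : nat) : R := n`!%:R^-1.

Lemma expR_ps x : ps_to nR exp_c x (expR x).
Proof.
apply/ps_to_cvg; rewrite /expR.
have -> : (fun n => exp_c n * x ^+ n) = exp_coeff x.
  by apply/funext => n; rewrite /exp_c /exp_coeff /= mulrC.
exact: is_cvg_series_exp_coeff.
Qed.

Lemma exp_c_ge0 n : 0 <= exp_c n. Proof. by rewrite invr_ge0. Qed.

Lemma exp_partial_le x n : 0 <= x -> \sum_(i < n) exp_c i * x ^+ i <= expR x.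
Proof.
move=> x0; apply/ler_addgt0Pr => e e0; have [M HM] := expR_ps x e0.
have := HM (M + n)%N (leq_addr _ _); rewrite addnC big_split_ord /= => /ler_normlW.
rewrite lerBlDl; apply: le_trans; rewrite lerDl sumr_ge0 // => i _.
by rewrite mulr_ge0 ?exprn_ge0 ?exp_c_ge0.
Qed.

Lemma sbnd_exp_c rho x : 0 <= rho -> sbnd nR rho (fun n => x ^+ n * exp_c n) (expR (rho * `|x|)).
Proof.
move=> r0 n; apply: le_trans (exp_partial_le n _); last by rewrite mulr_ge0.
apply: ler_sum => i _; rewrite normrM [X in _ * X * _]ger0_norm ?exp_c_ge0 // normrX.
by rewrite exprMn; have -> : `|x| ^+ i * exp_c i * rho ^+ i = exp_c i * (rho ^+ i * `|x| ^+ i) by ring.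
Qed.

Lemma expR_ps2 x y : ps_to nR (fun n => x ^+ n * exp_c n) y (expR (y * x)).
Proof.
have := expR_ps (y * x); apply: eq_slim; apply/funext => n; apply: eq_bigr => i _.
by rewrite exprMn; ring.
Qed.

Lemma cexp_ps (z : R[i]) : ps_to nC (fun n => (exp_c n)%:C) z (cexp z).
Proof.
pose rho := normc z + 1; have n0 := normc_ge0 z.
have r0 : 0 < rho by rewrite ltr_wpDl.
have [||||_ H] := @taylor_disc R (@cexp R) (rho + 1) rho (expR rho) => //.
- by move=> w _; exists (cexp w); exact: cexp_cdiff.
- by rewrite ltrDl.
- move=> y _; rewrite normc_cexp ler_expR (le_trans (ler_norm _)) // (le_trans (normc_Re _)) //.
  by rewrite normc_cexp /= lnK.
have -> : (fun n => (exp_c n)%:C) = circ_coef (@cexp R) rho.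
  apply: (@psC_unique rho _ _ (fun x => (expR x)%:C)) => // x x0 xr.
    by apply: ps_to_realC; exact: expR_ps.
  by rewrite -cexp_real; apply: H; rewrite normc_real gtr0_norm.
by apply: H; rewrite ltrDl.
Qed.

End real_series.

Section exponential_type.
Context {R : realType}.
Implicit Types (h : nat -> R) (x y l C r rho S : R).
Local Notation nR := (@Num.norm R R : R -> R).

(** [efun h] is the function [x |-> \sum_n h_n x ^ n / n!]; for [h] of geometric
    growth it is entire of exponential type. *)
Definition efun h x : R := limn (series (fun n => h n * exp_c n * x ^+ n)).

Definition exptype C r h := forall k, `|h k| <= C * r ^+ k.

Definition nshift n h k : R := h (n + k)%N.

Lemma exptype_shift C r h n : 0 <= r -> exptype C r h -> exptype (C * r ^+ n) r (nshift n h).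
Proof. by move=> r0 H k; rewrite /nshift (le_trans (H _)) // exprD mulrA. Qed.

Lemma exptype_C_ge0 C r h : exptype C r h -> 0 <= C.
Proof. by move=> /(_ 0%N); rewrite expr0 mulr1; apply: le_trans. Qed.

Lemma exptype_bound C r h x n : 0 <= r -> exptype C r h ->
  \sum_(i < n) `|h i * exp_c i * x ^+ i| <= C * expR (r * `|x|).
Proof.
move=> r0 hC; have C0 := exptype_C_ge0 hC.
apply: (@le_trans _ _ (C * \sum_(i < n) exp_c i * (r * `|x|) ^+ i)).
  rewrite mulr_sumr; apply: ler_sum => i _; rewrite !normrM normrX [`|exp_c i|]ger0_norm ?exp_c_ge0 //.
  rewrite exprMn -!mulrA [X in _ <= X](_ : _ = (C * r ^+ i) * (exp_c i * `|x| ^+ i)); last by ring.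
  by apply: ler_wpM2r => //; rewrite mulr_ge0 ?exp_c_ge0 ?exprn_ge0.
by apply: ler_wpM2l => //; apply: exp_partial_le; rewrite mulr_ge0.
Qed.

Lemma efun_slim C r h x : 0 <= r -> exptype C r h ->
  slim nR (fun n => \sum_(i < n) h i * exp_c i * x ^+ i) (efun h x).
Proof.
move=> r0 hC; have [l hl] := @ex_slim R (fun i => h i * exp_c i * x ^+ i) _ (fun n => exptype_bound x n r0 hC).
have -> // : efun h x = l.
have := hl; rewrite slim_cvg.
have -> : (fun n => \sum_(i < n) h i * exp_c i * x ^+ i) = series (fun n => h n * exp_c n * x ^+ n).
  by apply/funext => n; rewrite /series /= big_mkord.
by move/cvg_lim; apply; exact: Rhausdorff.
Qed.

Lemma efun_le C r h x : 0 <= r -> exptype C r h -> `|efun h x| <= C * expR (r * `|x|).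
Proof.
move=> r0 hC; apply: (slim_le absval_normr (efun_slim x r0 hC)) => n.
exact: (le_trans (ler_norm_sum _ _ _)) (exptype_bound x n r0 hC).
Qed.

Lemma is_derive_efun C r h x : 0 <= r -> exptype C r h ->
  is_derive x 1 (efun h) (efun (nshift 1 h) x).
Proof.
move=> r0 hC.
pose c n := h n * exp_c n.
have dc h' : pseries_diffs (fun n => h' n * exp_c n) = (fun n => nshift 1 h' n * exp_c n).
  apply/funext => n; rewrite /pseries_diffs /nshift /exp_c factS natrM invfM add1n.
  by rewrite mulrCA; congr (_ * _); rewrite mulrA divff ?mul1r // pnatr_eq0.
have cv h' C' y : exptype C' r h' -> cvgn (pseries (fun n => h' n * exp_c n) y).
  move=> hC'; have := efun_slim y r0 hC'; rewrite slim_cvg => H.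
  apply/cvg_ex; exists (efun h' y); rewrite /pseries.
  have -> // : series (fun i => h' i * exp_c i * y ^+ i) = (fun n => \sum_(i < n) h' i * exp_c i * y ^+ i).
  by apply/funext => n; rewrite /series /= big_mkord.
have := @pseries_snd_diffs R c (`|x| + 1) x; rewrite /c !dc; apply.
- exact: cv hC.
- exact: cv (exptype_shift 1 r0 hC).
- exact: cv (exptype_shift 1 r0 (exptype_shift 1 r0 hC)).
- by rewrite [X in _ < X]ger0_norm ?ltrDl // addr_ge0.
Qed.

Lemma derive1n_efun C r h n : 0 <= r -> exptype C r h -> derive1n n (efun h) = efun (nshift n h).
Proof.
move=> r0 hC; elim: n => [//|n IH].
rewrite derive1nS IH; apply/funext => x; rewrite derive1E.
have := is_derive_efun x r0 (exptype_shift n r0 hC) => H.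
rewrite (@derive_val _ _ _ _ _ _ _ H); congr efun; apply/funext => k.
by rewrite /nshift add1n addnS.
Qed.

End exponential_type.

(** * Expectations and moment series *)

Section expectations.
Context {R : realType} {d : measure_display} {Omega : measurableType d}.
Variable P : probability Omega R.
Implicit Types (F G Y Z : Omega -> R) (c C rho : R).
Local Notation nR := (@Num.norm R R : R -> R).
Local Notation nC := (@normc R).

Definition EX F : R := fine 'E_P[F].

Definition integ F := P.-integrable setT (EFin \o F).

Lemma EXE F : EX F = \int[P]_w F w.
Proof. by rewrite /EX unlock. Qed.

Lemma integ_meas F : integ F -> measurable_fun setT F.
Proof. by move/measurable_int/measurable_EFinP. Qed.

Lemma integ_le F G : measurable_fun setT F -> (forall o, `|F o| <= G o) -> integ G -> integ F.
Proof.
move=> mF FG iG; apply: le_integrable iG => //; first exact/measurable_EFinP.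
by move=> o _ /=; rewrite lee_fin (le_trans (FG o)) // ler_norm.
Qed.

Lemma integD F G : integ F -> integ G -> integ (fun o => F o + G o).
Proof. by move=> iF iG; have := integrableD measurableT iF iG; apply: eq_integrable. Qed.

Lemma integZ c F : integ F -> integ (fun o => c * F o).
Proof. by move=> iF; have := integrableZl measurableT c iF; apply: eq_integrable. Qed.

Lemma integB F G : integ F -> integ G -> integ (fun o => F o - G o).
Proof. by move=> iF iG; have := integrableB measurableT iF iG; apply: eq_integrable. Qed.

Lemma integ_abs F : integ F -> integ (fun o => `|F o|).
Proof. by move=> iF; have := integrable_norm iF; apply: eq_integrable. Qed.

Lemma integ_cst c : integ (fun=> c).
Proof. exact: finite_measure_integrable_cst. Qed.

Lemma integ_sum n (F : nat -> Omega -> R) : (forall i, integ (F i)) ->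
  integ (fun o => \sum_(i < n) F i o).
Proof.
move=> iF; elim: n => [|n IH].
  by under eq_fun do rewrite big_ord0; exact: integ_cst.
by under eq_fun do rewrite big_ord_recr /=; exact: integD.
Qed.

Lemma eq_EX F G : (forall o, F o = G o) -> EX F = EX G.
Proof. by move=> FG; congr EX; apply/funext. Qed.

Lemma EXD F G : integ F -> integ G -> EX (fun o => F o + G o) = EX F + EX G.
Proof. by move=> iF iG; rewrite !EXE RintegralD. Qed.

Lemma EXB F G : integ F -> integ G -> EX (fun o => F o - G o) = EX F - EX G.
Proof. by move=> iF iG; rewrite !EXE RintegralB. Qed.

Lemma EXZ c F : integ F -> EX (fun o => c * F o) = c * EX F.
Proof. by move=> iF; rewrite !EXE RintegralZl. Qed.

Lemma EX_cst c : EX (fun=> c) = c.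
Proof. rewrite EXE Rintegral_cst //=; have -> : P [set: Omega] = 1%E by exact: probability_setT.
by rewrite /= mulr1. Qed.

Lemma EX_sum n (F : nat -> Omega -> R) : (forall i, integ (F i)) ->
  EX (fun o => \sum_(i < n) F i o) = \sum_(i < n) EX (F i).
Proof.
move=> iF; elim: n => [|n IH].
  by rewrite big_ord0 -[RHS](EX_cst 0); apply: eq_EX => o; rewrite big_ord0.
rewrite big_ord_recr /= -IH -EXD //; last exact: integ_sum.
by apply: eq_EX => o; rewrite big_ord_recr.
Qed.

Lemma EX_ge0 F : (forall o, 0 <= F o) -> 0 <= EX F.
Proof. by move=> F0; rewrite EXE Rintegral_ge0. Qed.

Lemma EX_le F G : integ F -> integ G -> (forall o, F o <= G o) -> EX F <= EX G.
Proof. by move=> iF iG FG; rewrite !EXE le_Rintegral. Qed.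

Lemma EX_abs_le F G : integ F -> integ G -> (forall o, `|F o| <= G o) -> `|EX F| <= EX G.
Proof.
move=> iF iG FG; rewrite ler_norml; apply/andP; split.
  rewrite -mulN1r -EXZ //; apply: EX_le => // [|o]; first exact: integZ.
  by rewrite mulN1r; have := FG o; rewrite ler_norml => /andP[].
by apply: EX_le => // o; apply: le_trans (FG o); exact: ler_norm.
Qed.

Lemma measurable_efun C r (h : nat -> R) : 0 <= r -> exptype C r h ->
  measurable_fun setT (efun h).
Proof.
move=> r0 hC; apply: continuous_measurable_fun => x.
apply: differentiable_continuous; apply/derivable1_diffP.
exact: (@ex_derive _ _ _ _ _ _ _ (is_derive_efun x r0 hC)).
Qed.

Section moments.
Variables (Y Z : Omega -> R) (rho : R).
Hypotheses (mY : measurable_fun setT Y) (mZ : measurable_fun setT Z) (r0 : 0 < rho).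
Hypothesis iYZ : integ (fun o => `|Y o| * expR (rho * `|Z o|)).

Lemma meas_YZn n : measurable_fun setT (fun o => Y o * Z o ^+ n).
Proof. by apply: measurable_funM => //; exact: measurable_funX. Qed.

Lemma moment_partial_le (H : nat -> R) C n o : exptype C rho H ->
  \sum_(i < n) `|H i * exp_c i * (Y o * Z o ^+ i)| <= C * (`|Y o| * expR (rho * `|Z o|)).
Proof.
move=> hC; have := ler_wpM2l (normr_ge0 (Y o)) (exptype_bound (Z o) n (ltW r0) hC).
rewrite mulr_sumr [X in _ <= X -> _]mulrCA; apply: le_trans; apply: ler_sum => i _.
by rewrite !normrM; have -> : `|H i| * `|exp_c i| * (`|Y o| * `|Z o ^+ i|) =
  `|Y o| * (`|H i| * `|exp_c i| * `|Z o ^+ i|) by ring.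
Qed.

Lemma integ_moment n : integ (fun o => Y o * Z o ^+ n).
Proof.
pose H k := rho ^+ k : R.
have hC : exptype 1 rho H by move=> k; rewrite mul1r ger0_norm // exprn_ge0 // ltW.
pose k := (rho ^+ n * exp_c n)^-1 : R.
have k0 : 0 < rho ^+ n * exp_c n by rewrite mulr_gt0 ?exprn_gt0 // invr_gt0 ltr0n fact_gt0.
apply: (@integ_le _ (fun o => k * (`|Y o| * expR (rho * `|Z o|)))); last exact: integZ.
  exact: meas_YZn.
move=> o; rewrite /k [X in _ <= X]mulrC ler_pdivlMr // mulrC.
have := moment_partial_le n.+1 o hC; rewrite mul1r big_ord_recr /= => h.
apply: le_trans h; rewrite /H [`|_ * (Y o * _)|]normrM [`|rho ^+ n * _|]gtr0_norm // lerDr.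
by apply: sumr_ge0.
Qed.

Lemma sbnd_moment : sbnd nR rho (fun n => EX (fun o => Y o * Z o ^+ n) * exp_c n)
  (EX (fun o => `|Y o| * expR (rho * `|Z o|))).
Proof.
move=> n; pose F i o := rho ^+ i * exp_c i * `|Y o * Z o ^+ i|.
have iF i : integ (F i).
  apply: integZ; apply: (@integ_le _ (fun o => `|Y o * Z o ^+ i|)) => [|o|].
  - by apply: measurableT_comp => //; exact: meas_YZn.
  - by rewrite normr_id.
  - exact: integ_abs (integ_moment i).
apply: (@le_trans _ _ (EX (fun o => \sum_(i < n) F i o))).
  rewrite EX_sum //; apply: ler_sum => i _.
  rewrite normrM [`|exp_c i|]ger0_norm ?exp_c_ge0 // -mulrA mulrC /F EXZ; last first.
    exact: integ_abs (integ_moment i).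
  rewrite (mulrC (exp_c i)) ler_wpM2l ?mulr_ge0 ?exp_c_ge0 ?exprn_ge0 ?(ltW r0) //.
  apply: EX_abs_le => //; first exact: integ_moment.
  exact: integ_abs (integ_moment i).
apply: EX_le => //; first exact: integ_sum.
move=> o; have hC : exptype 1 rho (fun k => rho ^+ k).
  by move=> k; rewrite mul1r ger0_norm // exprn_ge0 // ltW.
have := moment_partial_le n o hC; rewrite mul1r; apply: le_trans.
apply: ler_sum => i _; rewrite /F [X in _ <= X]normrM ger0_norm //.
by rewrite mulr_ge0 ?exp_c_ge0 // exprn_ge0 // ltW.
Qed.

(** Dominated convergence: expectations of [Y * efun H Z] are computed term by term. *)
Lemma moment_series (H : nat -> R) C : exptype C rho H ->
  integ (fun o => Y o * efun H (Z o)) /\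
  slim nR (fun n => \sum_(i < n) H i * exp_c i * EX (fun o => Y o * Z o ^+ i))
     (EX (fun o => Y o * efun H (Z o))).
Proof.
move=> hC; pose f n o := \sum_(i < n) H i * exp_c i * (Y o * Z o ^+ i).
have mf n : measurable_fun setT (f n).
  apply: integ_meas; apply: (@integ_sum n (fun i o => H i * exp_c i * (Y o * Z o ^+ i))) => i.
  by apply: integZ; exact: integ_moment.
have mF : measurable_fun setT (fun o => Y o * efun H (Z o)).
  apply: measurable_funM => //; apply: measurableT_comp => //.
  exact: measurable_efun (ltW r0) hC.
have f_f : {ae P, forall o, setT o -> (fun n => (f n o)%:E) @ \oo --> (Y o * efun H (Z o))%:E}.
  apply: aeW => o _; apply: cvg_EFin; first by near=> n.
  rewrite /comp /=; apply/slim_cvg.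
  have := slimZ absval_normr (Y o) (efun_slim (Z o) (ltW r0) hC); apply: eq_slim.
  by apply/funext => n; rewrite mulr_sumr; apply: eq_bigr => i _; ring.
have f_g : {ae P, forall o n, setT o -> (`|(f n o)%:E| <= (C * (`|Y o| * expR (rho * `|Z o|)))%:E)%E}.
  apply: aeW => o n _; rewrite /= lee_fin.
  exact: (le_trans (ler_norm_sum _ _ _)) (moment_partial_le n o hC).
have [h1 _ h3] := @dominated_convergence _ _ _ P setT measurableT
  (fun n o => (f n o)%:E) (fun o => (Y o * efun H (Z o))%:E)
  (fun o => (C * (`|Y o| * expR (rho * `|Z o|)))%:E)
  (fun n => (measurable_EFinP _ _).2 (mf n)) ((measurable_EFinP _ _).2 mF)
  f_f (integZ C iYZ) f_g.
split; first exact: h1.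
apply/slim_cvg; rewrite EXE /Rintegral.
have -> : (fun n => \sum_(i < n) H i * exp_c i * EX (fun o => Y o * Z o ^+ i)) =
    (fun n => fine (\int[P]_(x in setT) (f n x)%:E)%E).
  apply/funext => n; have -> : fine (\int[P]_(x in setT) (f n x)%:E)%E = EX (f n) by rewrite EXE.
  rewrite (@EX_sum n (fun i o => H i * exp_c i * (Y o * Z o ^+ i))); last first.
    by move=> i; apply: integZ; exact: integ_moment.
  by apply: eq_bigr => i _; rewrite EXZ //; exact: integ_moment.
apply: fine_cvg; rewrite fineK; last exact: integrable_fin_num.
exact: h3.
Unshelve. all: by end_near. Qed.

End moments.

Section complex_moments.
Variables (Y Z : Omega -> R) (rho : R).
Hypotheses (mY : measurable_fun setT Y) (mZ : measurable_fun setT Z) (r0 : 0 < rho).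
Hypothesis iYZ : integ (fun o => `|Y o| * expR (rho * `|Z o|)).

Lemma exptype_ReX (z : R[i]) : normc z <= rho -> exptype 1 rho (fun k => complex.Re (z ^+ k)).
Proof.
move=> zr k; rewrite mul1r (le_trans (normc_Re _)) // normcX lerXn2r ?nnegrE ?normc_ge0 //.
exact: ltW.
Qed.

Lemma exptype_ImX (z : R[i]) : normc z <= rho -> exptype 1 rho (fun k => complex.Im (z ^+ k)).
Proof.
move=> zr k; rewrite mul1r (le_trans (normc_Im _)) // normcX lerXn2r ?nnegrE ?normc_ge0 //.
exact: ltW.
Qed.

Lemma cexp_efun (z : R[i]) x : normc z <= rho ->
  cexp (z * x%:C) = efun (fun k => complex.Re (z ^+ k)) x +i* efun (fun k => complex.Im (z ^+ k)) x.
Proof.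
move=> zr; have E n : \sum_(i < n) (exp_c i)%:C * (z * x%:C) ^+ i =
    (\sum_(i < n) complex.Re (z ^+ i) * exp_c i * x ^+ i)
    +i* (\sum_(i < n) complex.Im (z ^+ i) * exp_c i * x ^+ i).
  rewrite -[LHS]/(_ : R[i]) [LHS]complexE Re_sum Im_sum.
  rewrite (_ : \sum_(i < n) complex.Re _ = \sum_(i < n) complex.Re (z ^+ i) * exp_c i * x ^+ i); last first.
    by apply: eq_bigr => i _; rewrite exprMn real_complexX !ReM ImM /=; ring.
  rewrite (_ : \sum_(i < n) complex.Im _ = \sum_(i < n) complex.Im (z ^+ i) * exp_c i * x ^+ i); last first.
    by apply: eq_bigr => i _; rewrite exprMn real_complexX !ImM ReM /=; ring.
  by simpc.
have H := cexp_ps (z * x%:C).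
have HR : slim nR (fun n => \sum_(i < n) complex.Re (z ^+ i) * exp_c i * x ^+ i) (complex.Re (cexp (z * x%:C))).
  move=> e /H [M HM]; exists M => n /HM; rewrite E; apply: le_trans.
  by rewrite -ReN -[X in X + _]/(complex.Re (_ +i* (\sum_(i < n) complex.Im (z ^+ i) * exp_c i * x ^+ i))) -ReD normc_Re.
have HI : slim nR (fun n => \sum_(i < n) complex.Im (z ^+ i) * exp_c i * x ^+ i) (complex.Im (cexp (z * x%:C))).
  move=> e /H [M HM]; exists M => n /HM; rewrite E; apply: le_trans.
  by rewrite -ImN -[X in X + _]/(complex.Im ((\sum_(i < n) complex.Re (z ^+ i) * exp_c i * x ^+ i) +i* _)) -ImD normc_Im.
have -> := slim_unique absval_normr (efun_slim x (ltW r0) (exptype_ReX zr)) HR.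
have -> := slim_unique absval_normr (efun_slim x (ltW r0) (exptype_ImX zr)) HI.
by case: (cexp _).
Qed.

(** Real and imaginary parts of [exp (z * x)] are functions of [x] to which
    [moment_series] applies. *)
Lemma cmoment_series (z : R[i]) : normc z <= rho ->
  ps_to nC (fun n => (EX (fun o => Y o * Z o ^+ n) * exp_c n)%:C) z
    (cexpectation P (fun o => (Y o)%:C * cexp (z * (Z o)%:C))).
Proof.
move=> zr.
have [i1 s1] := moment_series mY mZ r0 iYZ (exptype_ReX zr).
have [i2 s2] := moment_series mY mZ r0 iYZ (exptype_ImX zr).
have -> : cexpectation P (fun o => (Y o)%:C * cexp (z * (Z o)%:C)) =
   EX (fun o => Y o * efun (fun k => complex.Re (z ^+ k)) (Z o)) +i*
   EX (fun o => Y o * efun (fun k => complex.Im (z ^+ k)) (Z o)).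
  congr (_ +i* _); apply: eq_EX => o; rewrite cexp_efun //; rewrite ?ReM ?ImM /=; ring.
move=> e e0; have e20 : 0 < e / 2 by rewrite divr_gt0.
have [M1 H1] := s1 _ e20; have [M2 H2] := s2 _ e20; exists (maxn M1 M2) => n.
rewrite geq_max => /andP[/H1 {}H1 /H2 {}H2].
apply: (le_trans (normc_le_ReIm _)); rewrite (splitr e) ReD ImD ReN ImN Re_sum Im_sum.
apply: lerD.
  apply: le_trans H1; rewrite le_eqVlt; apply/orP; left; apply/eqP.
  congr `|_ - _|; apply: eq_bigr => i _; rewrite ReM /=; ring.
apply: le_trans H2; rewrite le_eqVlt; apply/orP; left; apply/eqP.
congr `|_ - _|; apply: eq_bigr => i _; rewrite ImM /=; ring.
Qed.

End complex_moments.

End expectations.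

(** * Appell polynomials of one variable *)

Section egf_coefficients.
Context {R : realType}.
Local Notation nR := (@Num.norm R R : R -> R).
Implicit Types (c : nat -> R) (x y l : R).

Definition fnorm c n : R := c n * exp_c n.

Lemma is_egfE c x l : is_egf c x l <-> ps_to nR (fnorm c) x l.
Proof.
rewrite ps_to_cvg /is_egf.
suff -> : (fun n => c n * x ^+ n / n`!%:R) = (fun n => fnorm c n * x ^+ n) by [].
by apply/funext => n; rewrite /fnorm /exp_c mulrAC.
Qed.

Lemma fact_exp_c n : n`!%:R * exp_c n = 1 :> R.
Proof. by rewrite /exp_c divff // pnatr_eq0 -lt0n fact_gt0. Qed.

Lemma exp_c0 : exp_c 0 = 1 :> R. Proof. by rewrite /exp_c fact0 invr1. Qed.

Lemma exp_c1 : exp_c 1 = 1 :> R. Proof. by rewrite /exp_c factS fact0 muln1 invr1. Qed.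

Lemma exp_c_gt0 n : 0 < exp_c n :> R.
Proof. by rewrite invr_gt0 ltr0n fact_gt0. Qed.

Lemma egf_coefP (g : R -> R) (a : nat -> R) rho : 0 < rho ->
  (forall x, `|x| < rho -> ps_to nR a x (g x)) ->
  egf_coef g = fun n => n`!%:R * a n.
Proof.
move=> r0 ag; pose c n := n`!%:R * a n.
have ca : fnorm c = a.
  by apply/funext => n; rewrite /fnorm /c mulrAC fact_exp_c mul1r.
have cin : [set c : nat -> R | exists2 rho, 0 < rho & forall x, `|x| < rho -> is_egf c x (g x)] c.
  by exists rho => // x /ag; rewrite is_egfE ca.
apply: xget_unique => // c' [rho' r'0 H].
suff E : fnorm c' = fnorm c.
  apply/funext => n; have := congr1 (@^~ n) E; rewrite /fnorm.
  by apply: mulIf; rewrite gt_eqF // exp_c_gt0.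
apply: (@ps_unique R (Num.min rho rho') _ _ g) => [|x x0|x x0]; first by rewrite lt_min r0.
  by rewrite lt_min => /andP[_ xr]; apply/is_egfE/H; rewrite gtr0_norm.
by rewrite lt_min ca => /andP[xr _]; apply: ag; rewrite gtr0_norm.
Qed.

End egf_coefficients.

Section power_series_functions.
Context {R : realType}.
Local Notation nR := (@Num.norm R R : R -> R).
Variable rho : R.
Hypothesis rho0 : 0 <= rho.
Implicit Types g : R -> R.

(** Sums of power series on a common closed disc, with absolute convergence there;
    these functions form a ring. *)
Definition is_ps g := exists (c : nat -> R) (S : R), sbnd nR rho c S /\
  forall x, `|x| <= rho -> ps_to nR c x (g x).

Lemma is_ps_cst (x : R) : is_ps (fun=> x).
Proof.
exists (fun n => x * delta0 n), (`|x| * 1); split.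
  by apply: sbndZ; [exact: absval_normr|apply: sbnd_delta; exact: absval_normr].
move=> y _; rewrite -[X in ps_to _ _ _ X]mulr1; apply: ps_toZ; first exact: absval_normr.
move=> e e0; exists 1%N => -[//|n] _; rewrite big_ord_recl /delta0 expr0 mulr1.
by rewrite big1 ?addr0 ?subrr ?normr0 ?(ltW e0) // => i _; rewrite mul0r.
Qed.

Lemma is_psD g h : is_ps g -> is_ps h -> is_ps (fun x => g x + h x).
Proof.
move=> [a [S [aS ga]]] [b [T [bT hb]]]; exists (fun n => a n + b n), (S + T); split.
  exact: (sbndD absval_normr rho0 aS bT).
by move=> x xr; apply: ps_toD; [exact: absval_normr|exact: ga|exact: hb].
Qed.

Lemma is_psM g h : is_ps g -> is_ps h -> is_ps (fun x => g x * h x).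
Proof.
move=> [a [S [aS ga]]] [b [T [bT hb]]]; exists (conv a b), (S * T); split.
  exact: (sbnd_conv absval_normr rho0 aS bT).
by move=> x xr; apply: (ps_toM absval_normr xr aS bT); [exact: ga|exact: hb].
Qed.

Lemma is_psN g : is_ps g -> is_ps (fun x => - g x).
Proof.
move=> gp; have -> : (fun x => - g x) = (fun x => (-1) * g x).
  by apply/funext => x; rewrite mulN1r.
by apply: is_psM => //; exact: is_ps_cst.
Qed.

Lemma is_ps_sum n (F : nat -> R -> R) : (forall i, (i < n)%N -> is_ps (F i)) ->
  is_ps (fun x => \sum_(i < n) F i x).
Proof.
elim: n => [|n IH] H; first by under eq_fun do rewrite big_ord0; exact: is_ps_cst.
under eq_fun do rewrite big_ord_recr /=.
by apply: is_psD; [apply: IH => i lin; apply: H; exact: ltnW|exact: H].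
Qed.

Lemma is_ps_expR y : is_ps (fun x => expR (x * y)).
Proof.
exists (fun n => y ^+ n * exp_c n), (expR (rho * `|y|)); split; first exact: sbnd_exp_c.
by move=> x _; exact: expR_ps2.
Qed.

(** By strong induction along the recursion [finvS]. *)
Lemma is_ps_finv (a : R -> nat -> R) n : (forall k, is_ps (fun x => a x k)) ->
  is_ps (fun x => finv (a x) n).
Proof.
move=> ha; have [k] := ubnP n; elim: k n => // k IH [|n]; rewrite ltnS => nk.
  by under eq_fun do rewrite finv0; exact: is_ps_cst.
under eq_fun do rewrite finvS; apply: is_psN.
apply: (is_ps_sum (F := fun k x => a x k.+1 * finv (a x) (n - k))) => i lin.
apply: is_psM => //; apply: IH; rewrite (leq_ltn_trans _ nk) //.
by rewrite (leq_trans (leq_subr _ _)).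
Qed.

End power_series_functions.

Section appell_coefficients.
Context {R : realType} {d : measure_display} {Omega : measurableType d}.
Variable P : probability Omega R.
Implicit Types (Y Z : Omega -> R).
Local Notation nR := (@Num.norm R R : R -> R).

Definition mom Y Z n : R := EX P (fun o => Y o * Z o ^+ n) * exp_c n.

Definition mom1 Z := mom (fun=> 1) Z.

Definition expmon (x : R) n : R := x ^+ n * exp_c n.

Lemma mgfE Z th : mgf P Z th = EX P (fun o => expR (th * Z o)).
Proof.
rewrite /mgf /mmt_gen_fun; congr EX; apply/funext => o /=.
by rewrite /= mulrC.
Qed.

Lemma mom1_0 Z : mom1 Z 0 = 1.
Proof.
rewrite /mom1 /mom (eq_EX P (G := fun=> 1)) ?EX_cst ?mul1r ?exp_c0 // => o.
by rewrite expr0 mulr1.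
Qed.

Section one_variable.
Variables (Y Z : Omega -> R) (rho : R).
Hypotheses (mY : measurable_fun setT Y) (mZ : measurable_fun setT Z) (r0 : 0 < rho).

Lemma mom_ps x : integ P (fun o => `|Y o| * expR (rho * `|Z o|)) -> `|x| <= rho ->
  integ P (fun o => Y o * expR (x * Z o)) /\
  ps_to nR (mom Y Z) x (EX P (fun o => Y o * expR (x * Z o))).
Proof.
move=> iYZ xr; have hC : exptype 1 rho (fun k => x ^+ k).
  by move=> k; rewrite normrX mul1r lerXn2r // nnegrE // ltW.
have [i1 s1] := moment_series mY mZ r0 iYZ hC.
have E z : efun (fun k => x ^+ k) z = expR (x * z).
  apply: (slim_unique absval_normr (efun_slim z (ltW r0) hC)).
  have := expR_ps2 z x; apply: eq_slim; apply/funext => n; apply: eq_bigr => i _; ring.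
have EE : (fun o => Y o * efun (fun k => x ^+ k) (Z o)) = (fun o => Y o * expR (x * Z o)).
  by apply/funext => o; rewrite E.
rewrite EE in i1 s1; split => //.
by move: s1; apply: eq_slim; apply/funext => n; apply: eq_bigr => i _; rewrite /mom; ring.
Qed.

Lemma sbnd_mom : integ P (fun o => `|Y o| * expR (rho * `|Z o|)) ->
  sbnd nR rho (mom Y Z) (EX P (fun o => `|Y o| * expR (rho * `|Z o|))).
Proof. by move=> iYZ; exact: sbnd_moment. Qed.

End one_variable.

(** The generating function of the Appell polynomials is the product of the series of
    [exp (th * x)] and of the inverse series of the moments. *)
Lemma appellE Z rho n x : measurable_fun setT Z -> 0 < rho ->
  integ P (fun o => expR (rho * `|Z o|)) ->
  appell P Z n x = n`!%:R * conv (expmon x) (finv (mom1 Z)) n.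
Proof.
move=> mZ r0 iZ.
have m1 : measurable_fun setT ((fun=> 1) : Omega -> R) by exact: measurable_cst.
have iZ' : integ P (fun o => `|1 : R| * expR (rho * `|Z o|)).
  by apply: eq_integrable iZ => // o _; rewrite /= normr1 mul1r.
have mS := sbnd_mom m1 mZ r0 iZ'.
set S := EX P _ in mS; pose r := rho / (2 * (S + 1)).
have S0 := sbnd_ge0 mS.
have rp : 0 < r by rewrite divr_gt0 // mulr_gt0 // ltr_wpDl.
have rr : r <= rho.
  rewrite ler_pdivrMr; last by rewrite mulr_gt0 // ltr_wpDl.
  rewrite ler_pMr //; have : 1 <= S + 1 by rewrite lerDr.
  by lra.
have fS := sbnd_finv absval_normr r0 (mom1_0 Z) mS; rewrite -/r in fS.
have mS' := sbnd_le absval_normr (ltW rp) rr mS.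
rewrite /appell (@egf_coefP R _ (conv (expmon x) (finv (mom1 Z))) r) // => th thr.
have thr' := ltW thr.
have [_ pm] := mom_ps m1 mZ r0 iZ' (le_trans thr' rr).
have [l pf] := ex_ps_to fS thr'.
have := ps_toM absval_normr thr' mS' fS pm pf; rewrite (conv_finv (mom1_0 Z)) => pd.
have l1 : mgf P Z th * l = 1.
  rewrite mgfE; have -> : EX P (fun o => expR (th * Z o)) = EX P (fun o => 1 * expR (th * Z o)).
    by apply: eq_EX => o; rewrite mul1r.
  exact: (slim_unique absval_normr pd (ps_to_delta absval_normr th)).
have -> : expR (th * x) / mgf P Z th = expR (th * x) * l.
  congr (_ * _); have M0 : mgf P Z th != 0.
    by apply/eqP => M0; move/eqP: l1; rewrite M0 mul0r eq_sym oner_eq0.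
  by apply: (mulfI M0); rewrite l1 divff.
apply: (ps_toM absval_normr thr' (sbnd_exp_c x (ltW rp)) fS _ pf).
exact: expR_ps2.
Qed.

End appell_coefficients.

(** * Appell polynomials of two variables *)

Section joint_appell.
Context {R : realType} {d : measure_display} {Omega : measurableType d}.
Variable P : probability Omega R.
Local Notation nR := (@Num.norm R R : R -> R).
Local Notation aN := absval_normr.

Lemma is_ps_le (r r' : R) g : 0 <= r' -> r' <= r -> is_ps r g -> is_ps r' g.
Proof.
move=> r0 rr [c [S [cS gc]]]; exists c, S; split; first exact: (sbnd_le aN r0 rr cS).
by move=> x xr; apply: gc; exact: le_trans xr rr.
Qed.

Lemma ps_to_sum n (F : nat -> nat -> R) (x : R) (l : nat -> R) :
  (forall i, (i < n)%N -> ps_to nR (F i) x (l i)) ->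
  ps_to nR (fun k => \sum_(i < n) F i k) x (\sum_(i < n) l i).
Proof.
elim: n => [|n IH] H.
  move=> e e0; exists 0%N => k _; rewrite big_ord0 subr0 big1 ?normr0 ?(ltW e0) // => i _.
  by rewrite big_ord0 mul0r.
have := ps_toD aN (IH (fun i lin => H i (ltnW lin))) (H n (ltnSn n)).
rewrite big_ord_recr /=; apply: eq_slim; apply/funext => k.
by apply: eq_bigr => i _; rewrite big_ord_recr.
Qed.

(** Integrate [F + t ^ 2 / F >= 2 * t] with [t] so small that [t * E (1 / F) <= 1]. *)
Lemma EX_ge_inv (F : Omega -> R) (G : Omega -> R) : integ P F -> integ P G ->
  (forall o, 0 < F o) -> (forall o, F o * G o = 1) -> 0 < EX P F.
Proof.
move=> iF iG F0 FG.
have G0 o : 0 < G o by have := FG o; have := F0 o => f0 fg; rewrite -(pmulr_rgt0 _ f0) fg.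
have EG : 0 <= EX P G by apply: EX_ge0 => o; exact: ltW.
pose t := (EX P G + 1)^-1; have t0 : 0 < t by rewrite invr_gt0 ltr_wpDl.
have H : EX P (fun=> 2 * t) <= EX P (fun o => F o + t ^+ 2 * G o).
  apply: EX_le; [exact: integ_cst|by apply: integD => //; exact: integZ|move=> o].
  have := sqr_ge0 (F o - t); have := FG o; have := F0 o; have := G0 o.
  move: (F o) (G o) => f g g0 f0 fg h.
  rewrite -(ler_pM2l f0); rewrite mulrDr [f * (t ^+ 2 * g)](_ : _ = t ^+ 2 * (f * g)); last by ring.
  by rewrite fg mulr1 -subr_ge0; apply: le_trans h _; rewrite le_eqVlt; apply/orP; left; apply/eqP; ring.
move: H; rewrite EX_cst EXD ?EXZ //; last exact: integZ.
have tG : t * EX P G <= 1.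
  by rewrite /t mulrC ler_pdivrMr ?ltr_wpDl // mul1r lerDl.
have : t ^+ 2 * EX P G <= t by rewrite expr2 -mulrA ler_piMr // ltW.
by move=> h1 h2; move: h1 h2 t0; lra.
Qed.

Variables (Y Z : Omega -> R) (rho : R).
Hypotheses (mY : measurable_fun setT Y) (mZ : measurable_fun setT Z) (r0 : 0 < rho).
Hypothesis iYZ : integ P (fun o => expR (rho * `|Y o|) * expR (rho * `|Z o|)).

Let meas_exp (a : R) (W : Omega -> R) : measurable_fun setT W -> measurable_fun setT (fun o : Omega => expR (a * W o)).
Proof. by move=> mW; apply: measurableT_comp => //; apply: measurable_funM => //; exact: measurable_cst. Qed.

Let meas_absexp (a : R) (W : Omega -> R) : measurable_fun setT W -> measurable_fun setT (fun o : Omega => expR (a * `|W o|)).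
Proof. by move=> mW; apply: (meas_exp a); apply: measurableT_comp. Qed.

Let exp_le1 (W : R) : 1 <= expR (rho * `|W|).
Proof. by rewrite -[X in X <= _]expR0 ler_expR mulr_ge0 // ltW. Qed.

Lemma integ_expY : integ P (fun o => expR (rho * `|Y o|)).
Proof.
apply: integ_le iYZ; first exact: meas_absexp.
by move=> o; rewrite gtr0_norm ?expR_gt0 // ler_peMr ?expR_ge0.
Qed.

Let exp_eta_le (eta : R) (W : R) : `|eta| <= rho -> expR (eta * W) <= expR (rho * `|W|).
Proof.
by move=> er; rewrite ler_expR (le_trans (ler_norm _)) // normrM ler_wpM2r.
Qed.

Let wexp eta (o : Omega) : R := expR (eta * Y o).

Let iwZ eta : `|eta| <= rho -> integ P (fun o => `|wexp eta o| * expR (rho * `|Z o|)).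
Proof.
move=> er; apply: integ_le iYZ.
  by apply: measurable_funM; [apply: measurableT_comp => //; exact: meas_exp|exact: meas_absexp].
move=> o; rewrite /wexp normrM normr_id ![`|expR _|]gtr0_norm ?expR_gt0 // ler_wpM2r ?expR_ge0 //.
exact: exp_eta_le.
Qed.

Let M eta := mom P (wexp eta) Z.

Let mgf2_ps xi eta : `|xi| <= rho -> `|eta| <= rho -> ps_to nR (M eta) xi (mgf2 P Z Y xi eta).
Proof.
move=> xr er; have [_] := mom_ps (meas_exp eta mY) mZ r0 (iwZ er) xr.
rewrite /mgf2; have -> // : EX P (fun o => expR (eta * Y o) * expR (xi * Z o)) =
  fine 'E_P[fun o => expR (xi * Z o + eta * Y o)].
by apply: eq_EX => o; rewrite -expRD addrC.
Qed.

Let iZn n : integ P (fun o => `|Z o ^+ n| * expR (rho * `|Y o|)).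
Proof.
have iw : integ P (fun o => `|expR (rho * `|Y o|)| * expR (rho * `|Z o|)).
  by apply: eq_integrable iYZ => // o _ /=; rewrite [`|expR _|]gtr0_norm ?expR_gt0.
have := integ_abs (integ_moment (meas_absexp rho mY) mZ r0 iw n).
apply: eq_integrable => // o _ /=.
by rewrite normrM [`|expR _|]gtr0_norm ?expR_gt0 // mulrC.
Qed.

Let mu n k := exp_c n * mom P (fun o => Z o ^+ n) Y k.

Let M_ps n eta : `|eta| <= rho -> ps_to nR (mu n) eta (M eta n).
Proof.
move=> er; have [_ H] := mom_ps (measurable_funX n mZ) mY r0 (iZn n) er.
have := ps_toZ aN (exp_c n) H; have -> // : exp_c n * EX P (fun o => Z o ^+ n * expR (eta * Y o)) = M eta n.
by rewrite /M /mom mulrC; congr (_ * _); apply: eq_EX => o; rewrite mulrC.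
Qed.

Let mu_sbnd n : exists S, sbnd nR rho (mu n) S.
Proof.
exists (`|exp_c n| * EX P (fun o => `|Z o ^+ n| * expR (rho * `|Y o|))).
by apply: sbndZ; [exact: aN|apply: sbnd_mom => //; exact: measurable_funX].
Qed.

Let mu0 n : mu n 0 = mom1 P Z n.
Proof.
rewrite /mu /mom1 /mom exp_c0 mulr1 mulrC; congr (_ * _); apply: eq_EX => o.
by rewrite expr0 mulr1 mul1r.
Qed.

Let mu1 n : mu n 1 = mom P Y Z n.
Proof.
rewrite /mu /mom exp_c1 mulr1 mulrC; congr (_ * _); apply: eq_EX => o.
by rewrite expr1 mulrC.
Qed.

Let q := EX P (fun o => expR (- (rho * `|Y o|))).

Let iq : integ P (fun o => expR (- (rho * `|Y o|))).
Proof.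
apply: integ_le (integ_cst P 1); last first.
  by move=> o; rewrite gtr0_norm ?expR_gt0 // -[X in _ <= X]expR0 ler_expR oppr_le0 mulr_ge0 // ltW.
have -> : (fun o => expR (- (rho * `|Y o|))) = (fun o => expR (- rho * `|Y o|)).
  by apply/funext => o; rewrite mulNr.
exact: meas_absexp.
Qed.

Let q0 : 0 < q.
Proof.
apply: (EX_ge_inv iq integ_expY) => o; first exact: expR_gt0.
by rewrite -expRD addrC subrr expR0.
Qed.

Let M0_ge eta : `|eta| <= rho -> q <= M eta 0.
Proof.
move=> er; rewrite /M /mom exp_c0 mulr1; apply: EX_le => // [|o].
  have := iwZ er => i1; apply: integ_le i1.
    by apply: measurable_funM; [exact: meas_exp|exact: measurable_funX].
  by move=> o; rewrite expr0 mulr1 ler_peMr.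
rewrite expr0 mulr1 /wexp ler_expR -mulNr -lerN2 -!mulNr opprK.
by rewrite (le_trans (ler_norm _)) // normrM normrN ler_wpM2r.
Qed.

Let S1 := EX P (fun o => expR (rho * `|Y o|) * expR (rho * `|Z o|)).

Let M_sbnd eta : `|eta| <= rho -> sbnd nR rho (M eta) S1.
Proof.
move=> er n; apply: (le_trans (sbnd_mom (meas_exp eta mY) mZ r0 (iwZ er) n)).
apply: EX_le => //; first exact: iwZ.
move=> o; rewrite ler_wpM2r ?expR_ge0 // [`|wexp _ _|]gtr0_norm ?expR_gt0 //.
exact: exp_eta_le.
Qed.

(** For fixed [eta], divide the series of [exp (xi * x)] by that of [M eta] in [xi],
    normalized by its constant term [M eta 0]. Each coefficient of the quotient is a
    polynomial in power series in [eta] that share a disc of convergence. *)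
Lemma egf_coef2_exists x y : exists c : nat -> nat -> R, exists2 rho' : R, 0 < rho' &
  forall xi eta, `|xi| < rho' -> `|eta| < rho' ->
    exists2 b : nat -> R, (forall n, is_egf (c n) eta (b n)) &
      is_egf b xi (expR (xi * x + eta * y) / mgf2 P Z Y xi eta).
Proof.
pose a eta n := (M eta 0)^-1 * M eta n.
have a0 eta : `|eta| <= rho -> a eta 0%N = 1.
  by move=> /M0_ge h; rewrite /a mulVf // gt_eqF // (lt_le_trans q0).
pose S := q^-1 * S1.
have aS eta : `|eta| <= rho -> sbnd nR rho (a eta) S.
  move=> er n; apply: (le_trans (sbndZ aN (M eta 0)^-1 (M_sbnd er) n)).
  have h := M0_ge er; have h0 := lt_le_trans q0 h.
  rewrite ger0_norm ?invr_ge0 ?(ltW h0) // ler_wpM2r ?(sbnd_ge0 (M_sbnd er)) //.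
  by rewrite lef_pV2 ?posrE.
have S0 : 0 <= S by apply: (sbnd_ge0 (aS 0 _)); rewrite normr0 ltW.
pose r := rho / (2 * (S + 1)).
have rp : 0 < r by rewrite divr_gt0 // mulr_gt0 // ltr_wpDl.
have small (T : R) : 0 <= T -> rho / (2 * (T + 1)) <= rho.
  move=> T0; rewrite ler_pdivrMr; last by rewrite mulr_gt0 // ltr_wpDl.
  rewrite ler_pMr //; have : 1 <= T + 1 by rewrite lerDr.
  by lra.
have [S2 muS] := mu_sbnd 0; have S20 := sbnd_ge0 muS.
pose r1 := rho / (2 * (S2 + 1)).
have r1p : 0 < r1 by rewrite divr_gt0 // mulr_gt0 // ltr_wpDl.
pose r2 := Num.min r r1.
have r2p : 0 < r2 by rewrite lt_min rp.
have r2r : r2 <= r by rewrite ge_min lexx.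
have r21 : r2 <= r1 by rewrite ge_min lexx orbT.
have r2rho : r2 <= rho := le_trans r2r (small S S0).
have Mps n : is_ps r2 (fun eta => M eta n).
  apply: (@is_ps_le rho); rewrite ?(ltW r2p) //.
  have [T hT] := mu_sbnd n; exists (mu n), T; split => // eta; exact: M_ps.
have M0ps : is_ps r2 (fun eta => (M eta 0)^-1).
  apply: (@is_ps_le r1); rewrite ?(ltW r2p) //.
  have mu00 : mu 0 0 = 1 by rewrite mu0 mom1_0.
  have fS := sbnd_finv aN r0 mu00 muS.
  exists (finv (mu 0)), 2; split => // eta er.
  have er' := le_trans er (small S2 S20).
  have [l pl] := ex_ps_to fS er.
  have := ps_toM aN er (sbnd_le aN (ltW r1p) (small S2 S20) muS) fS (M_ps 0 er') pl.
  rewrite (conv_finv mu00) => pd.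
  suff -> : (M eta 0)^-1 = l by [].
  have Ml : M eta 0 * l = 1.
    exact: (slim_unique aN pd (ps_to_delta aN eta)).
  have h := lt_le_trans q0 (M0_ge er').
  by apply: (mulfI (lt0r_neq0 h)); rewrite Ml divff // gt_eqF.
have aps n : is_ps r2 (fun eta => a eta n) by apply: (is_psM (ltW r2p)).
pose b eta n := expR (eta * y) * (M eta 0)^-1 * conv (expmon x) (finv (a eta)) n.
have bps n : is_ps r2 (fun eta => b eta n).
  apply: (is_psM (ltW r2p)).
    by apply: (is_psM (ltW r2p)) => //; exact: is_ps_expR (ltW r2p) y.
  apply: (is_ps_sum (ltW r2p) (F := fun i eta => expmon x i * finv (a eta) (n - i))) => i _.
  by apply: (is_psM (ltW r2p)); [exact: is_ps_cst|exact: (is_ps_finv (ltW r2p))].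
have [c hc] := choice bps.
exists (fun n k => n`!%:R * (k`!%:R * c n k)); exists r2 => // xi eta xr er.
have [xr' er'] := (ltW xr, ltW er).
exists (fun n => n`!%:R * b eta n) => [n|].
  apply/is_egfE; have [S' [_ H]] := hc n.
  have := ps_toZ aN n`!%:R (H eta er'); apply: eq_slim; apply/funext => m.
  apply: eq_bigr => i _; rewrite /fnorm; congr (_ * _).
  have -> : n`!%:R * (i`!%:R * c n i) * exp_c i = n`!%:R * c n i * (i`!%:R * exp_c i) by ring.
  by rewrite fact_exp_c mulr1.
apply/is_egfE.
have -> : fnorm (fun n => n`!%:R * b eta n) = b eta.
  by apply/funext => n; rewrite /fnorm mulrAC fact_exp_c mul1r.
have er2 := le_trans er' r2rho; have xr2 := le_trans xr' r2rho.
have fS := sbnd_finv aN r0 (a0 eta er2) (aS eta er2); rewrite -/r in fS.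
have [l pl] := ex_ps_to fS (le_trans xr' r2r).
have pa : ps_to nR (a eta) xi ((M eta 0)^-1 * mgf2 P Z Y xi eta).
  by apply: ps_toZ; [exact: aN|exact: mgf2_ps].
have := ps_toM aN (le_trans xr' r2r) (sbnd_le aN (ltW rp) (small S S0) (aS eta er2)) fS pa pl.
rewrite (conv_finv (a0 eta er2)) => pd.
have Ml : (M eta 0)^-1 * mgf2 P Z Y xi eta * l = 1.
  exact: (slim_unique aN pd (ps_to_delta aN xi)).
have g0 : mgf2 P Z Y xi eta != 0.
  by apply/eqP => g0; move/eqP: Ml; rewrite g0 mulr0 mul0r eq_sym oner_eq0.
have -> : expR (xi * x + eta * y) / mgf2 P Z Y xi eta =
    expR (eta * y) * (M eta 0)^-1 * (expR (xi * x) * l).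
  rewrite expRD; apply: (mulIf g0); rewrite divfK //.
  rewrite -[LHS]mulr1 -Ml; ring.
apply: ps_toZ; first exact: aN.
apply: (ps_toM aN (le_trans xr' r2r) (sbnd_exp_c x (ltW rp)) fS _ pl).
exact: expR_ps2.
Qed.

(** The generating identity [c(xi, eta) * M(xi, eta) = exp(xi * x + eta * y)] read
    off in [eta]-degree 0 and 1. *)
Lemma appell2_conv x y :
  let C k n := appell2 P Z Y n k x y * exp_c n in
  conv (C 0%N) (mom1 P Z) = expmon x /\
  (forall n, conv (C 0%N) (mom P Y Z) n + conv (C 1%N) (mom1 P Z) n = y * expmon x n).
Proof.
move=> C.
pose c : nat -> nat -> R := egf_coef2 (fun xi eta => expR (xi * x + eta * y) / mgf2 P Z Y xi eta).
have [rh rh0 Hc] : exists2 rho' : R, 0 < rho' &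
  forall xi eta, `|xi| < rho' -> `|eta| < rho' ->
    exists2 b : nat -> R, (forall n, is_egf (c n) eta (b n)) &
      is_egf b xi (expR (xi * x + eta * y) / mgf2 P Z Y xi eta).
  exact: (xgetPex (fun _ _ => 0) (egf_coef2_exists x y)).
pose r1 := Num.min (rh / 4) rho.
have r1p : 0 < r1 by rewrite lt_min divr_gt0.
have r1h : r1 <= rh / 4 by rewrite ge_min lexx.
have r1r : r1 <= rho by rewrite ge_min lexx orbT.
have h4 : rh / 4 < rh by rewrite ltr_pdivrMr // ltr_pMr // ltr1n.
have h2 : rh / 2 < rh by rewrite ltr_pdivrMr // ltr_pMr // ltr1n.
have h24 : rh / 2 / 2 = rh / 4 by field.
have h20 : 0 < rh / 2 by rewrite divr_gt0.
(* the coefficients of the series in [xi] are functions of [eta] alone *)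
have Hb eta : 0 < eta -> eta < r1 -> exists2 b : nat -> R,
    (forall n, ps_to nR (fnorm (c n)) eta (b n)) &
    forall n, conv (fnorm b) (M eta) n = expR (eta * y) * expmon x n.
  move=> e0 er; have eh : `|eta| < rh.
    by rewrite gtr0_norm // (lt_trans er) // (le_lt_trans r1h).
  have er' : `|eta| <= rho by rewrite gtr0_norm // ltW // (lt_le_trans er).
  have [|b hb _] := Hc 0 eta _ eh; first by rewrite normr0.
  exists b => [n|]; first exact/is_egfE.
  have bg xi : `|xi| < rh -> ps_to nR (fnorm b) xi (expR (xi * x + eta * y) / mgf2 P Z Y xi eta).
    move=> xr; have [b' hb' hg] := Hc xi eta xr eh.
    have -> : b = b'.
      apply/funext => n; have /is_egfE k1 := hb n; have /is_egfE k2 := hb' n.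
      exact: (slim_unique aN k1 k2).
    exact/is_egfE.
  have [|T bT] := sbnd_of_ps_to h20 (bg (rh / 2) _); first by rewrite gtr0_norm.
  rewrite h24 in bT.
  have bT' := sbnd_le aN (ltW r1p) r1h bT; have MS := sbnd_le aN (ltW r1p) r1r (M_sbnd er').
  have E : conv (fnorm b) (M eta) = (fun n => expR (eta * y) * expmon x n).
    apply: (@ps_unique R r1 _ _ (fun xi => expR (eta * y) * expR (xi * x))) => // xi x0 xr.
      have xr' : `|xi| <= r1 by rewrite gtr0_norm // ltW.
      have xrho := le_trans xr' r1r.
      have := ps_toM aN xr' bT' MS (bg xi _) (mgf2_ps xrho er').
      rewrite divfK; last first.
        have [g0|//] := eqVneq (mgf2 P Z Y xi eta) 0.
        have iE : integ P (fun o => wexp eta o * expR (xi * Z o)).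
          by have [] := mom_ps (meas_exp eta mY) mZ r0 (iwZ er') xrho.
        suff : 0 < mgf2 P Z Y xi eta by rewrite g0 ltxx.
        rewrite -[mgf2 _ _ _ _ _]/(EX P _).
        have iE' : integ P (fun o => wexp (- eta) o * expR (- xi * Z o)).
          have er2 : `|- eta| <= rho by rewrite normrN.
          have xr2 : `|- xi| <= rho by rewrite normrN.
          by have [] := mom_ps (meas_exp (- eta) mY) mZ r0 (iwZ er2) xr2.
        apply: (EX_ge_inv _ iE') => [|o|o]; last 2 first.
          exact: expR_gt0.
          by rewrite /wexp -!expRD -[RHS]expR0; congr expR; ring.
        by apply: eq_integrable iE => // o _ /=; rewrite -expRD addrC.
      rewrite expRD mulrC; apply; rewrite gtr0_norm //.
      by rewrite (lt_trans xr) // (le_lt_trans r1h).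
    by apply: ps_toZ; [exact: aN|exact: expR_ps2].
  by move=> n; rewrite E.
(* the identity at order [n] in [xi], between power series in [eta] *)
pose ct i k := exp_c i * fnorm (c i) k.
have Hct n : (fun k => \sum_(i < n.+1) conv (ct i) (mu (n - i)) k) = (fun k => expmon x n * expmon y k).
  apply: (@ps_unique R r1 _ _ (fun eta => expR (eta * y) * expmon x n)) => // eta e0 er.
    have [b hb <-] := Hb eta e0 er.
    apply: (@ps_to_sum n.+1 (fun i => conv (ct i) (mu (n - i))) eta (fun i => fnorm b i * M eta (n - i))) => i _.
    have er' : `|eta| <= r1 by rewrite gtr0_norm // ltW.
    have [T cT] : exists T, sbnd nR r1 (fnorm (c i)) T.
      have n0 : `|0 : R| < rh by rewrite normr0.
      have n2 : `|rh / 2| < rh by rewrite gtr0_norm.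
      have [b' hb' _] := Hc 0 (rh / 2) n0 n2.
      have /is_egfE := hb' i => /(sbnd_of_ps_to h20) [T hT]; exists T; rewrite h24 in hT.
      exact: (sbnd_le aN (ltW r1p) r1h hT).
    have [T' mT] := mu_sbnd (n - i).
    apply: (ps_toM aN er' (sbndZ aN (exp_c i) cT) (sbnd_le aN (ltW r1p) r1r mT)).
      by rewrite /fnorm [b i * _]mulrC; apply: ps_toZ; [exact: aN|exact: hb].
    by apply: M_ps; exact: le_trans er' r1r.
  by rewrite mulrC; apply: ps_toZ; [exact: aN|exact: expR_ps2].
have C0E i : ct i 0 = C 0%N i by rewrite /ct /fnorm /C /appell2 -/c exp_c0 mulr1 mulrC.
have C1E i : ct i 1 = C 1%N i by rewrite /ct /fnorm /C /appell2 -/c exp_c1 mulr1 mulrC.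
split.
  apply/funext => n; have := congr1 (@^~ 0%N) (Hct n).
  rewrite [X in _ = X](_ : _ = expmon x n); last by rewrite /expmon /= expr0 exp_c0 !mulr1.
  move=> <-; apply: eq_bigr => i _.
  by rewrite [RHS]/conv big_ord1 C0E mu0.
move=> n; have := congr1 (@^~ 1%N) (Hct n).
rewrite [X in _ = X](_ : _ = y * expmon x n); last by rewrite /expmon /= expr1 exp_c1 mulr1 mulrC.
move=> <-; rewrite /conv -big_split; apply: eq_bigr => i _.
by rewrite !big_ord_recr big_ord0 /= add0r C0E C1E mu0 mu1.
Qed.

End joint_appell.

(** * The Wick product as a series *)

Section wick_products.
Context {R : realType} {d : measure_display} {Omega : measurableType d}.
Variable P : probability Omega R.
Local Notation nR := (@Num.norm R R : R -> R).
Local Notation aN := absval_normr.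

Lemma slim_shift (u : nat -> R) l : slim nR (fun n => u n.+1) l -> slim nR u l.
Proof. by move=> H e /H [M HM]; exists M.+1 => -[//|n] /HM. Qed.

Lemma slimB (u v : nat -> R) l m : slim nR u l -> slim nR v m -> slim nR (fun n => u n - v n) (l - m).
Proof.
move=> ul vm; have := slimD aN ul (slimZ aN (-1) vm); rewrite mulN1r; apply: eq_slim.
by apply/funext => n; rewrite mulN1r.
Qed.

Variables (Y Z : Omega -> R) (rho r C Si : R) (H : nat -> R).
Hypotheses (mY : measurable_fun setT Y) (mZ : measurable_fun setT Z).
Hypotheses (rho0 : 0 < rho) (r0 : 0 < r).
Hypothesis iYZ : integ P (fun o => expR (rho * `|Y o|) * expR (rho * `|Z o|)).
Hypothesis iZ : integ P (fun o => expR (r * `|Z o|)).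
Hypothesis iYeZ : integ P (fun o => `|Y o| * expR (r * `|Z o|)).
Hypothesis hSi : sbnd nR r (finv (mom1 P Z)) Si.
Hypothesis hC : exptype C r H.

(** The joint cumulants of [n] copies of [Z] and one of [Y], over [n!]: the
    coefficients of
    [E (Y * exp (th * Z)) / E (exp (th * Z))]. *)
Definition jcum : nat -> R := conv (finv (mom1 P Z)) (mom P Y Z).

Let m1 : measurable_fun setT ((fun=> 1) : Omega -> R).
Proof. exact: measurable_cst. Qed.

Let iZ1 : integ P (fun o => `|1 : R| * expR (r * `|Z o|)).
Proof. by apply: eq_integrable iZ => // o _; rewrite /= normr1 mul1r. Qed.

Lemma sbnd_jcum : sbnd nR r jcum (Si * EX P (fun o => `|Y o| * expR (r * `|Z o|))).
Proof. exact: (sbnd_conv aN (ltW r0) hSi (sbnd_mom mY mZ r0 iYeZ)). Qed.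

Lemma jcum0 : jcum 0 = EX P Y.
Proof.
rewrite /jcum /conv big_ord1 finv0 mul1r /mom exp_c0 mulr1; apply: eq_EX => o.
by rewrite expr0 mulr1.
Qed.

(** The coefficients are absolutely summable with weight [r], and the [n]-th
    derivative of [efun H] is at most of order [r ^ n]. *)
Lemma jcum_series_bound x n :
  \sum_(i < n) `|jcum i.+1 * efun (nshift i.+1 H) x| <=
  Si * EX P (fun o => `|Y o| * expR (r * `|Z o|)) * (C * expR (r * `|x|)).
Proof.
have C0 : 0 <= C * expR (r * `|x|).
  by apply: mulr_ge0; [exact: exptype_C_ge0 hC|exact: expR_ge0].
apply: le_trans (ler_wpM2r C0 (sbnd_jcum n.+1)).
apply: (@le_trans _ _ ((\sum_(i < n) `|jcum i.+1| * r ^+ i.+1) * (C * expR (r * `|x|)))).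
  rewrite mulr_suml; apply: ler_sum => i _; rewrite normrM -mulrA; apply: ler_wpM2l => //.
  apply: (le_trans (efun_le x (ltW r0) (exptype_shift i.+1 (ltW r0) hC))).
  by rewrite [r ^+ _ * _]mulrCA mulrA.
apply: ler_wpM2r => //; rewrite big_ord_recl lerDr.
by rewrite mulr_ge0 // exprn_ge0 // ltW.
Qed.

Lemma jcum_series_ex x : exists D, slim nR (fun n => \sum_(i < n) jcum i.+1 * efun (nshift i.+1 H) x) D.
Proof. exact: (@ex_slim R (fun i => jcum i.+1 * efun (nshift i.+1 H) x) _ (jcum_series_bound x)). Qed.

(** Pairing [H] with a series [phi] as in [pairing] turns [exp (th * x)] into
    [h x], its multiples [th^n * exp (th * x)] into [h^(n) x] and, after
    integration, [th^n * E (exp (th * Z))] into [E h^(n)(Z)]. The Wick product is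
    the pairing of [H] with [exp (th * x) * (y + E Y - B th)], where
    [B th = E (Y * exp (th * Z)) / E (exp (th * Z))]. *)
Lemma wick_series o D :
  slim nR (fun n => \sum_(i < n) jcum i.+1 * efun (nshift i.+1 H) (Z o)) D ->
  slim nR (fun n => \sum_(i < n) wick_term P (efun H) Z Y o i) (efun H (Z o) * Y o - D).
Proof.
move=> HD; set x := Z o in HD *; set y := Y o.
have [c0 c1] := appell2_conv mY mZ rho0 iYZ x y.
set C0 := (fun n => appell2 P Z Y n 0 x y * exp_c n) in c0 c1.
set C1 := (fun n => appell2 P Z Y n 1 x y * exp_c n) in c1.
pose m := mom1 P Z; pose ex := expmon x; pose b := jcum.
have m0 : m 0%N = 1 by exact: mom1_0.
have C0E : C0 = conv ex (finv m).
  by apply: (conv_inj m0); rewrite c0 -convA [conv (finv m) m]convC (conv_finv m0) conv_delta.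
have C0m1 : conv C0 (mom P Y Z) = conv b ex by rewrite C0E -convA [RHS]convC.
have c1' : conv C1 m = (fun n => y * ex n + (-1) * conv b ex n).
  by apply/funext => n; have := c1 n; rewrite C0m1 -/m -/ex => <-; rewrite mulN1r addrC addKr.
have C1E : C1 = conv (fun n => y * ex n + (-1) * conv b ex n) (finv m).
  by rewrite -c1' -convA (conv_finv m0) conv_delta.
have exS : sbnd nR r ex (expR (r * `|x|)) by exact: sbnd_exp_c (ltW r0).
have [S0 hS0] : exists S, sbnd nR r C0 S.
  by rewrite C0E; eexists; exact: (sbnd_conv aN (ltW r0) exS hSi).
have [S1 hS1] : exists S, sbnd nR r C1 S.
  rewrite C1E; eexists; apply: (sbnd_conv aN (ltW r0) _ hSi).
  apply: (sbndD aN (ltW r0)); first exact: (sbndZ aN).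
  by apply: (sbndZ aN); exact: (sbnd_conv aN (ltW r0) sbnd_jcum exS).
pose EY := EX P Y.
pose psi n := C1 n + EY * C0 n.
have hpsi := sbndD aN (ltW r0) hS1 (sbndZ aN EY hS0).
have hm := sbnd_mom m1 mZ r0 iZ1.
pose A n := EX P (fun o => 1 * efun (nshift n H) (Z o)).
have hA n : slim nR (fun k => \sum_(i < k) H (n + i)%N * m i) (A n).
  have [_ h] := moment_series m1 mZ r0 iZ1 (exptype_shift n (ltW r0) hC).
  by move: h; apply: eq_slim; apply/funext => k; apply: eq_bigr => i _; rewrite /m /mom1 /mom /nshift; ring.
have p1 := pairing aN (ltW r0) (exptype_C_ge0 hC) hC hpsi hm hA.
have hE n : slim nR (fun k => \sum_(i < k) H (n + i)%N * ex i) (efun (nshift n H) x).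
  have := efun_slim x (ltW r0) (exptype_shift n (ltW r0) hC); apply: eq_slim.
  by apply/funext => k; apply: eq_bigr => i _; rewrite /ex /expmon /nshift; ring.
have p2 := pairing aN (ltW r0) (exptype_C_ge0 hC) hC sbnd_jcum exS hE.
have HD' : slim nR (fun n => \sum_(i < n) jcum i * efun (nshift i H) x) (EY * efun H x + D).
  apply: slim_shift; have := slimD aN (slim_cst aN (EY * efun H x)) HD; apply: eq_slim.
  by apply/funext => n; rewrite big_ord_recl jcum0.
have p3 := slimB HD' p2; rewrite subr0 in p3.
have e0 : slim nR (fun n => \sum_(j < n) H j * ex j) (efun H x) by exact: (hE 0%N).
have p4 := slimB (slimZ aN (y + EY) e0) p3.
have := slimD aN p1 p4.
have -> : 0 + ((y + EY) * efun H x - (EY * efun H x + D)) = efun H x * y - D by ring.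
apply: eq_slim; apply/funext => n.
have -> : \sum_(i < n) wick_term P (efun H) Z Y o i = \sum_(i < n) psi i * A i.
  apply: eq_bigr => i _; rewrite /wick_term (derive1n_efun i (ltW r0) hC).
  have -> : fine 'E_P[fun o' => efun (nshift i H) (Z o')] = A i.
    by apply: eq_EX => o'; rewrite mul1r.
  rewrite -/EY -/x -/y /psi /C1 /C0 -[fine 'E_P[Y]]/EY /exp_c; ring.
have -> : \sum_(j < n) H j * conv psi m j = (y + EY) * (\sum_(j < n) H j * ex j) - \sum_(j < n) H j * conv jcum ex j.
  rewrite mulr_sumr -sumrB; apply: eq_bigr => j _.
  rewrite /psi convDl convZl c0 c1' -/ex; ring.
ring.
Qed.

End wick_products.

(** * Derivatives and continuity on a segment *)

Section within_derivatives.
Context {R : realType}.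
Implicit Types (a b u v x y e : R) (f g h phi psi : R -> R).

Lemma econt_unif a b f : econt a b f -> forall e, 0 < e -> exists2 dl : R, 0 < dl &
  forall x y, a <= x <= b -> a <= y <= b -> `|y - x| < dl -> `|f y - f x| <= e.
Proof.
move=> cf e e0.
have /compact_near_coveringP nc : compact `[a, b :> R] by exact: segment_compact.
have e20 : 0 < e / 2 by rewrite divr_gt0.
have [|dl /= dl0 H] := @nc _ (0 : R)^'+ (fun dl x => forall y, a <= x <= b -> a <= y <= b -> `|y - x| < dl ->
   `|f y - f x| <= e) _.
  move=> x0 /=; rewrite in_itv /= => x0ab.
  have [d d0 Hd] := cf x0 x0ab _ e20.
  exists (ball x0 (d / 2), [set t : R | t < d / 2]) => /=.
    split; first by apply: nbhsx_ballx; rewrite divr_gt0.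
    by apply: nbhs_right_lt; rewrite divr_gt0.
  move=> [x dl] [/=]; rewrite -ball_normE /= => xx0 dld y xab yab yx.
  have -> : f y - f x = (f y - f x0) - (f x - f x0) by ring.
  apply: (le_trans (ler_normB _ _)); rewrite (splitr e) lerD // Hd //.
    have -> : y - x0 = (y - x) + (x - x0) by ring.
    by rewrite (le_lt_trans (ler_normD _ _)) // (splitr d) ltrD // ?(lt_trans yx) // distrC.
  by rewrite distrC (lt_trans xx0) // ltr_pdivrMr // ltr_pMr // ltr1n.
exists (dl / 2); first by rewrite divr_gt0.
have := H (dl / 2); rewrite /= sub0r normrN gtr0_norm ?divr_gt0 // => H'.
move=> x y xab yab yx; apply: H' => //.
by rewrite ltr_pdivrMr // ltr_pMr // ltr1n.
Qed.

Lemma econt_bounded a b f : econt a b f -> exists2 M, 0 <= M & forall x, a <= x <= b -> `|f x| <= M.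
Proof.
have [ab|ba] := leP a b; last first.
  by move=> _; exists 0 => // x /andP[ax xb]; move: (le_lt_trans (le_trans ax xb) ba); rewrite ltxx.
move=> cf; have cf' : {within `[a, b], continuous (fun x => `|f x|)}.
  apply/econt_within => x xab e e0; have [dl dl0 H] := cf x xab e e0; exists dl => // y yab yx.
  by apply: le_trans (H y yab yx); exact: ler_dist_dist.
have [c cab H] := EVT_max ab cf'; by exists `|f c| => // x xab; apply: H.
Qed.

Lemma ccont_bounded a b (F : R -> R[i]) : ccont a b F ->
  exists2 M, 0 <= M & forall x, a <= x <= b -> normc (F x) <= M.
Proof.
move=> [/econt_bounded [M1 M10 H1] /econt_bounded [M2 M20 H2]].
exists (M1 + M2); first exact: addr_ge0.
by move=> x xab; rewrite (le_trans (normc_le_ReIm _)) // lerD ?H1 ?H2.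
Qed.

(** One-sided at the endpoints. *)
Definition wdiff a b phi g := forall u, a <= u <= b -> forall e, 0 < e ->
  exists2 dl : R, 0 < dl & forall v, a <= v <= b -> `|v - u| < dl ->
    `|phi v - phi u - (v - u) * g u| <= e * `|v - u|.

Lemma wdiff_cst a b c : wdiff a b (fun=> c) (fun=> 0).
Proof.
move=> u _ e e0; exists 1 => // v _ _; rewrite mulr0 subr0 subrr normr0.
by rewrite mulr_ge0 // ltW.
Qed.

Lemma wdiffD a b phi psi g h : wdiff a b phi g -> wdiff a b psi h ->
  wdiff a b (fun x => phi x + psi x) (fun x => g x + h x).
Proof.
move=> d1 d2 u uab e e0; have e20 : 0 < e / 2 by rewrite divr_gt0.
have [k1 k10 H1] := d1 u uab _ e20; have [k2 k20 H2] := d2 u uab _ e20.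
exists (Num.min k1 k2); first by rewrite lt_min k10.
move=> v vab; rewrite lt_min => /andP[/(H1 _ vab) {}H1 /(H2 _ vab) {}H2].
have -> : phi v + psi v - (phi u + psi u) - (v - u) * (g u + h u) =
  (phi v - phi u - (v - u) * g u) + (psi v - psi u - (v - u) * h u) by ring.
have -> : e * `|v - u| = e / 2 * `|v - u| + e / 2 * `|v - u| by field.
by rewrite (le_trans (ler_normD _ _)) // lerD.
Qed.

Lemma wdiff_econt a b phi g : wdiff a b phi g -> econt a b phi.
Proof.
move=> dphi u uab e e0; have [k k0 H] := dphi u uab 1 ltr01.
have g0 : 0 < 1 + `|g u| by rewrite ltr_pwDl.
exists (Num.min k (e / (1 + `|g u|))); first by rewrite lt_min k0 divr_gt0.
move=> v vab; rewrite lt_min => /andP[/(H _ vab) {}H]; rewrite ltr_pdivlMr // => vu.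
have -> : phi v - phi u = (phi v - phi u - (v - u) * g u) + (v - u) * g u by ring.
rewrite (le_trans (ler_normD _ _)) // (le_trans _ (ltW vu)) // mulrDr mulr1 normrM lerD2r.
by rewrite -[X in _ <= X]mul1r.
Qed.

Lemma wdiffM a b phi psi g h : wdiff a b phi g -> wdiff a b psi h ->
  wdiff a b (fun x => phi x * psi x) (fun x => g x * psi x + phi x * h x).
Proof.
move=> d1 d2 u uab e e0.
pose N := 1 + `|psi u| + `|phi u| + `|g u|.
have N0 : 0 < N by rewrite /N; have := normr_ge0 (psi u); have := normr_ge0 (phi u); have := normr_ge0 (g u); lra.
have e1 : 0 < Num.min 1 (e / (3 * N)) by rewrite lt_min ltr01 divr_gt0 // mulr_gt0.
have [k1 k10 H1] := d1 u uab _ e1; have [k2 k20 H2] := d2 u uab _ e1.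
have [k3 k30 H3] := wdiff_econt d2 uab e1.
exists (Num.min (Num.min k1 k2) k3); first by rewrite !lt_min k10 k20.
move=> v vab; rewrite !lt_min => /andP[/andP[/(H1 _ vab) {}H1 /(H2 _ vab) {}H2] /(H3 _ vab) {}H3].
set e' := Num.min 1 (e / (3 * N)) in e1 H1 H2 H3.
have e'1 : e' <= 1 by rewrite ge_min lexx.
have e'N : e' * N <= e / 3.
  have : e' <= e / (3 * N) by rewrite ge_min lexx orbT.
  move=> /(ler_wpM2r (ltW N0)); move/le_trans; apply.
  by rewrite le_eqVlt; apply/orP; left; apply/eqP; field; rewrite gt_eqF.
have -> : phi v * psi v - phi u * psi u - (v - u) * (g u * psi u + phi u * h u) =
  (phi v - phi u - (v - u) * g u) * psi v + (phi u * (psi v - psi u - (v - u) * h u)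
   + (v - u) * (g u * (psi v - psi u))) by ring.
set w := `|v - u| in H1 H2 *; have w0 : 0 <= w by exact: normr_ge0.
have psiv : `|psi v| <= N.
  have -> : psi v = (psi v - psi u) + psi u by ring.
  rewrite (le_trans (ler_normD _ _)) // /N; move: H3 e'1 (normr_ge0 (phi u)) (normr_ge0 (g u)); lra.
have [pN gN] : `|phi u| <= N /\ `|g u| <= N.
  by rewrite /N; split; move: (normr_ge0 (phi u)) (normr_ge0 (g u)) (normr_ge0 (psi u)); lra.
have T : e' * N * w <= e / 3 * w by rewrite ler_wpM2r.
have B1 : `|(phi v - phi u - (v - u) * g u) * psi v| <= e / 3 * w.
  by rewrite normrM; apply: (le_trans (ler_pM _ _ H1 psiv)) => //; rewrite mulrAC.
have B2 : `|phi u * (psi v - psi u - (v - u) * h u)| <= e / 3 * w.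
  rewrite normrM; apply: (le_trans (ler_pM _ _ pN H2)) => //.
  by apply: le_trans T; rewrite mulrCA mulrA.
have B3 : `|(v - u) * (g u * (psi v - psi u))| <= e / 3 * w.
  rewrite !normrM -/w mulrC; apply: ler_wpM2r => //.
  apply: le_trans e'N; rewrite mulrC; apply: ler_pM => //.
have := ler_normD ((phi v - phi u - (v - u) * g u) * psi v) (phi u * (psi v - psi u - (v - u) * h u)
   + (v - u) * (g u * (psi v - psi u))).
have := ler_normD (phi u * (psi v - psi u - (v - u) * h u)) ((v - u) * (g u * (psi v - psi u))).
move: B1 B2 B3.
have -> : e * w = e / 3 * w + (e / 3 * w + e / 3 * w) by field.
move: (`|_|) (`|_|) (`|_|) => X1 X2 X3 h1 h2 h3 h4 h5.
apply: (le_trans h5); apply: lerD => //; apply: (le_trans h4); exact: lerD.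
Qed.

Lemma wdiffZ a b c phi g : wdiff a b phi g -> wdiff a b (fun x => c * phi x) (fun x => c * g x).
Proof.
move=> dphi; have := wdiffM (@wdiff_cst a b c) dphi.
by congr wdiff; apply/funext => x; rewrite mul0r add0r.
Qed.

Lemma wdiff_sum a b n (phi g : nat -> R -> R) : (forall i, (i < n)%N -> wdiff a b (phi i) (g i)) ->
  wdiff a b (fun x => \sum_(i < n) phi i x) (fun x => \sum_(i < n) g i x).
Proof.
elim: n => [|n IH] H.
  have := @wdiff_cst a b 0; congr wdiff; apply/funext => x; by rewrite big_ord0.
have := wdiffD (IH (fun i lin => H i (ltnW lin))) (H n (ltnSn n)).
by congr wdiff; apply/funext => x; rewrite big_ord_recr.
Qed.

Lemma wdiff_is_derive a b phi g u : wdiff a b phi g -> a < u < b -> is_derive u 1 phi (g u).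
Proof.
move=> dphi /andP[au ub].
have uab : a <= u <= b by rewrite !ltW.
have key : (fun h : R => h^-1 *: ((phi \o shift u) (h *: (1 : R)) - phi u)) @ 0^' --> g u.
  apply/cvgrPdist_le => e e0.
  have [dl dl0 H] := dphi u uab e e0.
  pose d := Num.min dl (Num.min (u - a) (b - u)).
  have d0 : 0 < d by rewrite !lt_min dl0 !subr_gt0 au.
  apply/(nbhs_ballP (0 : R)); exists d => // h; rewrite -ball_normE /ball_ /= sub0r normrN.
  rewrite !lt_min => /andP[hdl /andP[hua hbu]] h0.
  rewrite /shift /= /GRing.scale /= mulr1 distrC.
  have -> : h^-1 * (phi (h + u) - phi u) - g u = h^-1 * (phi (h + u) - phi u - (h + u - u) * g u).
    by rewrite addrK [in RHS]mulrBr mulrA mulVf // mul1r.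
  rewrite normrM normrV ?unitfE // mulrC ler_pdivrMr ?normr_gt0 //.
  have := H (h + u); rewrite !addrK; apply => //.
  by move: hua hbu; rewrite !ltr_norml; move=> /andP[? ?] /andP[? ?]; lra.
apply: DeriveDef; first by apply/cvg_ex; exists (g u).
by apply/cvg_lim => //; exact: Rhausdorff.
Qed.

Lemma wdiff_MVT a b phi g u v : wdiff a b phi g -> a <= u <= b -> a <= v <= b -> u <= v ->
  exists2 c, u <= c <= v & phi v - phi u = g c * (v - u).
Proof.
move=> dphi /andP[au ub] /andP[av vb] uv.
have [||c] := @MVT_segment R phi g u v uv.
- move=> x; rewrite in_itv /= => /andP[ux xv]; apply: wdiff_is_derive dphi _.
  by rewrite (le_lt_trans au ux) (lt_le_trans xv vb).
- by apply/econt_within; apply: econtW au vb _; exact: wdiff_econt dphi.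
by rewrite in_itv /= => cuv E; exists c.
Qed.

(** The mean value theorem makes the first-order expansion uniform once the
    derivative is continuous. *)
Lemma wdiff_unif a b phi g : wdiff a b phi g -> econt a b g -> forall e, 0 < e ->
  exists2 dl : R, 0 < dl & forall u v, a <= u <= b -> a <= v <= b -> `|v - u| < dl ->
    `|phi v - phi u - (v - u) * g u| <= e * `|v - u|.
Proof.
move=> dphi cg e e0; have [dl dl0 H] := econt_unif cg e0; exists dl => // u v uab vab vu.
have [uv|vu'] := leP u v.
  have [c /andP[uc cv] ->] := wdiff_MVT dphi uab vab uv.
  rewrite mulrC -mulrBr normrM mulrC ler_wpM2r //.
  case/andP: uab => au ub; case/andP: vab => av vb.
  apply: H => //; rewrite ?au ?(le_trans au uc) ?(le_trans cv vb) //.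
  by apply: le_lt_trans vu; rewrite !ger0_norm ?subr_ge0 // lerD2r.
have [c /andP[vc cu] E] := wdiff_MVT dphi vab uab (ltW vu').
have -> : phi v - phi u - (v - u) * g u = (v - u) * (g c - g u).
  have -> : phi v - phi u = - (phi u - phi v) by ring.
  by rewrite E; ring.
rewrite normrM mulrC ler_wpM2r //.
case/andP: uab => au ub; case/andP: vab => av vb.
apply: H => //; rewrite ?au ?(le_trans av vc) ?(le_trans cu ub) //.
by apply: le_lt_trans vu; rewrite !ler0_norm ?subr_le0 ?(ltW vu') // lerN2 lerD2r.
Qed.

(** The mean value inequality. *)
Lemma wdiff_le a b phi g c : wdiff a b phi g -> (forall x, a <= x <= b -> `|g x| <= c) ->
  forall u v, a <= u <= b -> a <= v <= b -> `|phi v - phi u| <= c * `|v - u|.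
Proof.
move=> dphi gc.
have H u v : a <= u <= b -> a <= v <= b -> u <= v -> `|phi v - phi u| <= c * `|v - u|.
  move=> uab vab uv; have [x /andP[ux xv] ->] := wdiff_MVT dphi uab vab uv.
  rewrite normrM ler_wpM2r // gc //.
  by case/andP: uab => au _; case/andP: vab => _ vb; rewrite (le_trans au ux) (le_trans xv vb).
move=> u v uab vab; have [uv|/ltW vu] := leP u v; first exact: H.
by rewrite distrC [`|v - u|]distrC; exact: H.
Qed.

Lemma wdiff_rint a b g : econt a b g -> wdiff a b (fun v => rint a v g) g.
Proof.
move=> cg.
have H u v e : a <= u -> u <= v -> v <= b -> forall x, a <= x <= b ->
    (forall y, u <= y <= v -> `|g y - g x| <= e) -> `|rint a v g - rint a u g - (v - u) * g x| <= e * (v - u).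
  move=> au uv vb x xab gx.
  rewrite (rint_split au uv (econtW (lexx a) vb cg)) [rint a u g + _]addrC addrK [(v - u) * _]mulrC -(rint_cst (g x) uv).
  have cuv := econtW au vb cg.
  rewrite -rintB //; last exact: econt_cst.
  by apply: ler_norm_rint => //; apply: econtB => //; exact: econt_cst.
move=> u uab e e0; have [dl dl0 Hd] := cg u uab e e0; exists dl => // v vab vu.
case/andP: (uab) => au ub; case/andP: (vab) => av vb.
have [uv|/ltW vu'] := leP u v.
  rewrite [`|v - u|]ger0_norm ?subr_ge0 //; apply: H => // y /andP[uy yv]; apply: Hd.
    by rewrite (le_trans au uy) (le_trans yv vb).
  by apply: le_lt_trans vu; rewrite !ger0_norm ?subr_ge0 // lerD2r.
have -> : rint a v g - rint a u g - (v - u) * g u = - (rint a u g - rint a v g - (u - v) * g u) by ring.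
rewrite normrN [`|v - u|]distrC [`|u - v|]ger0_norm ?subr_ge0 //; apply: H => // y /andP[vy yu]; apply: Hd.
  by rewrite (le_trans av vy) (le_trans yu ub).
by apply: le_lt_trans vu; rewrite !ler0_norm ?subr_le0 // lerN2 lerD2r.
Qed.

Lemma is_deriv_within_wdiff a b (F : R -> cplx R) (dF : R -> cplx R) :
  (forall t, a <= t <= b -> is_deriv_within a b F t (dF t)) ->
  wdiff a b (fun t => complex.Re (F t)) (fun t => complex.Re (dF t)) /\
  wdiff a b (fun t => complex.Im (F t)) (fun t => complex.Im (dF t)).
Proof.
move=> dFt.
have key u : a <= u <= b -> forall e : R, 0 < e -> exists2 dl : R, 0 < dl & forall v,
    a <= v <= b -> `|v - u| < dl -> normc (F v - F u - (v - u)%:C * dF u) <= e * `|v - u|.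
  move=> uab e e0; have /cvgrPdist_le /(_ e%:C) := dFt u uab; rewrite ltcR e0 => /(_ isT).
  rewrite /prop_near1 /within /= => -[dl /= dl0 H]; exists dl => // v vab vu.
  have [->|vneu] := eqVneq v u; first by rewrite !subrr mul0r subr0 normc0 normr0 mulr0.
  have := H v; rewrite /= distrC => /(_ vu vneu); rewrite in_itv /= => /(_ vab).
  rewrite normc_le normcB => Hv.
  have vu0 : (v - u)%:C != 0 :> R[i].
    by rewrite -normc_gt0 normc_real normr_gt0 subr_eq0.
  have -> : F v - F u - (v - u)%:C * dF u = (v - u)%:C * ((v - u)%:C^-1 * (F v - F u) - dF u) :> R[i].
    by rewrite mulrBr mulrA divff // mul1r.
  by rewrite normcM normc_real mulrC ler_wpM2r.
split=> u uab e e0; have [dl dl0 H] := key u uab e e0; exists dl => // v vab vu.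
  apply: le_trans (H v vab vu); rewrite (le_trans _ (normc_Re _)) //.
  by rewrite !ReD !ReN ReM /= mul0r subr0.
apply: le_trans (H v vab vu); rewrite (le_trans _ (normc_Im _)) //.
by rewrite !ImD !ImN ImM /= mul0r addr0.
Qed.

End within_derivatives.

(** * The cumulant-generating function in time *)

(** [condition_ii] with the logarithm [K], its derivative [dK] in time and the bound
    [B] made explicit. *)
Record cgf_data {R : realType} {d : measure_display} {Omega : measurableType d}
    (P : probability Omega R) (X : R -> Omega -> R) (a b rad : R)
    (K dK : R -> R -> cplx R -> cplx R -> cplx R) (B : R) : Prop := CgfData {
  cgf_ab : a < b;
  cgf_meas : forall u, a <= u <= b -> measurable_fun setT (X u);
  cgf_rad : 0 < rad;
  cgf_integrable : forall s t z w, s \in `[a, b] -> t \in `[a, b] ->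
    cdisk rad z -> cdisk rad w ->
    cintegrable P (cexp_lin (X s) (X t) z w) /\
    cexpectation P (cexp_lin (X s) (X t) z w) != 0;
  cgf_log : forall s t, s \in `[a, b] -> t \in `[a, b] ->
    is_holomorphic_log rad
      (fun z w => cexpectation P (cexp_lin (X s) (X t) z w)) (K s t);
  cgf_deriv : forall s t z w, s \in `[a, b] -> t \in `[a, b] ->
    cdisk rad z -> cdisk rad w ->
    is_deriv_within a b (fun v => K s v z w) t (dK s t z w);
  cgf_cont : {within `[a, b] `*` `[a, b] `*` cdisk rad `*` cdisk rad,
    continuous (fun q : R * R * cplx R * cplx R => dK q.1.1.1 q.1.1.2 q.1.2 q.2)};
  cgf_bound : forall s t z w, s \in `[a, b] -> t \in `[a, b] ->
    cdisk rad z -> cdisk rad w -> `|dK s t z w| <= B%:C }.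

Section log_mgf.
Context {R : realType} {d : measure_display} {Omega : measurableType d}.
Variable P : probability Omega R.
Local Notation nR := (@Num.norm R R : R -> R).
Local Notation nC := (@normc R).

Definition cmgf (X : R -> Omega -> R) u (th : R[i]) : R[i] :=
  cexpectation P (fun o => (1 : R)%:C * cexp (th * (X u o)%:C)).

Definition cmgf2 (X : R -> Omega -> R) u v (z w : R[i]) : R[i] :=
  cexpectation P (cexp_lin (X u) (X v) z w).

Variables (X : R -> Omega -> R) (a b rad : R).
Variables (K dK : R -> R -> cplx R -> cplx R -> cplx R) (B : R).
Hypothesis H : cgf_data P X a b rad K dK B.

Local Notation cmX := (cmgf X).
Local Notation cmX2 := (cmgf2 X).
Let ab := cgf_ab H.
Let mX := cgf_meas H.
Let rad0 := cgf_rad H.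
Let hI := cgf_integrable H.
Let hK := cgf_log H.
Let hdK := cgf_deriv H.
Let hcont := cgf_cont H.

Let inab s : (s \in `[a, b]) = (a <= s <= b). Proof. by rewrite in_itv. Qed.

Lemma cdiskE (z : R[i]) : normc z < rad -> cdisk rad z.
Proof. by move=> zr; rewrite /cdisk /= normc_lt. Qed.

Lemma integ_exp_real s t z w : a <= s <= b -> a <= t <= b -> `|z| < rad -> `|w| < rad ->
  integ P (fun o => expR (z * X s o + w * X t o)).
Proof.
move=> sab tab zr wr; have [||||[i1 _] _] := @hI s t z%:C w%:C; rewrite ?inab //.
- by apply: cdiskE; rewrite normc_real.
- by apply: cdiskE; rewrite normc_real.
have E o : complex.Re (cexp_lin (X s) (X t) z%:C w%:C o) = expR (z * X s o + w * X t o).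
  rewrite /cexp_lin (_ : _ + _ = (z * X s o + w * X t o)%:C); last by rewrite rmorphD !rmorphM.
  by rewrite cexp_real.
by apply: eq_integrable i1 => // o _; rewrite E.
Qed.

Lemma integ_exp s t al be : a <= s <= b -> a <= t <= b -> 0 <= al < rad -> 0 <= be < rad ->
  integ P (fun o => expR (al * `|X s o| + be * `|X t o|)).
Proof.
move=> sab tab /andP[al0 alr] /andP[be0 ber].
have [alr' ber'] : `|al| < rad /\ `|be| < rad by rewrite !ger0_norm.
have i1 := integ_exp_real sab tab alr' ber'.
rewrite -normrN in alr'; have i2 := integ_exp_real sab tab alr' ber'.
rewrite -normrN in ber'; have i3 := integ_exp_real sab tab alr' ber'.
rewrite normrN in alr'; have i4 := integ_exp_real sab tab alr' ber'.
apply: integ_le (integD (integD i1 i2) (integD i3 i4)).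
  apply: measurableT_comp => //; apply: measurable_funD; apply: measurable_funM;
    by [exact: measurable_cst|apply: measurableT_comp => //; exact: mX].
move=> o; rewrite gtr0_norm ?expR_gt0 //.
have e1 := expR_ge0 (al * X s o + be * X t o); have e2 := expR_ge0 (- al * X s o + be * X t o).
have e3 := expR_ge0 (- al * X s o + - be * X t o); have e4 := expR_ge0 (al * X s o + - be * X t o).
move: e1 e2 e3 e4.
have absE (x : R) : `|x| = x \/ `|x| = - x by case: (lerP 0 x) => h; [left; rewrite ger0_norm|right; rewrite ler0_norm // ltW].
have NE (c x : R) : c * - x = - c * x by rewrite mulrN mulNr.
by case: (absE (X s o)) => ->; case: (absE (X t o)) => ->; rewrite ?NE; lra.
Qed.

Lemma cmgf2_diag u th w : cmX2 u u (th - w) w = cmX u th.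
Proof.
congr cexpectation; apply/funext => o; rewrite /cexp_lin mul1r; congr cexp.
by rewrite -mulrDl subrK.
Qed.

Lemma cmgf2_0l u v th : cmX2 u v 0 th = cmX v th.
Proof.
congr cexpectation; apply/funext => o; rewrite /cexp_lin mul1r; congr cexp.
by rewrite mul0r add0r.
Qed.

Let m1 : measurable_fun setT ((fun=> 1) : Omega -> R).
Proof. exact: measurable_cst. Qed.

Lemma integ_expX u rho : a <= u <= b -> 0 <= rho < rad -> integ P (fun o => expR (rho * `|X u o|)).
Proof.
move=> uab rr; have z0 : 0 <= (0 : R) < rad by rewrite lexx.
have := integ_exp uab uab rr z0; apply: eq_integrable => // o _ /=.
by rewrite mul0r addr0.
Qed.

Lemma integ_expX1 u rho : a <= u <= b -> 0 <= rho < rad ->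
  integ P (fun o => `|1 : R| * expR (rho * `|X u o|)).
Proof.
move=> uab rr; have := integ_expX uab rr; apply: eq_integrable => // o _ /=.
by rewrite normr1 mul1r.
Qed.

(** Use [k * |y| <= exp (k * |y|)] with [k] so small that the exponential rates remain
    below [rad]. *)
Lemma integ_incr_exp u v rho : a <= u <= b -> a <= v <= b -> 0 <= rho < rad ->
  integ P (fun o => `|X v o - X u o| * expR (rho * `|X u o|)).
Proof.
move=> uab vab /andP[r0 rr]; pose k := (rad - rho) / 2.
have k0 : 0 < k by rewrite divr_gt0 // subr_gt0.
have kr : k < rad by rewrite /k; lra.
have rk : rho + k < rad by rewrite /k; lra.
have h1 : 0 <= rho + k < rad by rewrite rk andbT addr_ge0 // ltW.
have h2 : 0 <= k < rad by rewrite kr andbT ltW.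
apply: (@integ_le _ _ _ P _ _ _ _ (integZ k^-1 (integ_exp uab vab h1 h2))).
  apply: measurable_funM.
    by apply: measurableT_comp => //; apply: measurable_funB; exact: mX.
  apply: measurableT_comp => //; apply: measurable_funM; first exact: measurable_cst.
  by apply: measurableT_comp => //; exact: mX.
move=> o; rewrite normrM normr_id [`|expR _|]gtr0_norm ?expR_gt0 //.
have -> : expR ((rho + k) * `|X u o| + k * `|X v o|) =
    expR (rho * `|X u o|) * expR (k * (`|X v o| + `|X u o|)).
  by rewrite -expRD; congr expR; ring.
rewrite mulrCA [X in X <= _]mulrC; apply: ler_wpM2l; first exact: expR_ge0.
rewrite ler_pdivlMl //; set z := k * (_ + _); apply: (@le_trans _ _ z).
  by rewrite /z ler_pM2l // ler_normB.
by rewrite (le_trans _ (expR_ge1Dx z)) // lerDr.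
Qed.

Lemma cmgf_ps u th : a <= u <= b -> normc th < rad ->
  ps_to nC (fun n => (mom1 P (X u) n)%:C) th (cmX u th).
Proof.
move=> uab tr; pose rho := (normc th + rad) / 2.
have n0 := normc_ge0 th.
have r0 : 0 < rho by rewrite divr_gt0 // ltr_wpDl.
have rr : 0 <= rho < rad by rewrite ltW //= /rho; lra.
by apply: (cmoment_series m1 (mX uab) r0 (integ_expX1 uab rr)); rewrite /rho; lra.
Qed.

Lemma sbnd_mom1 u rho : a <= u <= b -> 0 < rho -> rho < rad ->
  exists S, sbnd nR rho (mom1 P (X u)) S.
Proof.
move=> uab r0 rr; eexists; apply: (sbnd_mom m1 (mX uab) r0).
by apply: integ_expX1 => //; rewrite ltW.
Qed.

Lemma cmgf_neq0 u th : a <= u <= b -> normc th < rad -> cmX u th != 0.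
Proof.
move=> uab tr; rewrite -(cmgf2_0l u u); have [||||_] := @hI u u 0 th; rewrite ?inab //.
- by apply: cdiskE; rewrite normc0.
- exact: cdiskE.
Qed.

Lemma sbnd_realC rho (c : nat -> R) S : sbnd nR rho c S -> sbnd nC rho (fun n => (c n)%:C) S.
Proof. by move=> cS n; apply: le_trans (cS n); apply: ler_sum => i _; rewrite normc_real. Qed.

Lemma conv_realC (c c' : nat -> R) : conv (fun n => (c n)%:C : R[i]) (fun n => (c' n)%:C) = (fun n => (conv c c' n)%:C).
Proof.
apply/funext => n; rewrite /conv rmorph_sum; apply: eq_bigr => i _.
by rewrite rmorphM.
Qed.

Lemma geom_sbnd (c : nat -> R) rho rho' S : 0 <= rho -> rho < rho' -> 0 <= S ->
  (forall n, `|c n| * rho' ^+ n <= S) -> forall n, \sum_(i < n) `|c i| * rho ^+ i <= S / (1 - rho / rho').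
Proof.
move=> r0 rr S0 cS n; have r'0 : 0 < rho' by exact: le_lt_trans r0 rr.
set t := rho / rho'; have t0 : 0 <= t by rewrite divr_ge0 // ltW.
have t1 : t < 1 by rewrite ltr_pdivrMr // mul1r.
apply: (@le_trans _ _ (\sum_(i < n) S * t ^+ i)).
  apply: ler_sum => i _; have -> : rho = t * rho' by rewrite /t divfK // gt_eqF.
  by rewrite exprMn mulrCA mulrC; apply: ler_wpM2r; [exact: exprn_ge0|exact: cS].
rewrite -mulr_sumr ler_wpM2l // -[X in _ <= X]mul1r ler_pdivlMr ?subr_gt0 //.
rewrite mulrC; elim: n => [|n IH]; first by rewrite big_ord0 mulr0.
rewrite big_ord_recl expr0; under eq_bigr do rewrite /= exprS.
rewrite -mulr_sumr mulrDr mulr1 mulrCA.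
have : t * ((1 - t) * \sum_(i < n) t ^+ i) <= t by rewrite ler_piMr.
by move=> h; move: h; lra.
Qed.

(** Since [cmgf] does not vanish, [exp (- K)] is its holomorphic inverse on the whole
    disc, and its Taylor series is the formal inverse. *)
Lemma finv_mom1_sbnd u rho : a <= u <= b -> 0 < rho -> rho < rad ->
  exists2 S, sbnd nR rho (finv (mom1 P (X u))) S &
  forall th, normc th <= rho -> ps_to nC (fun n => (finv (mom1 P (X u)) n)%:C) th (cmX u th)^-1.
Proof.
move=> uab r0 rr; pose rho' := (rho + rad) / 2.
have rr' : rho < rho' by rewrite /rho'; lra.
have r'r : rho' < rad by rewrite /rho'; lra.
have r'0 : 0 < rho' by exact: lt_trans r0 rr'.
pose g (z : R[i]) : R[i] := cexp (- K u u z 0).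
have d0 : cdisk rad (0 : R[i]) by apply: cdiskE; rewrite normc0.
have [hd he _] := hK (etrans (inab u) uab) (etrans (inab u) uab).
have gE z : normc z < rad -> g z = (cmX u z)^-1.
  move=> zr; rewrite /g cexpN he //; last exact: cdiskE.
  by congr (_^-1); have := cmgf2_diag u z 0; rewrite subr0.
have hg z : normc z < rad -> exists l, cdiff g z l.
  move=> zr; have hKz : exists l, cdiff (fun z => K u u z 0) z l.
    apply/cdiffP/derivable1_diffP.
    have D1 := hd z 0 (cdiskE zr) d0.
    pose z' : cplx R := z.
    have D2 : differentiable (fun z : cplx R => (z, 0 : cplx R)) z'.
      by apply: differentiable_pair => //; exact: differentiable_cst.
    exact: (@differentiable_comp _ _ _ _ (fun z : cplx R => (z, 0 : cplx R))
      (fun q : cplx R * cplx R => K u u q.1 q.2) z D2 D1).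
  have [l dl] : hol (fun z => 0 - K u u z 0) z by apply: holB => //; exact: hol_cst.
  exists (cexp (0 - K u u z 0) * l).
  have -> : g = (fun z => cexp (0 - K u u z 0)) by apply/funext => y; rewrite /g sub0r.
  by apply: cdiff_comp dl _; exact: cexp_cdiff.
have er : expR (ln rho') = rho' by rewrite lnK.
have [S S0 hS] : exists2 S, 0 <= S & forall y, 0 <= y <= 2 * pi -> normc (g (cexp (ln rho' +i* y))) <= S.
  apply: (@ccont_bounded _ 0 (2 * pi) (fun y => g (cexp (ln rho' +i* y)))); apply: ccont_circle => z; rewrite er => zr.
  by apply: hol_cont; apply: hg; rewrite zr.
have [cS cP] := taylor_disc hg r'0 r'r hS.
set c := circ_coef g rho' in cS cP.
have cP' z : normc z <= rho -> ps_to nC c z (cmX u z)^-1.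
  by move=> zr; rewrite -gE ?(le_lt_trans zr) // ; apply: cP; exact: le_lt_trans zr rr'.
have S20 : 0 <= 2 * S by rewrite mulr_ge0.
have ReS n : `|complex.Re (c n)| * rho' ^+ n <= 2 * S.
  by apply: le_trans (cS n); rewrite ler_wpM2r ?exprn_ge0 ?(ltW r'0) // normc_Re.
have cB := geom_sbnd (ltW r0) rr' S20 ReS.
have cBC : sbnd nC rho c (2 * S / (1 - rho / rho')).
  have cS' n : `|normc (c n)| * rho' ^+ n <= 2 * S by rewrite ger0_norm ?normc_ge0.
  move=> n; apply: le_trans (geom_sbnd (ltW r0) rr' S20 cS' n).
  by apply: ler_sum => i _; rewrite [`|normc _|]ger0_norm ?normc_ge0.
have [T mT] := sbnd_mom1 uab r0 rr.
have cm : conv c (fun n => (mom1 P (X u) n)%:C) = delta0.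
  apply: (@psC_unique R rho _ _ (fun=> 1)) => // x x0 xr.
    have xr' : normc (x%:C : R[i]) <= rho by rewrite normc_real gtr0_norm // ltW.
    have := ps_toM absval_normc xr' cBC (sbnd_realC mT) (cP' _ xr') (cmgf_ps uab (le_lt_trans xr' rr)).
    by rewrite mulVf // cmgf_neq0 // (le_lt_trans xr').
  exact: (ps_to_delta absval_normc).
have m0 := mom1_0 P (X u).
(* formal inverses are unique *)
have cf : c = fun n => (finv (mom1 P (X u)) n)%:C.
  apply: (@conv_inj _ (fun n => (mom1 P (X u) n)%:C)); first by rewrite m0.
  rewrite cm conv_realC [conv _ (mom1 _ _)]convC (conv_finv m0).
  by apply/funext => n; rewrite /delta0 rmorph_nat.
exists (2 * S / (1 - rho / rho')).
  move=> n; apply: le_trans (cB n); apply: ler_sum => i _.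
  by rewrite cf.
by move=> z zr; rewrite -cf; exact: cP'.
Qed.

(** The mean value inequality, applied to the real and the imaginary part. *)
Lemma K_mvt u v z w l e : a <= u <= b -> a <= v <= b -> normc z < rad -> normc w < rad ->
  (forall r, a <= r <= b -> `|r - u| <= `|v - u| -> normc (dK u r z w - l) <= e) ->
  normc (K u v z w - K u u z w - (v - u)%:C * l) <= 2 * e * `|v - u|.
Proof.
move=> uab vab zr wr hr.
have [d1 d2] := @is_deriv_within_wdiff R a b (fun v => K u v z w) (fun v => dK u v z w)
  (fun t tab => hdK (etrans (inab u) uab) (etrans (inab t) tab) (cdiskE zr) (cdiskE wr)).
have key (phi g : R -> R) lx : wdiff a b phi g ->
    (forall r, a <= r <= b -> `|r - u| <= `|v - u| -> `|g r - lx| <= e) ->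
    `|phi v - phi u - (v - u) * lx| <= e * `|v - u|.
  move=> dphi gl; have [uv|/ltW vu] := leP u v.
    have [c /andP[uc cv] ->] := wdiff_MVT dphi uab vab uv.
    rewrite mulrC -mulrBr normrM mulrC ler_wpM2r // gl //.
      by case/andP: uab => au _; case/andP: vab => _ vb; rewrite (le_trans au uc) (le_trans cv vb).
    by rewrite !ger0_norm ?subr_ge0 // lerD2r.
  have [c /andP[vc cu] E] := wdiff_MVT dphi vab uab vu.
  have -> : phi v - phi u = - (phi u - phi v) by ring.
  rewrite E; have -> : - (g c * (u - v)) - (v - u) * lx = (v - u) * (g c - lx) by ring.
  rewrite normrM mulrC ler_wpM2r // gl //.
    by case/andP: uab => _ ub; case/andP: vab => av _; rewrite (le_trans av vc) (le_trans cu ub).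
  by rewrite !ler0_norm ?subr_le0 // lerN2 lerD2r.
apply: (le_trans (normc_le_ReIm _)).
have -> : 2 * e * `|v - u| = e * `|v - u| + e * `|v - u| by ring.
apply: lerD.
  rewrite !ReD !ReN ReM /= mul0r subr0; apply: (key _ _ _ d1) => r rab ru.
  by rewrite -ReN -ReD (le_trans (normc_Re _)) // hr.
rewrite !ImD !ImN ImM /= mul0r addr0; apply: (key _ _ _ d2) => r rab ru.
by rewrite -ImN -ImD (le_trans (normc_Im _)) // hr.
Qed.

Lemma dK_cont s t (z w : R[i]) e : a <= s <= b -> a <= t <= b -> normc z < rad -> normc w < rad ->
  0 < e -> exists2 dl : R, 0 < dl & forall s' t' z' w', a <= s' <= b -> a <= t' <= b ->
    normc z' < rad -> normc w' < rad -> `|s' - s| < dl -> `|t' - t| < dl ->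
    normc (z' - z) < dl -> normc (w' - w) < dl -> normc (dK s' t' z' w' - dK s t z w) <= e.
Proof.
move=> sab tab zr wr e0; have := hcont; rewrite subspace_continuousP.
have dom : (`[a, b] `*` `[a, b] `*` cdisk rad `*` cdisk rad) (s, t, z, w).
  by split => /=; [split => /=; [split => /=; rewrite inab|exact: cdiskE]|exact: cdiskE].
move=> /(_ _ dom) /cvgrPdist_le /(_ e%:C); rewrite ltcR e0 => /(_ isT).
rewrite /prop_near1 /within /=.
move=> [[U4 V4] [/= [[U3 V3] [/= [[U2 V2] [/= HU2 HV2] H2] HV3] H3] HV4] H4].
have [d1 /= d10 D1] := (nbhs_ballP s U2).1 HU2.
have [d2 /= d20 D2] := (nbhs_ballP t V2).1 HV2.
have [d3 /= d30 D3] := (nbhs_ballP (z : cplx R) V3).1 HV3.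
have [d4 /= d40 D4] := (nbhs_ballP (w : cplx R) V4).1 HV4.
have [d30' d3E] := complex_gt0 d30; have [d40' d4E] := complex_gt0 d40.
exists (Num.min (Num.min d1 d2) (Num.min (complex.Re d3) (complex.Re d4))).
  by rewrite !lt_min d10 d20 d30' d40'.
move=> s' t' z' w' sab' tab' zr' wr'; rewrite !lt_min.
move=> /andP[/andP[h1 _] _] /andP[/andP[_ h2] _] /andP[_ /andP[h3 _]] /andP[_ /andP[_ h4]].
rewrite -normcN opprB -normc_le.
apply: (H4 (s', t', z', w')).
  split => /=; last by apply: D4; rewrite -ball_normE /= d4E normc_lt -normcN opprB.
  apply: H3; split => /=; last by apply: D3; rewrite -ball_normE /= d3E normc_lt -normcN opprB.
  by apply: H2; split => /=; [apply: D1|apply: D2]; rewrite -ball_normE /= distrC.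
by split => /=; [split => /=; [split => /=; rewrite inab|exact: cdiskE]|exact: cdiskE].
Qed.

End log_mgf.

Section box_uniformity.
Context {R : realType}.
Implicit Types (a b c d e : R).

(** Compactness of [[a, b] * [a, b] * [c, d]]. *)
Lemma box_unif a b c d (q : R -> R -> R -> R[i]) :
  (forall u r y, a <= u <= b -> a <= r <= b -> c <= y <= d -> forall e, 0 < e ->
    exists2 dl : R, 0 < dl & forall u' r' y', a <= u' <= b -> a <= r' <= b -> c <= y' <= d ->
      `|u' - u| < dl -> `|r' - r| < dl -> `|y' - y| < dl -> normc (q u' r' y' - q u r y) <= e) ->
  forall e, 0 < e -> exists2 dl : R, 0 < dl & forall u r u' r' y,
    a <= u <= b -> a <= r <= b -> a <= u' <= b -> a <= r' <= b -> c <= y <= d ->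
    `|u' - u| < dl -> `|r' - r| < dl -> normc (q u' r' y - q u r y) <= e.
Proof.
move=> cq e e0.
have /compact_near_coveringP nc : compact (`[a, b] `*` `[a, b] `*` `[c, d] : set (R * R * R)).
  by apply: compact_setX; [apply: compact_setX|]; exact: segment_compact.
have e20 : 0 < e / 2 by rewrite divr_gt0.
have [|dl /= dl0 H] := @nc _ (0 : R)^'+ (fun dl p => forall u' r', a <= p.1.1 <= b -> a <= p.1.2 <= b ->
    c <= p.2 <= d -> a <= u' <= b -> a <= r' <= b ->
    `|u' - p.1.1| < dl -> `|r' - p.1.2| < dl -> normc (q u' r' p.2 - q p.1.1 p.1.2 p.2) <= e) _ _.
  move=> [[u r] y] /= [[]]; rewrite /= !in_itv /= => uab rab ycd.
  have [k k0 Hk] := cq u r y uab rab ycd _ e20.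
  have k20 : 0 < k / 2 by rewrite divr_gt0.
  exists (ball ((u, r), y) (k / 2), [set dl : R | 0 < dl < k / 2]).
    split => /=; first exact: nbhsx_ballx.
    by exists (k / 2) => //= z /=; rewrite sub0r normrN => zk z0; rewrite z0 /= (le_lt_trans (ler_norm z)).
  move=> [[[u1 r1] y1] dl] /= [[[b1 b2] b3] /andP[dl0 dlk]] u' r' u1ab r1ab y1cd u'ab r'ab h1 h2.
  move: b1 b2 b3; rewrite /ball /= => b1 b2 b3.
  have hk x : x < k / 2 -> x < k by move=> xk; rewrite (lt_trans xk) // ltr_pdivrMr // ltr_pMr // ltr1n.
  have tri (x x1 x' : R) : `|x - x1| < k / 2 -> `|x' - x1| < dl -> `|x' - x| < k.
    move=> t1 t2; have -> : x' - x = (x' - x1) - (x - x1) by ring.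
    by rewrite (le_lt_trans (ler_normB _ _)) // [ltRHS]splitr ltrD // (lt_trans t2).
  have H1 := Hk _ _ _ u'ab r'ab y1cd (tri _ _ _ b1 h1) (tri _ _ _ b2 h2).
  have H2 := Hk _ _ _ u1ab r1ab y1cd.
  rewrite ![`|_ - u|]distrC ![`|_ - r|]distrC ![`|_ - y|]distrC in H1 H2.
  have {}H1 := H1 (hk _ b3); have {}H2 := H2 (hk _ b1) (hk _ b2) (hk _ b3).
  have -> : q u' r' y1 - q u1 r1 y1 = (q u' r' y1 - q u r y) - (q u1 r1 y1 - q u r y) by ring.
  by rewrite (le_trans (ler_normcB _ _)) // [leRHS]splitr lerD.
have dl20 : 0 < dl / 2 by rewrite divr_gt0.
exists (dl / 2) => // u r u' r' y uab rab u'ab r'ab ycd h1 h2.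
have hd : `|0 - dl / 2| < dl.
  by rewrite sub0r normrN gtr0_norm // ltr_pdivrMr // ltr_pMr // ltr1n.
have hm : (`[a, b] `*` `[a, b] `*` `[c, d]) ((u, r), y) by split; [split|]; rewrite /= in_itv.
exact: (H _ hd dl20 _ hm).
Qed.

End box_uniformity.

(** * First-order expansion of the two-time generating function *)

Section complex_expectations.
Context {R : realType} {d : measure_display} {Omega : measurableType d}.
Variable P : probability Omega R.
Implicit Types (F G : Omega -> R[i]) (z : R[i]).

Lemma cEXE F : cexpectation P F =
  EX P (fun o => complex.Re (F o)) +i* EX P (fun o => complex.Im (F o)).
Proof. by []. Qed.

Lemma cintegrableB F G : cintegrable P F -> cintegrable P G -> cintegrable P (fun o => F o - G o).
Proof.
move=> [f1 f2] [g1 g2]; split.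
  apply: eq_integrable (@integB _ _ _ P _ _ f1 g1) => // o _.
  by rewrite /= ReD ReN.
apply: eq_integrable (@integB _ _ _ P _ _ f2 g2) => // o _.
by rewrite /= ImD ImN.
Qed.

Lemma cEXB F G : cintegrable P F -> cintegrable P G ->
  cexpectation P (fun o => F o - G o) = cexpectation P F - cexpectation P G.
Proof.
move=> [f1 f2] [g1 g2]; rewrite !cEXE.
under eq_EX do rewrite ReD ReN; under [X in _ +i* X]eq_EX do rewrite ImD ImN.
by rewrite (EXB f1 g1) (EXB f2 g2).
Qed.

Lemma cintegrableZ (k : R) F : cintegrable P F -> cintegrable P (fun o => k%:C * F o).
Proof.
move=> [f1 f2]; split.
  apply: eq_integrable (@integZ _ _ _ P k _ f1) => // o _.
  by rewrite /= ReM /= mul0r subr0.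
apply: eq_integrable (@integZ _ _ _ P k _ f2) => // o _.
by rewrite /= ImM /= mul0r addr0.
Qed.

Lemma cEXZ (k : R) F : cintegrable P F ->
  cexpectation P (fun o => k%:C * F o) = k%:C * cexpectation P F.
Proof.
move=> [f1 f2]; rewrite !cEXE.
under eq_EX do rewrite ReM /= mul0r subr0.
under [X in _ +i* X]eq_EX do rewrite ImM /= mul0r addr0.
rewrite (EXZ k f1) (EXZ k f2); apply/eqP; rewrite eq_complex ReM ImM /=.
by rewrite !mul0r subr0 addr0 !eqxx.
Qed.

Lemma normc_cEX F (G : Omega -> R) : cintegrable P F -> integ P G ->
  (forall o, normc (F o) <= G o) -> normc (cexpectation P F) <= 2 * EX P G.
Proof.
move=> [f1 f2] iG FG; rewrite cEXE (le_trans (normc_le_ReIm _)) //= mulrDl mul1r lerD //.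
  by apply: EX_abs_le => // o; rewrite (le_trans (normc_Re _)).
by apply: EX_abs_le => // o; rewrite (le_trans (normc_Im _)).
Qed.

End complex_expectations.

Section circle_paths.
Context {R : realType}.
Local Notation nC := (@normc R).

(** The point of argument [y] on the circle of radius [rho], in the form to which
    [circint] applies. *)
Definition circ (rho y : R) : R[i] := cexp (ln rho +i* y).

Lemma normc_circ rho y : 0 < rho -> normc (circ rho y) = rho.
Proof. by move=> r0; rewrite normc_cexp lnK. Qed.

Lemma circ_cont (rho y e : R) : 0 < e -> exists2 dl : R, 0 < dl & forall y', `|y' - y| < dl ->
  normc (circ rho y' - circ rho y) <= e.
Proof.
move=> e0; have cc : ccont_at (@cexp R) (ln rho +i* y).
  by apply: hol_cont; exists (cexp (ln rho +i* y)); exact: cexp_cdiff.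
have [dl dl0 H] := cc e e0; exists dl => // y' yy.
have := H (0 +i* (y' - y)); rewrite /normc expr0n add0r sqrtr_sqr => /(_ yy).
by have -> : (ln rho +i* y + 0 +i* (y' - y) : R[i]) = ln rho +i* y'
  by apply/eqP; rewrite eq_complex /= addr0 addrC subrK !eqxx.
Qed.

Lemma circ0 rho : 0 < rho -> circ rho 0 = rho%:C.
Proof. by move=> r0; rewrite /circ -[LHS]/(cexp (ln rho)%:C) cexp_real lnK. Qed.

Lemma circpi rho : 0 < rho -> circ rho pi = (- rho)%:C.
Proof.
move=> r0; rewrite /circ cexpE /= lnK // cospi sinpi mulrN1 mulr0.
by [].
Qed.

Lemma ps_le (a : nat -> R[i]) (z l : R[i]) rho S : sbnd nC rho a S -> normc z <= rho ->
  ps_to nC a z l -> normc l <= S.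
Proof.
move=> aS zr al; apply: (slim_le absval_normc al) => n.
rewrite (le_trans (normc_sum _)) //; apply: le_trans (aS n).
apply: ler_sum => i _; rewrite normcM normcX ler_wpM2l ?normc_ge0 //.
by rewrite lerXn2r ?nnegrE ?normc_ge0 // (le_trans (normc_ge0 z)).
Qed.

End circle_paths.

Section increments.
Context {R : realType} {d : measure_display} {Omega : measurableType d}.
Variable P : probability Omega R.
Local Notation nR := (@Num.norm R R : R -> R).
Local Notation nC := (@normc R).
Variables (X : R -> Omega -> R) (a b rad : R).
Variables (K dK : R -> R -> cplx R -> cplx R -> cplx R) (B : R).
Hypothesis H : cgf_data P X a b rad K dK B.
Let ab := cgf_ab H.
Let mX := cgf_meas H.
Let inab s : (s \in `[a, b]) = (a <= s <= b). Proof. by rewrite in_itv. Qed.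

Lemma normc_dK u v (z w : R[i]) : a <= u <= b -> a <= v <= b -> normc z < rad -> normc w < rad ->
  normc (dK u v z w) <= B.
Proof.
by move=> uab vab zr wr; rewrite -normc_le; apply: (cgf_bound H); rewrite ?inab //; exact: cdiskE.
Qed.

Lemma cgf_B_ge0 : 0 <= B.
Proof.
have aab : a <= a <= b by rewrite lexx ltW.
have r0 := cgf_rad H.
by apply: le_trans (normc_ge0 _) (normc_dK (z := 0) (w := 0) aab aab _ _); rewrite normc0.
Qed.

Lemma cmgf2_K u v (z w : R[i]) : a <= u <= b -> a <= v <= b -> normc z < rad -> normc w < rad ->
  cmgf2 P X u v z w = cexp (K u v z w).
Proof.
move=> uab vab zr wr; have [_ -> //] := cgf_log H (etrans (inab u) uab) (etrans (inab v) vab);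
  exact: cdiskE.
Qed.

(** [cmgf u / cmgf a = exp (K u - K a)], where the exponent is bounded by the mean
    value inequality. *)
Lemma cmgf_bounds rho : 0 < rho -> rho < rad -> exists2 M, 0 < M & forall u th,
  a <= u <= b -> normc th <= rho -> normc (cmgf P X u th) <= M /\ normc (cmgf P X u th)^-1 <= M.
Proof.
move=> r0 rr; have aab : a <= a <= b by rewrite lexx ltW.
have [S1 h1] := sbnd_mom1 H aab r0 rr; have [S2 h2 h3] := finv_mom1_sbnd H aab r0 rr.
have S10 := sbnd_ge0 h1; have S20 := sbnd_ge0 h2.
have B0 := cgf_B_ge0.
set E := expR (2 * B * (b - a)); have E0 : 0 < E by exact: expR_gt0.
exists ((S1 + S2 + 1) * E); first by rewrite mulr_gt0 // ltr_wpDl // addr_ge0.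
move=> u th uab tr; have tr' := le_lt_trans tr rr.
have z0 : normc (0 : R[i]) < rad by rewrite normc0 (cgf_rad H).
pose k := K a u 0 th - K a a 0 th.
have nk : normc k <= 2 * B * (b - a).
  have hr r : a <= r <= b -> `|r - a| <= `|u - a| -> normc (dK a r 0 th - 0) <= B.
    by move=> rab _; rewrite subr0; exact: normc_dK.
  have := K_mvt H aab uab z0 tr' hr; rewrite mulr0 subr0 => /le_trans; apply.
  case/andP: uab => au ub; rewrite ger0_norm ?subr_ge0 //.
  by rewrite ler_wpM2l ?mulr_ge0 // lerD2r.
have mE : cmgf P X u th = cmgf P X a th * cexp k.
  rewrite -(cmgf2_0l P X a u) -(cmgf2_0l P X a a) !cmgf2_K // -cexpD /k.
  by congr cexp; rewrite addrC subrK.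
have [nk1 nk2] : normc (cexp k) <= E /\ normc (cexp k)^-1 <= E.
  rewrite -cexpN !normc_cexp !ler_expR ReN; split.
    by rewrite (le_trans (ler_norm _)) // (le_trans (normc_Re _)).
  by rewrite (le_trans (ler_norm _)) // normrN (le_trans (normc_Re _)).
have n1 : normc (cmgf P X a th) <= S1 := ps_le (sbnd_realC h1) tr (cmgf_ps H aab tr').
have n2 : normc (cmgf P X a th)^-1 <= S2 := ps_le (sbnd_realC h2) tr (h3 _ tr).
split; rewrite mE; first rewrite normcM ler_pM ?normc_ge0 //.
  by rewrite (le_trans n1) // -addrA lerDl addr_ge0.
rewrite [X in normc X](invfM (cmgf P X a th) (cexp k)) normcM ler_pM ?normc_ge0 //.
by rewrite (le_trans n2) // addrAC lerDr addr_ge0.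
Qed.

Section fixed_radius.
Variables (rho : R).
Hypothesis rho0 : 0 < rho.

Let arg_lt y (om : R) : rho + `|om| < rad -> normc (circ rho y - om%:C) < rad /\ normc (om%:C : R[i]) < rad.
Proof.
move=> rr; split.
  by rewrite (le_lt_trans (ler_normcB _ _)) // normc_circ // normc_real.
by rewrite normc_real (le_lt_trans _ rr) // lerDr ltW.
Qed.

Lemma dK_circ_unif om : rho + `|om| < rad -> forall e, 0 < e ->
  exists2 dl : R, 0 < dl & forall u r u' r' y,
    a <= u <= b -> a <= r <= b -> a <= u' <= b -> a <= r' <= b -> 0 <= y <= 2 * pi ->
    `|u' - u| < dl -> `|r' - r| < dl ->
    normc (dK u' r' (circ rho y - om%:C) om%:C - dK u r (circ rho y - om%:C) om%:C) <= e.
Proof.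
move=> rr; apply: (@box_unif R a b 0 (2 * pi) (fun u r y => dK u r (circ rho y - om%:C) om%:C)).
move=> u r y uab rab ypi e e0; have [z1 w1] := arg_lt y rr.
have [dl dl0 D] := dK_cont H uab rab z1 w1 e0.
have dl20 : 0 < dl / 2 by rewrite divr_gt0.
have [dl' dl'0 D'] := circ_cont rho y dl20.
exists (Num.min dl dl'); first by rewrite lt_min dl0.
move=> u' r' y' u'ab r'ab _; rewrite !lt_min => /andP[h1 _] /andP[h2 _] /andP[_ h3].
have [z2 _] := arg_lt y' rr; apply: D => //; last by rewrite subrr normc0.
have -> : circ rho y' - om%:C - (circ rho y - om%:C) = circ rho y' - circ rho y by ring.
by rewrite (le_lt_trans (D' _ h3)) // ltr_pdivrMr // ltr_pMr // ltr1n.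
Qed.

(** Expand [exp (K u v - K u u)] to first order. *)
Lemma cmgf2_incr om e : rho + `|om| < rad -> 0 < e -> exists2 dl : R, 0 < dl & forall u v y,
  a <= u <= b -> a <= v <= b -> 0 <= y <= 2 * pi -> `|v - u| < dl ->
  normc (cmgf2 P X u v (circ rho y - om%:C) om%:C - cmgf P X u (circ rho y) *
     (1 + (v - u)%:C * dK u u (circ rho y - om%:C) om%:C))
  <= e * `|v - u| * normc (cmgf P X u (circ rho y)).
Proof.
move=> rr e0; have B0 := cgf_B_ge0.
have e40 : 0 < e / 4 by rewrite divr_gt0.
have e20 : 0 < e / 2 by rewrite divr_gt0.
have [d1 d10 D1] := dK_circ_unif rr e40.
have N0 : 0 < B + e / 2 by rewrite ltr_wpDl.
have [d2 d20 D2] := cexp_cdiff0 (divr_gt0 e20 N0).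
exists (Num.min d1 (d2 / (B + e / 2))); first by rewrite lt_min d10 divr_gt0.
move=> u v y uab vab ypi; rewrite lt_min => /andP[uv1 uv2].
have [z1 w1] := arg_lt y rr.
set z := circ rho y - om%:C; set w := om%:C; set l := dK u u z w.
(* [cmgf2 u v = cmgf u * exp k] *)
pose k := K u v z w - K u u z w.
have nk1 : normc (k - (v - u)%:C * l) <= e / 2 * `|v - u|.
  have hr r : a <= r <= b -> `|r - u| <= `|v - u| -> normc (dK u r z w - l) <= e / 4.
    by move=> rab ru; apply: D1; rewrite ?subrr ?normr0 // (le_lt_trans ru).
  have := K_mvt H uab vab z1 w1 hr.
  by have -> : 2 * (e / 4) = e / 2 by field.
have nk2 : normc k <= (B + e / 2) * `|v - u|.
  have -> : k = (v - u)%:C * l + (k - (v - u)%:C * l) by ring.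
  rewrite (le_trans (le_normcD _ _)) // mulrDl lerD //.
  by rewrite normcM normc_real mulrC ler_wpM2r // normc_dK.
have nk3 : normc (cexp k - 1 - k) <= e / 2 * `|v - u|.
  have kd : normc k < d2 by rewrite (le_lt_trans nk2) // mulrC -ltr_pdivlMr.
  have := D2 k kd; rewrite add0r mul1r cexp0 => /le_trans; apply.
  rewrite -[X in X <= _]mulrA; apply: ler_wpM2l; first exact: ltW.
  by rewrite ler_pdivrMl.
have mE : cmgf2 P X u v z w = cmgf P X u (circ rho y) * cexp k.
  rewrite -(cmgf2_diag P X u (circ rho y) w) !cmgf2_K // -cexpD /k.
  by congr cexp; rewrite addrC subrK.
rewrite mE -mulrBr normcM mulrC ler_wpM2r ?normc_ge0 //.
have -> : cexp k - (1 + (v - u)%:C * l) = (cexp k - 1 - k) + (k - (v - u)%:C * l) by ring.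
by rewrite (le_trans (le_normcD _ _)) // [e]splitr mulrDl lerD.
Qed.

End fixed_radius.
End increments.

(** * Exponential variance of small increments *)

Section increment_moments.
Context {R : realType} {d : measure_display} {Omega : measurableType d}.
Variable P : probability Omega R.
Local Notation nR := (@Num.norm R R : R -> R).
Local Notation nC := (@normc R).
Variables (X : R -> Omega -> R) (a b rad : R).
Variables (K dK : R -> R -> cplx R -> cplx R -> cplx R) (B : R).
Hypothesis H : cgf_data P X a b rad K dK B.
Let ab := cgf_ab H.
Let mX := cgf_meas H.
Let inab s : (s \in `[a, b]) = (a <= s <= b). Proof. by rewrite in_itv. Qed.

Variables (rho om : R).
Hypotheses (rho0 : 0 < rho) (om0 : 0 < om) (rr : rho + om < rad).

Let rhor : rho < rad. Proof. by apply: lt_trans rr; rewrite ltrDl. Qed.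
Let omr : om < rad. Proof. by apply: lt_trans rr; rewrite ltrDr. Qed.

(** [2 * (cosh x - 1)], which dominates the second-order remainder of [exp]. *)
Definition cosh2 (x : R) := expR x + expR (- x) - 2.

Lemma cosh2_ge (x : R) : `|expR x - 1 - x| <= cosh2 x.
Proof.
have h1 := expR_ge1Dx x; have h2 := expR_ge1Dx (- x).
by rewrite ger0_norm /cosh2; lra.
Qed.

Definition exp_var u v x := EX P (fun o => expR (x * X u o) * cosh2 (om * (X v o - X u o))).

Let expcosh u v x o : expR (x * X u o) * cosh2 (om * (X v o - X u o)) =
  (expR ((x - om) * X u o + om * X v o) + expR ((x + om) * X u o + - om * X v o)) -
   2 * expR (x * X u o + 0 * X u o).
Proof.
have -> : expR ((x - om) * X u o + om * X v o) = expR (x * X u o) * expR (om * (X v o - X u o)).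
  by rewrite -expRD; congr expR; ring.
have -> : expR ((x + om) * X u o + - om * X v o) = expR (x * X u o) * expR (- (om * (X v o - X u o))).
  by rewrite -expRD; congr expR; ring.
by rewrite mul0r addr0 /cosh2; ring.
Qed.

Section at_points.
Variables (u v x : R).
Hypotheses (uab : a <= u <= b) (vab : a <= v <= b) (xr : `|x| <= rho).

Let nx1 : `|x - om| < rad.
Proof. by rewrite (le_lt_trans (ler_normB _ _)) // (le_lt_trans _ rr) // lerD // gtr0_norm. Qed.
Let nx2 : `|x + om| < rad.
Proof. by rewrite (le_lt_trans (ler_normD _ _)) // (le_lt_trans _ rr) // lerD // gtr0_norm. Qed.
Let nom : `|om| < rad. Proof. by rewrite gtr0_norm. Qed.
Let nmom : `|- om| < rad. Proof. by rewrite normrN gtr0_norm. Qed.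
Let nx : `|x| < rad. Proof. exact: le_lt_trans xr rhor. Qed.
Let n0 : `|0 : R| < rad. Proof. by rewrite normr0 (cgf_rad H). Qed.

Let i1 := integ_exp_real H uab vab nx1 nom.
Let i2 := integ_exp_real H uab vab nx2 nmom.
Let i3 := integ_exp_real H uab uab nx n0.

Lemma integ_exp_var : integ P (fun o => expR (x * X u o) * cosh2 (om * (X v o - X u o))).
Proof.
apply: eq_integrable (integB (integD i1 i2) (integZ 2 i3)) => // o _.
by rewrite /= expcosh.
Qed.

Lemma cmgf2_real z w : `|z| < rad -> `|w| < rad ->
  cmgf2 P X u v z%:C w%:C = (EX P (fun o => expR (z * X u o + w * X v o)))%:C.
Proof.
move=> zr wr; rewrite /cmgf2 cEXE.
have E o : cexp_lin (X u) (X v) z%:C w%:C o = (expR (z * X u o + w * X v o))%:C.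
  rewrite /cexp_lin (_ : _ + _ = (z * X u o + w * X v o)%:C); last by rewrite rmorphD !rmorphM.
  by rewrite cexp_real.
under eq_EX do rewrite E; under [X in _ +i* X]eq_EX do rewrite E /=.
by rewrite EX_cst.
Qed.

End at_points.

Lemma exp_varE u v x : a <= u <= b -> a <= v <= b -> `|x| <= rho ->
  (exp_var u v x)%:C = cmgf2 P X u v (x%:C - om%:C) om%:C +
    cmgf2 P X u v (x%:C - (- om)%:C) (- om)%:C - 2 * cmgf P X u x%:C.
Proof.
move=> uab vab xr.
have nx1 : `|x - om| < rad.
  by rewrite (le_lt_trans (ler_normB _ _)) // (le_lt_trans _ rr) // lerD // gtr0_norm.
have nx2 : `|x + om| < rad.
  by rewrite (le_lt_trans (ler_normD _ _)) // (le_lt_trans _ rr) // lerD // gtr0_norm.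
have nom : `|om| < rad by rewrite gtr0_norm.
have nmom : `|- om| < rad by rewrite normrN gtr0_norm.
have nx : `|x| < rad by exact: le_lt_trans xr rhor.
have n0 : `|0 : R| < rad by rewrite normr0 (cgf_rad H).
have -> : cmgf P X u x%:C = cmgf2 P X u u x%:C (0 : R)%:C.
  by rewrite -(cmgf2_diag P X u x%:C 0) subr0.
have -> : x%:C - (- om)%:C = (x + om)%:C :> R[i] by rewrite -rmorphB opprK.
rewrite -rmorphB !cmgf2_real // -[2]/((2 : nat)%:R) -(rmorph_nat (@real_complex R)) -!rmorphM -!rmorphD -rmorphB; congr (_%:C).
rewrite /exp_var; under eq_EX do rewrite expcosh.
have i1 := integ_exp_real H uab vab nx1 nom.
have i2 := integ_exp_real H uab vab nx2 nmom.
have i3 := integ_exp_real H uab uab nx n0.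
by rewrite (EXB (integD i1 i2) (integZ 2 i3)) (EXD i1 i2) (EXZ 2 i3).
Qed.

Lemma exp_var_ge0 u v x : 0 <= exp_var u v x.
Proof.
apply: EX_ge0 => o; rewrite mulr_ge0 ?expR_ge0 //.
exact: le_trans (normr_ge0 _) (cosh2_ge _).
Qed.

(** The variance [exp_var u v x] is nonnegative on both sides of [v = u], where
    it vanishes, so its derivative there is zero. *)
Lemma exp_var_small x y : circ rho y = x%:C -> 0 <= y <= 2 * pi -> forall e, 0 < e ->
  exists2 dl : R, 0 < dl & forall u v, a <= u <= b -> a <= v <= b -> `|v - u| < dl ->
    exp_var u v x <= e * `|v - u|.
Proof.
move=> xE ypi.
have xr : `|x| <= rho by rewrite -(normc_real x) -xE normc_circ.
have rr1 : rho + `|om| < rad by rewrite gtr0_norm.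
have rr2 : rho + `|- om| < rad by rewrite normrN.
have nx : `|x| < rad by exact: le_lt_trans xr rhor.
have n0 : `|0 : R| < rad by rewrite normr0 (cgf_rad H).
pose lam u := complex.Re (dK u u (x%:C - om%:C) om%:C) + complex.Re (dK u u (x%:C - (- om)%:C) (- om)%:C).
pose m u := complex.Re (cmgf P X u x%:C).
have mE u : a <= u <= b -> cmgf P X u x%:C = (m u)%:C.
  move=> uab; have := cmgf2_diag P X u x%:C 0; rewrite /m => <-; rewrite subr0.
  by rewrite (@cmgf2_real u u x 0 nx n0).
have m0 u : a <= u <= b -> 0 < m u.
  move=> uab; rewrite lt_neqAle; apply/andP; split.
    apply/eqP => m0; have := cmgf_neq0 H (u := u) (th := x%:C) uab.
    by rewrite normc_real mE // -m0 eqxx => /(_ (le_lt_trans xr rhor)).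
  have := cmgf2_diag P X u x%:C 0; rewrite /m => <-; rewrite subr0 (@cmgf2_real u u x 0 nx n0) /=.
  by apply: EX_ge0 => o; exact: expR_ge0.
have st1 e : 0 < e -> exists2 dl : R, 0 < dl & forall u v, a <= u <= b -> a <= v <= b -> `|v - u| < dl ->
    `|exp_var u v x - m u * ((v - u) * lam u)| <= e * `|v - u| * m u.
  move=> e0; have e20 : 0 < e / 2 by rewrite divr_gt0.
  have [d1 d10 D1] := cmgf2_incr H rho0 rr1 e20.
  have [d2 d20 D2] := cmgf2_incr H rho0 rr2 e20.
  exists (Num.min d1 d2); first by rewrite lt_min d10.
  move=> u v uab vab; rewrite lt_min => /andP[uv1 uv2].
  have {}D1 := D1 u v y uab vab ypi uv1; have {}D2 := D2 u v y uab vab ypi uv2.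
  have mn : normc (cmgf P X u (circ rho y)) = m u by rewrite xE mE // normc_real gtr0_norm // m0.
  rewrite xE in D1 D2 mn; rewrite mn in D1 D2.
  have E1 := exp_varE uab vab xr.
  set A1 := cmgf2 P X u v _ om%:C in D1 E1; set A2 := cmgf2 P X u v _ (- om)%:C in D2 E1.
  set l1 := dK u u _ om%:C in D1; set l2 := dK u u _ (- om)%:C in D2.
  have -> : e * `|v - u| * m u = e / 2 * `|v - u| * m u + e / 2 * `|v - u| * m u by field.
  have E2 : (exp_var u v x)%:C - (m u)%:C * ((v - u)%:C * (l1 + l2)) =
      (A1 - cmgf P X u x%:C * (1 + (v - u)%:C * l1)) + (A2 - cmgf P X u x%:C * (1 + (v - u)%:C * l2)).
    by rewrite E1 -mE //; ring.
  have -> : exp_var u v x - m u * ((v - u) * lam u) =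
      complex.Re ((exp_var u v x)%:C - (m u)%:C * ((v - u)%:C * (l1 + l2))).
    by rewrite ReD ReN !ReM ReD /=; rewrite !mul0r !subr0.
  rewrite (le_trans (normc_Re _)) // E2 (le_trans (le_normcD _ _)) // lerD //.
have lamc e : 0 < e -> exists2 dl : R, 0 < dl & forall u v, a <= u <= b -> a <= v <= b -> `|v - u| < dl ->
    `|lam v - lam u| <= e.
  move=> e0; have e20 : 0 < e / 2 by rewrite divr_gt0.
  have [d1 d10 D1] := dK_circ_unif H rho0 rr1 e20.
  have [d2 d20 D2] := dK_circ_unif H rho0 rr2 e20.
  exists (Num.min d1 d2); first by rewrite lt_min d10.
  move=> u v uab vab; rewrite lt_min => /andP[uv1 uv2].
  have {}D1 := D1 u u v v y uab uab vab vab ypi uv1 uv1.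
  have {}D2 := D2 u u v v y uab uab vab vab ypi uv2 uv2.
  rewrite xE in D1 D2.
  have -> : lam v - lam u = (complex.Re (dK v v (x%:C - om%:C) om%:C) - complex.Re (dK u u (x%:C - om%:C) om%:C)) +
     (complex.Re (dK v v (x%:C - (- om)%:C) (- om)%:C) - complex.Re (dK u u (x%:C - (- om)%:C) (- om)%:C)).
    by rewrite /lam; ring.
  have reB (z w : R[i]) : `|complex.Re z - complex.Re w| <= normc (z - w).
    by rewrite -ReN -ReD normc_Re.
  by rewrite (le_trans (ler_normD _ _)) // [e]splitr lerD // (le_trans (reB _ _)).
(* [v] slightly after [u]; the times before [u] give the opposite sign in [lamneg] *)
have lampos u : a <= u < b -> 0 <= lam u.
  move=> /andP[au ub]; have uab : a <= u <= b by rewrite au ltW.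
  rewrite -oppr_le0; apply/ler_addgt0Pl => e e0; rewrite addr0.
  have [dl dl0 D] := st1 e e0.
  pose k := Num.min (dl / 2) (b - u).
  have k0 : 0 < k by rewrite lt_min divr_gt0 //= subr_gt0.
  have kdl : k < dl by rewrite gt_min ltr_pdivrMr // ltr_pMr // ltr1n.
  have kb : u + k <= b by rewrite -lerBrDl ge_min lexx orbT.
  have kab : a <= u + k <= b by rewrite kb andbT (le_trans au) // lerDl ltW.
  have := D u (u + k) uab kab; rewrite [u + k - u]addrC addKr gtr0_norm // => /(_ kdl).
  rewrite ler_norml => /andP[_]; have := exp_var_ge0 u (u + k) x.
  move: (exp_var _ _ _) => V V0 h.
  have : 0 <= (m u * k) * (lam u + e).
    have -> : (m u * k) * (lam u + e) = m u * (k * lam u) + e * k * m u by ring.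
    by move: h V0; lra.
  by rewrite pmulr_rge0 ?mulr_gt0 ?m0 //; lra.
have lamneg u : a < u <= b -> lam u <= 0.
  move=> /andP[au ub]; have uab : a <= u <= b by rewrite ub ltW.
  apply/ler_addgt0Pl => e e0; rewrite addr0.
  have [dl dl0 D] := st1 e e0.
  pose k := Num.min (dl / 2) (u - a).
  have k0 : 0 < k by rewrite lt_min divr_gt0 //= subr_gt0.
  have kdl : k < dl by rewrite gt_min ltr_pdivrMr // ltr_pMr // ltr1n.
  have kb : a <= u - k by rewrite lerBrDr -lerBrDl ge_min lexx orbT.
  have kab : a <= u - k <= b by rewrite kb /= (le_trans _ ub) // gerBl ltW.
  have := D u (u - k) uab kab; rewrite [u - k - u]addrC addKr normrN gtr0_norm // => /(_ kdl).
  rewrite ler_norml => /andP[_]; have := exp_var_ge0 u (u - k) x.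
  move: (exp_var _ _ _) => V V0 h.
  have : 0 <= (m u * k) * (e - lam u).
    have -> : (m u * k) * (e - lam u) = m u * (- k * lam u) + e * k * m u by ring.
    by move: h V0; lra.
  by rewrite pmulr_rge0 ?mulr_gt0 ?m0 //; lra.
(* at the endpoints only one side is available: pass to the limit from inside *)
have lam0 u : a <= u <= b -> lam u = 0.
  move=> uab; case/andP: (uab) => au ub; apply/eqP; rewrite eq_le; apply/andP; split.
    move: au; rewrite [a <= u]le_eqVlt => /orP[/eqP aE|au]; last by apply: lamneg; rewrite au.
    apply/ler_addgt0Pl => e e0; rewrite addr0; have [dl dl0 D] := lamc e e0.
    pose k := Num.min (dl / 2) (b - a).
    have k0 : 0 < k by rewrite lt_min divr_gt0 //= subr_gt0.
    have kdl : k < dl by rewrite gt_min ltr_pdivrMr // ltr_pMr // ltr1n.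
    have kb : a + k <= b by rewrite -lerBrDl ge_min lexx orbT.
    have h1 : a < a + k <= b by rewrite kb ltrDl k0.
    have kab : a <= a + k <= b by rewrite kb lerDl ltW.
    have := D u (a + k) uab kab; rewrite -aE [a + k - a]addrC addKr gtr0_norm // => /(_ kdl).
    by rewrite ler_norml => /andP[h _]; have := lamneg _ h1; move: h; lra.
  move: ub; rewrite [u <= b]le_eqVlt => /orP[/eqP bE|ub]; last by apply: lampos; rewrite au.
  rewrite -oppr_le0; apply/ler_addgt0Pl => e e0; rewrite addr0; have [dl dl0 D] := lamc e e0.
  pose k := Num.min (dl / 2) (b - a).
  have k0 : 0 < k by rewrite lt_min divr_gt0 //= subr_gt0.
  have kdl : k < dl by rewrite gt_min ltr_pdivrMr // ltr_pMr // ltr1n.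
  have kb : a <= b - k by rewrite lerBrDr -lerBrDl ge_min lexx orbT.
  have h1 : a <= b - k < b by rewrite kb /= gtrBl.
  have kab : a <= b - k <= b by rewrite kb /= gerBl ltW.
  have := D u (b - k) uab kab; rewrite bE [b - k - b]addrC addKr normrN gtr0_norm // => /(_ kdl).
  by rewrite ler_norml => /andP[_ h]; have := lampos _ h1; move: h; lra.
move=> e e0; have [M M0 HM] := cmgf_bounds H rho0 rhor.
have [dl dl0 D] := st1 (e / M) (divr_gt0 e0 M0); exists dl => // u v uab vab uv.
have := D u v uab vab uv; rewrite lam0 // !mulr0 subr0 => h.
rewrite (le_trans (ler_norm _)) // (le_trans h) //.
have mM : m u <= M.
  have xr' : normc (x%:C : R[i]) <= rho by rewrite normc_real.
  by have [h1 _] := HM u _ uab xr'; rewrite (le_trans _ h1) // mE // normc_real ler_norm.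
rewrite mulrAC ler_wpM2r // mulrAC ler_pdivrMr // ler_wpM2l //.
exact: ltW.
Qed.

End increment_moments.

(** * Moments of small increments *)

Section ratio_increments.
Context {R : realType} {d : measure_display} {Omega : measurableType d}.
Variable P : probability Omega R.
Local Notation nR := (@Num.norm R R : R -> R).
Local Notation nC := (@normc R).
Variables (X : R -> Omega -> R) (a b rad : R).
Variables (K dK : R -> R -> cplx R -> cplx R -> cplx R) (B : R).
Hypothesis H : cgf_data P X a b rad K dK B.
Let ab := cgf_ab H.
Let mX := cgf_meas H.
Let inab s : (s \in `[a, b]) = (a <= s <= b). Proof. by rewrite in_itv. Qed.

Variables (rho om : R).
Hypotheses (rho0 : 0 < rho) (om0 : 0 < om) (rr : rho + om < rad).

Let rhor : rho < rad. Proof. by apply: lt_trans rr; rewrite ltrDl. Qed.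
Let omr : om < rad. Proof. by apply: lt_trans rr; rewrite ltrDr. Qed.

Definition incr_cmom u v (th : R[i]) : R[i] :=
  cexpectation P (fun o => ((X v \- X u) o)%:C * cexp (th * (X u o)%:C)).

Section at_points.
Variables (u v : R) (th : R[i]).
Hypotheses (uab : a <= u <= b) (vab : a <= v <= b) (tr : normc th <= rho).

Let ReZ o : complex.Re (th * (X u o)%:C) = complex.Re th * X u o.
Proof. by rewrite ReM /= mulr0 subr0. Qed.

Let expRe_le o : expR (complex.Re th * X u o) <= expR (rho * `|X u o|).
Proof.
rewrite ler_expR (le_trans (ler_norm _)) // normrM ler_wpM2r //.
exact: le_trans (normc_Re _) tr.
Qed.

Lemma cintegrable_cexp : cintegrable P (fun o => 1 * cexp (th * (X u o)%:C)).
Proof.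
have z0 : normc (0 : R[i]) < rad by rewrite normc0 (cgf_rad H).
have [i _] := cgf_integrable H (etrans (inab u) uab) (etrans (inab u) uab)
  (cdiskE (le_lt_trans tr rhor)) (cdiskE z0).
suff <- : cexp_lin (X u) (X u) th 0 = (fun o => 1 * cexp (th * (X u o)%:C)) by [].
by apply/funext => o; rewrite /cexp_lin mul0r addr0 mul1r.
Qed.

Lemma cintegrable_incr : cintegrable P (fun o => ((X v \- X u) o)%:C * cexp (th * (X u o)%:C)).
Proof.
have [i1 i2] := cintegrable_cexp.
have rr' : 0 <= rho < rad by rewrite ltW.
have iD := integ_incr_exp H uab vab rr'.
have mY : measurable_fun setT (X v \- X u) by apply: measurable_funB; exact: mX.
have bd o : normc (((X v \- X u) o)%:C * cexp (th * (X u o)%:C)) <= `|X v o - X u o| * expR (rho * `|X u o|).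
  by rewrite normcM normc_real normc_cexp ReZ ler_wpM2l.
have ReE (k : R) (z : R[i]) : complex.Re (k%:C * z) = k * complex.Re (1 * z).
  by rewrite mul1r ReM mul0r subr0.
have ImE (k : R) (z : R[i]) : complex.Im (k%:C * z) = k * complex.Im (1 * z).
  by rewrite mul1r ImM mul0r addr0.
split; apply: (@integ_le _ _ _ P _ _ _ _ iD).
- rewrite (_ : (fun o => _) = (fun o => (X v \- X u) o * complex.Re (1 * cexp (th * (X u o)%:C)))).
    by apply: measurable_funM => //; exact: integ_meas i1.
  by apply/funext => o; rewrite ReE.
- by move=> o; rewrite (le_trans (normc_Re _)).
- rewrite (_ : (fun o => _) = (fun o => (X v \- X u) o * complex.Im (1 * cexp (th * (X u o)%:C)))).
    by apply: measurable_funM => //; exact: integ_meas i2.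
  by apply/funext => o; rewrite ImE.
- by move=> o; rewrite (le_trans (normc_Im _)).
Qed.

(** Replacing [exp (om * y) - 1] by [om * y], [y = X_v - X_u], costs [cosh2 (om * y)],
    and [|exp (th * x)|] is at most [exp (rho * x) + exp (- rho * x)]. *)
Lemma incr_cmom_bound :
  normc (cmgf2 P X u v (th - om%:C) om%:C - cmgf P X u th - om%:C * incr_cmom u v th)
  <= 2 * (exp_var P X om u v rho + exp_var P X om u v (- rho)).
Proof.
have zr : normc (th - om%:C) < rad.
  rewrite (le_lt_trans (ler_normcB _ _)) // (le_lt_trans _ rr) // lerD //.
  by rewrite normc_real gtr0_norm.
have wr : normc (om%:C : R[i]) < rad by rewrite normc_real gtr0_norm.
have [i1 _] := cgf_integrable H (etrans (inab u) uab) (etrans (inab v) vab) (cdiskE zr) (cdiskE wr).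
have i2 := cintegrable_cexp; have i3 := cintegrable_incr.
rewrite /incr_cmom -(cEXZ om i3) /cmgf2 /cmgf -(cEXB i1 i2) -(cEXB (cintegrableB i1 i2) (cintegrableZ om i3)).
have nr : `|rho| <= rho by rewrite gtr0_norm.
have nr' : `|- rho| <= rho by rewrite normrN gtr0_norm.
have j1 := integ_exp_var H rho0 om0 rr uab vab nr; have j2 := integ_exp_var H rho0 om0 rr uab vab nr'.
rewrite /exp_var -(EXD j1 j2).
apply: normc_cEX (integD j1 j2) _; first exact: cintegrableB (cintegrableB i1 i2) (cintegrableZ om i3).
move=> o; set y := X v o - X u o.
have -> : cexp_lin (X u) (X v) (th - om%:C) om%:C o = cexp (th * (X u o)%:C) * (expR (om * y))%:C.
  rewrite /cexp_lin -cexp_real -cexpD; congr cexp; rewrite /y rmorphM rmorphB /=; ring.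
have -> : cexp (th * (X u o)%:C) * (expR (om * y))%:C - 1 * cexp (th * (X u o)%:C) -
    om%:C * (((X v \- X u) o)%:C * cexp (th * (X u o)%:C)) =
    cexp (th * (X u o)%:C) * (expR (om * y) - 1 - om * y)%:C.
  have yE : (X v \- X u) o = y by []. 
  rewrite yE; clearbody y; move: (cexp _) (expR _) => c E.
  by rewrite !rmorphB rmorphM rmorph1; ring.
rewrite normcM normc_real normc_cexp ReZ -mulrDl ler_pM ?expR_ge0 //; last exact: cosh2_ge.
rewrite (le_trans (expRe_le o)) //; have := expR_ge0 (rho * X u o); have := expR_ge0 (- rho * X u o).
have [x0|x0] := leP 0 (X u o); first by rewrite ger0_norm //; lra.
by rewrite ltr0_norm // mulrN -mulNr; lra.
Qed.

End at_points.

Definition dKlog u y : R[i] := dK u u (circ rho y - om%:C) om%:C / om%:C.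

(** Divide the first-order expansion of [E (exp (th * X_u) * (exp (om * y) - 1))],
    [y = X_v - X_u], by [cmgf], which is bounded below. *)
Lemma ratio_incr e : 0 < e -> exists2 dl : R, 0 < dl & forall u v y,
  a <= u <= b -> a <= v <= b -> 0 <= y <= 2 * pi -> `|v - u| < dl ->
  normc ((cmgf P X u (circ rho y))^-1 * incr_cmom u v (circ rho y) - (v - u)%:C * dKlog u y)
  <= e * `|v - u|.
Proof.
move=> e0; have [M M0 HM] := cmgf_bounds H rho0 rhor.
pose e' := e * om / (M * M + 4 * M).
have MM : 0 < M * M + 4 * M by rewrite addr_gt0 // mulr_gt0.
have e'0 : 0 < e' by rewrite divr_gt0 // mulr_gt0.
have rr1 : rho + `|om| < rad by rewrite gtr0_norm.
have y0 : 0 <= (0 : R) <= 2 * pi by rewrite lexx mulr_ge0 // pi_ge0.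
have ypi : 0 <= (pi : R) <= 2 * pi by rewrite pi_ge0 mulrDl mul1r lerDl pi_ge0.
have [d1 d10 D1] := cmgf2_incr H rho0 rr1 e'0.
have [d2 d20 D2] := exp_var_small H rho0 om0 rr (circ0 rho0) y0 e'0.
have [d3 d30 D3] := exp_var_small H rho0 om0 rr (circpi rho0) ypi e'0.
exists (Num.min d1 (Num.min d2 d3)); first by rewrite !lt_min d10 d20.
move=> u v y uab vab y2; rewrite !lt_min => /andP[/(D1 u v y uab vab y2) {}D1].
move=> /andP[/(D2 u v uab vab) {}D2 /(D3 u v uab vab) {}D3].
have tr : normc (circ rho y) <= rho by rewrite normc_circ.
have D4 := incr_cmom_bound uab vab tr.
have [m1 m2] := HM u _ uab tr.
have mn0 := cmgf_neq0 H uab (le_lt_trans tr rhor).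
rewrite /dKlog.
set m := cmgf P X u _ in m1 m2 mn0 D1 D4 *; set N := incr_cmom _ _ _ in D4 *.
set A := cmgf2 P X _ _ _ _ in D1 D4; set l := dK u u _ _ in D1 *.
have om0' : om%:C != 0 :> R[i] by rewrite -normc_gt0 normc_real gtr0_norm.
have -> : m^-1 * N - (v - u)%:C * (l / om%:C) =
    m^-1 / om%:C * ((A - m * (1 + (v - u)%:C * l)) - (A - m - om%:C * N)).
  by field; rewrite mn0 om0'.
rewrite !normcM [normc (om%:C)^-1]normcV normc_real gtr0_norm //.
have h1 : normc ((A - m * (1 + (v - u)%:C * l)) - (A - m - om%:C * N)) <= e' * `|v - u| * (M + 4).
  have -> : e' * `|v - u| * (M + 4) = e' * `|v - u| * M + 4 * (e' * `|v - u|) by ring.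
  rewrite (le_trans (ler_normcB _ _)) // lerD //.
    by rewrite (le_trans D1) // ler_wpM2l // mulr_ge0 // ltW.
  by move: D4 D2 D3; set V1 := exp_var _ _ _ _ _ _; set V2 := exp_var _ _ _ _ _ _; lra.
have -> : e * `|v - u| = M / om * (e' * `|v - u| * (M + 4)).
  rewrite /e'; field; rewrite !gt_eqF //.
apply: ler_pM; [by rewrite mulr_ge0 ?normc_ge0 // invr_ge0 ltW|exact: normc_ge0| |exact: h1].
by rewrite ler_wpM2r // invr_ge0 ltW.
Qed.

End ratio_increments.

(** * Power series close to a function on a circle *)

Section circle_coefficients.
Context {R : realType}.
Implicit Types (g h : R[i] -> R[i]) (rho S : R).
Local Notation nR := (@Num.norm R R : R -> R).
Local Notation nC := (@normc R).

Definition ccirc rho g := ccont 0 (2 * pi) (fun y => g (circ rho y)).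

Lemma ccirc_hol rho g : 0 < rho -> (forall z, z != 0 -> hol g z) -> ccirc rho g.
Proof.
move=> r0 hg; apply: ccont_circle => z; rewrite lnK // => zr; apply: hol_cont; apply: hg.
by rewrite -normc_gt0 zr.
Qed.

Lemma ccircV rho n : 0 < rho -> ccirc rho (fun z => (z ^+ n)^-1).
Proof. by move=> r0; apply: ccirc_hol => // z z0; exact: hol_invX. Qed.

Lemma circ_coefB rho g h n : 0 < rho -> ccirc rho g -> ccirc rho h ->
  circ_coef (fun z => g z - h z) rho n = circ_coef g rho n - circ_coef h rho n.
Proof.
move=> r0 cg ch; rewrite /circ_coef /circint -mulrBr; congr (_ * _).
rewrite -cintB; [|exact: ccontM cg (ccircV n r0)|exact: ccontM ch (ccircV n r0)].
by apply: eq_cint => y _; rewrite mulrBl.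
Qed.

Lemma circ_coefZ rho (k : R[i]) g n : 0 < rho -> ccirc rho g ->
  circ_coef (fun z => k * g z) rho n = k * circ_coef g rho n.
Proof.
move=> r0 cg; rewrite /circ_coef /circint mulrCA; congr (_ * _).
rewrite -cintZ; last exact: ccontM cg (ccircV n r0).
by apply: eq_cint => y _; rewrite mulrA.
Qed.

Lemma circ_coef_poly rho (c : nat -> R[i]) N n : 0 < rho -> (n < N)%N ->
  circ_coef (fun z => \sum_(i < N) c i * z ^+ i) rho n = c n.
Proof.
move=> r0 nN; have cX i : ccont 0 (2 * pi) (fun y => circ rho y ^+ i / circ rho y ^+ n).
  exact: (@ccirc_hol rho (fun z => z ^+ i / z ^+ n) r0 (fun z z0 => hol_monom i n z0)).
rewrite /circ_coef /circint.
have -> : cint 0 (2 * pi) (fun y => (\sum_(i < N) c i * cexp (ln rho +i* y) ^+ i) / cexp (ln rho +i* y) ^+ n) =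
    cint 0 (2 * pi) (fun y => \sum_(i < N) c i * (circ rho y ^+ i / circ rho y ^+ n)).
  by apply: eq_cint => y _; rewrite mulr_suml; apply: eq_bigr => i _; rewrite mulrA.
rewrite (cint_sum _ (fun i => ccontZ (c i) (cX i))).
under eq_bigr do rewrite (cintZ _ (cX _)).
rewrite (bigD1 (Ordinal nN)) //= big1 ?addr0.
  rewrite -[cint _ _ _]/(circint (fun z => z ^+ n / z ^+ n) (ln rho)) circle_int1.
  rewrite mulrCA mulVf ?mulr1 // -normc_gt0 normc_real gtr0_norm; exact: pi2_gt0.
move=> i ni; rewrite -[cint _ _ _]/(circint (fun z => z ^+ i / z ^+ n) (ln rho)).
by rewrite circle_orth ?mulr0.
Qed.

(** A partial sum of the series has its coefficients as Fourier coefficients, and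
    Cauchy's estimate applies to its difference with [g]. *)
Lemma coef_approx rho (a : nat -> R) S g (F : R -> R[i]) eta n : 0 < rho ->
  sbnd nR rho a S -> ccirc rho g ->
  (forall y, 0 <= y <= 2 * pi -> ps_to nC (fun k => (a k)%:C) (circ rho y) (F y)) ->
  (forall y, 0 <= y <= 2 * pi -> normc (F y - g (circ rho y)) <= eta) ->
  `|a n - complex.Re (circ_coef g rho n)| * rho ^+ n <= 2 * eta.
Proof.
move=> r0 aS cg aF Fg; apply/ler_addgt0Pl => e e0.
have [t [t0 _ t_small t_tail]] := sbnd_tail absval_normr (ltW r0) aS.
have e20 : 0 < e / 2 by rewrite divr_gt0.
have [M HM] := t_small _ e20; pose N := (M + n.+1)%N.
have tN : t N <= e / 2 by apply: HM; exact: leq_addr.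
have nN : (n < N)%N by rewrite /N addnS ltnS leq_addl.
clearbody N; pose p z : R[i] := \sum_(i < N) (a i)%:C * z ^+ i.
have cp : ccirc rho p.
  apply: ccirc_hol => // z _; rewrite /p; elim: N {tN nN p} => [|k IH].
    by under eq_fun do rewrite big_ord0; exact: hol_cst.
  under eq_fun do rewrite big_ord_recr /=.
  have -> : (fun z => \sum_(i < k) (a i)%:C * z ^+ i + (a k)%:C * z ^+ k) =
     (fun z : R[i] => \sum_(i < k) (a i)%:C * z ^+ i - (- (a k)%:C) * z ^+ k).
    by apply/funext => x; rewrite mulNr opprK.
  apply: holB => //; apply: holM; [exact: hol_cst|exact: holX].
have pF y : 0 <= y <= 2 * pi -> normc (F y - p (circ rho y)) <= t N.
  move=> y2; apply/ler_addgt0Pl => k k0; have [M' HM'] := aF y y2 k k0.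
  have := HM' (N + M')%N (leq_addl _ _); set q := \sum_(i < N + M') _ => Fq.
  have -> : F y - p (circ rho y) = (q - p (circ rho y)) - (q - F y) by ring.
  rewrite (le_trans (ler_normcB _ _)) // [k + _]addrC lerD //.
  apply: le_trans (t_tail N M'); rewrite /q /p !big_split_ord /= ![_ + _ - _]addrAC !subrr !add0r.
  apply: (le_trans (normc_sum _)); apply: ler_sum => i _.
  by rewrite normcM normcX normc_real normc_circ.
have -> : a n = complex.Re (circ_coef p rho n).
  by have -> : circ_coef p rho n = (a n)%:C := circ_coef_poly (fun i => (a i)%:C) r0 nN.
rewrite -ReN -ReD -circ_coefB //.
have b y : 0 <= y <= 2 * pi -> normc (p (circ rho y) - g (circ rho y)) <= eta + e / 2.
  move=> y2; have -> : p (circ rho y) - g (circ rho y) = (F y - g (circ rho y)) - (F y - p (circ rho y)) by ring.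
  by rewrite (le_trans (ler_normcB _ _)) // lerD ?Fg // (le_trans (pF y y2)).
have := @normc_circ_coef R (fun z => p z - g z) rho (eta + e / 2) n r0 (ccontB cp cg) b.
have -> : 2 * (eta + e / 2) = e + 2 * eta by field.
apply: le_trans; rewrite ler_wpM2r ?exprn_ge0 ?(ltW r0) //; exact: normc_Re.
Qed.

End circle_coefficients.

(** * Power series of the logarithm of the generating function *)

Section power_series_derivatives.
Context {R : realType}.
Implicit Types (c : nat -> R) (g : R -> R) (x rho r S : R).
Local Notation nR := (@Num.norm R R : R -> R).

(** [rho ^ n.+1 - r ^ n.+1] is [rho - r] times a sum of [n.+1] terms, the least of
    which is [r ^ n]. *)
Lemma subrX_ge rho r n : 0 <= r -> r <= rho -> n.+1%:R * r ^+ n * (rho - r) <= rho ^+ n.+1.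
Proof.
move=> r0 rr; have r'0 := le_trans r0 rr.
apply: (@le_trans _ _ (rho ^+ n.+1 - r ^+ n.+1)); last by rewrite gerBl exprn_ge0.
rewrite subrXX mulrC ler_wpM2l ?subr_ge0 // mulr_natl -[X in r ^+ n *+ X]card_ord -sumr_const.
apply: ler_sum => i _ /=; rewrite -[X in r ^+ X](@subnK i n) ?exprD; last by rewrite -ltnS.
by rewrite ler_wpM2r ?exprn_ge0 // lerXn2r.
Qed.

Lemma sbnd_diffs rho r c S : 0 <= r -> r < rho -> sbnd nR rho c S ->
  sbnd nR r (pseries_diffs c) (S / (rho - r)).
Proof.
move=> r0 rr cS n; have d0 : 0 < rho - r by rewrite subr_gt0.
rewrite ler_pdivlMr //; apply: le_trans (cS n.+1).
have rho0 : 0 <= rho by exact: le_trans r0 (ltW rr).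
rewrite big_ord_recl mulr_suml -[X in X <= _]add0r lerD // ?mulr_ge0 ?exprn_ge0 //.
apply: ler_sum => i _; rewrite /pseries_diffs normrM ger0_norm //.
have -> : i.+1%:R * `|c i.+1| * r ^+ i * (rho - r) = `|c i.+1| * (i.+1%:R * r ^+ i * (rho - r)) by ring.
by rewrite ler_wpM2l // subrX_ge // ltW.
Qed.

Definition ps_on rho c g := (exists S, sbnd nR rho c S) /\ forall x, `|x| < rho -> ps_to nR c x (g x).

Lemma ps_on_derive rho c g x : ps_on rho c g -> `|x| < rho ->
  exists2 l, ps_to nR (pseries_diffs c) x l & is_derive x 1 g l.
Proof.
move=> [[S cS] cg] xr; pose r := (`|x| + rho) / 2; pose r' := (r + rho) / 2.
have n0 := normr_ge0 x.
have xr1 : `|x| < r by rewrite /r; lra.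
have r0 : 0 <= r by exact: le_trans n0 (ltW xr1).
have rr : r < r' by rewrite /r' /r; lra.
have rr2 : r' < rho by rewrite /r' /r; lra.
have c1 := sbnd_diffs (le_trans r0 (ltW rr)) rr2 cS.
have c2 := sbnd_diffs r0 rr c1.
have c1' := sbnd_le absval_normr r0 (ltW rr) c1.
have rrho := ltW (lt_trans rr rr2).
have c0' := sbnd_le absval_normr r0 rrho cS.
have cv a T y : `|y| <= r -> sbnd nR r a T -> cvgn (pseries a y).
  move=> yr aT; have [l al] := ex_ps_to aT yr; apply/cvg_ex; exists l; exact/ps_to_cvg.
have nr : `|r| <= r by rewrite ger0_norm.
have := @pseries_snd_diffs R c r x (cv _ _ _ nr c0') (cv _ _ _ nr c1') (cv _ _ _ nr c2).
rewrite [`|r|]ger0_norm // => /(_ xr1) D.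
exists (limn (pseries (pseries_diffs c) x)).
  by apply/ps_to_cvg; exact: cv (ltW xr1) c1'.
apply: near_eq_is_derive D.
have : ball x (r - `|x|) x by apply: ballxx; rewrite subr_gt0.
exists (r - `|x|) => /=; first by rewrite subr_gt0.
move=> y /=; rewrite distrC => yx.
have yr : `|y| < rho.
  have -> : y = x + (y - x) by ring.
  by rewrite (le_lt_trans (ler_normD _ _)) // (lt_le_trans _ rrho) // -ltrBrDl.
apply: cvg_lim; first exact: Rhausdorff.
by apply/ps_to_cvg; exact: cg.
Qed.

Lemma ps_on_derive1 rho r c g : 0 <= r -> r < rho -> ps_on rho c g ->
  ps_on r (pseries_diffs c) (derive1 g).
Proof.
move=> r0 rr cg; split.
  by case: cg => -[S cS] _; exists (S / (rho - r)); exact: sbnd_diffs.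
move=> x xr; have [l cl [_ D]] := ps_on_derive cg (lt_trans xr rr).
by rewrite derive1E D.
Qed.

Lemma ps_on_derive1n rho c g n : 0 < rho -> ps_on rho c g -> derive1n n g 0 = n`!%:R * c n.
Proof.
elim: n rho c g => [|n IH] rho c g r0 cg.
  rewrite derive1n0 fact0 mul1r; case: cg => _ /(_ 0); rewrite normr0 => /(_ r0) h.
  exact: (slim_unique absval_normr h (ps_to0 absval_normr c)).
have r20 : 0 < rho / 2 by rewrite divr_gt0.
have r2 : rho / 2 < rho by rewrite ltr_pdivrMr // ltr_pMr // ltr1n.
rewrite derive1Sn (IH _ _ _ r20 (ps_on_derive1 (ltW r20) r2 cg)) /pseries_diffs.
by rewrite factS mulnC natrM mulrA.
Qed.

(** Two functions with the same derivative and the same value at [0]. *)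
Lemma ps_on_eq rho c f g : 0 < rho -> ps_on rho c g -> f 0 = 0 -> c 0%N = 0 ->
  (forall x l, `|x| < rho -> ps_to nR (pseries_diffs c) x l -> is_derive x 1 (f : R -> R) l) ->
  forall x, 0 <= x < rho -> f x = g x.
Proof.
move=> rho0 cg f0 c0 df x /andP[x0 xr].
have g0 : g 0 = 0.
  case: cg => _ /(_ 0); rewrite normr0 => /(_ rho0) h.
  by rewrite -[RHS]c0; exact: (slim_unique absval_normr h (ps_to0 absval_normr c)).
have D (y : R) : `|y| < rho -> is_derive y 1 (fun y : R => f y - g y) (0 : R).
  move=> yr; have [l cl dg] := ps_on_derive cg yr.
  by have dfl := df _ _ yr cl; rewrite -(subrr l); exact: is_deriveB.
have [||c' c'x E] := @MVT_segment R (fun y => f y - g y) (fun=> 0) 0 x x0.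
- move=> y; rewrite in_itv /= => /andP[y0 yx]; apply: D; rewrite ger0_norm ?(ltW y0) //.
  exact: lt_trans yx xr.
- apply: derivable_within_continuous => y; rewrite in_itv /= => /andP[y0 yx].
  by have [] := D y _; rewrite ?ger0_norm // (le_lt_trans yx xr).
by move: E; rewrite f0 g0 mul0r subrr subr0 => /eqP; rewrite subr_eq0 => /eqP.
Qed.

End power_series_derivatives.

Section log_mgf_series.
Context {R : realType} {d : measure_display} {Omega : measurableType d}.
Variable P : probability Omega R.
Local Notation nR := (@Num.norm R R : R -> R).
Variables (Z : Omega -> R) (rho : R).
Hypotheses (mZ : measurable_fun setT Z) (rho0 : 0 < rho).
Hypothesis iZ : integ P (fun o => expR (rho * `|Z o|)).
Variable S : R.
Hypothesis hS : sbnd nR rho (finv (mom1 P Z)) S.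

Let m1 : measurable_fun setT ((fun=> 1) : Omega -> R).
Proof. exact: measurable_cst. Qed.

Let iZ1 : integ P (fun o => `|1 : R| * expR (rho * `|Z o|)).
Proof. by apply: eq_integrable iZ => // o _; rewrite /= normr1 mul1r. Qed.

Lemma mgf_ps_on : ps_on rho (mom1 P Z) (mgf P Z).
Proof.
split; first by eexists; exact: (sbnd_mom m1 mZ rho0 iZ1).
move=> x xr; rewrite mgfE; have [_ h] := mom_ps m1 mZ rho0 iZ1 (ltW xr).
suff -> : EX P (fun o => expR (x * Z o)) = EX P (fun o => 1 * expR (x * Z o)) by [].
by apply: eq_EX => o; rewrite mul1r.
Qed.

Lemma mgf_gt0 x : `|x| <= rho -> 0 < mgf P Z x.
Proof.
move=> xr; rewrite lt_neqAle; apply/andP; split; last first.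
  by rewrite mgfE; apply: EX_ge0 => o; exact: expR_ge0.
apply/eqP => M0.
have [_ h1] := mom_ps m1 mZ rho0 iZ1 xr.
have h1' : ps_to nR (mom1 P Z) x 0.
  move: h1; congr (ps_to _ _ _ _); rewrite M0 mgfE; apply: eq_EX => o; by rewrite mul1r.
have [l h2] := ex_ps_to hS xr.
have := ps_toM absval_normr xr (sbnd_mom m1 mZ rho0 iZ1) hS h1' h2.
rewrite -/(mom1 P Z) conv_finv ?mom1_0 // mul0r => h.
by have := ps_to_delta absval_normr x; move/(slim_unique absval_normr h)/eqP; rewrite eq_sym oner_eq0.
Qed.

(** The coefficients of [M' / M], [M] being the moment-generating function. *)
Definition dlog_c : nat -> R := conv (finv (mom1 P Z)) (pseries_diffs (mom1 P Z)).

(** The coefficients of [ln M], obtained by integrating [M' / M]. *)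
Definition log_c n : R := if n is k.+1 then dlog_c k / k.+1%:R else 0.

Lemma diffs_log_c : pseries_diffs log_c = dlog_c.
Proof. by apply/funext => n; rewrite /pseries_diffs /log_c mulrC divfK // pnatr_eq0. Qed.

Lemma ln_mgf_derive x : `|x| < rho -> exists2 l, ps_to nR dlog_c x l &
  is_derive x 1 (fun th => ln (mgf P Z th)) l.
Proof.
move=> xr; have [l hl D] := ps_on_derive mgf_ps_on xr.
pose r := (`|x| + rho) / 2; have n0 := normr_ge0 x.
have xr1 : `|x| <= r by rewrite /r; lra.
have rr : r < rho by rewrite /r; lra.
have r0 := le_trans n0 xr1.
have [S1 mS1] := mgf_ps_on.1.
have dS := sbnd_diffs r0 rr mS1.
have vS := sbnd_le absval_normr r0 (ltW rr) hS.
have mS := sbnd_le absval_normr r0 (ltW rr) mS1.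
have [k hk] := ex_ps_to vS xr1.
have hm := mgf_ps_on.2 _ xr.
have M0 := mgf_gt0 (ltW xr).
have kE : (mgf P Z x)^-1 = k.
  have := ps_toM absval_normr xr1 mS vS hm hk; rewrite conv_finv ?mom1_0 // => h.
  have /(slim_unique absval_normr h) E := ps_to_delta absval_normr x.
  by apply: (mulfI (lt0r_neq0 M0)); rewrite E divff // gt_eqF.
exists (k * l); first exact: (ps_toM absval_normr xr1 vS dS hk hl).
by rewrite -kE; apply: is_derive1_comp; exact: is_derive1_ln.
Qed.

Lemma ps_on_dlog r : 0 <= r -> r < rho -> ps_on r dlog_c (derive1 (fun th => ln (mgf P Z th))).
Proof.
move=> r0 rr; split.
  have [[S1 mS1] _] := mgf_ps_on; eexists.
  exact: (sbnd_conv absval_normr r0 (sbnd_le absval_normr r0 (ltW rr) hS) (sbnd_diffs r0 rr mS1)).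
move=> x xr; have [l hl [_ D]] := ln_mgf_derive (lt_trans xr rr).
by rewrite derive1E D.
Qed.

Lemma cumulantE n : cumulant P Z n.+1 = n`!%:R * dlog_c n.
Proof.
have r20 : 0 < rho / 2 by rewrite divr_gt0.
have r2 : rho / 2 < rho by rewrite ltr_pdivrMr // ltr_pMr // ltr1n.
by rewrite /cumulant derive1Sn (ps_on_derive1n n r20 (ps_on_dlog (ltW r20) r2)).
Qed.

Lemma ln_mgf_ps r x : 0 < r -> r < rho -> 0 <= x < r -> ps_to nR log_c x (ln (mgf P Z x)).
Proof.
move=> r0 rr xr; have [[T dT] _] := ps_on_dlog (ltW r0) rr.
have lT : sbnd nR r log_c (r * T).
  case=> [|n]; first by rewrite big_ord0 mulr_ge0 ?(ltW r0) // (sbnd_ge0 dT).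
  rewrite big_ord_recl normr0 mul0r add0r; apply: (@le_trans _ _ (r * \sum_(i < n) `|dlog_c i| * r ^+ i)).
    rewrite mulr_sumr; apply: ler_sum => i _; rewrite /= normrM exprS mulrCA.
    rewrite ler_wpM2l ?(ltW r0) // ler_wpM2r ?exprn_ge0 ?(ltW r0) // ler_piMr //.
    by rewrite ger0_norm ?invr_ge0 // invf_le1 // ler1n.
  by rewrite ler_wpM2l ?(ltW r0).
pose g y := limn (series (fun n => log_c n * y ^+ n)).
have hg y : `|y| < r -> ps_to nR log_c y (g y).
  by move=> yr; have [l hl] := ex_ps_to lT (ltW yr); apply/ps_to_cvg; apply/cvg_ex; exists l; exact/ps_to_cvg.
have on_g : ps_on r log_c g by split => //; exists (r * T).
have -> : ln (mgf P Z x) = g x.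
  apply: (@ps_on_eq R r log_c (fun th => ln (mgf P Z th)) g r0 on_g _ _ _ x xr) => //.
    rewrite -[RHS](@ln1 R) mgfE -(@EX_cst _ _ _ P 1); congr (ln _).
    by apply: eq_EX => o; rewrite mul0r expR0.
  move=> y l yr; rewrite diffs_log_c => h.
  have [l' hl' D] := ln_mgf_derive (lt_trans yr rr).
  by rewrite (slim_unique absval_normr h hl').
by apply: hg; case/andP: xr => x0 xr; rewrite ger0_norm.
Qed.

End log_mgf_series.

(** * Densities of the cumulants *)

Section cumulant_densities.
Context {R : realType} {d : measure_display} {Omega : measurableType d}.
Variable P : probability Omega R.
Local Notation nR := (@Num.norm R R : R -> R).
Local Notation nC := (@normc R).
Variables (X : R -> Omega -> R) (a b rad : R).
Variables (K dK : R -> R -> cplx R -> cplx R -> cplx R) (B : R).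
Hypothesis H : cgf_data P X a b rad K dK B.
Let ab := cgf_ab H.
Let mX := cgf_meas H.
Let inab s : (s \in `[a, b]) = (a <= s <= b). Proof. by rewrite in_itv. Qed.

Variables (rho om : R).
Hypotheses (rho0 : 0 < rho) (om0 : 0 < om) (rr : rho + om < rad).

Let rhor : rho < rad. Proof. by apply: lt_trans rr; rewrite ltrDl. Qed.
Let omr : om < rad. Proof. by apply: lt_trans rr; rewrite ltrDr. Qed.
Let rrn : rho + `|om| < rad. Proof. by rewrite gtr0_norm. Qed.

Definition dKquot u (z : R[i]) : R[i] := dK u u (z - om%:C) om%:C / om%:C.

(** The coefficients of [d/du log M_u(th) / th], [M_u] being the generating function
    of [X_u]: up to a factorial, the derivatives of the cumulants. The arguments
    [(th - om, om)] of [dK] are those that [ratio_incr] meets; [cbeta_series] brings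
    them back to [(0, th)]. *)
Definition cbeta n u : R := complex.Re (circ_coef (dKquot u) rho n).

Let arg_lt y : normc (circ rho y - om%:C) < rad /\ normc (om%:C : R[i]) < rad.
Proof.
split; last by rewrite normc_real (le_lt_trans _ rrn) // lerDr ltW.
by rewrite (le_lt_trans (ler_normcB _ _)) // normc_circ // normc_real.
Qed.

Let normc_om (z : R[i]) : normc (z / om%:C) = normc z / om.
Proof. by rewrite normcM normcV normc_real gtr0_norm. Qed.

Lemma dKquot_bound u y : a <= u <= b -> normc (dKquot u (circ rho y)) <= B / om.
Proof.
move=> uab; have [z1 w1] := arg_lt y.
rewrite /dKquot normc_om ler_wpM2r ?invr_ge0 ?(ltW om0) //.
exact: (normc_dK H).
Qed.

Lemma dKquot_cont u : a <= u <= b -> ccirc rho (dKquot u).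
Proof.
move=> uab; apply: ccontP => y _ e e0.
have [z1 w1] := arg_lt y; have e'0 : 0 < e * om by rewrite mulr_gt0.
have [dl dl0 D] := dK_cont H uab uab z1 w1 e'0.
have dl20 : 0 < dl / 2 by rewrite divr_gt0.
have [dl' dl'0 D'] := circ_cont rho y dl20.
exists dl' => // y' _ yy; have [z2 _] := arg_lt y'.
rewrite /dKquot -mulrBl normc_om ler_pdivrMr //; apply: D; rewrite ?subrr ?normr0 ?normc0 //.
have -> : circ rho y' - om%:C - (circ rho y - om%:C) = circ rho y' - circ rho y by ring.
by rewrite (le_lt_trans (D' _ yy)) // ltr_pdivrMr // ltr_pMr // ltr1n.
Qed.

Lemma cbeta_bound n u : a <= u <= b -> `|cbeta n u| * rho ^+ n <= 2 * (B / om).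
Proof.
move=> uab; apply: le_trans (normc_circ_coef n rho0 (dKquot_cont uab) (fun y _ => dKquot_bound y uab)).
by rewrite ler_wpM2r ?exprn_ge0 ?(ltW rho0) // normc_Re.
Qed.

Lemma cbeta_cont n : econt a b (cbeta n).
Proof.
move=> u uab e e0; have rn : 0 < rho ^+ n by rewrite exprn_gt0.
have e'0 : 0 < e * rho ^+ n * om / 2 by rewrite divr_gt0 // !mulr_gt0.
have [dl dl0 D] := dK_circ_unif H rho0 rrn e'0.
exists dl => // v vab vu; rewrite -(ler_pM2r rn).
have cu := dKquot_cont uab; have cv := dKquot_cont vab.
rewrite /cbeta -ReN -ReD -circ_coefB //.
apply: (@le_trans _ _ (normc (circ_coef (fun z => dKquot v z - dKquot u z) rho n) * rho ^+ n)).
  by rewrite ler_pM2r // normc_Re.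
have -> : e * rho ^+ n = 2 * (e * rho ^+ n / 2) by field.
apply: (normc_circ_coef n rho0 (ccontB cv cu)) => y y2.
rewrite /dKquot -mulrBl normc_om ler_pdivrMr //.
have -> : e * rho ^+ n / 2 * om = e * rho ^+ n * om / 2 by ring.
exact: D.
Qed.

Lemma jcum_ps u v (th : R[i]) : a <= u <= b -> a <= v <= b -> normc th <= rho ->
  ps_to nC (fun n => (jcum P (X v \- X u) (X u) n)%:C) th ((cmgf P X u th)^-1 * incr_cmom P X u v th).
Proof.
move=> uab vab tr; have [Si hSi hv] := finv_mom1_sbnd H uab rho0 rhor.
have mY : measurable_fun setT (X v \- X u) by apply: measurable_funB; exact: mX.
have iY : integ P (fun o => `|(X v \- X u) o| * expR (rho * `|X u o|)).
  by apply: (integ_incr_exp H uab vab); rewrite ltW.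
rewrite /jcum -conv_realC.
apply: (ps_toM absval_normc tr (sbnd_realC hSi) (sbnd_realC (sbnd_mom mY (mX uab) rho0 iY)) (hv _ tr)).
exact: (cmoment_series mY (mX uab) rho0 iY tr).
Qed.

Lemma sbnd_jcum_incr u v : a <= u <= b -> a <= v <= b ->
  exists S, sbnd nR rho (jcum P (X v \- X u) (X u)) S.
Proof.
move=> uab vab; have [Si hSi _] := finv_mom1_sbnd H uab rho0 rhor.
have mY : measurable_fun setT (X v \- X u) by apply: measurable_funB; exact: mX.
eexists; apply: (sbnd_jcum mY (mX uab) rho0 _ hSi).
by apply: (integ_incr_exp H uab vab); rewrite ltW.
Qed.

(** [ratio_incr] compares the corresponding functions on the circle, so the error is
    uniform in [n] with weight [rho ^+ n]. *)
Lemma jcum_incr e : 0 < e -> exists2 dl : R, 0 < dl & forall u v n,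
  a <= u <= b -> a <= v <= b -> `|v - u| < dl ->
  `|jcum P (X v \- X u) (X u) n - (v - u) * cbeta n u| * rho ^+ n <= e * `|v - u|.
Proof.
move=> e0; have e20 : 0 < e / 2 by rewrite divr_gt0.
have [dl dl0 D] := ratio_incr H rho0 om0 rr e20; exists dl => // u v n uab vab uv.
have [S hS] := sbnd_jcum_incr uab vab.
have cu := dKquot_cont uab.
have cvu : ccirc rho (fun z => (v - u)%:C * dKquot u z) by exact: ccontZ.
have -> : e * `|v - u| = 2 * (e / 2 * `|v - u|) by field.
have -> : (v - u) * cbeta n u = complex.Re (circ_coef (fun z => (v - u)%:C * dKquot u z) rho n).
  by rewrite circ_coefZ // ReM mul0r subr0.
apply: (coef_approx n rho0 hS cvu (F := fun y => (cmgf P X u (circ rho y))^-1 * incr_cmom P X u v (circ rho y))).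
  by move=> y _; apply: jcum_ps => //; rewrite normc_circ.
by move=> y y2; exact: D.
Qed.

End cumulant_densities.

Section cumulant_derivative.
Context {R : realType} {d : measure_display} {Omega : measurableType d}.
Variable P : probability Omega R.
Local Notation nR := (@Num.norm R R : R -> R).
Local Notation nC := (@normc R).
Variables (X : R -> Omega -> R) (a b rad : R).
Variables (K dK : R -> R -> cplx R -> cplx R -> cplx R) (B : R).
Hypothesis H : cgf_data P X a b rad K dK B.
Let ab := cgf_ab H.
Let mX := cgf_meas H.

Variables (rho om : R).
Hypotheses (rho0 : 0 < rho) (om0 : 0 < om) (rr : rho + om < rad).
Let rhor : rho < rad. Proof. by apply: lt_trans rr; rewrite ltrDl. Qed.
Local Notation cbeta := (cbeta dK rho om).

Lemma near_time u dl : a <= u <= b -> 0 < dl -> exists v, [/\ a <= v <= b, `|v - u| < dl & v != u].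
Proof.
move=> /andP[au ub] dl0; pose k := Num.min (dl / 2) ((b - a) / 2).
have k0 : 0 < k by rewrite lt_min !divr_gt0 // subr_gt0.
have kd : k < dl by rewrite gt_min ltr_pdivrMr // ltr_pMr // ltr1n.
have kb : k <= (b - a) / 2 by rewrite ge_min lexx orbT.
have [um|mu] := leP u ((a + b) / 2).
  exists (u + k); rewrite addrAC subrr add0r gtr0_norm // -subr_eq0 addrAC subrr add0r gt_eqF //.
  by split => //; apply/andP; split; move: k0 kb um; lra.
exists (u - k); rewrite addrAC subrr add0r normrN gtr0_norm // -subr_eq0 addrAC subrr add0r oppr_eq0 gt_eqF //.
by split => //; apply/andP; split; move: k0 kb mu; lra.
Qed.

(** On the circle of radius [th], the choice [om = th] in [ratio_incr] involves
    [dK u u 0 th] only; both choices of [om] describe the same ratio to first order. *)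
Lemma cbeta_series u th : a <= u <= b -> 0 < th -> th < rho -> th + th < rad ->
  ps_to nR (fun n => cbeta n u) th (complex.Re (dK u u 0 th%:C) / th).
Proof.
move=> uab th0 tr ttr; pose C := 1 - th / rho.
have t1 : th / rho < 1 by rewrite ltr_pdivrMr // mul1r.
have t0 : 0 <= th / rho by rewrite divr_ge0 // ltW.
have C0 : 0 < C by rewrite subr_gt0.
have bS : forall n, `|cbeta n u| * rho ^+ n <= 2 * (B / om) := fun n => cbeta_bound H rho0 om0 rr n uab.
have B0 := cgf_B_ge0 H.
have hS : sbnd nR th (fun n => cbeta n u) (2 * (B / om) / C).
  by apply: (geom_sbnd (ltW th0) tr) => //; rewrite mulr_ge0 // divr_ge0 // ltW.
have nth : `|th| <= th by rewrite gtr0_norm.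
have [l hl] := ex_ps_to hS nth; suff -> : complex.Re (dK u u 0 th%:C) / th = l by [].
apply/eqP; rewrite -subr_eq0 -normr_le0; apply/ler_addgt0Pl => e e0; rewrite addr0.
(* summing the errors of [D1] over the orders costs the factor [C^-1] *)
pose e' := e / (1 + C^-1).
have C1 : 0 < 1 + C^-1 by rewrite ltr_pwDl // invr_ge0 ltW.
have e'0 : 0 < e' by rewrite divr_gt0.
have [d1 d10 D1] := jcum_incr H rho0 om0 rr e'0.
have [d2 d20 D2] := ratio_incr H th0 th0 ttr e'0.
have [|v [vab vu vne]] := @near_time u (Num.min d1 d2) uab; first by rewrite lt_min d10.
move: vu; rewrite lt_min => /andP[/(D1 u v _ uab vab) {}D1].
have y0 : 0 <= (0 : R) <= 2 * pi by rewrite lexx mulr_ge0 // pi_ge0.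
move=> /(D2 u v 0 uab vab y0); rewrite /dKlog circ0 // subrr; set J := _^-1 * _ => {}D2.
have tr' : normc (th%:C : R[i]) <= rho by rewrite normc_real gtr0_norm // ltW.
have := ps_to_Re (jcum_ps H rho0 om0 rr uab vab tr'); rewrite -/J => hJ.
have vu0 : 0 < `|v - u| by rewrite normr_gt0 subr_eq0.
have h1 : `|complex.Re J - (v - u) * l| <= e' * C^-1 * `|v - u|.
  have h := slimB hJ (slimZ absval_normr (v - u) hl).
  apply: (slim_le absval_normr h) => n /=.
  rewrite mulr_sumr -sumrB; apply: (le_trans (ler_norm_sum _ _ _)).
  under eq_bigr do rewrite mulrA -mulrBl.
  have hg k : `|(jcum P (X v \- X u) (X u) k - (v - u) * cbeta k u)| * rho ^+ k <= e' * `|v - u| by exact: D1.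
  have ev0 : 0 <= e' * `|v - u| by rewrite mulr_ge0 // ltW.
  have := geom_sbnd (ltW th0) tr ev0 hg n; rewrite -/C.
  rewrite [X in _ -> _ <= X]mulrAC; apply: le_trans; apply: ler_sum => i _.
  by rewrite normrM normrX [`|th|]gtr0_norm.
have h2 : `|complex.Re J - (v - u) * (complex.Re (dK u u 0 th%:C) / th)| <= e' * `|v - u|.
  apply: le_trans D2.
  have -> : (v - u) * (complex.Re (dK u u 0 th%:C) / th) = complex.Re ((v - u)%:C * (dK u u 0 th%:C / th%:C)).
    rewrite ReM mul0r subr0; congr (_ * _).
    by rewrite -fmorphV ReM mulr0 subr0.
  by rewrite -ReN -ReD normc_Re.
rewrite -(ler_pM2r vu0) -normrM.
have -> : (complex.Re (dK u u 0 th%:C) / th - l) * (v - u) =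
   (complex.Re J - (v - u) * l) - (complex.Re J - (v - u) * (complex.Re (dK u u 0 th%:C) / th)) by ring.
rewrite (le_trans (ler_normB _ _)) //.
have -> : e * `|v - u| = e' * C^-1 * `|v - u| + e' * `|v - u|.
  have eE : e = e' * (1 + C^-1) by rewrite /e' divfK // gt_eqF.
  by rewrite [X in X * _ = _]eE mulrDr mulr1 mulrDl addrC.
exact: lerD.
Qed.

End cumulant_derivative.

(** * Cumulants as integrals of their densities *)

Section uniform_series.
Context {R : realType}.
Local Notation nR := (@Num.norm R R : R -> R).
Implicit Types (a b u v th rho S : R).

Lemma geom_tail (c : nat -> R) rho th S l N : 0 <= th -> th < rho -> 0 <= S ->
  (forall n, `|c n| * rho ^+ n <= S) -> ps_to nR c th l ->
  `|\sum_(i < N) c i * th ^+ i - l| <= S * (th / rho) ^+ N / (1 - th / rho).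
Proof.
move=> t0 tr S0 cS cl; have rho0 : 0 < rho by exact: le_lt_trans t0 tr.
have tS : forall n, `|c (N + n)%N * th ^+ N| * rho ^+ n <= S * (th / rho) ^+ N.
  move=> n; have -> : th ^+ N = (th / rho) ^+ N * rho ^+ N by rewrite -exprMn divfK // gt_eqF.
  rewrite !normrM !normrX ![`|th / rho|]ger0_norm ?divr_ge0 ?(ltW rho0) // [`|rho|]gtr0_norm //.
  have -> : `|c (N + n)%N| * ((th / rho) ^+ N * rho ^+ N) * rho ^+ n = `|c (N + n)%N| * rho ^+ (N + n) * (th / rho) ^+ N.
    by rewrite exprD; ring.
  by rewrite ler_wpM2r ?cS // exprn_ge0 // divr_ge0 // ltW.
have S'0 : 0 <= S * (th / rho) ^+ N by rewrite mulr_ge0 // exprn_ge0 // divr_ge0 // ltW.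
apply/ler_addgt0Pl => e e0; have [M HM] := cl e e0.
have := HM (N + M)%N (leq_addl _ _); rewrite big_split_ord /= => h.
set p := \sum_(i < N) _ in h *; set q := \sum_(i < M) _ in h.
have -> : p - l = (p + q - l) - q by ring.
rewrite (le_trans (ler_normB _ _)) // lerD //.
rewrite (le_trans (ler_norm_sum _ _ _)) //; apply: le_trans (geom_sbnd t0 tr S'0 tS M).
by apply: ler_sum => i _; rewrite exprD mulrA [in X in X <= _]normrM [`|th ^+ i|]ger0_norm ?exprn_ge0.
Qed.

Lemma geom_small (S q e : R) : 0 <= S -> 0 <= q -> q < 1 -> 0 < e -> exists N, S * q ^+ N / (1 - q) <= e.
Proof.
move=> S0 q0 q1 e0; have S1 : 0 < S / (1 - q) + 1 by rewrite ltr_wpDl // divr_ge0 // subr_ge0 ltW.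
have := @cvg_expr R q; rewrite ger0_norm // => /(_ q1) /cvgrPdist_le /(_ _ (divr_gt0 e0 S1)).
move=> [N _ h]; exists N; have := h N (leqnn N); rewrite sub0r normrN ger0_norm ?exprn_ge0 //.
rewrite ler_pdivlMr // => h'; apply: le_trans h'.
by rewrite mulrAC mulrC ler_wpM2l ?exprn_ge0 // lerDl.
Qed.

(** Geometric domination gives uniform convergence. *)
Lemma uniform_series a b (c : nat -> R -> R) g rho S th : 0 <= th -> th < rho ->
  (forall n, econt a b (c n)) -> (forall n u, a <= u <= b -> `|c n u| * rho ^+ n <= S) ->
  (forall u, a <= u <= b -> ps_to nR (fun n => c n u) th (g u)) ->
  econt a b g /\ forall v, a <= v <= b -> ps_to nR (fun n => rint a v (c n)) th (rint a v g).
Proof.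
move=> t0 tr cc cS cg; have rho0 : 0 < rho by exact: le_lt_trans t0 tr.
have q0 : 0 <= th / rho by rewrite divr_ge0 // ltW.
have q1 : th / rho < 1 by rewrite ltr_pdivrMr // mul1r.
have S0 u : a <= u <= b -> 0 <= S.
  by move=> uab; apply: le_trans (cS 0%N u uab); rewrite mulr_ge0.
have unif e : 0 < e -> exists N, forall M u, (N <= M)%N -> a <= u <= b -> `|\sum_(i < M) c i u * th ^+ i - g u| <= e.
  move=> e0; have [ab|ba] := leP a b; last first.
    by exists 0%N => M u _ /andP[au ub]; move: (lt_le_trans ba (le_trans au ub)); rewrite ltxx.
  have SS : 0 <= S by apply: (S0 a); rewrite lexx.
  have [N HN] := geom_small SS q0 q1 e0; exists N => M u NM uab.
  rewrite (le_trans (geom_tail M t0 tr SS (fun n => cS n u uab) (cg u uab))) // (le_trans _ HN) //.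
  rewrite ler_wpM2r ?invr_ge0 ?subr_ge0 ?(ltW q1) // ler_wpM2l //.
  by rewrite ler_wiXn2l // ltW.
have cs n : econt a b (fun u => \sum_(i < n) c i u * th ^+ i).
  apply: (@econt_sum R a b n (fun i u => c i u * th ^+ i)) => i.
  by apply: econtM; [exact: cc|exact: econt_cst].
have eg : econt a b g.
  move=> u uab e e0; have e30 : 0 < e / 3 by rewrite divr_gt0.
  have [N HN] := unif _ e30; have [dl dl0 D] := cs N u uab _ e30; exists dl => // v vab vu.
  have h1 := HN N v (leqnn N) vab; have h2 := HN N u (leqnn N) uab; have {}D := D v vab vu.
  move: h1 h2 D; set p := \sum_(i < N) _; set q := \sum_(i < N) _ => h1 h2 D.
  have -> : g v - g u = (p - q) - (p - g v) + (q - g u) by ring.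
  rewrite (le_trans (ler_normD _ _)) //.
  have -> : e = e / 3 + e / 3 + e / 3 by field.
  by rewrite lerD // (le_trans (ler_normB _ _)) // lerD.
split=> // v /andP[av vb] e e0.
have d0 : 0 < v - a + 1 by rewrite ltr_wpDl // subr_ge0.
have [N HN] := unif _ (divr_gt0 e0 d0); exists N => n Nn.
have av' := econtW (lexx a) vb.
have -> : \sum_(i < n) rint a v (c i) * th ^+ i = rint a v (fun u => \sum_(i < n) c i u * th ^+ i).
  rewrite (rint_sum n (F := fun i u => c i u * th ^+ i)) //; last first.
    by move=> i; apply: econtM; [exact: av' (cc i)|exact: econt_cst].
  apply: eq_bigr => i _; rewrite mulrC -rintZ; last exact: av' (cc i).
  by apply: eq_rint => x _; rewrite mulrC.
rewrite -rintB; [|exact: av' (cs n)|exact: av' eg].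
have bd x : a <= x <= v -> `|\sum_(i < n) c i x * th ^+ i - g x| <= e / (v - a + 1).
  by move=> /andP[ax xv]; apply: HN => //; rewrite ax (le_trans xv).
apply: (le_trans (ler_norm_rint av (econtB (av' _ (cs n)) (av' _ eg)) bd)).
by rewrite -mulrA ger_pMr // ler_pdivrMl // mulr1 lerDl.
Qed.

Lemma wdiff_ftc a b phi g v : wdiff a b phi g -> econt a b g -> a <= v <= b ->
  phi v - phi a = rint a v g.
Proof.
move=> dphi cg vab; have /andP[av vb] := vab.
have aab : a <= a <= b by rewrite lexx (le_trans av).
have D := wdiffD dphi (wdiffZ (-1) (wdiff_rint cg)).
have := @wdiff_le _ _ _ _ _ 0 D _ a v aab vab.
have g0 x : a <= x <= b -> `|g x + -1 * g x| <= 0 by rewrite mulN1r subrr normr0.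
move=> /(_ g0); rewrite mul0r normr_le0 subr_eq0 => /eqP.
have raa : rint a a g = 0 by rewrite /rint set_itv1 Rintegral_set1.
by rewrite raa mulr0 addr0 => <-; rewrite mulN1r; ring.
Qed.

End uniform_series.

Section cumulant_integral.
Context {R : realType} {d : measure_display} {Omega : measurableType d}.
Variable P : probability Omega R.
Local Notation nR := (@Num.norm R R : R -> R).
Local Notation nC := (@normc R).
Variables (X : R -> Omega -> R) (a b rad : R).
Variables (K dK : R -> R -> cplx R -> cplx R -> cplx R) (B : R).
Hypothesis H : cgf_data P X a b rad K dK B.
Let ab := cgf_ab H.
Let mX := cgf_meas H.
Let inab s : (s \in `[a, b]) = (a <= s <= b). Proof. by rewrite in_itv. Qed.

(** For real arguments [ln M_v] is the real part of [K u v 0]. *)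
Lemma ln_mgf_wdiff th : `|th| < rad ->
  wdiff a b (fun u => ln (mgf P (X u) th)) (fun u => complex.Re (dK u u 0 th%:C)).
Proof.
move=> tr u uab e e0.
have z0 : normc (0 : R[i]) < rad by rewrite normc0 (cgf_rad H).
have w0 : normc (th%:C : R[i]) < rad by rewrite normc_real.
have r0 := cgf_rad H.
have [d1 _] := @is_deriv_within_wdiff R a b (fun v => K u v 0 th%:C) (fun v => dK u v 0 th%:C)
  (fun t tab => cgf_deriv H (etrans (inab u) uab) (etrans (inab t) tab) (cdiskE z0) (cdiskE w0)).
have mE v : a <= v <= b -> ln (mgf P (X v) th) = complex.Re (K u v 0 th%:C).
  move=> vab; rewrite -[RHS]expRK -normc_cexp -(cmgf2_K H uab vab z0 w0).
  have n0 : `|0 : R| < rad by rewrite normr0.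
  have -> : cmgf2 P X u v 0 th%:C = (EX P (fun o => expR (0 * X u o + th * X v o)))%:C.
    exact: (cmgf2_real P X u v n0 tr).
  rewrite normc_real ger0_norm; last by apply: EX_ge0 => o; exact: expR_ge0.
  by rewrite mgfE; congr ln; apply: eq_EX => o; rewrite mul0r add0r.
have [dl dl0 D] := d1 u uab e e0; exists dl => // v vab vu.
by rewrite !mE //; exact: D.
Qed.

Variables (rho om : R).
Hypotheses (rho0 : 0 < rho) (om0 : 0 < om) (rr : rho + om < rad).
Let rhor : rho < rad. Proof. by apply: lt_trans rr; rewrite ltrDl. Qed.
Local Notation cbeta := (cbeta dK rho om).

(** Integrate in time the series of [d/du ln M_u(x)] and compare the coefficients of
    its powers of [x]. *)
Lemma log_c_rint v n : a <= v <= b ->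
  log_c P (X v) n.+1 = log_c P (X a) n.+1 + rint a v (cbeta n).
Proof.
move=> vab; have aab : a <= a <= b by rewrite lexx ltW.
(* the time integral of [th * \sum_n cbeta n u * th ^ n] *)
pose q k := if k is j.+1 then rint a v (cbeta j) else 0.
pose t0 := Num.min (rho / 2) (rad / 2).
have t00 : 0 < t0 by rewrite lt_min !divr_gt0 // (cgf_rad H).
suff E : (fun n => log_c P (X v) n + -1 * log_c P (X a) n) = q.
  by have := congr1 (fun f => f n.+1) E; rewrite /q mulN1r => <-; rewrite addrC subrK.
have rho2 : rho / 2 < rho by rewrite ltr_pdivrMr // ltr_pMr // ltr1n.
have lp u x : a <= u <= b -> 0 < x -> x < t0 -> ps_to nR (log_c P (X u)) x (ln (mgf P (X u) x)).
  move=> uab x0; rewrite lt_min => /andP[xr _]; have [Si hSi _] := finv_mom1_sbnd H uab rho0 rhor.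
  have iu : integ P (fun o => expR (rho * `|X u o|)) by apply: (integ_expX H uab); rewrite ltW.
  by apply: (ln_mgf_ps (mX uab) rho0 iu hSi _ rho2); rewrite ?divr_gt0 // ltW.
apply: (@ps_unique R t0 _ _ (fun x => ln (mgf P (X v) x) - ln (mgf P (X a) x))) => // x x0 xt.
  have := ps_toD absval_normr (lp v x vab x0 xt) (ps_toZ absval_normr (-1) (lp a x aab x0 xt)).
  by rewrite mulN1r.
move: xt; rewrite lt_min => /andP[xrho xrad].
have x1 : x < rho by exact: lt_trans xrho rho2.
have x2 : x + x < rad by move: xrad; lra.
have xr : `|x| < rad by rewrite gtr0_norm //; exact: lt_trans x1 rhor.
have bnd n u := @cbeta_bound _ _ _ _ _ _ _ _ _ _ _ H rho om rho0 om0 rr n u.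
have ser u (uab : a <= u <= b) := cbeta_series H rho0 om0 rr uab x0 x1 x2.
have [cg /(_ v vab) hg] := uniform_series (ltW x0) x1 (cbeta_cont H rho0 om0 rr) bnd ser.
have cRe : econt a b (fun u => complex.Re (dK u u 0 x%:C)).
  have := econtM (@econt_cst R a b x) cg; congr econt; apply/funext => u.
  by rewrite mulrC divfK // gt_eqF.
rewrite (wdiff_ftc (ln_mgf_wdiff xr) cRe vab).
have cg' := econtW (lexx a) (proj2 (andP vab)) cg.
have -> : rint a v (fun u => complex.Re (dK u u 0 x%:C)) = x * rint a v (fun u => complex.Re (dK u u 0 x%:C) / x).
  by rewrite -rintZ //; apply: eq_rint => u _; rewrite mulrC divfK // gt_eqF.
apply: slim_shift; have := slimZ absval_normr x hg; congr (slim _ _ _).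
apply/funext => k; rewrite mulr_sumr big_ord_recl /= mul0r add0r; apply: eq_bigr => i _.
by rewrite /= exprS mulrCA.
Qed.

Lemma cumulant_rint v n : a <= v <= b ->
  cumulant P (X v) n.+1 = cumulant P (X a) n.+1 + n.+1`!%:R * rint a v (cbeta n).
Proof.
move=> vab; have aab : a <= a <= b by rewrite lexx ltW.
have E u : a <= u <= b -> cumulant P (X u) n.+1 = n.+1`!%:R * log_c P (X u) n.+1.
  move=> uab; have [Si hSi _] := finv_mom1_sbnd H uab rho0 rhor.
  have iu : integ P (fun o => expR (rho * `|X u o|)) by apply: (integ_expX H uab); rewrite ltW.
  rewrite (cumulantE (mX uab) rho0 iu hSi) /= factS natrM [RHS]mulrC -mulrA.
  by rewrite mulKf ?pnatr_eq0 // mulrC.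
by rewrite !E // log_c_rint // mulrDr.
Qed.

End cumulant_integral.

(** * Riemann sums along paths of finite variation *)

Section riemann_sums.
Context {R : realType}.
Implicit Types (a b s t u v c q e M : R) (p : seq R) (tau : nat -> R).

Fixpoint vsum (g : R -> R -> R) a p : R := if p is y :: p' then g a y + vsum g y p' else 0.

(** The partition whose points are those of [p] and the tags. *)
Fixpoint refine p tau : seq R :=
  if p is y :: p' then tau 0%N :: y :: refine p' (fun i => tau i.+1) else [::].

Lemma ppoint_cons a y p i : (i <= size p)%N -> ppoint a (y :: p) i.+1 = ppoint y p i.
Proof. by move=> ip; rewrite /ppoint /=; apply: set_nth_default. Qed.

Lemma sum_steps (g : nat -> R -> R -> R) a y p :
  \sum_(0 <= i < size (y :: p)) g i (ppoint a (y :: p) i) (ppoint a (y :: p) i.+1) =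
  g 0%N a y + \sum_(0 <= i < size p) g i.+1 (ppoint y p i) (ppoint y p i.+1).
Proof.
rewrite /= big_nat_recl //; congr (_ + _).
by apply: eq_big_nat => i /andP[_ ip]; rewrite !ppoint_cons // ltnW.
Qed.

Lemma sum_ppoint (g : R -> R -> R) a p :
  \sum_(0 <= i < size p) g (ppoint a p i) (ppoint a p i.+1) = vsum g a p.
Proof.
elim: p a => [|y p IH] a; first by rewrite big_nil.
by rewrite (sum_steps (fun=> g)) IH.
Qed.

Lemma vsum_refine (g : R -> R -> R) a p tau : vsum g a (refine p tau) =
  \sum_(0 <= i < size p) (g (ppoint a p i) (tau i) + g (tau i) (ppoint a p i.+1)).
Proof.
elim: p a tau => [|y p IH] a tau; first by rewrite big_nil.
rewrite (sum_steps (fun i u v => g u (tau i) + g (tau i) v)) /= IH.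
by rewrite addrA.
Qed.

Lemma refine_path a p tau : path <%R a p ->
  (forall i, (i < size p)%N -> ppoint a p i <= tau i <= ppoint a p i.+1) ->
  path <=%R a (refine p tau) /\ last a (refine p tau) = last a p.
Proof.
elim: p a tau => [//|y p IH] a tau /= /andP[ay yp] H.
have /andP[-> ->] := H 0%N isT; apply: IH => // i ip.
by have := H i.+1 ip; rewrite !ppoint_cons // ltnW.
Qed.

(** Tags may coincide with points of the partition. *)
Lemma dedup_path (g : R -> R -> R) : (forall x, g x x = 0) -> forall a p, path <=%R a p ->
  exists p', [/\ path <%R a p', last a p' = last a p & vsum g a p' = vsum g a p].
Proof.
move=> g0 a p; elim: p a => [|y p IH] a /=; first by exists [::].
move=> /andP[ay yp]; have [p' [h1 h2 h3]] := IH y yp.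
move: ay; rewrite le_eqVlt => /orP[/eqP ->|ay]; first by exists p'; rewrite g0 add0r.
by exists (y :: p') => /=; rewrite ay h1 h2 h3.
Qed.

Lemma vsum_cat (g : R -> R -> R) a p p' : vsum g a (p ++ p') = vsum g a p + vsum g (last a p) p'.
Proof. by elim: p a => [|y p IH] a /=; rewrite ?add0r // IH addrA. Qed.

(** The tags become points of a partition of [[a, b]]; the two end pieces outside
    [[s, t]] only increase the sum. *)
Lemma variation_tagged q a b (x : R -> R) M : 0 < q ->
  (forall p, itv_partition a b p ->
     \sum_(0 <= i < size p) `|x (ppoint a p i.+1) - x (ppoint a p i)| `^ q <= M) ->
  forall s t p tau, a <= s -> t <= b -> itv_partition s t p ->
    (forall i, (i < size p)%N -> ppoint s p i <= tau i <= ppoint s p i.+1) ->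
    \sum_(0 <= i < size p) (`|x (tau i) - x (ppoint s p i)| `^ q +
       `|x (ppoint s p i.+1) - x (tau i)| `^ q) <= M.
Proof.
move=> q0 HM s t p tau as_ tb [sp /eqP pt] Htau.
pose g u v := `|x v - x u| `^ q.
have g0 u : g u u = 0 by rewrite /g subrr normr0 powR0 // gt_eqF.
have gge u v : 0 <= g u v by exact: powR_ge0.
have [rp rl] := refine_path sp Htau.
have pp : path <=%R a (s :: refine p tau ++ [:: b]).
  by rewrite /= as_ cat_path rp /= rl pt tb.
have [p' [h1 h2 h3]] := dedup_path g0 pp.
have hp' : itv_partition a b p' by split => //; rewrite h2 /= last_cat.
apply: le_trans (HM p' hp'); rewrite (sum_ppoint g) h3 /= vsum_cat.
rewrite (vsum_refine g) /= addr0.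
by rewrite addrCA lerDl addr_ge0.
Qed.

Lemma step_lt_mesh a p i e : mesh a p < e -> (i < size p)%N -> ppoint a p i.+1 - ppoint a p i < e.
Proof.
move=> me ip; apply: le_lt_trans me; rewrite /mesh.
by apply: (@le_bigmax_seq _ _ _ _ _ i) => //; rewrite mem_index_iota.
Qed.

Lemma ppoint_itv s t p i : itv_partition s t p -> (i <= size p)%N -> s <= ppoint s p i <= t.
Proof.
move=> pst ip; rewrite /ppoint (@set_nth_default _ _ t) //.
by rewrite (itv_partition_nth_ge _ pst) // (itv_partition_nth_le _ pst).
Qed.

Lemma ppoint_lt s t p i : itv_partition s t p -> (i < size p)%N -> ppoint s p i < ppoint s p i.+1.
Proof. by move=> [sp _] ip; move/pathP: sp => /(_ s i ip). Qed.

(** As [q < 2], the squared increments of [x] sum to at most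
    [(sup of the increments) ^ (2 - q) * M], which vanishes with the mesh, and the
    increments of [A] telescope. *)
Lemma riemann_limit q a b (x : R -> R) M s t C (A : R -> R) (w : R -> R -> R -> R) : 0 < q -> q < 2 ->
  econt a b x ->
  (forall p, itv_partition a b p ->
     \sum_(0 <= i < size p) `|x (ppoint a p i.+1) - x (ppoint a p i)| `^ q <= M) ->
  a <= s -> t <= b -> 0 <= C ->
  (forall e, 0 < e -> exists2 dl : R, 0 < dl & forall u c v, s <= u -> u <= c -> c <= v -> v <= t ->
     v - u < dl -> `|A v - A u - w u c v| <= e * (v - u) + C * (`|x c - x u| ^+ 2 + `|x v - x c| ^+ 2)) ->
  forall e, 0 < e -> exists2 dl : R, 0 < dl & forall p tau, itv_partition s t p -> mesh s p < dl ->
    (forall i, (i < size p)%N -> ppoint s p i <= tau i <= ppoint s p i.+1) ->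
    `|\sum_(0 <= i < size p) w (ppoint s p i) (tau i) (ppoint s p i.+1) - (A t - A s)| <= e.
Proof.
move=> q0 q2 cx HM as_ tb C0 Hw e e0.
have e1 : 0 < e / 2 / (`|t - s| + 1) by rewrite !divr_gt0 // ltr_wpDl.
have [d1 d10 D1] := Hw _ e1.
have M1 : 0 < C * (`|M| + 1) + 1 by rewrite ltr_wpDl // mulr_ge0 // addr_ge0.
pose k := e / 2 / (C * (`|M| + 1) + 1).
have k0 : 0 < k by rewrite !divr_gt0.
(* increments below [eta] have squares below [k] times their [q]-th powers *)
pose eta := k `^ (2 - q)^-1.
have eta0 : 0 < eta by rewrite powR_gt0.
have q2' : 0 < 2 - q by rewrite subr_gt0.
have etaE : eta `^ (2 - q) = k by rewrite /eta -powRrM mulVf ?powRr1 ?ltW // gt_eqF.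
have [d2 d20 D2] := econt_unif cx eta0.
exists (Num.min d1 d2); first by rewrite lt_min d10.
move=> p tau pst; rewrite lt_min => /andP[m1 m2] Htau.
have Ast : A t - A s = \sum_(0 <= i < size p) (A (ppoint s p i.+1) - A (ppoint s p i)).
  by rewrite telescope_sumr // /ppoint (itv_partition_nth_size _ pst).
have tst : t - s = \sum_(0 <= i < size p) (ppoint s p i.+1 - ppoint s p i).
  by rewrite telescope_sumr // /ppoint (itv_partition_nth_size _ pst).
have sq u v : a <= u <= b -> a <= v <= b -> `|v - u| < d2 -> `|x v - x u| ^+ 2 <= k * `|x v - x u| `^ q.
  move=> uab vab uv; have h := D2 u v uab vab uv.
  have [->|n0] := eqVneq (`|x v - x u|) 0; first by rewrite expr0n /= mulr_ge0 ?powR_ge0 // ltW.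
  have n0' : 0 < `|x v - x u| by rewrite lt_neqAle eq_sym n0 normr_ge0.
  rewrite -powR_mulrn //; have -> : (2%:R : R) = (2 - q) + q by ring.
  rewrite powRD; last by rewrite n0 implybT.
  rewrite ler_wpM2r ?powR_ge0 // -etaE; by apply: ge0_ler_powR; rewrite ?nnegrE //; exact: ltW.
rewrite Ast distrC -sumrB.
have step i : (i < size p)%N ->
    `|A (ppoint s p i.+1) - A (ppoint s p i) - w (ppoint s p i) (tau i) (ppoint s p i.+1)| <=
    e / 2 / (`|t - s| + 1) * (ppoint s p i.+1 - ppoint s p i) +
    C * k * (`|x (tau i) - x (ppoint s p i)| `^ q + `|x (ppoint s p i.+1) - x (tau i)| `^ q).
  move=> ip; have /andP[u1 u2] := ppoint_itv pst (ltnW ip); have /andP[v1 v2] := ppoint_itv pst ip.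
  have /andP[c1 c2] := Htau i ip; have st1 := step_lt_mesh m1 ip; have st2 := step_lt_mesh m2 ip.
  move: (ppoint s p i) (ppoint s p i.+1) (tau i) u1 u2 v1 v2 c1 c2 st1 st2 => u v c u1 u2 v1 v2 c1 c2 st1 st2.
  apply: (le_trans (D1 u c v u1 c1 c2 v2 st1)); rewrite lerD2l -mulrA ler_wpM2l // mulrDr.
  have uab : a <= u <= b by rewrite (le_trans as_ u1) (le_trans u2 tb).
  have vab : a <= v <= b by rewrite (le_trans as_ v1) (le_trans v2 tb).
  have cab : a <= c <= b.
    by case/andP: uab => h _; case/andP: vab => _ h'; rewrite (le_trans h c1) (le_trans c2 h').
  apply: lerD; apply: sq => //; rewrite ger0_norm ?subr_ge0 //; apply: le_lt_trans st2.
    by rewrite lerD2r.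
  by rewrite lerD2l lerN2.
apply: (le_trans (ler_norm_sum _ _ _)).
apply: (@le_trans _ _ (e / 2 / (`|t - s| + 1) * (t - s) + C * k * M)).
  rewrite big_nat_cond; apply: le_trans (_ : \sum_(0 <= i < size p) (e / 2 / (`|t - s| + 1) * (ppoint s p i.+1 - ppoint s p i) +
    C * k * (`|x (tau i) - x (ppoint s p i)| `^ q + `|x (ppoint s p i.+1) - x (tau i)| `^ q)) <= _).
    rewrite [X in _ <= X]big_nat_cond; apply: ler_sum => i /andP[/andP[_ ip] _]; exact: step.
  rewrite big_split /= -!mulr_sumr -tst lerD2l.
  apply: ler_wpM2l; first by apply: mulr_ge0 => //; exact: ltW.
  exact: (variation_tagged q0 HM as_ tb pst Htau).
rewrite [X in _ <= X]splitr; apply: lerD.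
  rewrite -mulrA ger_pMr ?divr_gt0 // mulrC ler_pdivrMr ?ltr_wpDl // mul1r.
  by rewrite (le_trans (ler_norm _)) // lerDl.
rewrite mulrAC /k mulrA ler_pdivrMr // mulrC ler_pM2l ?divr_gt0 //.
have := ler_norm M; move: M1 => _; have := ler_wpM2l C0 (ler_norm M).
by rewrite mulrDr mulr1; move: C0; lra.
Qed.

End riemann_sums.

(** * Entire functions of exponential type *)

Section entire_functions.
Context {R : realType}.
Local Notation nR := (@Num.norm R R : R -> R).
Local Notation nC := (@normc R).

(** Stirling's upper bound, from [(1 + 1 / n) ^ (n + 1) >= e]. *)
Lemma fact_le_pow (n : nat) : n.+1`!%:R * expR n.+1%:R <= expR 1 * n.+1%:R ^+ n.+2 :> R.
Proof.
elim: n => [|n IH]; first by rewrite factS fact0 mul1r expr1n mulr1.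
have n1 : (0 : R) < n.+1%:R by rewrite ltr0n.
have n2 : (0 : R) < n.+2%:R by rewrite ltr0n.
rewrite factS natrM -[X in expR X]natr1 expRD.
have -> : n.+2%:R * n.+1`!%:R * (expR n.+1%:R * expR 1) = n.+2%:R * expR 1 * (n.+1`!%:R * expR n.+1%:R) :> R by ring.
apply: (@le_trans _ _ (n.+2%:R * expR 1 * (expR 1 * n.+1%:R ^+ n.+2))).
  by rewrite ler_wpM2l // mulr_ge0 // expR_ge0.
have -> : n.+2%:R * expR 1 * (expR 1 * n.+1%:R ^+ n.+2) = expR 1 * (n.+2%:R * (expR 1 * n.+1%:R ^+ n.+2)) :> R by ring.
rewrite ler_wpM2l ?expR_ge0 // [X in _ <= X]exprS ler_wpM2l //.
have h : n.+1%:R / n.+2%:R <= expR (- n.+2%:R^-1) :> R.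
  apply: le_trans (expR_ge1Dx _); have -> : n.+1%:R = n.+2%:R - 1 :> R by rewrite -[X in _ = X - 1]natr1 addrK.
  by rewrite mulrBl divff ?gt_eqF // mul1r.
have h2 : (n.+1%:R / n.+2%:R) ^+ n.+2 <= expR (- 1) :> R.
  have -> : expR (- 1 : R) = expR (- n.+2%:R^-1) ^+ n.+2.
    by rewrite -expRM_natl; congr expR; rewrite mulrN mulfV ?gt_eqF.
  by rewrite lerXn2r ?nnegrE ?expR_ge0 // divr_ge0.
rewrite -ler_pdivlMl ?expR_gt0 // -expRN; apply: le_trans (_ : expR (-1) * n.+2%:R ^+ n.+2 <= _) => //.
by rewrite -ler_pdivrMr ?exprn_gt0 // -expr_div_n.
Qed.

(** Cauchy's estimates [|c_n| <= 2 * C * exp (r * rho) / rho ^ n], optimal for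
    [rho = n / r], bound the derivatives at [0] by a multiple of [n * r ^ n], hence
    of the powers of any larger rate. *)
Lemma entire_efun rad (f : R -> R) : 0 < rad -> extends_entire_exp rad f ->
  exists h C r, [/\ 0 < r, r < rad, exptype C r h & f = efun h].
Proof.
move=> rad0 [g [eg gf [C [r0 [C0 r0r gb]]]]].
(* the given rate may be negative *)
pose r1 := Num.max r0 (rad / 2).
have r10 : 0 < r1 by rewrite lt_max divr_gt0 ?orbT.
have r1r : r1 < rad by rewrite gt_max r0r ltr_pdivrMr // ltr_pMr // ltr1n.
have gbound z : normc (g z) <= C * expR (r1 * normc z).
  have := gb z; rewrite normc_le normE /= => /le_trans; apply.
  rewrite ler_wpM2l ?(ltW C0) // ler_expR ler_wpM2r ?normc_ge0 //.
  by rewrite le_max lexx.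
have hg rho z : normc z < rho + 1 -> exists l, cdiff g z l.
  by move=> _; exists ('D_1 g z); apply: derivable_cdiff; exact: eg.
have tay rho : 0 < rho ->
    (forall n, normc (circ_coef g rho n) * rho ^+ n <= 2 * (C * expR (r1 * rho))) /\
    (forall z, normc z < rho -> ps_to nC (circ_coef g rho) z (g z)).
  move=> rho0; apply: (taylor_disc (hg rho) rho0) => [|y _]; first by rewrite ltrDl.
  by apply: (le_trans (gbound _)); rewrite -/(circ rho y) normc_circ.
pose c := circ_coef g 1.
have cE rho : 0 < rho -> circ_coef g rho = c.
  move=> rho0; have m0 : 0 < Num.min rho 1 by rewrite lt_min rho0 ltr01.
  apply: (@psC_unique R (Num.min rho 1) _ _ (fun x => g x%:C)) => // x x0; rewrite lt_min => /andP[x1 x2].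
    by apply: (tay _ rho0).2; rewrite normc_real gtr0_norm.
  by apply: (tay _ ltr01).2; rewrite normc_real gtr0_norm.
pose h n := n`!%:R * complex.Re (c n).
pose r2 := (r1 + rad) / 2.
have r12 : r1 < r2 by rewrite /r2; lra.
have r20 : 0 < r2 by exact: lt_trans r10 r12.
have r2r : r2 < rad by rewrite /r2; lra.
have cB n : `|complex.Re (c n)| * n`!%:R <= 2 * C * expR 1 * (n.+1%:R * r1 ^+ n).
  have [m mE] : exists m : R, m = n.-1.+1%:R by exists n.-1.+1%:R.
  have m0 : 0 < m by rewrite mE ltr0n.
  have rho0 : 0 < m / r1 by rewrite divr_gt0.
  have := (tay _ rho0).1 n; rewrite cE // (_ : r1 * (m / r1) = m) => [hc|]; last by rewrite mulrC divfK // gt_eqF.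
  have {}hc : `|complex.Re (c n)| * (m / r1) ^+ n <= 2 * (C * expR m).
    by apply: le_trans hc; rewrite ler_wpM2r ?exprn_ge0 ?(ltW rho0) // normc_Re.
  have hc' : `|complex.Re (c n)| * m ^+ n <= 2 * (C * expR m) * r1 ^+ n.
    by rewrite -ler_pdivrMr ?exprn_gt0 // -mulrA -expr_div_n.
  have C20 : 0 <= 2 * C by rewrite mulr_ge0 // ltW.
  clear hc; case: n mE hc' => [|n] /= mE hc'.
    by move: hc'; rewrite fact0 mE !expr0 !mulr1 mulrA.
  have mn : 0 < m ^+ n.+1 by rewrite exprn_gt0.
  rewrite -(ler_pM2r mn) mulrAC.
  apply: (@le_trans _ _ (2 * (C * expR m) * r1 ^+ n.+1 * n.+1`!%:R)); first by rewrite ler_wpM2r.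
  have -> : 2 * (C * expR m) * r1 ^+ n.+1 * n.+1`!%:R = 2 * C * r1 ^+ n.+1 * (n.+1`!%:R * expR m) by ring.
  apply: (@le_trans _ _ (2 * C * r1 ^+ n.+1 * (expR 1 * m ^+ n.+2))).
    by apply: ler_wpM2l; [rewrite mulr_ge0 ?exprn_ge0 // ltW|rewrite mE; exact: fact_le_pow].
  have -> : 2 * C * expR 1 * (n.+2%:R * r1 ^+ n.+1) * m ^+ n.+1 = 2 * C * r1 ^+ n.+1 * (expR 1 * (n.+2%:R * m ^+ n.+1)) by ring.
  apply: ler_wpM2l; first by rewrite mulr_ge0 ?exprn_ge0 // ltW.
  rewrite ler_wpM2l ?expR_ge0 // exprS ler_wpM2r ?exprn_ge0 ?(ltW m0) //.
  by rewrite mE ler_nat.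
exists h, (2 * C * expR 1 * (r2 / (r2 - r1))), r2; split => //.
  move=> n; rewrite /h normrM ger0_norm // mulrC; apply: (le_trans (cB n)).
  rewrite -[X in _ <= X]mulrA; apply: ler_wpM2l.
    by rewrite !mulr_ge0 ?expR_ge0 // ltW.
  have d0 : 0 < r2 - r1 by rewrite subr_gt0.
  by rewrite mulrAC -exprS ler_pdivlMr //; apply: subrX_ge; exact: ltW.
apply/funext => x; apply/esym; apply: cvg_lim; first exact: Rhausdorff.
have x1 : 0 < `|x| + 1 by rewrite ltr_wpDl.
have hx : normc (x%:C : R[i]) < `|x| + 1 by rewrite normc_real ltrDl.
have := (tay _ x1).2 _ hx; rewrite cE // gf => /ps_to_Re /ps_to_cvg.
have -> // : (fun n => h n * exp_c n * x ^+ n) = (fun n => complex.Re (c n) * x ^+ n).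
by apply/funext => n; rewrite /h [n`!%:R * _ * exp_c n]mulrAC fact_exp_c mul1r.
Qed.

End entire_functions.

(** * Wick sums along a path *)

Section efun_estimates.
Context {R : realType}.
Local Notation nR := (@Num.norm R R : R -> R).
Implicit Types (h : nat -> R) (C r x y L : R).

Lemma derive_mvt (f g : R -> R) : (forall x, is_derive x 1 f (g x)) -> forall x y,
  exists c, [/\ f y - f x = g c * (y - x), `|c - x| <= `|y - x| & forall L, `|x| <= L -> `|y| <= L -> `|c| <= L].
Proof.
move=> df.
have key x y : x <= y -> exists2 c, x <= c <= y & f y - f x = g c * (y - x).
  move=> xy; have cf : {within `[x, y], continuous f}.
    by apply: derivable_within_continuous => z _; have [] := df z.
  have [c] := @MVT_segment R f g x y xy (fun z _ => df z) cf.
  by rewrite in_itv /= => ? ?; exists c.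
move=> x y; have [xy|/ltW yx] := leP x y.
  have [c /andP[xc cy] E] := key x y xy; exists c; split => //.
    by rewrite !ger0_norm ?subr_ge0 // lerD2r.
  move=> L; rewrite !ler_norml => /andP[h1 _] /andP[_ h2].
  by rewrite (le_trans h1 xc) (le_trans cy h2).
have [c /andP[yc cx] E] := key y x yx; exists c; split.
- by rewrite -opprB E -mulrN opprB.
- by rewrite !ler0_norm ?subr_le0 // lerN2 lerD2r.
move=> L; rewrite !ler_norml => /andP[_ h1] /andP[h2 _].
by rewrite (le_trans h2 yc) (le_trans cx h1).
Qed.

Lemma efun_bounded C r h L x : 0 <= r -> exptype C r h -> `|x| <= L -> `|efun h x| <= C * expR (r * L).
Proof.
move=> r0 hC xL; apply: (le_trans (efun_le x r0 hC)).
by rewrite ler_wpM2l ?(exptype_C_ge0 hC) // ler_expR ler_wpM2l.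
Qed.

Lemma efun_lip C r h L x y : 0 <= r -> exptype C r h -> `|x| <= L -> `|y| <= L ->
  `|efun h y - efun h x| <= C * r * expR (r * L) * `|y - x|.
Proof.
move=> r0 hC xL yL; have [c [-> _ cL]] := derive_mvt (fun z => is_derive_efun z r0 hC) x y.
rewrite normrM ler_wpM2r //; have := exptype_shift 1 r0 hC; rewrite expr1 => h1.
exact: (efun_bounded r0 h1 (cL L xL yL)).
Qed.

Lemma efun_taylor C r h L x y : 0 <= r -> exptype C r h -> `|x| <= L -> `|y| <= L ->
  `|efun h y - efun h x - (y - x) * efun (nshift 1 h) x| <= C * r * r * expR (r * L) * `|y - x| ^+ 2.
Proof.
move=> r0 hC xL yL; have [c [-> cx cL]] := derive_mvt (fun z => is_derive_efun z r0 hC) x y.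
have -> : efun (nshift 1 h) c * (y - x) - (y - x) * efun (nshift 1 h) x =
  (efun (nshift 1 h) c - efun (nshift 1 h) x) * (y - x) by ring.
rewrite normrM expr2 mulrA ler_wpM2r //.
have := exptype_shift 1 r0 hC; rewrite expr1 => h1.
apply: (le_trans (efun_lip r0 h1 xL (cL L xL yL))).
by rewrite ler_wpM2l // !mulr_ge0 ?expR_ge0 // (exptype_C_ge0 hC).
Qed.

Lemma econt_efun C r h a b (x : R -> R) : 0 <= r -> exptype C r h -> econt a b x ->
  econt a b (fun u => efun h (x u)).
Proof.
move=> r0 hC cx; have [L L0 xL] := econt_bounded cx.
move=> u uab e e0; pose N := C * r * expR (r * L) + 1.
have N0 : 0 < N by rewrite ltr_wpDl // !mulr_ge0 ?expR_ge0 // (exptype_C_ge0 hC).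
have [dl dl0 D] := cx u uab _ (divr_gt0 e0 N0); exists dl => // v vab vu.
apply: (le_trans (efun_lip r0 hC (xL u uab) (xL v vab))).
have := D v vab vu; rewrite ler_pdivlMr // mulrC; apply: le_trans.
by rewrite ler_wpM2r // lerDl.
Qed.

(** The coefficients of the antiderivative vanishing at [0]. *)
Definition primitive h n : R := if n is k.+1 then h k else 0.

Lemma exptype_primitive C r h : 0 < r -> exptype C r h -> exptype (C / r) r (primitive h).
Proof.
move=> r0 hC [|n] /=.
  by rewrite normr0 mulr_ge0 ?exprn_ge0 ?divr_ge0 ?(exptype_C_ge0 hC) // ltW.
by rewrite exprS mulrA divfK ?gt_eqF.
Qed.

Lemma nshift_primitive h : nshift 1 (primitive h) = h.
Proof. by []. Qed.

End efun_estimates.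

Section wick_increments.
Context {R : realType} {d : measure_display} {Omega : measurableType d}.
Variable P : probability Omega R.
Local Notation nR := (@Num.norm R R : R -> R).
Local Notation nC := (@normc R).
Variables (X : R -> Omega -> R) (a b rad : R).
Variables (K dK : R -> R -> cplx R -> cplx R -> cplx R) (B : R).
Hypothesis H : cgf_data P X a b rad K dK B.
Let mX := cgf_meas H.

Variables (rho om r C : R).
Hypotheses (r0 : 0 < r) (rrho : r < rho) (om0 : 0 < om) (rr : rho + om < rad).
Let rho0 : 0 < rho. Proof. exact: lt_trans rrho. Qed.
Let rhor : rho < rad. Proof. by apply: lt_trans rr; rewrite ltrDl. Qed.
Let rrad : r < rad. Proof. exact: lt_trans rrho rhor. Qed.
Local Notation cbeta := (cbeta dK rho om).

Section one_function.
Variable h : nat -> R.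
Hypothesis hC : exptype C r h.

(** [wick_series] for an increment. *)
Lemma wick_prod_lim u v o D : a <= u <= b -> a <= v <= b ->
  slim nR (fun n => \sum_(i < n) jcum P (X v \- X u) (X u) i.+1 * efun (nshift i.+1 h) (X u o)) D ->
  slim nR (series (wick_term P (efun h) (X u) (X v \- X u) o)) (efun h (X u o) * (X v o - X u o) - D).
Proof.
move=> uab vab hD.
have mY : measurable_fun setT (X v \- X u) by apply: measurable_funB; exact: mX.
have [Si hSi _] := finv_mom1_sbnd H uab r0 rrad.
have rr' : 0 <= r < rad by rewrite ltW.
(* [exp (k * |X_v - X_u|) * exp (k * |X_u|)] has rate [2 * k < rad] in [X_u] *)
pose k := rad / 4; have rd0 := cgf_rad H.
have k0 : 0 < k by rewrite divr_gt0.
have k2 : 0 <= k + k < rad by apply/andP; split; rewrite /k; move: rd0; lra.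
have k1 : 0 <= k < rad by apply/andP; split; rewrite /k; move: rd0; lra.
have iYZ : integ P (fun o => expR (k * `|(X v \- X u) o|) * expR (k * `|X u o|)).
  apply: (@integ_le _ _ _ P _ _ _ _ (integ_exp H uab vab k2 k1)).
    by apply: measurable_funM; apply: measurableT_comp => //; apply: measurable_funM;
      by [exact: measurable_cst|apply: measurableT_comp => //; exact: mX].
  move=> o'; rewrite -expRD ger0_norm ?expR_ge0 // ler_expR.
  have := ler_normB (X v o') (X u o') => /(ler_wpM2l (ltW k0)); rewrite /=; lra.
have := wick_series mY (mX uab) k0 r0 iYZ (integ_expX H uab rr') (integ_incr_exp H uab vab rr') hSi hC hD.
by apply: eq_slim; apply/funext => n; rewrite /series /= big_mkord.
Qed.

Lemma jcum_slim u v o : a <= u <= b -> a <= v <= b ->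
  exists D, slim nR (fun n => \sum_(i < n) jcum P (X v \- X u) (X u) i.+1 * efun (nshift i.+1 h) (X u o)) D.
Proof.
move=> uab vab.
have mY : measurable_fun setT (X v \- X u) by apply: measurable_funB; exact: mX.
have [Si hSi _] := finv_mom1_sbnd H uab r0 rrad.
have rr' : 0 <= r < rad by rewrite ltW.
exact: (jcum_series_ex mY (mX uab) r0 (integ_incr_exp H uab vab rr') hSi hC).
Qed.

Lemma wick_cvg u v o : a <= u <= b -> a <= v <= b ->
  cvgn (series (wick_term P (efun h) (X u) (X v \- X u) o)).
Proof.
move=> uab vab; have [D hD] := jcum_slim o uab vab.
by apply/cvg_ex; eexists; apply/slim_cvg; exact: wick_prod_lim hD.
Qed.

Lemma cbeta_term_bound n u x : a <= u <= b ->
  `|cbeta n.+1 u * efun (nshift n.+1 h) x| * (rho / r) ^+ n <= 2 * (B / om) * C * expR (r * `|x|).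
Proof.
move=> uab; have bb := cbeta_bound H rho0 om0 rr n.+1 uab.
have eb := efun_le x (ltW r0) (exptype_shift n.+1 (ltW r0) hC).
have C0 := exptype_C_ge0 hC.
have q1 : 1 <= rho / r by rewrite ler_pdivlMr // mul1r ltW.
apply: (@le_trans _ _ (`|cbeta n.+1 u * efun (nshift n.+1 h) x| * (rho / r) ^+ n.+1)).
  by rewrite ler_wpM2l // exprS ler_peMl // exprn_ge0 // divr_ge0 // ltW.
rewrite normrM expr_div_n mulrACA.
have -> : 2 * (B / om) * C * expR (r * `|x|) = (2 * (B / om)) * (C * expR (r * `|x|)) by ring.
apply: ler_pM => //; try by rewrite ?mulr_ge0 ?invr_ge0 ?exprn_ge0 // ltW.
rewrite ler_pdivrMr ?exprn_gt0 //; apply: (le_trans eb).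
by rewrite mulrAC.
Qed.

Lemma cbeta_slim u x : a <= u <= b ->
  exists D, slim nR (fun n => \sum_(i < n) cbeta i.+1 u * efun (nshift i.+1 h) x) D.
Proof.
move=> uab; set S := 2 * (B / om) * C * expR (r * `|x|).
have bS n : `|cbeta n.+1 u * efun (nshift n.+1 h) x| * (rho / r) ^+ n <= S by exact: cbeta_term_bound.
have q1 : 1 < rho / r by rewrite ltr_pdivlMr // mul1r.
have S0 : 0 <= S by apply: le_trans (bS 0%N); rewrite mulr_ge0.
apply: (@ex_slim R (fun i => cbeta i.+1 u * efun (nshift i.+1 h) x) (S / (1 - 1 / (rho / r)))) => n.
have := geom_sbnd ler01 q1 S0 bS n.
by under eq_bigr do rewrite expr1n mulr1.
Qed.

End one_function.

(** The time density of the series [D] that [wick_series] subtracts; its integral is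
    the cumulant series, see [cumulant_series]. *)
Definition drift (h : nat -> R) u x : R :=
  limn (series (fun n => cbeta n.+1 u * efun (nshift n.+1 h) x)).

Lemma drift_slim h u x : exptype C r h -> a <= u <= b ->
  slim nR (fun n => \sum_(i < n) cbeta i.+1 u * efun (nshift i.+1 h) x) (drift h u x).
Proof.
move=> hC uab; have [D hD] := cbeta_slim hC x uab.
have E : series (fun n => cbeta n.+1 u * efun (nshift n.+1 h) x) =
   (fun n => \sum_(i < n) cbeta i.+1 u * efun (nshift i.+1 h) x).
  by apply/funext => n; rewrite /series /= big_mkord.
apply/slim_cvg; rewrite /drift E; apply/cvg_ex; exists D; exact/slim_cvg.
Qed.

(** Sum [jcum_incr] over the orders, with [r < rho]. *)
Lemma wick_incr e : 0 < e -> exists2 dl : R, 0 < dl & forall h u v o, exptype C r h ->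
  a <= u <= b -> a <= v <= b -> `|v - u| < dl ->
  `|wick_prod P (efun h) (X u) (X v \- X u) o -
    (efun h (X u o) * (X v o - X u o) - (v - u) * drift h u (X u o))| <= e * `|v - u| * expR (r * `|X u o|).
Proof.
move=> e0; pose q := 1 - r / rho.
have q0 : 0 < q by rewrite subr_gt0 ltr_pdivrMr // mul1r.
have C1 : 0 < `|C| + 1 by rewrite ltr_wpDl.
pose e1 := e * q / (`|C| + 1).
have e10 : 0 < e1 by rewrite divr_gt0 // mulr_gt0.
have [dl dl0 D] := jcum_incr H rho0 om0 rr e10; exists dl => // h u v o hC uab vab vu.
have C0 := exptype_C_ge0 hC.
have [J hJ] := jcum_slim hC o uab vab.
have -> : wick_prod P (efun h) (X u) (X v \- X u) o = efun h (X u o) * (X v o - X u o) - J.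
  by apply: cvg_lim; [exact: Rhausdorff|apply/slim_cvg; exact: wick_prod_lim hJ].
have -> : efun h (X u o) * (X v o - X u o) - J - (efun h (X u o) * (X v o - X u o) - (v - u) * drift h u (X u o)) =
   - (J - (v - u) * drift h u (X u o)) by ring.
rewrite normrN; have hd := slimB hJ (slimZ absval_normr (v - u) (drift_slim (X u o) hC uab)).
apply: (slim_le absval_normr hd) => n /=; rewrite mulr_sumr -sumrB.
set E := expR (r * `|X u o|); have E0 : 0 <= E by exact: expR_ge0.
pose c i := jcum P (X v \- X u) (X u) i - (v - u) * cbeta i u.
have cS i : `|c i| * rho ^+ i <= e1 * `|v - u| by exact: D.
have S0 : 0 <= e1 * `|v - u| by rewrite mulr_ge0 // ltW.
have gs := geom_sbnd (ltW r0) rrho S0 cS n.+1.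
have -> : e * `|v - u| * E = e1 * `|v - u| / q * ((`|C| + 1) * E).
  have -> : e = e1 * (`|C| + 1) / q by rewrite /e1 divfK ?mulfK // gt_eqF.
  ring.
apply: le_trans (_ : (\sum_(i < n.+1) `|c i| * r ^+ i) * ((`|C| + 1) * E) <= _); last first.
  by rewrite ler_wpM2r // mulr_ge0 // ltW.
rewrite big_ord_recl mulrDl; apply: (le_trans (ler_norm_sum _ _ _)).
rewrite -[X in X <= _]add0r lerD //.
  by rewrite !mulr_ge0 // ltW.
rewrite mulr_suml; apply: ler_sum => i _.
have -> : jcum P (X v \- X u) (X u) i.+1 * efun (nshift i.+1 h) (X u o) - (v - u) * (cbeta i.+1 u * efun (nshift i.+1 h) (X u o)) =
  c i.+1 * efun (nshift i.+1 h) (X u o) by rewrite /c; ring.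
rewrite normrM -mulrA ler_wpM2l //; apply: (le_trans (efun_le _ (ltW r0) (exptype_shift i.+1 (ltW r0) hC))).
rewrite -/E [C * _]mulrC -mulrA ler_wpM2l ?exprn_ge0 ?(ltW r0) // ler_wpM2r //.
by rewrite (le_trans (ler_norm C)) // lerDl.
Qed.

(** The error terms are those of [riemann_limit]; the tags are the left endpoints. *)
Lemma wick_sum_cvg (Hs : R -> nat -> R) s t o q M C2 (A : R -> R) : a <= s -> t <= b ->
  (forall u, s <= u <= t -> exptype C r (Hs u)) ->
  0 < q -> q < 2 -> econt a b (fun u => X u o) ->
  (forall p, itv_partition a b p ->
     \sum_(0 <= i < size p) `|X (ppoint a p i.+1) o - X (ppoint a p i) o| `^ q <= M) -> 0 <= C2 ->
  (forall e, 0 < e -> exists2 dl : R, 0 < dl & forall u v, s <= u -> u <= v -> v <= t -> v - u < dl ->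
    `|A v - A u - (efun (Hs u) (X u o) * (X v o - X u o) - (v - u) * drift (Hs u) u (X u o))|
     <= e * (v - u) + C2 * `|X v o - X u o| ^+ 2) ->
  forall p : nat -> seq R, (forall m, itv_partition s t (p m)) ->
    (mesh s (p m) @[m --> \oo] --> (0 : R)) ->
    wick_sum P (fun u => efun (Hs u)) X s (p m) o @[m --> \oo] --> A t - A s.
Proof.
move=> as_ tb hHs q0 q2 cx HM C20 HA p pst pm.
have [L L0 xL] := econt_bounded cx.
have EL := expR_gt0 (r * L).
pose w u (_ : R) v := wick_prod P (efun (Hs u)) (X u) (X v \- X u) o.
have Hw e : 0 < e -> exists2 dl : R, 0 < dl & forall u c v, s <= u -> u <= c -> c <= v -> v <= t ->
     v - u < dl -> `|A v - A u - w u c v| <= e * (v - u) + (2 * C2) * (`|X c o - X u o| ^+ 2 + `|X v o - X c o| ^+ 2).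
  move=> e0; have e20 : 0 < e / 2 by rewrite divr_gt0.
  have [d1 d10 D1] := HA _ e20; have [d2 d20 D2] := wick_incr (divr_gt0 e20 EL).
  exists (Num.min d1 d2); first by rewrite lt_min d10.
  move=> u c v su uc cv vt; rewrite lt_min => /andP[uv1 uv2].
  have uv := le_trans uc cv; have ut := le_trans uv vt; have sv := le_trans su uv.
  have uab : a <= u <= b by rewrite (le_trans as_ su) (le_trans ut tb).
  have vab : a <= v <= b by rewrite (le_trans as_ sv) (le_trans vt tb).
  have vu0 : 0 <= v - u by rewrite subr_ge0.
  have ust : s <= u <= t by rewrite su.
  have := D2 (Hs u) u v o (hHs u ust) uab vab; rewrite ger0_norm // => /(_ uv2) h2.
  have h1 := D1 u v su uv vt uv1.
  set I := efun _ _ * _ - _ in h1 h2.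
  have -> : A v - A u - w u c v = (A v - A u - I) - (w u c v - I) by ring.
  rewrite (le_trans (ler_normB _ _)) //.
  have h3 : `|w u c v - I| <= e / 2 * (v - u).
    apply: (le_trans h2); rewrite mulrAC ler_wpM2r // mulrAC ler_pdivrMr // ler_wpM2l ?(ltW e20) //.
    by rewrite ler_expR ler_wpM2l ?(ltW r0) ?xL.
  (* [riemann_limit] asks for an estimate through every intermediate tag [c] *)
  have h4 : `|X v o - X u o| ^+ 2 <= 2 * (`|X c o - X u o| ^+ 2 + `|X v o - X c o| ^+ 2).
    have -> : X v o - X u o = (X c o - X u o) + (X v o - X c o) by ring.
    rewrite !real_normK ?num_real //; move: (X c o - X u o) (X v o - X c o) => x y.
    by have := sqr_ge0 (x - y); lra.
  have h5 := ler_wpM2l C20 h4.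
  move: h1 h3 h5; set n1 := `|A v - A u - I|; set n2 := `|w u c v - I|.
  set n3 := _ + `|X v o - X c o| ^+ 2; lra.
have C22 : 0 <= 2 * C2 by rewrite mulr_ge0.
have key := riemann_limit q0 q2 cx HM as_ tb C22 Hw.
apply/cvgrPdist_le => e e0; have [dl dl0 D] := key e e0.
move/cvgrPdist_lt : pm => /(_ dl dl0); apply: filterS => m; rewrite sub0r normrN => ml.
rewrite distrC; apply: (D (p m) (fun i => ppoint s (p m) i)) => //.
  exact: le_lt_trans (ler_norm _) ml.
by move=> i ip; rewrite lexx /= ltW // (ppoint_lt (pst m)).
Qed.

End wick_increments.

(** * The chain rule along a path *)

Section interior_integrals.
Context {R : realType}.

(** Derivatives in time are known inside the interval only; the endpoints are
    negligible. *)
Lemma eq_rint_interior (s t : R) (f g : R -> R) : econt s t g -> (forall u, s < u < t -> f u = g u) ->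
  lebesgue_measure.-integrable `[s, t] (EFin \o f) /\ rint s t f = rint s t g.
Proof.
move=> cg fg; have ig := econt_integrable cg.
have mg : measurable_fun `[s, t] (EFin \o g) by exact: (measurable_int lebesgue_measure).
have mg' : measurable_fun `]s, t[ (EFin \o g).
  by apply: measurable_funS mg => //; exact: subset_itv_oo_cc.
have mf : measurable_fun `]s, t[ (EFin \o f).
  apply: eq_measurable_fun mg' => u; rewrite inE /= in_itv /= => ust.
  by rewrite fg.
have mf' : measurable_fun `[s, t] (EFin \o f).
  by apply/emeasurable_fun_itv_obnd_cbndP/emeasurable_fun_itv_bndo_bndcP.
split.
  move: ig; rewrite !integrable.unlock => /asboolP[_ ig]; apply/asboolP; split => //.
  rewrite integral_itv_bndoo; last by apply: measurableT_comp.
  move: ig; rewrite integral_itv_bndoo; last by apply: measurableT_comp.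
  by congr (_ < _)%E; apply: eq_integral => u; rewrite inE /= in_itv /= => ust; rewrite fg.
rewrite /rint /Rintegral integral_itv_bndoo // [in RHS]integral_itv_bndoo //; congr fine.
by apply: eq_integral => u; rewrite inE /= in_itv /= => ust; rewrite fg.
Qed.

End interior_integrals.

Section ito_formula.
Context {R : realType} {d : measure_display} {Omega : measurableType d}.
Variable P : probability Omega R.
Local Notation nR := (@Num.norm R R : R -> R).
Variables (X : R -> Omega -> R) (a b rad : R).
Variables (K dK : R -> R -> cplx R -> cplx R -> cplx R) (B : R).
Hypothesis H : cgf_data P X a b rad K dK B.

Variables (rho om r C : R).
Hypotheses (r0 : 0 < r) (rrho : r < rho) (om0 : 0 < om) (rr : rho + om < rad).
Let rho0 : 0 < rho. Proof. exact: lt_trans rrho. Qed.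
Local Notation cbeta := (cbeta dK rho om).
Local Notation drift := (drift dK rho om).

Lemma cumulant_wdiff n : wdiff a b (fun v => cumulant P (X v) n.+1) (fun u => n.+1`!%:R * cbeta n u).
Proof.
have D := wdiffZ n.+1`!%:R (wdiff_rint (cbeta_cont H rho0 om0 rr n)).
move=> u uab e e0; have [dl dl0 h] := D u uab e e0; exists dl => // v vab vu.
have := h v vab vu.
rewrite (cumulant_rint H rho0 om0 rr n vab) (cumulant_rint H rho0 om0 rr n uab).
move: (n.+1`!%:R) (cumulant P (X a) n.+1) => k c.
by have -> : c + k * rint a v (cbeta n) - (c + k * rint a u (cbeta n)) = k * rint a v (cbeta n) - k * rint a u (cbeta n) by ring.
Qed.

Lemma derive1_cumulant n u : a < u < b ->
  derive1 (fun v => cumulant P (X v) n.+1) u = n.+1`!%:R * cbeta n u.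
Proof.
by move=> uab; have [_ E] := wdiff_is_derive (cumulant_wdiff n) uab; rewrite derive1E E.
Qed.

Variable h : nat -> R.
Hypothesis hC : exptype C r h.
Variables (s t : R) (o : Omega).
Hypotheses (as_ : a <= s) (st : s < t) (tb : t <= b).
Hypothesis cx : econt a b (fun u => X u o).

Let term n u := cbeta n.+1 u * efun (nshift n.+1 h) (X u o).

Let term_series : econt s t (fun u => drift h u (X u o)) /\
  slim nR (fun n => \sum_(i < n) rint s t (term i)) (rint s t (fun u => drift h u (X u o))).
Proof.
have [L L0 xL] := econt_bounded cx.
have q1 : 1 < rho / r by rewrite ltr_pdivlMr // mul1r.
have stab u : s <= u <= t -> a <= u <= b.
  by move=> /andP[su ut]; rewrite (le_trans as_ su) (le_trans ut tb).
have ct n : econt s t (term n).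
  apply: (econtW as_ tb); apply: econtM; first exact: (cbeta_cont H rho0 om0 rr).
  exact: (econt_efun (ltW r0) (exptype_shift n.+1 (ltW r0) hC) cx).
have bd n u : s <= u <= t -> `|term n u| * (rho / r) ^+ n <= 2 * (B / om) * C * expR (r * L).
  move=> ust; have uab := stab u ust.
  apply: (le_trans (cbeta_term_bound H r0 rrho om0 rr hC n (X u o) uab)).
  apply: ler_wpM2l; last by rewrite ler_expR ler_wpM2l ?(ltW r0) ?xL.
  rewrite mulr_ge0 ?(exptype_C_ge0 hC) // mulr_ge0 // divr_ge0 ?(ltW om0) //.
  exact: cgf_B_ge0 H.
have ps u : s <= u <= t -> ps_to nR (fun n => term n u) 1 (drift h u (X u o)).
  move=> ust; have := drift_slim H r0 rrho om0 rr (X u o) hC (stab u ust).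
  by apply: eq_slim; apply/funext => n; apply: eq_bigr => i _; rewrite expr1n mulr1.
have [cd /(_ t) hp] := uniform_series ler01 q1 ct bd ps; split => //.
have tst : s <= t <= t by rewrite lexx ltW.
have := hp tst.
by apply: eq_slim; apply/funext => n; apply: eq_bigr => i _; rewrite expr1n mulr1.
Qed.

(** The terms are, up to a factorial, those of the series [drift], which converges
    uniformly in time. *)
Lemma cumulant_series (g : nat -> R -> R) :
  (forall n, (2 <= n)%N -> g n = efun (nshift n.-1 h)) ->
  is_cumulant_series P X g s t o (rint s t (fun u => drift h u (X u o))).
Proof.
move=> gE; have [cd hs] := term_series.
have ct n : econt s t (term n).
  apply: (econtW as_ tb); apply: econtM; first exact: (cbeta_cont H rho0 om0 rr).
  exact: (econt_efun (ltW r0) (exptype_shift n.+1 (ltW r0) hC) cx).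
have E n u : s < u < t -> cumulant_integrand P X (g n.+2) n.+2 o u = n.+2`!%:R * term n u.
  move=> /andP[su ut]; rewrite /cumulant_integrand gE // derive1_cumulant.
    by rewrite /term /= mulrC mulrA.
  by rewrite (le_lt_trans as_ su) (lt_le_trans ut tb).
have cZ n : econt s t (fun u => n.+2`!%:R * term n u) by apply: econtM => //; exact: econt_cst.
split=> [[//|[//|n]] _|]; first by have [] := eq_rint_interior (cZ n) (E n).
rewrite -(cvg_shiftn 2); move/slim_cvg: hs; apply: cvg_trans; apply: near_eq_cvg.
apply: nearW => N; rewrite /= addn2 -(big_mkord xpredT (fun i => rint s t (term i))) [RHS]big_add1 /= big_add1 /=.
apply: eq_bigr => n _; have [_ En] := eq_rint_interior (cZ n) (E n).
transitivity (n.+2`!%:R^-1 * rint s t (cumulant_integrand P X (g n.+2) n.+2 o)); last by [].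
rewrite En (rintZ n.+2`!%:R (ct n)) mulrA mulVf ?mul1r // pnatr_eq0 -lt0n fact_gt0.
Qed.

Variables (q M : R).
Hypotheses (q0 : 0 < q) (q2 : q < 2).
Hypothesis HM : forall p, itv_partition a b p ->
  \sum_(0 <= i < size p) `|X (ppoint a p i.+1) o - X (ppoint a p i) o| `^ q <= M.

Variables (hF : nat -> R) (C' : R).
Hypotheses (hF_C : exptype C' r hF) (hF_h : nshift 1 hF = h).

Let xs : econt s t (fun u => X u o) := econtW as_ tb cx.

Let C'0 : 0 <= C' := exptype_C_ge0 hF_C.

(** Expand the antiderivative at the tag: the error is quadratic in the increments. *)
Lemma young_efun : is_young_integral (fun u => efun h (X u o)) (fun u => X u o) s t
  (efun hF (X t o) - efun hF (X s o)).
Proof.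
have [L L0 xL] := econt_bounded cx.
pose C2 := C' * r * r * expR (r * L).
have C20 : 0 <= C2 by rewrite !mulr_ge0 ?expR_ge0 // ltW.
have C220 : 0 <= 4 * C2 by rewrite mulr_ge0.
have Hw e : 0 < e -> exists2 dl : R, 0 < dl & forall u c v, s <= u -> u <= c -> c <= v -> v <= t ->
     v - u < dl -> `|efun hF (X v o) - efun hF (X u o) - efun h (X c o) * (X v o - X u o)| <=
     e * (v - u) + (4 * C2) * (`|X c o - X u o| ^+ 2 + `|X v o - X c o| ^+ 2).
  move=> e0; exists 1 => // u c v su uc cv vt _.
  have sab z : s <= z -> z <= t -> `|X z o| <= L.
    by move=> sz zt; apply: xL; rewrite (le_trans as_ sz) (le_trans zt tb).
  have xu := sab u su (le_trans uc (le_trans cv vt)).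
  have xc := sab c (le_trans su uc) (le_trans cv vt).
  have xv := sab v (le_trans su (le_trans uc cv)) vt.
  have h1 := efun_taylor (ltW r0) hF_C xc xu; have h2 := efun_taylor (ltW r0) hF_C xc xv.
  rewrite hF_h -/C2 in h1 h2.
  have -> : efun hF (X v o) - efun hF (X u o) - efun h (X c o) * (X v o - X u o) =
    (efun hF (X v o) - efun hF (X c o) - (X v o - X c o) * efun h (X c o)) -
    (efun hF (X u o) - efun hF (X c o) - (X u o - X c o) * efun h (X c o)) by ring.
  rewrite (le_trans (ler_normB _ _)) //; rewrite [`|X u o - _|]distrC in h1.
  have vu0 : 0 <= v - u by rewrite subr_ge0 (le_trans uc).
  have evu : 0 <= e * (v - u) by rewrite mulr_ge0 // ltW.
  have s1 := mulr_ge0 C20 (exprn_ge0 2 (normr_ge0 (X c o - X u o))).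
  have s2 := mulr_ge0 C20 (exprn_ge0 2 (normr_ge0 (X v o - X c o))).
  by move: h1 h2 s1 s2; lra.
have key := riemann_limit q0 q2 cx HM as_ tb C220 Hw.
move=> e e0; have e20 : 0 < e / 2 by rewrite divr_gt0.
have [dl dl0 D] := key _ e20; exists dl => // p tau pst mp ht.
by apply: le_lt_trans (D p tau pst mp ht) _; rewrite ltr_pdivrMr // ltr_pMr // ltr1n.
Qed.

(** The antiderivative of the integrand along the path, minus the integrated drift,
    satisfies [wick_sum_cvg]. *)
Lemma wick_efun (p : nat -> seq R) : (forall m, itv_partition s t (p m)) ->
  (mesh s (p m) @[m --> \oo] --> (0 : R)) ->
  wick_sum P (fun=> efun h) X s (p m) o @[m --> \oo] -->
    efun hF (X t o) - efun hF (X s o) - rint s t (fun u => drift h u (X u o)).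
Proof.
move=> pst pm; have [cd _] := term_series.
have [L L0 xL] := econt_bounded cx.
pose C2 := C' * r * r * expR (r * L).
have C20 : 0 <= C2 by rewrite !mulr_ge0 ?expR_ge0 // ltW.
pose A u := efun hF (X u o) - rint s u (fun u => drift h u (X u o)).
have -> : efun hF (X t o) - efun hF (X s o) - rint s t (fun u => drift h u (X u o)) = A t - A s.
  by rewrite /A (_ : rint s s _ = 0); [ring|rewrite /rint set_itv1 Rintegral_set1].
apply: (@wick_sum_cvg _ _ _ P X a b rad K dK B H rho om r C r0 rrho om0 rr (fun=> h) s t o q M C2 A as_ tb
  (fun _ _ => hC) q0 q2 cx HM C20 _ p pst pm) => e e0.
have [dl dl0 D] := wdiff_unif (wdiff_rint cd) cd e0; exists dl => // u v su uv vt vu.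
have ust : s <= u <= t by rewrite su (le_trans uv).
have vst : s <= v <= t by rewrite vt andbT (le_trans su).
have sab z : s <= z <= t -> `|X z o| <= L.
  by move=> /andP[sz zt]; apply: xL; rewrite (le_trans as_ sz) (le_trans zt tb).
have h1 := efun_taylor (ltW r0) hF_C (sab u ust) (sab v vst); rewrite hF_h -/C2 in h1.
have vu0 : 0 <= v - u by rewrite subr_ge0.
have := D u v ust vst; rewrite ger0_norm // => /(_ vu) h2.
have -> : A v - A u - (efun h (X u o) * (X v o - X u o) - (v - u) * drift h u (X u o)) =
  (efun hF (X v o) - efun hF (X u o) - (X v o - X u o) * efun h (X u o)) -
  (rint s v (fun u => drift h u (X u o)) - rint s u (fun u => drift h u (X u o)) - (v - u) * drift h u (X u o)).
  by rewrite /A; ring.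
by rewrite (le_trans (ler_normB _ _)) // addrC lerD.
Qed.

End ito_formula.

(** * Appell polynomials along a path *)

Section formal_derivatives.
Context {R : realType}.
Implicit Types (c e m : nat -> R).

Lemma diffs_conv c e : pseries_diffs (conv c e) =
  (fun n => conv (pseries_diffs c) e n + conv c (pseries_diffs e) n).
Proof.
apply/funext => n; pose p := \poly_(i < n.+2) c i; pose q := \poly_(i < n.+2) e i.
have -> : pseries_diffs (conv c e) n = ((p * q)^`())`_n.
  by rewrite coef_deriv /pseries_diffs (@conv_poly R c e n.+1 n.+1) // mulr_natl.
have dp (f : nat -> R) i : (i < n.+1)%N -> ((\poly_(j < n.+2) f j)^`())`_i = pseries_diffs f i.
  by move=> iN; rewrite coef_deriv coef_poly ltnS iN /pseries_diffs mulr_natl.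
have cp (f : nat -> R) i : (i < n.+1)%N -> (\poly_(j < n.+2) f j)`_i = f i.
  by move=> iN; rewrite coef_poly ltnS ltnW.
rewrite derivM coefD !coefM /conv; congr (_ + _); apply: eq_bigr => i _.
  by rewrite dp // cp // ltnS leq_subr.
by rewrite cp // dp // ltnS leq_subr.
Qed.

Lemma diffs_finv m : m 0%N = 1 ->
  pseries_diffs (finv m) = (fun n => - conv (conv (finv m) (pseries_diffs m)) (finv m) n).
Proof.
move=> m0; set i := finv m.
have h : (fun n => conv (pseries_diffs m) i n + conv m (pseries_diffs i) n) = (fun=> 0).
  rewrite -diffs_conv (conv_finv m0); apply/funext => n.
  by rewrite /pseries_diffs /delta0 mulr0.
have h2 : conv i (fun n => conv (pseries_diffs m) i n + conv m (pseries_diffs i) n) = (fun=> 0).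
  by rewrite h; apply/funext => n; rewrite /conv big1 // => k _; rewrite mulr0.
move: h2; rewrite convC convDl => h2; apply/funext => n.
have := congr1 (fun f => f n) h2.
rewrite [conv (conv m _) i]convC convA [conv i m]convC (conv_finv m0) [conv delta0 _]convC conv_delta.
rewrite [conv (conv _ i) i]convC convA => /eqP; rewrite addrC addr_eq0 => /eqP ->.
by [].
Qed.

Definition fshift c n : R := if n is k.+1 then c k else 0.

(** Leibniz' rule for [(th * c) * (1 / m)]; together with [finv_rec] it solves the
    differential equation of [finv_wdiff] order by order. *)
Lemma diffs_fshift_conv m c n : m 0%N = 1 ->
  let l := conv (finv m) (pseries_diffs m) in
  n.+1%:R * conv (fshift c) (finv m) n.+1 =
  \sum_(k < n.+1) (k.+1%:R * c k * finv m (n - k)%N - l k * conv (fshift c) (finv m) (n - k)%N).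
Proof.
move=> m0 l; have -> : n.+1%:R * conv (fshift c) (finv m) n.+1 = pseries_diffs (conv (fshift c) (finv m)) n by [].
rewrite diffs_conv diffs_finv // sumrB; congr (_ + _).
have -> : conv (fshift c) (fun k => - conv l (finv m) k) n = - conv (fshift c) (conv l (finv m)) n.
  by rewrite /conv -sumrN; apply: eq_bigr => k _; rewrite mulrN.
by congr (- _); rewrite convA [conv (fshift c) l]convC -convA.
Qed.

(** Coefficient [n] of [(1 / m)' = - (m' / m) * (1 / m)]. *)
Lemma finv_rec m n : m 0%N = 1 ->
  n.+1%:R * finv m n.+1 = - \sum_(k < n.+1) conv (finv m) (pseries_diffs m) k * finv m (n - k)%N.
Proof.
by move=> m0; rewrite -[LHS]/(pseries_diffs (finv m) n) diffs_finv.
Qed.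

End formal_derivatives.

Section appell_functions.
Context {R : realType}.
Local Notation nR := (@Num.norm R R : R -> R).
Implicit Types (i : nat -> R).

(** The coefficients of the polynomial [\sum_(k <= n) x^k / k! * i_(n - k)]. *)
Definition appell_h i n k : R := if (k <= n)%N then i (n - k)%N else 0.

Lemma efun_finite (h : nat -> R) n x : (forall k, (n < k)%N -> h k = 0) ->
  efun h x = \sum_(k < n.+1) h k * exp_c k * x ^+ k.
Proof.
move=> h0; apply: cvg_lim; first exact: Rhausdorff.
rewrite -(cvg_shiftn n.+1) /series /=.
have -> : (fun N => \sum_(0 <= k < N + n.+1) h k * exp_c k * x ^+ k) =
    (fun=> \sum_(k < n.+1) h k * exp_c k * x ^+ k); last exact: cvg_cst.
apply/funext => N; rewrite addnC (big_cat_nat (leq0n n.+1)) ?leq_addr //= big_mkord.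
rewrite [X in _ + X]big_nat_cond [X in _ + X]big1 ?addr0 // => k /andP[/andP[nk _] _].
by rewrite h0 // !mul0r.
Qed.

Lemma efun_appell_h i n x : efun (appell_h i n) x = conv (expmon x) i n.
Proof.
rewrite (@efun_finite _ n) => [|k nk]; last by rewrite /appell_h leqNgt nk.
by rewrite /conv; apply: eq_bigr => k _; rewrite /appell_h -ltnS ltn_ord /expmon; ring.
Qed.

Lemma nshift_appell_h i n j : (j <= n)%N -> nshift j (appell_h i n) = appell_h i (n - j).
Proof.
by move=> jn; apply/funext => k; rewrite /nshift /appell_h addnC leq_subRL // [(k + j)%N]addnC subnDA.
Qed.

Lemma nshift_appell_h0 i n j x : (n < j)%N -> efun (nshift j (appell_h i n)) x = 0.
Proof.
move=> nj; rewrite (@efun_finite _ 0) => [|k _]; last first.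
  by rewrite /nshift /appell_h leqNgt (leq_trans nj) // leq_addr.
by rewrite big_ord1 /nshift /appell_h addn0 leqNgt nj /= !mul0r.
Qed.

Lemma expmon_le (x : R) k : `|expmon x k| <= expR `|x|.
Proof.
rewrite /expmon normrM normrX [`|exp_c _|]ger0_norm ?exp_c_ge0 // mulrC.
apply: le_trans (exp_partial_le k.+1 (normr_ge0 x)); rewrite big_ord_recr /= lerDr.
by apply: sumr_ge0 => i _; rewrite mulr_ge0 ?exp_c_ge0 ?exprn_ge0.
Qed.

Lemma conv_expmon_le (x D : R) (e : nat -> R) n : (forall j, (j <= n)%N -> `|e j| <= D) ->
  `|conv (expmon x) e n| <= n.+1%:R * (expR `|x| * D).
Proof.
move=> eD; apply: (le_trans (ler_norm_sum _ _ _)).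
rewrite mulr_natl -[X in _ *+ X]card_ord -sumr_const; apply: ler_sum => k _.
by rewrite normrM ler_pM ?expmon_le ?eD ?leq_subr.
Qed.

Lemma exptype_appell_h i n N M r : 0 < r -> (n < N)%N -> (forall j, (j <= n)%N -> `|i j| <= M) ->
  exptype (M * \sum_(k < N) (r ^+ k)^-1) r (appell_h i n).
Proof.
move=> r0 nN iM k; have M0 : 0 <= M := le_trans (normr_ge0 _) (iM 0%N (leq0n n)).
rewrite /appell_h; case: leqP => kn; last first.
  rewrite normr0 mulr_ge0 ?exprn_ge0 ?(ltW r0) // mulr_ge0 // sumr_ge0 // => j _.
  by rewrite invr_ge0 exprn_ge0 // ltW.
apply: (le_trans (iM _ (leq_subr _ _))); rewrite -mulrA ler_peMr //.
have kN : (k < N)%N by exact: leq_ltn_trans kn nN.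
rewrite (bigD1 (Ordinal kN)) //= mulrDl mulVf ?expf_neq0 ?gt_eqF // lerDl mulr_ge0 ?exprn_ge0 ?(ltW r0) //.
by apply: sumr_ge0 => j _; rewrite invr_ge0 exprn_ge0 // ltW.
Qed.

End appell_functions.

Section appell_integral.
Context {R : realType} {d : measure_display} {Omega : measurableType d}.
Variable P : probability Omega R.
Local Notation nR := (@Num.norm R R : R -> R).
Variables (X : R -> Omega -> R) (a b rad : R).
Variables (K dK : R -> R -> cplx R -> cplx R -> cplx R) (B : R).
Hypothesis H : cgf_data P X a b rad K dK B.
Let ab := cgf_ab H.
Let mX := cgf_meas H.

Variables (rho om r : R).
Hypotheses (r0 : 0 < r) (rrho : r < rho) (om0 : 0 < om) (rr : rho + om < rad).
Let rho0 : 0 < rho. Proof. exact: lt_trans rrho. Qed.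
Let rhor : rho < rad. Proof. by apply: lt_trans rr; rewrite ltrDl. Qed.
Local Notation cbeta := (cbeta dK rho om).
Local Notation drift := (drift dK rho om).
Local Notation iv u := (finv (mom1 P (X u))).
Local Notation bs u := (fshift (fun k => cbeta k u)).

Lemma dlog_c_wdiff k : wdiff a b (fun u => dlog_c P (X u) k) (fun u => k.+1%:R * cbeta k u).
Proof.
have D := wdiffZ k.+1%:R (wdiff_rint (cbeta_cont H rho0 om0 rr k)).
move=> u uab e e0; have [dl dl0 h] := D u uab e e0; exists dl => // v vab vu.
have E w : a <= w <= b -> dlog_c P (X w) k = dlog_c P (X a) k + k.+1%:R * rint a w (cbeta k).
  move=> wab; have := log_c_rint H rho0 om0 rr k wab; rewrite /log_c.
  move=> /(congr1 (fun z => z * k.+1%:R)); rewrite mulrDl !divfK ?pnatr_eq0 // => ->.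
  by rewrite [_ * k.+1%:R]mulrC.
have := h v vab vu; rewrite (E v vab) (E u uab).
move: (k.+1%:R) (dlog_c P (X a) k) => n c.
by have -> : c + n * rint a v (cbeta k) - (c + n * rint a u (cbeta k)) = n * rint a v (cbeta k) - n * rint a u (cbeta k) by ring.
Qed.

(** [d/du (1 / M_u) = - (1 / M_u) * d/du (log M_u)], proved on coefficients: the
    recursion [finv_rec] expresses them through those of the logarithmic derivative,
    whose time derivatives [log_c_rint] provides. *)
Lemma finv_wdiff m : wdiff a b (fun u => iv u m) (fun u => - conv (bs u) (iv u) m).
Proof.
elim/ltn_ind: m => -[_|m IH].
  have := @wdiff_cst R a b 1; congr wdiff; apply/funext => u.
  by rewrite /conv big_ord1 mul0r oppr0.
have D (k : nat) : (k < m.+1)%N -> wdiff a b (fun u => dlog_c P (X u) k * iv u (m - k)%N)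
    (fun u => k.+1%:R * cbeta k u * iv u (m - k)%N + dlog_c P (X u) k * - conv (bs u) (iv u) (m - k)%N).
  by move=> km; apply: wdiffM; [exact: dlog_c_wdiff|apply: IH; rewrite ltnS leq_subr].
have := wdiffZ (- m.+1%:R^-1) (wdiff_sum D).
have n0 : m.+1%:R != 0 :> R by rewrite pnatr_eq0.
congr wdiff; apply/funext => u.
  apply: (mulfI n0); rewrite finv_rec ?mom1_0 // mulrA mulrN divff // mulN1r.
  by [].
apply: (mulfI n0); rewrite mulrN diffs_fshift_conv ?mom1_0 // mulrA mulrN divff // mulN1r; congr (- _).
by apply: eq_bigr => k _; rewrite mulrN.
Qed.

Lemma econt_conv (f g : R -> nat -> R) n : (forall k, econt a b (f^~ k)) -> (forall k, econt a b (g^~ k)) ->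
  econt a b (fun u => conv (f u) (g u) n).
Proof.
move=> cf cg; apply: (@econt_sum R a b n.+1 (fun k u => f u k * g u (n - k)%N)) => k.
by apply: econtM; [exact: cf|exact: cg].
Qed.

Lemma finv_lip N : exists2 M, 0 <= M & forall m u v, (m < N)%N -> a <= u <= b -> a <= v <= b ->
  `|iv u m| <= M /\ `|iv v m - iv u m| <= M * `|v - u|.
Proof.
elim: N => [|N [M M0 IH]]; first by exists 0.
have ci k : econt a b (fun u => iv u k) := wdiff_econt (finv_wdiff k).
have cb k : econt a b (fun u => bs u k).
  by case: k => [|k]; [exact: econt_cst|exact: (cbeta_cont H rho0 om0 rr)].
have [M1 M10 h1] := econt_bounded (ci N).
have [M2 M20 h2] := econt_bounded (econtN (econt_conv N cb ci)).
have mle : M <= M + M1 + M2 by rewrite -addrA lerDl addr_ge0.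
exists (M + M1 + M2); first by rewrite !addr_ge0.
move=> m u v; rewrite ltnS leq_eqVlt => /orP[/eqP -> uab vab|mN uab vab].
  split; first by rewrite (le_trans (h1 u uab)) // addrAC lerDr addr_ge0.
  rewrite (le_trans (wdiff_le (finv_wdiff N) h2 uab vab)) // ler_wpM2r // lerDr.
  exact: addr_ge0.
have [l1 l2] := IH m u v mN uab vab; split; first exact: le_trans l1 mle.
by rewrite (le_trans l2) // ler_wpM2r.
Qed.

Lemma finv_unif N e : 0 < e -> exists2 dl : R, 0 < dl & forall m u v, (m < N)%N -> a <= u <= b -> a <= v <= b ->
  `|v - u| < dl -> `|iv v m - iv u m - (v - u) * - conv (bs u) (iv u) m| <= e * `|v - u|.
Proof.
move=> e0; elim: N => [|N [d1 d10 IH]]; first by exists 1.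
have ci k : econt a b (fun u => iv u k) := wdiff_econt (finv_wdiff k).
have cb k : econt a b (fun u => bs u k).
  by case: k => [|k]; [exact: econt_cst|exact: (cbeta_cont H rho0 om0 rr)].
have [d2 d20 h] := wdiff_unif (finv_wdiff N) (econtN (econt_conv N cb ci)) e0.
exists (Num.min d1 d2); first by rewrite lt_min d10.
move=> m u v; rewrite ltnS leq_eqVlt lt_min => /orP[/eqP -> uab vab /andP[_ vu]|mN uab vab /andP[vu _]].
  exact: h.
exact: IH.
Qed.

Hypothesis centred : forall u, a <= u <= b -> EX P (X u) = 0.

(** The means of the increments vanish. *)
Lemma centred_cbeta0 u : a <= u <= b -> cbeta 0 u = 0.
Proof.
move=> uab; apply/eqP; rewrite -normr_le0; apply/ler_addgt0Pl => e e0; rewrite addr0.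
have [dl dl0 D] := jcum_incr H rho0 om0 rr e0.
have [v [vab vu vne]] := near_time H uab dl0.
have := D u v 0%N uab vab vu; rewrite expr0 mulr1 jcum0.
have ix w : a <= w <= b -> integ P (X w).
  move=> wab; have m1 : measurable_fun setT ((fun=> 1) : Omega -> R) by exact: measurable_cst.
  have rr' : 0 <= rho < rad by rewrite ltW.
  have := integ_moment m1 (mX wab) rho0 (integ_expX1 H wab rr') 1.
  by apply: eq_integrable => // o _; rewrite /= mul1r expr1.
rewrite -[X in EX P X]/(fun o => X v o - X u o) (EXB (ix v vab) (ix u uab)) !centred // subrr sub0r normrN normrM mulrC.
by rewrite ler_pM2r // normr_gt0 subr_eq0.
Qed.

Variable n : nat.
Let c : R := n`!%:R.
Let ci u j := c * iv u j.

Let conv_ci x u m : conv (expmon x) (ci u) m = c * conv (expmon x) (iv u) m.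
Proof. by rewrite convC convZl convC. Qed.

Lemma appell_efun u x m : a <= u <= b -> m`!%:R * conv (expmon x) (iv u) m = appell P (X u) m x.
Proof.
move=> uab; have rr' : 0 <= rho < rad by rewrite ltW.
by rewrite (appellE _ _ (mX uab) rho0 (integ_expX H uab rr')).
Qed.

(** The drift is minus the time derivative of the next Appell polynomial. *)
Lemma drift_appell u x : a <= u <= b ->
  drift (appell_h (ci u) n) u x = c * conv (expmon x) (conv (bs u) (iv u)) n.+1.
Proof.
move=> uab; rewrite convA [conv (expmon x) _]convC -convA.
have -> : conv (bs u) (conv (expmon x) (iv u)) n.+1 = \sum_(k < n) cbeta k.+1 u * conv (expmon x) (iv u) (n - k.+1)%N.
  by rewrite /conv big_ord_recl mul0r add0r big_ord_recl /= centred_cbeta0 // mul0r add0r.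
apply: cvg_lim; first exact: Rhausdorff.
rewrite -(cvg_shiftn n) /series /=.
have -> : (fun N => \sum_(0 <= k < N + n) cbeta k.+1 u * efun (nshift k.+1 (appell_h (ci u) n)) x) =
    (fun=> c * \sum_(k < n) cbeta k.+1 u * conv (expmon x) (iv u) (n - k.+1)%N); last exact: cvg_cst.
apply/funext => N; rewrite addnC (big_cat_nat (leq0n n)) ?leq_addr //= big_mkord.
rewrite [X in _ + X]big_nat_cond [X in _ + X]big1 ?addr0; last first.
  by move=> k /andP[/andP[nk _] _]; rewrite nshift_appell_h0 ?mulr0 // ltnS.
rewrite mulr_sumr; apply: eq_bigr => k _.
by rewrite nshift_appell_h // efun_appell_h conv_ci mulrCA.
Qed.

Variables (s t : R) (o : Omega).
Hypotheses (as_ : a <= s) (st : s < t) (tb : t <= b).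
Hypothesis cx : econt a b (fun u => X u o).
Variables (q M : R).
Hypotheses (q0 : 0 < q) (q2 : q < 2).
Hypothesis HM : forall p, itv_partition a b p ->
  \sum_(0 <= i < size p) `|X (ppoint a p i.+1) o - X (ppoint a p i) o| `^ q <= M.

(** The Appell polynomials solve the backward equation that cancels the drift, as
    the Hermite polynomials do for Brownian motion: [A] is the next Appell polynomial
    evaluated along the path, expanded to first order in time and space. *)
Lemma wick_appell (p : nat -> seq R) : (forall m, itv_partition s t (p m)) ->
  (mesh s (p m) @[m --> \oo] --> (0 : R)) ->
  wick_sum P (fun u => efun (appell_h (ci u) n)) X s (p m) o @[m --> \oo] -->
    (appell P (X t) n.+1 (X t o) - appell P (X s) n.+1 (X s o)) / n.+1%:R.
Proof.
move=> pst pm; have [L L0 xL] := econt_bounded cx.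
pose A u := c * conv (expmon (X u o)) (iv u) n.+1.
have stab u : s <= u -> u <= t -> a <= u <= b.
  by move=> su ut; rewrite (le_trans as_ su) (le_trans ut tb).
have -> : (appell P (X t) n.+1 (X t o) - appell P (X s) n.+1 (X s o)) / n.+1%:R = A t - A s.
  rewrite -!appell_efun; [|exact: stab (ltW st)|exact: stab (ltW st) (lexx t)].
  have E : n.+1`!%:R = n.+1%:R * c :> R by rewrite factS natrM.
  by rewrite E /A -!mulrBr mulrAC [_ * c]mulrC mulfK // pnatr_eq0.
have c0 : 0 <= c by rewrite /c.
have [Mi Mi0 hi] := finv_lip n.+2.
pose SR := \sum_(k < n.+2) (r ^+ k)^-1.
pose C := c * Mi * SR.
have ciM u j : (j < n.+2)%N -> a <= u <= b -> `|ci u j| <= c * Mi.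
  by move=> jn uab; rewrite /ci normrM [`|c|]ger0_norm // ler_wpM2l //; have [] := hi j u u jn uab uab.
have hC u : a <= u <= b -> exptype C r (appell_h (ci u) n).
  by move=> uab; apply: exptype_appell_h => // j jn; apply: ciM => //; rewrite ltnS ltnW.
have hC1 u : a <= u <= b -> exptype C r (appell_h (ci u) n.+1).
  by move=> uab; apply: exptype_appell_h => // j jn; apply: ciM.
have aab : a <= a <= b by rewrite lexx ltW.
have C0 : 0 <= C := exptype_C_ge0 (hC a aab).
clearbody C; pose C2 := C * r * r * expR (r * L).
have C20 : 0 <= C2 by rewrite !mulr_ge0 ?expR_ge0 // ltW.
apply: (@wick_sum_cvg _ _ _ P X a b rad K dK B H rho om r C r0 rrho om0 rr (fun u => appell_h (ci u) n) s t o q M C2 A as_ tb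
  _ q0 q2 cx HM C20 _ p pst pm); first by move=> u /andP[su ut]; apply: hC; exact: stab.
move=> e e0; pose E := expR L; have E0 : 0 < E by exact: expR_gt0.
pose N1 := c * (n.+2%:R * E) + 1.
have N10 : 0 < N1 by rewrite ltr_wpDl // !mulr_ge0 // ltW.
pose N2 := c * (n.+1%:R * (E * Mi)) + 1.
have N20 : 0 < N2 by rewrite ltr_wpDl // !mulr_ge0 // ltW.
have e1 : 0 < e / 2 / N1 by rewrite !divr_gt0.
have e2 : 0 < e / 2 / N2 by rewrite !divr_gt0.
have [d1 d10 D1] := finv_unif n.+2 e1.
have [d2 d20 D2] := econt_unif cx e2.
exists (Num.min d1 d2); first by rewrite lt_min d10.
move=> u v su uv vt; rewrite lt_min => /andP[vu1 vu2].
have uab := stab u su (le_trans uv vt); have vab := stab v (le_trans su uv) vt.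
have vu0 : 0 <= v - u by rewrite subr_ge0.
have EL z : a <= z <= b -> expR `|X z o| <= E by move=> zab; rewrite ler_expR xL.
rewrite drift_appell // efun_appell_h.
set xu := X u o; set xv := X v o.
(* first-order expansion in time, at the earlier point of the path *)
have h1 : `|c * conv (expmon xu) (fun m => iv v m - iv u m - (v - u) * - conv (bs u) (iv u) m) n.+1| <= e / 2 * (v - u).
  rewrite normrM [`|c|]ger0_norm //.
  have hD j : (j <= n.+1)%N -> `|iv v j - iv u j - (v - u) * - conv (bs u) (iv u) j| <= e / 2 / N1 * (v - u).
    by move=> jn; have := D1 j u v jn uab vab; rewrite [`|v - u|]ger0_norm // => /(_ vu1).
  have := ler_wpM2l c0 (conv_expmon_le xu hD) => /le_trans; apply.
  have nn : 0 <= e / 2 / N1 * (v - u) by rewrite mulr_ge0 // ltW.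
  apply: (@le_trans _ _ (N1 * (e / 2 / N1 * (v - u)))); last first.
    by rewrite mulrA [N1 * _]mulrC divfK // gt_eqF.
  move: (e / 2 / N1 * (v - u)) nn => D nn.
  have -> : c * (n.+2%:R * (expR `|xu| * D)) = c * (n.+2%:R * expR `|xu|) * D by ring.
  apply: ler_wpM2r => //; apply: le_trans (_ : c * (n.+2%:R * E) <= _); last by rewrite lerDl.
  by rewrite !ler_wpM2l // EL.
(* the mixed increment in time and space *)
have h2 : `|(xv - xu) * (c * conv (expmon xu) (fun m => iv v m - iv u m) n)| <= e / 2 * (v - u).
  have hD j : (j <= n)%N -> `|iv v j - iv u j| <= Mi * (v - u).
    move=> jn; have jn2 : (j < n.+2)%N by rewrite ltnS ltnW.
    by have [_] := hi j u v jn2 uab vab; rewrite [`|v - u|]ger0_norm.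
  have := conv_expmon_le xu hD => h.
  have xx : `|xv - xu| <= e / 2 / N2 by apply: D2 => //; rewrite ger0_norm.
  rewrite !normrM [`|c|]ger0_norm //.
  apply: (@le_trans _ _ (e / 2 / N2 * (N2 * (v - u)))); last by rewrite mulrA divfK // gt_eqF.
  apply: ler_pM => //; first by rewrite mulr_ge0.
  apply: (le_trans (ler_wpM2l c0 h)).
  have -> : c * (n.+1%:R * (expR `|xu| * (Mi * (v - u)))) = c * (n.+1%:R * (expR `|xu| * Mi)) * (v - u) by ring.
  apply: ler_wpM2r => //; apply: le_trans (_ : c * (n.+1%:R * (E * Mi)) <= _); last by rewrite lerDl.
  by rewrite !ler_wpM2l // ler_wpM2r // EL.
(* Taylor's formula in space, at the later time *)
have h3 := efun_taylor (ltW r0) (hC1 v vab) (xL u uab) (xL v vab).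
rewrite nshift_appell_h // subn1 /= !efun_appell_h !conv_ci -/C2 -/xu -/xv in h3.
have cD f g m : conv (expmon xu) (fun j => f j - g j) m = conv (expmon xu) f m - conv (expmon xu) g m.
  by rewrite /conv -sumrB; apply: eq_bigr => k _; rewrite mulrBr.
have cN w f m : conv (expmon xu) (fun j => w * - f j) m = - (w * conv (expmon xu) f m).
  by rewrite /conv mulr_sumr -sumrN; apply: eq_bigr => k _; ring.
rewrite !cD cN in h1; rewrite cD in h2.
rewrite conv_ci /A -/xu -/xv.
move: h1 h2 h3; set k1 := conv (expmon xu) (iv v) n.+1; set k2 := conv (expmon xu) (iv u) n.+1.
set k3 := conv (expmon xu) (conv _ _) n.+1; set k4 := conv (expmon xu) (iv v) n; set k5 := conv (expmon xu) (iv u) n.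
set k6 := conv (expmon xv) (iv v) n.+1 => h1 h2 h3.
have -> : c * k6 - c * k2 - (c * k5 * (xv - xu) - (v - u) * (c * k3)) =
  (c * k6 - c * k1 - (xv - xu) * (c * k4)) + (c * (k1 - k2 - - ((v - u) * k3)) + (xv - xu) * (c * (k4 - k5))) by ring.
rewrite (le_trans (ler_normD _ _)) // addrC lerD //.
rewrite (le_trans (ler_normD _ _)) //.
have -> : e * (v - u) = e / 2 * (v - u) + e / 2 * (v - u) by field.
exact: lerD.
Qed.

End appell_integral.

(** * Wick integrals *)

Section wick_integrals.
Context {R : realType} {d : measure_display} {Omega : measurableType d}.
Variable P : probability Omega R.
Local Notation nR := (@Num.norm R R : R -> R).

Lemma condition_ii_cgf (X : R -> Omega -> R) (a b rad : R) : a < b ->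
  (forall u, a <= u <= b -> measurable_fun setT (X u)) -> condition_ii P X a b rad ->
  exists K dK B, cgf_data P X a b rad K dK B.
Proof.
move=> ab mX [rad0 hI [K [dK [hK hdK hc [B hB]]]]].
by exists K, dK, B; split.
Qed.

Lemma condition_i_path (X : R -> Omega -> R) (a b : R) : condition_i P X a b ->
  exists q : R, [/\ 0 < q, q < 2 & {ae P, forall o, econt a b (fun u => X u o) /\
    exists M, forall p, itv_partition a b p ->
     \sum_(0 <= i < size p) `|X (ppoint a p i.+1) o - X (ppoint a p i) o| `^ q <= M}].
Proof.
move=> [q [q1 q2 h]]; exists q; split => //; first exact: lt_le_trans q1.
apply: filterS h => o [/econt_within cx [M HM]]; split => //.
by exists M.
Qed.

Section on_interval.
Variables (X : R -> Omega -> R) (a b rad : R).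
Variables (K dK : R -> R -> cplx R -> cplx R -> cplx R) (B : R).
Hypothesis H : cgf_data P X a b rad K dK B.
Hypothesis Xi : condition_i P X a b.
Variables (s t : R).
Hypotheses (as_ : a <= s) (st : s < t) (tb : t <= b).

Let stab u : s <= u -> u <= t -> a <= u <= b.
Proof. by move=> su ut; rewrite (le_trans as_ su) (le_trans ut tb). Qed.

Variables (rho om r C : R).
Hypotheses (r0 : 0 < r) (rrho : r < rho) (om0 : 0 < om) (rr : rho + om < rad).

Section chain_rule.
Variables (h hF : nat -> R) (C' : R).
Hypotheses (hC : exptype C r h) (hF_C : exptype C' r hF) (hF_h : nshift 1 hF = h).

Definition wick_efun_val o : R := efun hF (X t o) - efun hF (X s o) -
  rint s t (fun u => drift dK rho om h u (X u o)).

Lemma wick_integral_efun : is_wick_integral P (fun=> efun h) X s t wick_efun_val.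
Proof.
split=> [u v su uv vt|p pst pm].
  apply: aeW => o; apply: (wick_cvg H r0 rrho om0 rr hC); apply: stab => //.
    by rewrite (le_trans (ltW uv)).
  by rewrite (le_trans su) // ltW.
have [q [q0 q2 hx]] := condition_i_path Xi; apply: filterS hx => o [cx [M HM]].
exact: (wick_efun H r0 rrho om0 rr hC as_ st tb cx q0 q2 HM hF_C hF_h pst pm).
Qed.

Lemma cumulant_young (g : nat -> R -> R) :
  (forall n, (2 <= n)%N -> g n = efun (nshift n.-1 h)) ->
  {ae P, forall o,
    is_young_integral (fun u => efun h (X u o)) (fun u => X u o) s t (efun hF (X t o) - efun hF (X s o)) /\
    is_cumulant_series P X g s t o (efun hF (X t o) - efun hF (X s o) - wick_efun_val o)}.
Proof.
move=> gE; have [q [q0 q2 hx]] := condition_i_path Xi; apply: filterS hx => o [cx [M HM]].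
split; first exact: (young_efun r0 as_ tb cx q0 q2 HM hF_C hF_h).
rewrite /wick_efun_val opprB addrC subrK.
exact: (cumulant_series H r0 rrho om0 rr hC as_ st tb cx gE).
Qed.

End chain_rule.

Lemma wick_integral_appell n : (forall u, a <= u <= b -> EX P (X u) = 0) ->
  is_wick_integral P (fun u => appell P (X u) n) X s t
    (fun o => (appell P (X t) n.+1 (X t o) - appell P (X s) n.+1 (X s o)) / n.+1%:R).
Proof.
move=> centred.
pose hn u := appell_h (fun j => n`!%:R * finv (mom1 P (X u)) j) n.
have hE u : a <= u <= b -> appell P (X u) n = efun (hn u).
  move=> uab; apply/funext => x; rewrite efun_appell_h convC convZl [conv (finv _) _]convC.
  by rewrite (appell_efun H r0 rrho om0 rr).
have [Mi Mi0 hi] := finv_lip H r0 rrho om0 rr n.+1.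
split=> [u v su uv vt|p pst pm].
  have uab : a <= u <= b by apply: stab => //; rewrite (le_trans (ltW uv)).
  have vab : a <= v <= b by apply: stab => //; rewrite (le_trans su) // ltW.
  have hC : exptype (n`!%:R * Mi * \sum_(k < n.+1) (r ^+ k)^-1) r (hn u).
    apply: exptype_appell_h => // j jn; rewrite normrM ger0_norm // ler_wpM2l //.
    by have [] := hi j u u jn uab uab.
  by rewrite hE //; apply: aeW => o; exact: (wick_cvg H r0 rrho om0 rr hC uab vab).
have [q [q0 q2 hx]] := condition_i_path Xi; apply: filterS hx => o [cx [M HM]].
have := wick_appell H r0 rrho om0 rr centred as_ st tb cx q0 q2 HM pst pm.
move=> /(_ n); apply: cvg_trans; apply: near_eq_cvg; apply: nearW => m /=.
apply: eq_big_nat => i /andP[_ ip] /=; congr (wick_prod _ _ _ _ _).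
have /andP[h1 h2] := ppoint_itv (pst m) (ltnW ip).
by rewrite hE // stab.
Qed.

End on_interval.

Lemma appell_zero n : appell P (fun=> 0) n.+1 0 = 0.
Proof.
have i0 : integ P (fun o => expR (1 * `|(fun=> 0 : R) o|)) by exact: integ_cst.
rewrite (appellE n.+1 0 (measurable_cst _) ltr01 i0).
have -> : expmon (0 : R) = delta0.
  apply/funext => -[|k]; first by rewrite /expmon expr0 exp_c0 mulr1.
  by rewrite /expmon expr0n /= mul0r.
have E : mom1 P (fun=> 0) = delta0.
  apply/funext => -[|k]; first exact: mom1_0.
  rewrite /mom1 /mom (@eq_EX _ _ _ _ _ (fun=> 0)) ?EX_cst ?mul0r // => o.
  by rewrite expr0n mulr0.
have -> : finv (mom1 P (fun=> 0)) = delta0.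
  by rewrite E; apply/esym; apply: finv_unique => //; exact: conv_delta.
by rewrite conv_delta /delta0 mulr0.
Qed.

End wick_integrals.

Local Close Scope complex_scope.

Theorem proposition3p11 (R : realType) (d : measure_display)
    (Omega : measurableType d) (P : probability Omega R)
    (T rad : R) (X : R -> Omega -> R) (f : R -> R)
    (mX : forall u : R, u \in `[0, T] -> measurable_fun setT (X u))
    (hX : wick_conditions P X 0 T rad)
    (hf : extends_entire_exp rad f)
    (s t : R) (s0 : 0 <= s) (st : s < t) (tT : t <= T) :
  [/\ exists2 W : Omega -> R,
        is_wick_integral P (fun _ => f) X s t W &
        {ae P, forall o, exists Y S : R,
          [/\ is_young_integral (fun u => f (X u o)) (fun u => X u o) s t Y,
              is_cumulant_series P X (fun n => derive1n n.-1 f) s t o S &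
              W o = Y - S]},
      exists2 W : Omega -> R,
        is_wick_integral P (fun _ => derive1 f) X s t W &
        {ae P, forall o, exists2 S : R,
          is_cumulant_series P X (fun n => derive1n n f) s t o S &
          f (X t o) - f (X s o) = W o + S}
    & (forall u : R, u \in `[0, T] -> ('E_P[X u] = 0)%E) ->
      forall n : nat,
        is_wick_integral P (fun u => appell P (X u) n) X s t
          (fun o => (appell P (X t) n.+1 (X t o)
                     - appell P (X s) n.+1 (X s o)) / n.+1%:R)
        /\
        ((exists rad', wick_conditions P (shifted X s) s T rad') ->
         is_wick_integral P (fun u => appell P (shifted X s u) n)
           (shifted X s) s t
           (fun o => appell P (shifted X s t) n.+1 (shifted X s t o)
                     / n.+1%:R))].
Proof.
have T0 : 0 < T by exact: le_lt_trans s0 (lt_le_trans st tT).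
have mX' u : 0 <= u <= T -> measurable_fun setT (X u).
  by move=> uT; apply: mX; rewrite in_itv.
have [Xi Xii _] := hX; have [rad0 _ _] := Xii.
have [K [dK [B H]]] := condition_ii_cgf T0 mX' Xii.
have [h [C [r [r0 rr hC fE]]]] := entire_efun rad0 hf.
pose rho := (r + rad) / 2; pose om := (rad - rho) / 2.
have rrho : r < rho by rewrite /rho; lra.
have rhor : rho < rad by rewrite /rho; lra.
have om0 : 0 < om by rewrite /om; lra.
have ro : rho + om < rad by rewrite /om; lra.
have r0' := ltW r0.
have dn n : derive1n n f = efun (nshift n h) by rewrite fE (derive1n_efun n r0' hC).
have d1 : derive1 f = efun (nshift 1 h) by rewrite -derive1n1 dn.
split.
- have hF_C := exptype_primitive r0 hC.
  rewrite {1}fE; exists (wick_efun_val X dK s t rho om h (primitive h)).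
    exact: (wick_integral_efun H Xi s0 st tT r0 rrho om0 ro hC hF_C (nshift_primitive h)).
  have := cumulant_young H Xi s0 st tT r0 rrho om0 ro hC hF_C (nshift_primitive h) (g := fun n => derive1n n.-1 f)
     (fun n _ => dn n.-1).
  apply: filterS => o [hY hS]; do 2 eexists; split; [rewrite fE; exact: hY|exact: hS|].
  by rewrite subKr.
- have hC1 := exptype_shift 1 r0' hC; rewrite d1.
  exists (wick_efun_val X dK s t rho om (nshift 1 h) h).
    exact: (wick_integral_efun H Xi s0 st tT r0 rrho om0 ro hC1 hC (erefl _)).
  have gE n : (2 <= n)%N -> derive1n n f = efun (nshift n.-1 (nshift 1 h)).
    by case: n => [//|n _]; rewrite dn.
  have := cumulant_young H Xi s0 st tT r0 rrho om0 ro hC1 hC (erefl _) gE.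
  apply: filterS => o [_ hS]; eexists; first exact: hS.
  by rewrite fE [RHS]addrC subrK.
move=> EX0; have centred u : 0 <= u <= T -> EX P (X u) = 0.
  by move=> uT; rewrite /EX EX0 ?in_itv.
move=> n; split; first exact: (wick_integral_appell H Xi s0 st tT r0 rrho om0 ro n centred).
move=> [rad' [Yi Yii _]].
have sT : s < T by exact: lt_le_trans st tT.
have sub u : s <= u <= T -> 0 <= u <= T by move=> /andP[su uT]; rewrite (le_trans s0 su).
have s0T : 0 <= s <= T by rewrite s0 ltW.
have mY u : s <= u <= T -> measurable_fun setT (shifted X s u).
  by move=> us; apply: measurable_funB; apply: mX' => //; exact: sub.
have [K' [dK' [B' H']]] := condition_ii_cgf sT mY Yii.
have [rad'0 _ _] := Yii.
have q1 : 0 < rad' / 4 by rewrite divr_gt0.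
have q2 : rad' / 4 < rad' / 2 by lra.
have q3 : rad' / 2 + rad' / 4 < rad' by lra.
have iX u : 0 <= u <= T -> integ P (X u).
  move=> uT; have m1 : measurable_fun setT ((fun=> 1) : Omega -> R) by exact: measurable_cst.
  have rr' : 0 <= r < rad by rewrite r0'.
  have := integ_moment m1 (mX' u uT) r0 (integ_expX1 H uT rr') 1.
  by apply: eq_integrable => // o _; rewrite /= mul1r expr1.
have centred' u : s <= u <= T -> EX P (shifted X s u) = 0.
  move=> us; rewrite -[shifted X s u]/(fun o => X u o - X s o).
  by rewrite (EXB (iX u (sub u us)) (iX s s0T)) !centred ?subrr // sub.
have := wick_integral_appell H' Yi (lexx s) st tT q1 q2 q1 q3 n centred'.
have -> // : (fun o => (appell P (shifted X s t) n.+1 (shifted X s t o) -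
    appell P (shifted X s s) n.+1 (shifted X s s o)) / n.+1%:R) =
  (fun o => appell P (shifted X s t) n.+1 (shifted X s t o) / n.+1%:R).
have Es : shifted X s s = (fun=> 0) by apply/funext => o; rewrite /shifted /= subrr.
by apply/funext => o; rewrite Es appell_zero subr0.
Qed.
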